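(* Let $k\geq 0$ be an integer. (i) Any analytic germ of a family of vector fields $\tilde{\bm{X}}(x;\lambda)$ depending on a multi-parameter $\lambda\in(\mathbb{C}^m,0)$ and unfolding $\tilde{\bm{X}}(x;0)=x^{k+1}\frac{1}{\omega(x)}\frac{\partial}{\partial x}$, with $\omega$ an analytic germ and $\omega(0)\neq0$, is analytically conjugate to a family of the form $$\bm{X}(x;\lambda)=c(\lambda)\,x\,\frac{\partial}{\partial x}\qquad\text{if } k=0,\tag{A}$$ $$\bm{X}(x;\lambda)=\frac{x^{k+1}+y_{k-1}(\lambda)x^{k-1}+\ldots+y_0(\lambda)}{1+\mu(\lambda)x^k}\,\frac{\partial}{\partial x}\qquad\text{if } k\geq1,\tag{B}$$ where $c,y_j,\mu$ are analytic germs in $\lambda$, with $y_0(0)=\ldots=y_{k-1}(0)=0$, and where (for $k\geq 1$) $$\mu(\lambda)=-\mathrm{Res}_{x=\infty}\,\bm{X}(x;\lambda)^{-1}$$ is the sum of the residues of $\tilde{\bm{X}}(x;\lambda)^{-1}$ over its local polar locus around the origin. (ii) The normal form (A) for $k=0$ and the normal form (B) for $k=1$ are unique, while the normal form (B) for $k>1$ is unique up to the action of $$x\mapsto e^{2\pi i\frac{l}{k}}x,\qquad y_j(\lambda)\mapsto e^{-2\pi i\frac{(j-1)l}{k}}y_j(\lambda),\quad j=0,\ldots,k-1,\qquad l\in\mathbb{Z}_k .$$ More precisely, if $x\mapsto\phi(x,\lambda)$ is an analytic transformation, fixing $\lambda$, between two families $\bm{X}$ and $\bm{X}'$ in normal form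 (A) (if $k=0$) or (B) (if $k\geq1$), i.e. $\bm{X}=\phi^*\bm{X}'$, then $$\phi(x,\lambda)=\begin{cases} e^{t(\lambda)}x, & \text{if } k=0,\\ e^{2\pi i\frac{l}{k}}\exp\big(t(\lambda)\bm{X}\big)(x;\lambda), & \text{if } k\geq1,\end{cases}$$ for some $l\in\mathbb{Z}_k$ and some analytic germ $t(\lambda)$.
   Context: All objects are germs at the origin, in one variable $x\in(\mathbb{C},0)$ and a parameter $\lambda\in(\mathbb{C}^m,0)$. ''Analytic'' means complex analytic. Two germs of analytic parametric families of vector fields $\bm{X}(x;\lambda)$, $\bm{X}'(x';\lambda)$ depending on the same parameter $\lambda$ are (analytically) conjugate if there is a germ of analytic invertible change of coordinate $x'=\phi(x;\lambda)$ (with $\phi(0;0)=0$, $\partial_x\phi(0;0)\neq0$), preserving the parameter, changing one family into the other; one writes $\bm{X}=\phi^*\bm{X}'$. Explicitly, if $\bm{X}=a(x;\lambda)\frac{\partial}{\partial x}$ and $\bm{X}'=b(x';\lambda)\frac{\partial}{\partial x'}$, then $\bm{X}=\phi^*\bm{X}'$ means $b(\phi(x;\lambda);\lambda)=a(x;\lambda)\,\partial_x\phi(x;\lambda)$. A family $\tilde{\bm{X}}(x;\lambda)$ unfolds the vector field $\tilde{\bm{X}}(x;0)$. For $\bm{X}=a(x;\lambda)\frac{\partial}{\partial x}$, $\bm{X}^{-1}$ denotes the dual meromorphic 1-form $\frac{dx}{a(x;\lambda)}$. The local polar locus of $\tilde{\bm{X}}(x;\lambda)^{-1}$ is the set of poles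 (for small fixed $\lambda$) lying near $x=0$, i.e. the $k+1$ zeros (with multiplicity) of $\tilde{\bm{X}}(\cdot;\lambda)$ merging at $x=0$ as $\lambda\to0$. $\exp(t\bm{X})(x;\lambda)$ denotes the time-$t$ flow map of $\bm{X}(\cdot;\lambda)$, with $\lambda$ fixed. In (ii), normal forms (A) are understood with $c(0)\ne0$ and normal forms (B) with $y_0(0)=\ldots=y_{k-1}(0)=0$. *)

(* Defs.v *)
From HB Require Import structures.
From mathcomp Require Import all_boot all_order all_algebra.
From mathcomp Require Import all_classical all_reals all_analysis.
From mathcomp.real_closed Require Import complex.
Set Implicit Arguments. Unset Strict Implicit. Unset Printing Implicit Defensive.
Import Order.TTheory GRing.Theory Num.Theory numFieldNormedType.Exports.
Local Open Scope classical_set_scope.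
Local Open Scope ring_scope.

(* The topology of R[i] is not declared on the carrier itself; packing R[i] as
   a numClosedFieldType gives it the topology and norm that MathComp-Analysis
   puts on every numFieldType.  Norms and radii therefore live in Cplx R, where
   [0 < r] entails that r is real. *)
Definition Cplx (R : realType) : numClosedFieldType := (R[i] : numClosedFieldType).

(* exp (a + i b) = e^a (cos b + i sin b) *)
Definition cexp (R : realType) (z : Cplx R) : Cplx R :=
  Complex (expR (complex.Re z) * cos (complex.Im z))
          (expR (complex.Re z) * sin (complex.Im z)).

Definition two_pi_i (R : realType) : Cplx R := Complex 0 (pi *+ 2).

Section Analytic.
Variable R : realType.
Local Notation C := (Cplx R).

(* Partial sum over the multi-indices with all entries < N. *)
Definition box_sum n (c : {ffun 'I_n -> nat} -> C) (z : 'rV[C]_n) (N : nat) : C :=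
  \sum_(a : {ffun 'I_n -> 'I_N})
     c [ffun i => val (a i)] * \prod_(i < n) z 0 i ^+ val (a i).

(* Near the origin, f is the sum of an absolutely convergent power series.
   Germs are represented by total functions, whose values away from a
   neighbourhood of the origin are irrelevant. *)
Definition analytic_germ n (f : 'rV[C]_n -> C) : Prop :=
  exists c : {ffun 'I_n -> nat} -> C,
    \forall z \near (0 : 'rV[C]_n),
      (exists M : C, forall N : nat,
         box_sum (fun a => `|c a|) (map_mx Num.norm z) N <= M) /\
      box_sum c z N @[N --> \oo] --> f z.

Definition analytic_at1 (f : C -> C) (p : C) : Prop :=
  analytic_germ (fun z : 'rV[C]_1 => f (p + z 0 0)).

(* The coordinates of 'rV_(1 + m) are (x, lambda). *)
Definition analytic_family m (f : C -> 'rV[C]_m -> C) : Prop :=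
  analytic_germ (fun z : 'rV[C]_(1 + m) => f (lsubmx z 0 0) (rsubmx z)).

Definition pole_part N (c : 'I_N -> C) (p z : C) : C :=
  \sum_(j < N) c j / (z - p) ^+ j.+1.

(* f dz is meromorphic at p with residue r: a principal part, whose coefficient
   of (z - p)^-1 is r, plus an analytic function. *)
Definition is_residue (f : C -> C) (p r : C) : Prop :=
  exists (N : nat) (c : 'I_N.+1 -> C) (h : C -> C),
    [/\ analytic_at1 h p,
        \forall z \near p^', f z = pole_part c p z + h z
      & r = c ord0].

(* With w = 1/x one has f(x) dx = - f(1/w) w^-2 dw. *)
Definition is_residue_infty (f : C -> C) (r : C) : Prop :=
  is_residue (fun w => - (f w^-1 / w ^+ 2)) 0 r.

End Analytic.

Section VectorFields.
Variables (R : realType) (m : nat).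
Local Notation C := (Cplx R).

(* A family of vector fields a(x; lambda) d/dx is given by its coefficient a. *)

(* a d/dx = phi^* (b d/dx), as germs at the origin *)
Definition is_conjugacy (phi a b : C -> 'rV[C]_m -> C) : Prop :=
  [/\ analytic_family phi,
      phi 0 0 = 0,
      derive1 (fun u => phi u 0) 0 != 0
    & \forall z \near ((0, 0) : C * 'rV[C]_m),
        b (phi z.1 z.2) z.2 = a z.1 z.2 * derive1 (fun u => phi u z.2) z.1].

Definition conjugate (a b : C -> 'rV[C]_m -> C) : Prop :=
  exists phi, is_conjugacy phi a b.

(* z = exp (t v)(x) for the vector field v d/dx and a complex time t: the
   holomorphic solution of gamma' = v(gamma) with gamma(0) = x is followed along
   the segment [0, t].  In C, [0 <= s <= 1] forces s to be real. *)
Definition time_flow (v : C -> C) (t x z : C) : Prop :=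
  exists gamma : C -> C,
    [/\ gamma 0 = x,
        gamma t = z
      & forall s : C, 0 <= s <= 1 ->
          is_derive (s * t) (1 : C) gamma (v (gamma (s * t)))].

(* mu(lambda) is the sum of the residues of dx / a(x; lambda) over the poles
   lying near x = 0, i.e. in any sufficiently small disc |x| < r fixed before
   letting lambda tend to 0. *)
Definition is_local_residue_sum (a : C -> 'rV[C]_m -> C) (mu : 'rV[C]_m -> C) : Prop :=
  exists2 r0 : C, 0 < r0 & forall r : C, 0 < r <= r0 ->
    \forall lam \near (0 : 'rV[C]_m),
      exists (poles : seq C) (res : C -> C),
        [/\ uniq poles,
            forall x, x \in poles <-> `|x| < r /\ a x lam = 0,
            forall p, p \in poles -> is_residue (fun x => (a x lam)^-1) p (res p)
          & mu lam = \sum_(p <- poles) res p].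

Definition form_A (c : 'rV[C]_m -> C) (x : C) (lam : 'rV[C]_m) : C := c lam * x.

Definition form_B k (y : 'I_k -> 'rV[C]_m -> C) (mu : 'rV[C]_m -> C)
    (x : C) (lam : 'rV[C]_m) : C :=
  (x ^+ k.+1 + \sum_(j < k) y j lam * x ^+ j) / (1 + mu lam * x ^+ k).

Definition form_B_data k (y : 'I_k -> 'rV[C]_m -> C) (mu : 'rV[C]_m -> C) : Prop :=
  [/\ forall j, analytic_germ (y j),
      analytic_germ mu
    & forall j, y j 0 = 0].

(* Elements of Z_k are represented by 'I_k. *)
Definition rot_factor k (l : 'I_k) : C := cexp (two_pi_i R * l%:R / k%:R).

Definition rot_coef k (l : 'I_k) (y : 'I_k -> 'rV[C]_m -> C) (j : 'I_k)
    (lam : 'rV[C]_m) : C :=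
  cexp (- (two_pi_i R * (j%:R - 1) * l%:R / k%:R)) * y j lam.

End VectorFields.

(* Main.v *)
Require Import Defs.
From HB Require Import structures.
From mathcomp Require Import all_boot all_order all_algebra.
From mathcomp Require Import all_classical all_reals all_analysis.
From mathcomp.real_closed Require Import complex.
From mathcomp Require Import ring lra zify.
Set Implicit Arguments. Unset Strict Implicit. Unset Printing Implicit Defensive.
Import Order.TTheory GRing.Theory Num.Theory numFieldNormedType.Exports.
Local Open Scope classical_set_scope.
Local Open Scope ring_scope.

(* Germs are rescaled to absolutely convergent power series on the closed unit
   polydisc, with the l^1 norm of the coefficients; smallness always comes from
   rescaling x and lambda.

   Existence: after rescaling, the family is a = x^(k+1) + e with e small, and one
   looks for phi = x + tau x^(k+1) + xi and P = x^(k+1) + sum_i y_i x^i with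
   P(phi) = (1 + mu phi^k) a phi'.  Linearizing at the model x^(k+1) gives the
   homological operator
     (xi, y, mu) |-> (k+1) x^k xi - x^(k+1) xi' + sum_i y_i x^i - mu x^(2k+1),
   which has an explicit right inverse, monomial by monomial, for which both xi and
   xi' are bounded; there is no small divisor and a Newton scheme converges.  At
   lambda = 0 the polynomial P(phi) vanishes to order k + 1 at x = 0, which forces
   P = x^(k+1) and phi(0, 0) = 0.

   Rigidity: normalizing xi(1) = 0 makes the solution unique once tau is given.
   Up to a k-th root of unity and a rescaling, a conjugacy between two normal forms
   is close to the identity, hence determined by its value at x = 1.  The flow of
   the first normal form, for the time t(lambda) that produces the same value at
   x = 1, is another solution for the same a and tau; so the conjugacy is this flow
   and the two normal forms coincide.  For k = 0 the comparison of Taylor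
   coefficients is enough.

   Residues: near the origin phi carries the zeros of the family to the roots of P.
   In the partial fraction expansion of (1 + mu w^k) / P(w) the coefficients of the
   simple poles add up to mu, and phi' / (phi - q)^(j+1) is exact for j > 0. *)

(** * Norms and unordered sums *)

(** The nonlinear problems are solved for the coefficient family [u] of the right-hand side of the
    linearized equation, not for the map itself. Composed with the right inverse, the linear part
    becomes [ev u], and it is enough that the rest be Lipschitz with a small constant in l^1 norm.
    No radius is lost: on x^j the inverse divides by 2k+1-j and differentiation multiplies by j-k,
    with bounded quotient. The shape of (B) reflects the operator xi |-> (k+1) x^k xi - x^(k+1) xi'.
    Degrees below k are never reached, hence y_0, ..., y_(k-1); the factor 2k+1-j vanishes at j =
    2k+1, hence mu; and x^(k+1) is annihilated, which is the freedom of the flow, hence tau. The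
    value at x = 1 is a convenient coordinate on this kernel: the flow meets a prescribed value
    there once a linear equation is solved for its time. The parameter is a passenger: the estimates
    hold over any system of monomials bounded by 1, so analyticity in lambda is part of the norm.
    The uniqueness argument works at each fixed lambda. *)

Section ComplexNorm.
Variable R : realType.
Local Notation C := (Cplx R).

(** The norm of [C] takes its values in [C]; it is brought back to [R], where the tactics for real
    arithmetic apply. [cR] goes the other way. *)
Definition nrm (z : C) : R := complex.Re `|z|.
Definition cR (x : R) : C := Complex x 0.
Definition cI : C := Complex 0 1.

Lemma cRD x y : cR (x + y) = cR x + cR y.
Proof. exact: (rmorphD (real_complex R)). Qed.
Lemma cRB x y : cR (x - y) = cR x - cR y.
Proof. exact: (rmorphB (real_complex R)). Qed.
Lemma cRM x y : cR (x * y) = cR x * cR y.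
Proof. exact: (rmorphM (real_complex R)). Qed.
Lemma cRV x : cR x^-1 = (cR x)^-1.
Proof. exact: (fmorphV (real_complex R)). Qed.
Lemma cRX x n : cR (x ^+ n) = cR x ^+ n.
Proof. exact: (rmorphXn (real_complex R)). Qed.
Lemma cR0 : cR 0 = 0. Proof. by []. Qed.
Lemma cR1 : cR 1 = 1. Proof. by []. Qed.
Lemma cRn n : cR n%:R = n%:R.
Proof. exact: (rmorph_nat (real_complex R)). Qed.
Lemma cR_sum (I : Type) (s : seq I) (f : I -> R) :
  cR (\sum_(i <- s) f i) = \sum_(i <- s) cR (f i).
Proof. exact: (rmorph_sum (real_complex R)). Qed.
Lemma cR_eq0 x : (cR x == 0) = (x == 0).
Proof. exact: (fmorph_eq0 (real_complex R)). Qed.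

Lemma nrmE (z : C) : `|z| = cR (nrm z).
Proof. by rewrite /nrm normc_def. Qed.

Lemma ler_cR (x y : R) : (cR x <= cR y) = (x <= y).
Proof. exact: lecR. Qed.
Lemma ltr_cR (x y : R) : (cR x < cR y) = (x < y).
Proof. exact: ltcR. Qed.
Lemma cR_inj (x y : R) : cR x = cR y -> x = y.
Proof. by case. Qed.

Lemma pos_cR (r : C) : 0 < r -> exists2 s : R, 0 < s & r = cR s.
Proof.
move=> r0; have /complex_realP[s e] : r \is Num.real by apply: gtr0_real.
by exists s; rewrite ?e // -ltr_cR cR0 -[cR s]/(s%:C)%C -e.
Qed.

Lemma nrm_def (z : C) : nrm z = Num.sqrt (complex.Re z ^+ 2 + complex.Im z ^+ 2).
Proof. by rewrite /nrm normc_def. Qed.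

Lemma nrm_ge0 z : 0 <= nrm z.
Proof. by rewrite -ler_cR -nrmE normr_ge0. Qed.
Lemma nrm0 : nrm 0 = 0.
Proof. by apply: cR_inj; rewrite -nrmE normr0. Qed.
Lemma nrm1 : nrm 1 = 1.
Proof. by apply: cR_inj; rewrite -nrmE normr1. Qed.
Lemma nrmM x y : nrm (x * y) = nrm x * nrm y.
Proof. by apply: cR_inj; rewrite cRM -!nrmE normrM. Qed.
Lemma nrmV x : nrm x^-1 = (nrm x)^-1.
Proof. by apply: cR_inj; rewrite cRV -!nrmE normfV. Qed.
Lemma nrmX x n : nrm (x ^+ n) = nrm x ^+ n.
Proof. by apply: cR_inj; rewrite cRX -!nrmE normrX. Qed.
Lemma nrmD x y : nrm (x + y) <= nrm x + nrm y.
Proof. by rewrite -ler_cR cRD -!nrmE ler_normD. Qed.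
Lemma nrmN x : nrm (- x) = nrm x.
Proof. by apply: cR_inj; rewrite -!nrmE normrN. Qed.
Lemma nrmBC x y : nrm (x - y) = nrm (y - x).
Proof. by rewrite -nrmN opprB. Qed.
Lemma nrmB x y : nrm (x - y) <= nrm x + nrm y.
Proof. by rewrite -(nrmN y) nrmD. Qed.
Lemma nrm_eq0 x : (nrm x == 0) = (x == 0).
Proof. by rewrite -cR_eq0 -nrmE normr_eq0. Qed.
Lemma nrm_gt0 x : (0 < nrm x) = (x != 0).
Proof. by rewrite lt_neqAle nrm_ge0 andbT eq_sym nrm_eq0. Qed.
Lemma nrm_cR x : nrm (cR x) = `|x|.
Proof. by rewrite nrm_def /= expr0n addr0 sqrtr_sqr. Qed.
Lemma nrm_cR0 x : 0 <= x -> nrm (cR x) = x.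
Proof. by move=> x0; rewrite nrm_cR ger0_norm. Qed.
Lemma nrm_nat n : nrm n%:R = n%:R.
Proof. by rewrite -cRn nrm_cR0. Qed.
Lemma nrm_cI : nrm cI = 1.
Proof. by rewrite nrm_def /= expr0n add0r expr1n sqrtr1. Qed.
Lemma nrm_sum (I : Type) (s : seq I) (P : pred I) (f : I -> C) :
  nrm (\sum_(i <- s | P i) f i) <= \sum_(i <- s | P i) nrm (f i).
Proof.
elim: s => [|a s ih]; first by rewrite !big_nil nrm0.
rewrite !big_cons; case: ifP => // _.
by apply: (le_trans (nrmD _ _)); rewrite lerD2l.
Qed.
Lemma nrm_Re z : `|complex.Re z| <= nrm z.
Proof. by rewrite nrm_def -sqrtr_sqr ler_wsqrtr // lerDl sqr_ge0. Qed.
Lemma nrm_Im z : `|complex.Im z| <= nrm z.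
Proof. by rewrite nrm_def -sqrtr_sqr ler_wsqrtr // lerDr sqr_ge0. Qed.
Lemma cRI z : z = cR (complex.Re z) + cI * cR (complex.Im z).
Proof.
by case: z => a b; rewrite /cR /cI; apply/eqP; rewrite eq_complex /=; apply/andP; split;
  apply/eqP => /=; ring.
Qed.
Lemma nrm_le_eps z : (forall e, 0 < e -> nrm z <= e) -> z = 0.
Proof.
move=> h; apply/eqP; rewrite -nrm_eq0 eq_le nrm_ge0 andbT.
by apply/ler_addgt0Pr => e e0; rewrite add0r h.
Qed.
Lemma nrm_leD x y a b : nrm x <= a -> nrm y <= b -> nrm (x + y) <= a + b.
Proof. by move=> h1 h2; apply: (le_trans (nrmD _ _)); rewrite lerD. Qed.
Lemma nrm_leM x y a b : nrm x <= a -> nrm y <= b -> nrm (x * y) <= a * b.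
Proof. by move=> h1 h2; rewrite nrmM ler_pM ?nrm_ge0. Qed.
Lemma nrm_leX x a n : nrm x <= a -> nrm (x ^+ n) <= a ^+ n.
Proof. by move=> h; rewrite nrmX lerXn2r ?nnegrE ?nrm_ge0 // (le_trans (nrm_ge0 x)). Qed.
Lemma nrm_geB x y : nrm x - nrm y <= nrm (x + y).
Proof. by rewrite lerBlDr; apply: le_trans (nrmB _ _); rewrite addrK. Qed.

End ComplexNorm.
Arguments cI {R}.

Section UnorderedSums.
Variable R : realType.
Local Notation C := (Cplx R).

(** Sums run over duplicate-free lists in an arbitrary [eqType]: no enumeration of the indices is
    chosen, and the same results serve exponents, multi-indices and their products. [absb f M]
    bounds the l^1 norm of [f] by [M]. *)
Definition absb (I : eqType) (f : I -> C) (M : R) : Prop :=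
  forall s : seq I, uniq s -> \sum_(i <- s) nrm (f i) <= M.

Definition hsum (I : eqType) (f : I -> C) (s : C) : Prop :=
  forall e : R, 0 < e -> exists s0 : seq I, uniq s0 /\
    forall t, uniq t -> {subset s0 <= t} -> nrm (\sum_(i <- t) f i - s) <= e.

Lemma sum_uniq_le (I : eqType) (f : I -> R) (s t : seq I) :
  (forall i, 0 <= f i) -> uniq s -> {subset s <= t} ->
  \sum_(i <- s) f i <= \sum_(i <- t) f i.
Proof.
move=> f0; elim: s t => [|a s ih] t; first by rewrite big_nil sumr_ge0.
move=> /= /andP[as_ us] st; have at_ : a \in t by apply: st; rewrite inE eqxx.
rewrite (perm_big _ (perm_to_rem at_)) !big_cons lerD2l; apply: ih => // x xs.
have := st x; rewrite inE xs orbT => /(_ isT).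
rewrite (perm_mem (perm_to_rem at_)) inE => /orP[/eqP xa|//].
by rewrite -xa xs in as_.
Qed.

Lemma hsum_unique (I : eqType) (f : I -> C) s s' : hsum f s -> hsum f s' -> s = s'.
Proof.
move=> h h'; apply/eqP; rewrite -subr_eq0; apply/eqP/nrm_le_eps => e e0.
have e2 : 0 < e / 2 by lra.
have [t [ut ht]] := h _ e2; have [t' [ut' ht']] := h' _ e2.
have uu : uniq (undup (t ++ t')) by exact: undup_uniq.
have h1 := ht _ uu; have h2 := ht' _ uu.
rewrite [e]splitr; set S := \sum_(i <- undup (t ++ t')) f i in h1 h2.
have -> : s - s' = (S - s') + - (S - s) by ring.
apply: nrm_leD; last rewrite nrmN; [apply: h2|apply: h1] => x xt;
 by rewrite mem_undup mem_cat xt ?orbT.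
Qed.

Lemma hsum_ext (I : eqType) (f g : I -> C) s : f =1 g -> hsum f s -> hsum g s.
Proof. by move=> /funext ->. Qed.

Lemma hsumD (I : eqType) (f g : I -> C) s t :
  hsum f s -> hsum g t -> hsum (fun i => f i + g i) (s + t).
Proof.
move=> h h' e e0; have e2 : 0 < e / 2 by lra.
have [t1 [ut ht]] := h _ e2; have [t2 [ut' ht']] := h' _ e2.
exists (undup (t1 ++ t2)); split; first exact: undup_uniq.
move=> w uw sw; rewrite big_split /=.
set A := \sum_(i <- w) f i; set B := \sum_(i <- w) g i.
have -> : A + B - (s + t) = (A - s) + (B - t) by ring.
rewrite [e]splitr; apply: nrm_leD; [apply: ht|apply: ht'] => // x xt;
 by apply: sw; rewrite mem_undup mem_cat xt ?orbT.
Qed.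

Lemma hsumZ (I : eqType) (f : I -> C) s (c : C) :
  hsum f s -> hsum (fun i => c * f i) (c * s).
Proof.
move=> h e e0; have c1 : 0 < nrm c + 1 by rewrite ltr_wpDl ?nrm_ge0.
have e2 : 0 < e / (nrm c + 1) by rewrite divr_gt0.
have [t [ut ht]] := h _ e2; exists t; split=> // w uw sw.
rewrite -mulr_sumr -mulrBr nrmM; have := ht _ uw sw.
rewrite ler_pdivlMr // => h1; apply: le_trans h1; rewrite mulrC.
by rewrite ler_wpM2l ?nrm_ge0 // lerDl.
Qed.

Lemma hsumB (I : eqType) (f g : I -> C) s t :
  hsum f s -> hsum g t -> hsum (fun i => f i - g i) (s - t).
Proof.
move=> h /(hsumZ (-1)) h'; rewrite -mulN1r.
by apply: hsum_ext (hsumD h h') => i; rewrite mulN1r.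
Qed.

Lemma hsum_le (I : eqType) (f : I -> C) s M : absb f M -> hsum f s -> nrm s <= M.
Proof.
move=> h1 h2; apply/ler_addgt0Pr => e e0; have [t [ut ht]] := h2 _ e0.
have -> : s = \sum_(i <- t) f i + - (\sum_(i <- t) f i - s) by ring.
apply: nrm_leD; last by rewrite nrmN; exact: ht.
by apply: le_trans (h1 _ ut); exact: nrm_sum.
Qed.

Lemma absb_ge0 (I : eqType) (f : I -> C) M : absb f M -> 0 <= M.
Proof. by move=> /(_ [::] isT); rewrite big_nil. Qed.

Lemma absb_mono (I : eqType) (f g : I -> C) M :
  (forall i, nrm (f i) <= nrm (g i)) -> absb g M -> absb f M.
Proof. by move=> h hg s us; apply: le_trans (hg s us); apply: ler_sum => i _. Qed.

Lemma absb_le (I : eqType) (f : I -> C) M M' : M <= M' -> absb f M -> absb f M'.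
Proof. by move=> h hf s us; apply: le_trans (hf s us) h. Qed.

Lemma absbD (I : eqType) (f g : I -> C) M M' :
  absb f M -> absb g M' -> absb (fun i => f i + g i) (M + M').
Proof.
move=> h h' s us; apply: le_trans (lerD (h s us) (h' s us)).
by rewrite -big_split; apply: ler_sum => i _; exact: nrmD.
Qed.

Lemma absbZ (I : eqType) (f : I -> C) M c :
  absb f M -> absb (fun i => c * f i) (nrm c * M).
Proof.
move=> h s us; under eq_bigr do rewrite nrmM.
by rewrite -mulr_sumr ler_wpM2l ?nrm_ge0 // h.
Qed.

Lemma absbN (I : eqType) (f : I -> C) M : absb f M -> absb (fun i => - f i) M.
Proof. by apply: absb_mono => i; rewrite nrmN. Qed.

Lemma absb_inj (I J : eqType) (h : I -> J) (f : J -> C) M :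
  injective h -> absb f M -> absb (f \o h) M.
Proof.
move=> hi hf s us; rewrite -(big_map h xpredT (fun j => nrm (f j))).
by apply: hf; rewrite map_inj_uniq.
Qed.

Lemma absb_fin (I : eqType) (f : I -> C) (s : seq I) : (forall i, i \notin s -> f i = 0) ->
  absb f (\sum_(i <- s) nrm (f i)).
Proof.
move=> fs t ut; rewrite (bigID (mem s)) /= [X in _ + X]big1 ?addr0; last first.
  by move=> i /fs ->; rewrite nrm0.
rewrite -big_filter; apply: sum_uniq_le => [i||i]; rewrite ?nrm_ge0 ?filter_uniq //.
by rewrite mem_filter => /andP[].
Qed.

Lemma hsum_fin (I : eqType) (f : I -> C) (s : seq I) : uniq s ->
  (forall i, i \notin s -> f i = 0) -> hsum f (\sum_(i <- s) f i).
Proof.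
move=> us fs e e0; exists s; split=> // t ut st.
rewrite [X in X - _](bigID (mem s)) /= [X in _ + X - _]big1 ?addr0; last by move=> i /fs.
rewrite -big_filter (perm_big s) ?subrr ?nrm0 ?ltW //.
apply: uniq_perm; rewrite ?filter_uniq // => i; rewrite mem_filter.
by apply/andP/idP => [[]//|si]; split=> //; exact: st.
Qed.

Lemma hsum_single (I : eqType) (f : I -> C) i0 : (forall i, i != i0 -> f i = 0) ->
  hsum f (f i0).
Proof.
move=> h; have := @hsum_fin _ f [:: i0] isT; rewrite big_seq1; apply=> i.
by rewrite inE => /h.
Qed.

Lemma absb_single (I : eqType) (f : I -> C) i0 : (forall i, i != i0 -> f i = 0) ->
  absb f (nrm (f i0)).
Proof.
move=> h; have := @absb_fin _ f [:: i0]; rewrite big_seq1; apply=> i.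
by rewrite inE => /h.
Qed.

Lemma hsum0 (I : eqType) : hsum (fun _ : I => 0) 0.
Proof. by have := @hsum_fin I (fun=> 0) [::] isT; rewrite big_nil; apply. Qed.

Lemma hsum_reindex (I J : eqType) (h : I -> J) (f : J -> C) s : injective h ->
  (forall j, f j != 0 -> exists i, j = h i) -> hsum (f \o h) s -> hsum f s.
Proof.
move=> hi him hs e e0; have [t [ut ht]] := hs _ e0.
exists (map h t); split=> [|w uw sw]; first by rewrite map_inj_uniq.
have [t' [ut' mt' eqt]] : exists t', [/\ uniq t', forall i, (i \in t') = (h i \in w) &
    \sum_(i <- t') f (h i) = \sum_(j <- w) f j].
  elim: w uw {sw} => [|j w ih] /=; first by exists [::]; split=> //; rewrite !big_nil.
  move=> /andP[jw uw]; have [t' [ut' mt' et']] := ih uw.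
  have [[i ji]|nj] := pselect (exists i, j = h i).
    exists (i :: t'); split=> [|i'|].
    - by rewrite /= ut' mt' -ji jw.
    - by rewrite !inE mt' ji (inj_eq hi).
    - by rewrite !big_cons et' ji.
  exists t'; split=> // [i|].
    rewrite mt' inE; case: eqP => // hij; by case: nj; exists i.
  rewrite big_cons; have [->|/him//] := eqVneq (f j) 0; by rewrite add0r.
rewrite -eqt; apply: ht => // x xt; rewrite mt'; apply: sw; exact: map_f.
Qed.

Lemma choose_cover (I J : eqType) (t : seq J) (P : J -> seq I -> Prop) :
  (forall j, j \in t -> exists s0 : seq I, forall s : seq I, uniq s -> {subset s0 <= s} -> P j s) ->
  exists s0 : seq I, forall s : seq I, uniq s -> {subset s0 <= s} -> forall j, j \in t -> P j s.
Proof.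
elim: t => [|j t ih] h; first by exists [::].
have [j0 jt0|s0 hs0] := ih; first by apply: h; rewrite inE jt0 orbT.
have [|s1 hs1] := h j; first by rewrite inE eqxx.
exists (s0 ++ s1) => s us ss j'; rewrite inE => /orP[/eqP ->|].
  by apply: hs1 => // x xs; apply: ss; rewrite mem_cat xs orbT.
by apply: hs0 => // x xs; apply: ss; rewrite mem_cat xs.
Qed.

Lemma sum_fibers (I J : eqType) (V : nmodType) (p : I -> J) (f : I -> V) (S : seq I) (t : seq J) :
  uniq t ->
  \sum_(j <- t) \sum_(i <- S) (if p i == j then f i else 0) =
  \sum_(i <- [seq i <- S | p i \in t]) f i.
Proof.
move=> ut; rewrite exchange_big /= [RHS]big_filter [RHS]big_mkcond /=; apply: eq_bigr => i _.
case: ifP => pit; last first.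
  rewrite big_seq big1 // => j jt; case: eqP => // pj; by rewrite -pj pit in jt.
rewrite (bigD1_seq (p i)) //= eqxx big1 ?addr0 // => j; by rewrite eq_sym => /negbTE ->.
Qed.

Lemma fibers_approx (I J : eqType) (p : I -> J) (f : I -> C) (g : J -> C) (t : seq J) (e : R) :
  (forall j, hsum (fun i => if p i == j then f i else 0) (g j)) -> 0 < e ->
  exists s0 : seq I, forall S : seq I, uniq S -> {subset s0 <= S} ->
  forall j, j \in t -> nrm (\sum_(i <- S) (if p i == j then f i else 0) - g j) <= e / (size t)%:R.
Proof.
move=> h e0; apply: choose_cover => j jt; have t0 : (0 < size t)%N by case: t jt.
have [|s0 [_ hs0]] := h j (e / (size t)%:R); first by rewrite divr_gt0 ?ltr0n.
by exists s0.
Qed.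

Lemma sum_size_le (J : eqType) (t : seq J) (f : J -> R) (e : R) : 0 < e ->
  (forall j, j \in t -> f j <= e / (size t)%:R) -> \sum_(j <- t) f j <= e.
Proof.
move=> e0; case: t => [|j t] h; first by rewrite big_nil ltW.
apply: (@le_trans _ _ (\sum_(i <- j :: t) e / (size (j :: t))%:R)).
  by rewrite !big_seq; apply: ler_sum.
rewrite big_const_seq count_predT.
by rewrite iter_addr addr0 -[leLHS]mulr_natr -mulrA mulVf ?mulr1 // pnatr_eq0.
Qed.

(** Summation by blocks. For a finite list [t] of blocks, one finite set of indices approximates all
    block sums within a total of [e / 2]; the part of it lying over [t] is then a partial sum of [f]
    that contains [s0]. *)
Lemma hsum_group (I J : eqType) (p : I -> J) (f : I -> C) (g : J -> C) s :
  (forall j, hsum (fun i => if p i == j then f i else 0) (g j)) ->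
  hsum f s -> hsum g s.
Proof.
move=> h hs e e0; have e2 : 0 < e / 2 by lra.
have [s0 [us0 hs0]] := hs _ e2; exists (undup (map p s0)); split; first exact: undup_uniq.
move=> t ut st; have [s1 hs1] := fibers_approx t h e2.
pose S := undup (s0 ++ s1).
have uS : uniq S by exact: undup_uniq.
have S1 : {subset s1 <= S} by move=> x xs; rewrite mem_undup mem_cat xs orbT.
have := hs1 S uS S1; move=> hS.
have -> : \sum_(i <- t) g i - s = \sum_(j <- t) (g j - \sum_(i <- S) (if p i == j then f i else 0))
    + (\sum_(i <- [seq i <- S | p i \in t]) f i - s).
  by rewrite -sum_fibers // sumrB; ring.
rewrite [e]splitr; apply: nrm_leD.
  apply: le_trans (nrm_sum _ _ _) _; apply: sum_size_le => // j jt.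
  by rewrite nrmBC; exact: hS.
apply: hs0; first by rewrite filter_uniq.
move=> x xs; rewrite mem_filter mem_undup mem_cat xs andbT; apply: st.
by rewrite mem_undup map_f.
Qed.

Lemma absb_group (I J : eqType) (p : I -> J) (f : I -> C) (g : J -> C) M :
  (forall j, hsum (fun i => if p i == j then f i else 0) (g j)) ->
  absb f M -> absb g M.
Proof.
move=> h hM t ut; apply/ler_addgt0Pr => e e0.
have [s1 hs1] := fibers_approx t h e0.
pose S := undup s1.
have uS : uniq S by exact: undup_uniq.
have S1 : {subset s1 <= S} by move=> x xs; rewrite mem_undup.
have {hs1} hS := hs1 S uS S1.
apply: (@le_trans _ _ (\sum_(j <- t) (\sum_(i <- S) (if p i == j then nrm (f i) else 0)
   + nrm (\sum_(i <- S) (if p i == j then f i else 0) - g j)))).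
  apply: ler_sum => j _; set A := \sum_(i <- S) (if _ then f i else _).
  rewrite [in leLHS](_ : g j = A + - (A - g j)); last by ring.
  apply: nrm_leD; last by rewrite nrmN.
  apply: le_trans (nrm_sum _ _ _) _; apply: ler_sum => i _.
  by case: ifP; rewrite ?nrm0.
rewrite big_split /=; apply: lerD; last exact: sum_size_le.
rewrite sum_fibers //; apply: hM; exact: filter_uniq.
Qed.

Lemma hsum_ex_ge0 (I : eqType) (f : I -> R) M : (forall i, 0 <= f i) ->
  absb (fun i => cR (f i)) M -> exists s, hsum (fun i => cR (f i)) s.
Proof.
move=> f0 hM; pose A := [set x | exists2 s : seq I, uniq s & x = \sum_(i <- s) f i].
have hsA : has_sup A.
  split; first by exists 0; exists [::] => //; rewrite big_nil.
  exists M => _ [s us ->]; apply: le_trans (hM s us); apply: ler_sum => i _.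
  by rewrite nrm_cR0.
exists (cR (sup A)) => e e0; have [_ [s us ->] hlt] := sup_adherent e0 hsA.
exists s; split=> // t ut st; rewrite -cR_sum -cRB nrm_cR.
have h1 := sum_uniq_le f0 us st.
have h2 : \sum_(i <- t) f i <= sup A by apply: ub_le_sup; [case: hsA|exists t].
by rewrite ler0_norm; lra.
Qed.

(** Real and imaginary parts are treated apart, and a real family g is the difference of the
    nonnegative families |g| + g and |g|, whose sums are suprema. *)
Lemma hsum_ex (I : eqType) (f : I -> C) M : absb f M -> exists s, hsum f s.
Proof.
move=> hM.
have pos (g : I -> R) : (forall i, `|g i| <= nrm (f i)) -> exists s, hsum (fun i => cR (g i)) s.
  move=> hg; have [|//|s1 h1] := @hsum_ex_ge0 _ (fun i => `|g i| + g i) (M + M).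
  - by move=> i; have := ler_norm (- g i); rewrite normrN; lra.
  - have hf := absbD hM hM; apply: absb_mono (_ : absb (fun i => cR (nrm (f i) + nrm (f i))) _).
      move=> i; rewrite !nrm_cR [leRHS]ger0_norm ?addr_ge0 ?nrm_ge0 //.
      by apply: le_trans (ler_normD _ _) _; rewrite normr_id lerD.
    move=> s us; under eq_bigr do rewrite nrm_cR0 ?addr_ge0 ?nrm_ge0 //.
    by rewrite big_split lerD // hM.
  have [|//|s2 h2] := @hsum_ex_ge0 _ (fun i => `|g i|) M => //.
    by apply: absb_mono hM => i; rewrite nrm_cR normr_id.
  exists (s1 - s2); apply: hsum_ext (hsumB h1 h2) => i; by rewrite cRD; ring.
have [s1 h1] := pos (fun i => complex.Re (f i)) (fun i => nrm_Re _).
have [s2 h2] := pos (fun i => complex.Im (f i)) (fun i => nrm_Im _).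
exists (s1 + cI * s2); apply: hsum_ext (hsumD h1 (hsumZ cI h2)) => i.
by rewrite -cRI.
Qed.

(** A finite set of pairs is contained in the product of its two projections. *)
Lemma absb_sig (K J : eqType) (f : K -> J -> C) (m : K -> R) M :
  (forall k, absb (f k) (m k)) -> (forall s, uniq s -> \sum_(k <- s) m k <= M) ->
  absb (fun kj => f kj.1 kj.2) M.
Proof.
move=> h hM S uS; pose s1 := undup (map fst S); pose s2 := undup (map snd S).
apply: le_trans (hM s1 (undup_uniq _)).
apply: (@le_trans _ _ (\sum_(k <- s1) \sum_(j <- s2) nrm (f k j))); last first.
  by apply: ler_sum => k _; apply: h; exact: undup_uniq.
rewrite -(@big_allpairs _ _ _ _ _ s1 s2 (fun kj => nrm (f kj.1 kj.2))).
apply: sum_uniq_le => // [kj|[k j] kj]; first exact: nrm_ge0.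
apply/allpairsP; exists (k, j); rewrite !mem_undup; split=> //.
  by apply/mapP; exists (k, j).
by apply/mapP; exists (k, j).
Qed.

Lemma hsum_fiber1 (K J : eqType) (f : K -> J -> C) k s : hsum (f k) s ->
  hsum (fun kj => if kj.1 == k then f kj.1 kj.2 else 0) s.
Proof.
move=> h; apply: (@hsum_reindex _ _ (fun j => (k, j))) => [j j' []//|[k' j] /=|].
  by case: (eqVneq k' k) => [->|]; [exists j|rewrite eqxx].
by apply: hsum_ext h => j /=; rewrite eqxx.
Qed.

Lemma hsum_fiber2 (K J : eqType) (f : K -> J -> C) j s : hsum (f^~ j) s ->
  hsum (fun kj => if kj.2 == j then f kj.1 kj.2 else 0) s.
Proof.
move=> h; apply: (@hsum_reindex _ _ (fun k => (k, j))) => [k k' []//|[k j'] /=|].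
  by case: (eqVneq j' j) => [->|]; [exists k|rewrite eqxx].
by apply: hsum_ext h => k /=; rewrite eqxx.
Qed.

Lemma hsum_iter1 (K J : eqType) (f : K -> J -> C) (a : K -> C) s :
  (forall k, hsum (f k) (a k)) -> hsum (fun kj => f kj.1 kj.2) s -> hsum a s.
Proof.
by move=> h; apply: (hsum_group (p := fst)) => k; apply: hsum_fiber1; exact: h.
Qed.

Lemma hsum_iter2 (K J : eqType) (f : K -> J -> C) (a : J -> C) s :
  (forall j, hsum (f^~ j) (a j)) -> hsum (fun kj => f kj.1 kj.2) s -> hsum a s.
Proof.
by move=> h; apply: (hsum_group (p := snd)) => k; apply: hsum_fiber2; exact: h.
Qed.

Lemma absb_iter2 (K J : eqType) (f : K -> J -> C) (a : J -> C) M :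
  (forall j, hsum (f^~ j) (a j)) -> absb (fun kj => f kj.1 kj.2) M -> absb a M.
Proof.
by move=> h; apply: (absb_group (p := snd)) => k; apply: hsum_fiber2; exact: h.
Qed.

Lemma absb_prod (K J : eqType) (f : K -> C) (g : J -> C) M N :
  absb f M -> absb g N -> absb (fun kj => f kj.1 * g kj.2) (M * N).
Proof.
move=> hf hg; apply: (absb_sig (f := fun k j => f k * g j) (m := fun k => nrm (f k) * N)) => [k|s us].
  exact: absbZ.
by rewrite -mulr_suml ler_wpM2r ?(absb_ge0 hg) // hf.
Qed.

Lemma hsum_prod (K J : eqType) (f : K -> C) (g : J -> C) M N s t :
  absb f M -> absb g N -> hsum f s -> hsum g t ->
  hsum (fun kj => f kj.1 * g kj.2) (s * t).
Proof.
move=> hf hg hs ht; have [u hu] := hsum_ex (absb_prod hf hg).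
suff -> : s * t = u by [].
have h1 := @hsum_iter1 _ _ (fun k j => f k * g j) (fun k => f k * t) u (fun k => hsumZ _ ht) hu.
apply: hsum_unique h1; rewrite mulrC.
by apply: hsum_ext (hsumZ t hs) => i; rewrite mulrC.
Qed.

(* A total choice of the sum; meaningless on families that are not summable. *)
Definition hs (I : eqType) (f : I -> C) : C := xget 0 [set s | hsum f s].

Lemma hsP (I : eqType) (f : I -> C) M : absb f M -> hsum f (hs f).
Proof. by move=> /hsum_ex[s h]; apply: (@xgetPex _ 0 [set s | hsum f s]); exists s. Qed.

Lemma hsE (I : eqType) (f : I -> C) s : hsum f s -> hs f = s.
Proof.
by move=> h; apply: (@hsum_unique _ f) => //; apply: (@xgetPex _ 0 [set s | hsum f s]); exists s.
Qed.

End UnorderedSums.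

Section Geometric.
Variable R : realType.
Local Notation C := (Cplx R).

Lemma geometric_le (q : R) (s : seq nat) : 0 <= q -> q < 1 -> uniq s ->
  \sum_(k <- s) q ^+ k <= (1 - q)^-1.
Proof.
move=> q0 q1 us; pose n := (\max_(k <- s) k).+1.
have hs k : k \in s -> (k < n)%N by move=> ks; rewrite ltnS; exact: leq_bigmax_seq.
apply: (@le_trans _ _ (\sum_(0 <= k < n) q ^+ k)).
  apply: sum_uniq_le => [k||k /hs]; [exact: exprn_ge0|by []|by rewrite mem_index_iota].
have q1' : 0 < 1 - q by lra.
rewrite big_mkord -[leRHS]mul1r ler_pdivlMr //.
have -> : (\sum_(i < n) q ^+ i) * (1 - q) = - (q ^+ n - 1) by rewrite subrX1; ring.
by have := exprn_ge0 n q0; lra.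
Qed.

Lemma geometric_absb (q : C) : nrm q < 1 -> absb (fun k : nat => q ^+ k) (1 - nrm q)^-1.
Proof.
move=> q1 s us; under eq_bigr do rewrite nrmX.
by apply: geometric_le; rewrite ?nrm_ge0.
Qed.

(** Convergence is already known, and shifting the index shows that the sum satisfies s = 1 + q
    s. *)
Lemma geometric_hsum (q : C) : nrm q < 1 -> hsum (fun k : nat => q ^+ k) (1 - q)^-1.
Proof.
move=> q1; have [s hs] := hsum_ex (geometric_absb q1).
suff -> : (1 - q)^-1 = s by [].
have h1 : hsum (fun k : nat => q ^+ k) (1 + q * s).
  have h2 : hsum (fun k : nat => if k == 0%N then 1 else 0 : C) 1.
    by have := @hsum_single R _ (fun k : nat => if k == 0%N then 1 else 0 : C) 0%N; apply=> i /negbTE ->.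
  have h3 : hsum (fun k : nat => if k == 0%N then 0 else q ^+ k) (q * s).
    apply: (@hsum_reindex _ _ _ succn) => [i j []//|[|j]|]; first by rewrite /= eqxx.
      by exists j.
    by apply: hsum_ext (hsumZ q hs) => i /=; rewrite exprS.
  by apply: hsum_ext (hsumD h2 h3) => -[|i] /=; rewrite ?addr0 ?add0r.
have e := hsum_unique hs h1.
have n0 : 1 - q != 0.
  by apply/eqP => /subr0_eq q1'; move: q1; rewrite -q1' nrm1 ltxx.
apply: (mulfI n0); rewrite divff //.
by rewrite mulrBl mul1r {1}e addrK.
Qed.

End Geometric.

(** * Algebras of absolutely convergent series *)

Section MonomialSystems.
Variable R : realType.
Local Notation C := (Cplx R).

(* A family of monomials that is closed under products and bounded by 1 on a
   domain [mdom], which stands for the closed unit polydisc. *)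
Record msys := MSys {
  mi : eqType;
  mt : Type;
  mdom : mt -> Prop;
  mv : mi -> mt -> C;
  mone : mi;
  mmul : mi -> mi -> mi;
  mv_le1 : forall a z, mdom z -> nrm (mv a z) <= 1;
  mv1 : forall z, mv mone z = 1;
  mvM : forall a b z, mv (mmul a b) z = mv a z * mv b z }.

Variable Q : msys.
Local Notation J := (mi Q).
Local Notation T := (mt Q).
Implicit Types (f g : T -> C) (c : J -> C) (M N : R).

(** An upper bound for the Wiener norm, stated without an infimum. The coefficients stay
    existential, so that computing with functions requires no uniqueness of the expansion. *)
Definition mass f M : Prop :=
  exists c : J -> C, absb c M /\
    forall z, mdom z -> hsum (fun a => c a * mv a z) (f z).

Definition ev c (z : T) : C := hs (fun a => c a * mv a z).

Lemma absb_mv c M z : absb c M -> mdom z -> absb (fun a => c a * mv a z) M.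
Proof.
move=> h hz; apply: absb_mono h => a; rewrite nrmM ler_piMr ?nrm_ge0 //.
exact: mv_le1.
Qed.

Lemma ev_hsum c M z : absb c M -> mdom z -> hsum (fun a => c a * mv a z) (ev c z).
Proof. by move=> h hz; exact: hsP (absb_mv h hz). Qed.

Lemma mass_ev c M : absb c M -> mass (ev c) M.
Proof. by move=> h; exists c; split=> // z hz; exact: ev_hsum h hz. Qed.

Lemma mass_ge0 f M : mass f M -> 0 <= M.
Proof. by case=> c [/absb_ge0]. Qed.

Lemma mass_le f M N : M <= N -> mass f M -> mass f N.
Proof. by move=> h [c [hc hf]]; exists c; split=> //; exact: absb_le hc. Qed.

Lemma mass_ext f g M : (forall z, mdom z -> f z = g z) -> mass f M -> mass g M.
Proof. by move=> h [c [hc hf]]; exists c; split=> // z hz; rewrite -h //; exact: hf. Qed.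

Lemma mass_sup f M z : mass f M -> mdom z -> nrm (f z) <= M.
Proof. by move=> [c [hc hf]] hz; exact: hsum_le (absb_mv hc hz) (hf z hz). Qed.

Lemma mass_mono a : mass (mv a) 1.
Proof.
exists (fun b => if b == a then 1 else 0); split.
  have := @absb_single R J (fun b => if b == a then 1 else 0) a.
  by rewrite eqxx nrm1; apply=> i /negbTE ->.
move=> z hz; have := @hsum_single R J (fun b => (if b == a then 1 else 0) * mv b z) a.
by rewrite eqxx mul1r; apply=> i /negbTE ->; rewrite mul0r.
Qed.

Lemma massZ f M (k : C) : mass f M -> mass (fun z => k * f z) (nrm k * M).
Proof.
move=> [c [hc hf]]; exists (fun a => k * c a); split; first exact: absbZ.
by move=> z hz; apply: hsum_ext (hsumZ k (hf z hz)) => a; rewrite mulrA.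
Qed.

Lemma mass_const (k : C) : mass (fun _ => k) (nrm k).
Proof.
have := massZ k (mass_mono (mone Q)); rewrite mulr1.
by apply: mass_ext => z _; rewrite mv1 mulr1.
Qed.

Lemma mass1 : mass (fun _ => 1) 1.
Proof. by have := mass_const 1; rewrite nrm1. Qed.

Lemma mass0 M : 0 <= M -> mass (fun _ => 0) M.
Proof. by move=> h; apply: mass_le (mass_const 0); rewrite nrm0. Qed.

Lemma massD f g M N : mass f M -> mass g N -> mass (fun z => f z + g z) (M + N).
Proof.
move=> [c [hc hf]] [d [hd hg]]; exists (fun a => c a + d a); split; first exact: absbD.
by move=> z hz; apply: hsum_ext (hsumD (hf z hz) (hg z hz)) => a; rewrite mulrDl.
Qed.

Lemma massN f M : mass f M -> mass (fun z => - f z) M.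
Proof.
move=> /(massZ (-1)); rewrite nrmN nrm1 mul1r.
by apply: mass_ext => z _; rewrite mulN1r.
Qed.

Lemma massB f g M N : mass f M -> mass g N -> mass (fun z => f z - g z) (M + N).
Proof. by move=> hf hg; exact: (massD hf (massN hg)). Qed.

Lemma mass_sum (K : eqType) (f : K -> T -> C) (m : K -> R) g M :
  (forall k, mass (f k) (m k)) ->
  (forall s : seq K, uniq s -> \sum_(k <- s) m k <= M) ->
  (forall z, mdom z -> hsum (fun k => f k z) (g z)) -> mass g M.
Proof.
move=> hf hm hg; have [c hc] := choice hf.
have hp : absb (fun ka => c ka.1 ka.2) M by exact: (absb_sig (fun k => (hc k).1)).
have hcol a : hsum (fun k => c k a) (hs (fun k => c k a)).
  by apply: (@hsP _ _ _ M); apply: (absb_inj (h := fun k => (k, a)) _ hp) => k k' [].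
exists (fun a => hs (fun k => c k a)); split; first exact: absb_iter2 hp.
move=> z hz; have hpz : absb (fun ka => c ka.1 ka.2 * mv ka.2 z) M.
  apply: absb_mono hp => -[k a] /=; rewrite nrmM ler_piMr ?nrm_ge0 //; exact: mv_le1.
have [u hu] := hsum_ex hpz.
have hu1 := @hsum_iter1 _ _ _ (fun k a => c k a * mv a z) _ _ (fun k => (hc k).2 z hz) hu.
rewrite (hsum_unique (hg z hz) hu1).
apply: (@hsum_iter2 _ _ _ (fun k a => c k a * mv a z)) hu => a.
by rewrite mulrC; apply: hsum_ext (hsumZ (mv a z) (hcol a)) => k; rewrite mulrC.
Qed.

(** No Cauchy product is formed: the products of monomials, indexed by pairs, are themselves
    monomials and are summed by [mass_sum]. *)
Lemma massM f g M N : mass f M -> mass g N -> mass (fun z => f z * g z) (M * N).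
Proof.
move=> [c [hc hf]] [d [hd hg]].
apply: (@mass_sum _ (fun ab => fun z => c ab.1 * d ab.2 * mv (mmul ab.1 ab.2) z)
   (fun ab => nrm (c ab.1 * d ab.2))).
- by move=> ab; rewrite -[nrm _]mulr1; apply: massZ; exact: mass_mono.
- exact: absb_prod hc hd.
- move=> z hz; apply: hsum_ext (hsum_prod (absb_mv hc hz) (absb_mv hd hz) (hf z hz) (hg z hz)).
  by move=> ab /=; rewrite mvM; ring.
Qed.

Lemma massX f M n : mass f M -> mass (fun z => f z ^+ n) (M ^+ n).
Proof.
move=> h; elim: n => [|n ih]; first by rewrite expr0; apply: mass_ext mass1 => z _.
by rewrite exprS; apply: mass_ext (massM h ih) => z _; rewrite exprS.
Qed.

Lemma mass_bigsum (I : Type) (s : seq I) (f : I -> T -> C) (m : I -> R) :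
  (forall i, mass (f i) (m i)) ->
  mass (fun z => \sum_(i <- s) f i z) (\sum_(i <- s) m i).
Proof.
move=> h; elim: s => [|i s ih].
  by rewrite big_nil; apply: mass_ext (mass0 (lexx 0)) => z _; rewrite big_nil.
by rewrite big_cons; apply: mass_ext (massD (h i) ih) => z _; rewrite big_cons.
Qed.

Lemma mass_inv f q : q < 1 -> mass f q -> mass (fun z => (1 - f z)^-1) (1 - q)^-1.
Proof.
move=> q1 hf; have q0 := mass_ge0 hf.
apply: (@mass_sum _ (fun k z => f z ^+ k) (fun k => q ^+ k)) => [k|s us|z hz].
- exact: massX.
- exact: geometric_le.
- by apply: geometric_hsum; apply: le_lt_trans q1; exact: mass_sup hf hz.
Qed.

End MonomialSystems.

(** * Neighbourhoods in terms of the real modulus *)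

Section Near.
Variable R : realType.
Local Notation C := (Cplx R).

Lemma ball_nrm (x y : C) (r : R) : ball x (cR r) y <-> nrm (y - x) < r.
Proof. by rewrite -ball_normE /ball_ /= distrC nrmE ltr_cR. Qed.

Lemma near_C (p : C) (P : C -> Prop) :
  (\forall x \near p, P x) <-> exists2 r : R, 0 < r & forall x, nrm (x - p) < r -> P x.
Proof.
split=> [/nbhs_ballP[e /= /pos_cR[r r0 ->] h]|[r r0 h]].
  by exists r => // x hx; apply: h; apply/ball_nrm.
apply/nbhs_ballP; exists (cR r); first by rewrite /= -cR0 ltr_cR.
by move=> x /ball_nrm; exact: h.
Qed.

Lemma near_dnbhs (p : C) (P : C -> Prop) :
  (\forall x \near p^', P x) <->
  exists2 r : R, 0 < r & forall x, x != p -> nrm (x - p) < r -> P x.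
Proof.
have -> : (\forall x \near p^', P x) <-> (\forall x \near p, x != p -> P x) by [].
rewrite near_C; split=> -[r r0 h]; exists r => // x; first by move=> *; exact: h.
by move=> h1 h2; exact: h.
Qed.

Lemma near_rV n (P : 'rV[C]_n -> Prop) :
  (\forall z \near (0 : 'rV[C]_n), P z) <->
  exists2 r : R, 0 < r & forall z : 'rV[C]_n, (forall i, nrm (z 0 i) < r) -> P z.
Proof.
split=> [/nbhs_ballP[e /= /pos_cR[r r0 ->] h]|[r r0 h]].
  exists r => // z hz; apply: h; split=> [|i j]; first by rewrite -cR0 ltr_cR.
  by rewrite ord1 mxE; apply/ball_nrm; rewrite subr0.
apply/nbhs_ballP; exists (cR r); first by rewrite /= -cR0 ltr_cR.
move=> z [_ hz]; apply: h => i; have := hz 0 i; rewrite mxE => /ball_nrm.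
by rewrite subr0.
Qed.

Lemma near_pair n (P : C * 'rV[C]_n -> Prop) :
  (\forall z \near ((0, 0) : C * 'rV[C]_n), P z) <->
  exists2 r : R, 0 < r &
    forall x (l : 'rV[C]_n), nrm x < r -> (forall i, nrm (l 0 i) < r) -> P (x, l).
Proof.
split=> [/nbhs_ballP[e /= /pos_cR[r r0 ->] h]|[r r0 h]].
  exists r => // x l hx hl; apply: h; split => /=.
    by apply/ball_nrm; rewrite subr0.
  split=> [|i j]; first by rewrite -cR0 ltr_cR.
  by rewrite ord1 mxE; apply/ball_nrm; rewrite subr0.
apply/nbhs_ballP; exists (cR r); first by rewrite /= -cR0 ltr_cR.
move=> [x l] [/= /ball_nrm hx [_ hl]]; apply: h; first by rewrite subr0 in hx.
by move=> i; have := hl 0 i; rewrite mxE => /ball_nrm; rewrite subr0.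
Qed.

End Near.

(** * Monomials in a main variable and parameters *)

Section Systems.
Variable R : realType.
Local Notation C := (Cplx R).

Definition pmon m (a : {ffun 'I_m -> nat}) (z : 'rV[C]_m) : C := \prod_i z 0 i ^+ a i.

Lemma pmon_le1 m a (z : 'rV[C]_m) : (forall i, nrm (z 0 i) <= 1) -> nrm (pmon a z) <= 1.
Proof.
move=> h; rewrite /pmon; elim/big_ind: _ => [|x y hx hy|i _]; first by rewrite nrm1.
  by rewrite nrmM mulr_ile1 ?nrm_ge0.
by rewrite nrmX exprn_ile1 ?nrm_ge0.
Qed.

Lemma pmon1 m (z : 'rV[C]_m) : pmon [ffun=> 0%N] z = 1.
Proof. by rewrite /pmon big1 // => i _; rewrite ffunE expr0. Qed.

Lemma pmonM m (a b : {ffun 'I_m -> nat}) (z : 'rV[C]_m) :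
  pmon [ffun i => (a i + b i)%N] z = pmon a z * pmon b z.
Proof. by rewrite /pmon -big_split; apply: eq_bigr => i _; rewrite ffunE exprD. Qed.

Definition par m : msys R :=
  @MSys R {ffun 'I_m -> nat} 'rV[C]_m (fun z => forall i, nrm (z 0 i) <= 1)
    (@pmon m) [ffun=> 0%N] (fun a b => [ffun i => (a i + b i)%N])
    (@pmon_le1 m) (@pmon1 m) (@pmonM m).

Section Ext.
Variable Q : msys R.

Definition emon (a : nat * mi Q) (z : C * mt Q) : C := z.1 ^+ a.1 * mv a.2 z.2.

Lemma emon_le1 a z : nrm z.1 <= 1 /\ mdom z.2 -> nrm (emon a z) <= 1.
Proof.
move=> [h1 h2]; rewrite nrmM mulr_ile1 ?nrm_ge0 //; last exact: mv_le1.
by rewrite nrmX exprn_ile1 ?nrm_ge0.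
Qed.

Lemma emon1 z : emon (0%N, mone Q) z = 1.
Proof. by rewrite /emon mv1 expr0 mulr1. Qed.

Lemma emonM a b z : emon ((a.1 + b.1)%N, mmul a.2 b.2) z = emon a z * emon b z.
Proof. by rewrite /emon mvM exprD /=; ring. Qed.

(** Adjoins one variable in front of [Q]. A single use gives functions of (x, lambda); two uses give
    functions of (s, x, lambda), as needed for flows. *)
Definition ext : msys R :=
  @MSys R (nat * mi Q)%type (C * mt Q)%type (fun z => nrm z.1 <= 1 /\ mdom z.2)
    emon (0%N, mone Q) (fun a b => ((a.1 + b.1)%N, mmul a.2 b.2)) emon_le1 emon1 emonM.

Lemma mass_lift (g : mt Q -> C) M : mass g M -> @mass R ext (fun z => g z.2) M.
Proof.
move=> [c [hc hg]].
apply: (@mass_sum R ext (mi Q) (fun b z => c b * @mv R ext (0%N, b) z) (fun b => nrm (c b))).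
- by move=> b; rewrite -[nrm _]mulr1; apply: massZ; exact: mass_mono.
- exact: hc.
- by move=> z [_ hz]; apply: hsum_ext (hg _ hz) => b /=; rewrite /emon expr0 mul1r.
Qed.

Lemma mass_x : @mass R ext (fun z => z.1) 1.
Proof.
by apply: mass_ext (@mass_mono R ext (1%N, mone Q)) => z _ /=; rewrite /emon mv1 expr1 mulr1.
Qed.

Lemma mass_at (f : C * mt Q -> C) M x : nrm x <= 1 -> @mass R ext f M -> mass (fun l => f (x, l)) M.
Proof.
move=> hx [c [hc hf]].
apply: (@mass_sum R Q (mi ext) (fun a l => c a * x ^+ a.1 * mv a.2 l) (fun a => nrm (c a))) => //.
- move=> a; apply: mass_le (massZ _ (mass_mono a.2)).
  by rewrite mulr1 nrmM ler_piMr ?nrm_ge0 // nrmX exprn_ile1 ?nrm_ge0.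
- by move=> l hl; apply: hsum_ext (hf (x, l) (conj hx hl)) => a /=; rewrite /emon; ring.
Qed.

(** Access to the Taylor coefficients in x at a fixed parameter: the double series is summed over
    the parameter monomials first. *)
Lemma slice (c : mi ext -> C) M l : absb c M -> mdom l ->
  absb (fun j => ev (fun b => c (j, b)) l) M /\
  forall x, nrm x <= 1 -> hsum (fun j => ev (fun b => c (j, b)) l * x ^+ j) (ev c (x, l)).
Proof.
move=> hc hl.
have hj j : absb (fun b => c (j, b)) M by apply: (absb_inj (h := pair j)) hc => b b' [].
have hjs j := ev_hsum (hj j) hl.
have hp : absb (fun a : mi ext => c a * mv a.2 l) M.
  apply: absb_mono hc => a; rewrite nrmM ler_piMr ?nrm_ge0 //; exact: mv_le1.
split=> [|x hx].
  apply: (absb_group (p := fst)) hp => j.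
  by apply: hsum_ext (@hsum_fiber1 R nat (mi Q) (fun j b => c (j, b) * mv b l) j _ (hjs j)) => -[].
have he := @ev_hsum R ext c M (x, l) hc (conj hx hl).
apply: (@hsum_iter1 R nat (mi Q) (fun j b => c (j, b) * emon (j, b) (x, l))); last first.
  by apply: hsum_ext he => -[j b].
move=> j; rewrite mulrC; apply: hsum_ext (hsumZ (x ^+ j) (hjs j)) => b.
by rewrite /emon /=; ring.
Qed.

End Ext.

(** Induction on j: once the lower coefficients of the difference vanish, its j-th term c'_j t^j is
    O(t^(j+1)) for small real t > 0, which forces c'_j = 0. *)
Lemma series_order (c : nat -> C) M (F : C -> C) (gam : C) d (K r : R) :
  absb c M -> (forall x, nrm x <= 1 -> hsum (fun j => c j * x ^+ j) (F x)) ->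
  0 < r -> (forall x, nrm x <= r -> nrm (F x - gam * x ^+ d) <= K * nrm x ^+ d.+1) ->
  c d = gam /\ forall j, (j < d)%N -> c j = 0.
Proof.
move=> hc hF r0 hK.
pose c' j := c j - (if j == d then gam else 0).
have hg1 : absb (fun j => if j == d then gam else 0 : C) (nrm gam).
  have := @absb_single R _ (fun j => if j == d then gam else 0 : C) d; rewrite eqxx.
  by apply=> i /negbTE ->.
have hc' : absb c' (M + nrm gam) by apply: absbD => //; exact: absbN.
have hF' x : nrm x <= 1 -> hsum (fun j => c' j * x ^+ j) (F x - gam * x ^+ d).
  move=> hx; have := @hsum_single R _ (fun j => if j == d then gam * x ^+ d else 0 : C) d.
  rewrite eqxx => h; have {}h := h (fun i => _).
  have h2 : hsum (fun j => if j == d then gam * x ^+ d else 0 : C) (gam * x ^+ d).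
    by apply: h => i /negbTE ->.
  apply: hsum_ext (hsumB (hF x hx) h2) => j; rewrite /c'.
  by case: eqP => [->|_]; ring.
suff key j : (j <= d)%N -> c' j = 0.
  split; first by have := key d (leqnn d); rewrite /c' eqxx => /subr0_eq.
  by move=> j jd; have := key j (ltnW jd); rewrite /c' ltn_eqF // subr0.
elim/ltn_ind: j => j ih jd.
pose M' := M + nrm gam.
have M'0 : 0 <= M' by exact: absb_ge0 hc'.
have low x : nrm x <= 1 -> nrm (F x - gam * x ^+ d - c' j * x ^+ j) <= M' * nrm x ^+ j.+1.
  move=> hx.
  have h2 : hsum (fun i => if i == j then c' j * x ^+ j else 0 : C) (c' j * x ^+ j).
    have := @hsum_single R _ (fun i => if i == j then c' j * x ^+ j else 0 : C) j.
    by rewrite eqxx; apply=> i /negbTE ->.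
  apply: hsum_le (hsumB (hF' x hx) h2).
  apply: absb_mono (_ : absb (fun i => cR (nrm x ^+ j.+1) * c' i) _); last first.
    by rewrite mulrC -[X in X * _](nrm_cR0 (exprn_ge0 j.+1 (nrm_ge0 x))); exact: absbZ.
  move=> i; rewrite nrmM nrm_cR0 ?exprn_ge0 ?nrm_ge0 //.
  case: (ltngtP i j) => [ij|ij|->].
  - by rewrite ih // ?mul0r ?subr0 ?nrm0 ?mulr0 // (leq_trans (ltnW ij)).
  - rewrite subr0 nrmM mulrC ler_wpM2r ?nrm_ge0 // nrmX.
    by apply: ler_wiXn2l; rewrite ?nrm_ge0.
  - by rewrite subrr nrm0 mulr_ge0 ?exprn_ge0 ?nrm_ge0.
apply: nrm_le_eps => e e0.
(* [K] has no prescribed sign; its positive part may be multiplied by t^(j+1), which is at least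
   t^(d+1). The summand 1 makes [K'] positive. *)
pose K' := Num.max K 0 + M' + 1.
have mx0 : 0 <= Num.max K 0 by rewrite le_max lexx orbT.
have K'0 : 0 < K' by rewrite /K'; lra.
pose t := Num.min (Num.min r 1) (e / K').
have t0 : 0 < t by rewrite !lt_min r0 ltr01 divr_gt0.
have tr : t <= r by rewrite !ge_min lexx.
have t1 : t <= 1 by rewrite !ge_min lexx !orbT.
have te : t * K' <= e by rewrite -ler_pdivlMr // ge_min lexx orbT.
have nt : nrm (cR t) = t by rewrite nrm_cR0 // ltW.
have h1 := low (cR t); rewrite nt in h1; have {h1} h1 := h1 t1.
have h2 := hK (cR t); rewrite nt in h2; have {h2} h2 := h2 tr.
have h3 : nrm (c' j) * t ^+ j <= K' * t ^+ j.+1.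
  rewrite -{1}nt -nrmX -nrmM.
  have -> : c' j * cR t ^+ j = (F (cR t) - gam * cR t ^+ d) -
     (F (cR t) - gam * cR t ^+ d - c' j * cR t ^+ j) by ring.
  apply: le_trans (nrmB _ _) _; apply: le_trans (lerD h2 h1) _.
  rewrite /K' !mulrDl mul1r.
  have h4 : K * t ^+ d.+1 <= Num.max K 0 * t ^+ j.+1.
    apply: (@le_trans _ _ (Num.max K 0 * t ^+ d.+1)).
      by rewrite ler_wpM2r ?exprn_ge0 ?le_max ?lexx // ltW.
    rewrite ler_wpM2l ?le_max ?lexx ?orbT //.
    by apply: ler_wiXn2l; rewrite ?ltnS // ltW.
  have := exprn_ge0 j.+1 (ltW t0); lra.
move: h3; rewrite exprS mulrA ler_pM2r ?exprn_gt0 // => h3.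
by apply: le_trans h3 _; rewrite mulrC.
Qed.

Lemma series_zero (c : nat -> C) M (r : R) :
  absb c M -> 0 < r -> (forall x, nrm x <= 1 -> nrm x <= r -> hsum (fun j => c j * x ^+ j) 0) ->
  forall j, c j = 0.
Proof.
move=> hc r0 h j.
pose F x := hs (fun j => c j * x ^+ j).
have hF x : nrm x <= 1 -> hsum (fun j => c j * x ^+ j) (F x).
  move=> hx; apply: (@hsP _ _ _ M); apply: absb_mono hc => i.
  by rewrite nrmM ler_piMr ?nrm_ge0 // nrmX exprn_ile1 ?nrm_ge0.
pose r' := Num.min r 1.
have r'0 : 0 < r' by rewrite lt_min r0 ltr01.
have [] // := @series_order c M F 0 j 0 r' hc hF r'0 => x hx.
rewrite mul0r subr0 mul0r /F (hsE (h x _ _)) ?nrm0 //; apply: le_trans hx _;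
  by rewrite ge_min lexx ?orbT.
Qed.

Definition deg m (b : {ffun 'I_m -> nat}) := (\sum_i b i)%N.

Lemma pmonZ m (b : {ffun 'I_m -> nat}) (s : C) (l : 'rV[C]_m) :
  pmon b (s *: l) = s ^+ deg b * pmon b l.
Proof.
rewrite /pmon /deg.
under eq_bigr do rewrite mxE exprMn.
by rewrite big_split /= -prodrXr.
Qed.

Lemma deg0 m (b : {ffun 'I_m -> nat}) : deg b = 0%N -> b = [ffun=> 0%N].
Proof.
move=> /eqP; rewrite sum_nat_eq0 => /forallP h; apply/ffunP => i; rewrite ffunE.
by have /eqP := h i.
Qed.

Definition scoef m (c : nat * {ffun 'I_m -> nat} -> C) (rho sig : R) : nat * {ffun 'I_m -> nat} -> C :=
  fun a => c a * cR rho ^+ a.1 * cR sig ^+ deg a.2.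

Lemma scoef_hsum m (c : nat * {ffun 'I_m -> nat} -> C) (rho sig : R) (x : C) (l : 'rV[C]_m) s :
  hsum (fun a => c a * @mv R (ext (par m)) a (cR rho * x, cR sig *: l)) s ->
  hsum (fun a => scoef c rho sig a * @mv R (ext (par m)) a (x, l)) s.
Proof.
by apply: hsum_ext => a; rewrite /= /emon /scoef /= pmonZ exprMn; ring.
Qed.

Lemma scoef_absb m (c : nat * {ffun 'I_m -> nat} -> C) (rho sig : R) M :
  0 <= rho <= 1 -> 0 <= sig <= 1 -> absb c M -> absb (scoef c rho sig) M.
Proof.
move=> /andP[r0 r1] /andP[s0 s1]; apply: absb_mono => a.
rewrite /scoef !nrmM !nrmX !nrm_cR0 // -mulrA ler_piMr ?nrm_ge0 //.
by rewrite mulr_ile1 ?exprn_ge0 ?exprn_ile1.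
Qed.

Lemma scale_dom m (rho sig : R) (z : mt (ext (par m))) :
  0 <= rho <= 1 -> 0 <= sig <= 1 -> mdom z ->
  @mdom R (ext (par m)) (cR rho * z.1, cR sig *: z.2).
Proof.
move=> /andP[r0 r1] /andP[s0 s1] [h1 h2]; split=> /= [|i].
  by rewrite nrmM nrm_cR0 // mulr_ile1 ?nrm_ge0.
by rewrite mxE nrmM nrm_cR0 // mulr_ile1 ?nrm_ge0 //; exact: h2.
Qed.

Lemma mass_scale m (f : C * 'rV[C]_m -> C) (rho sig : R) M :
  0 <= rho <= 1 -> 0 <= sig <= 1 -> @mass R (ext (par m)) f M ->
  @mass R (ext (par m)) (fun z => f (cR rho * z.1, cR sig *: z.2)) M.
Proof.
move=> hr hs [c [hc hf]]; exists (scoef c rho sig); split; first exact: scoef_absb.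
by move=> [x l] hz; apply: scoef_hsum; apply: hf; exact: (scale_dom hr hs hz).
Qed.

(** A monomial that involves a parameter gains at least one factor [sig]; a pure power of x has
    degree at least [d] and gains rho^d. Only the order in x at lambda = 0 therefore has to be
    known. *)
Lemma scoef_small m (c : nat * {ffun 'I_m -> nat} -> C) (rho sig : R) M d :
  0 <= rho <= 1 -> 0 <= sig <= 1 -> absb c M ->
  (forall j, (j < d)%N -> c (j, [ffun=> 0%N]) = 0) ->
  absb (scoef c rho sig) ((rho ^+ d + sig) * M).
Proof.
move=> /andP[r0 r1] /andP[s0 s1] hc hd.
have sd0 : 0 <= rho ^+ d + sig by rewrite addr_ge0 ?exprn_ge0.
rewrite -[X in X * M](nrm_cR0 sd0).
apply: absb_mono (absbZ (cR (rho ^+ d + sig)) hc) => -[j b].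
rewrite /scoef !nrmM !nrmX !nrm_cR0 //= [leRHS]mulrC.
have e1 n : rho ^+ n <= 1 by rewrite exprn_ile1.
have e2 n : 0 <= rho ^+ n by rewrite exprn_ge0.
have e3 n : sig ^+ n <= 1 by rewrite exprn_ile1.
have e4 n : 0 <= sig ^+ n by rewrite exprn_ge0.
have [b0|b0] := posnP (deg b).
  have [jd|jd] := ltnP j d; first by rewrite (deg0 b0) hd // nrm0 !mul0r.
  rewrite -!mulrA ler_wpM2l ?nrm_ge0 //; rewrite b0 expr0 mulr1; apply: (@le_trans _ _ (rho ^+ d)); last by rewrite lerDl.
  exact: ler_wiXn2l.
rewrite -!mulrA ler_wpM2l ?nrm_ge0 //.
apply: (@le_trans _ _ sig); last by rewrite lerDr.
rewrite -(prednK b0) exprS mulrCA; rewrite -[leRHS]mulr1 ler_wpM2l // mulr_ile1 //.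
Qed.

Lemma mass_par_scale m (f : 'rV[C]_m -> C) (sig : R) M :
  0 <= sig <= 1 -> @mass R (par m) f M -> @mass R (par m) (fun z => f (cR sig *: z)) M.
Proof.
move=> hs hf.
have h1 : 0 <= (1 : R) <= 1 by rewrite ler01 lexx.
have := @mass_at (par m) _ _ 0 _ (mass_scale h1 hs (@mass_lift (par m) _ _ hf)).
by apply; rewrite nrm0.
Qed.

(** Vanishing at the origin removes the constant coefficient, and every other monomial gains a
    factor [sig]. *)
Lemma mass_par_small m (f : 'rV[C]_m -> C) (sig : R) M :
  0 <= sig <= 1 -> f 0 = 0 -> @mass R (par m) f M ->
  @mass R (par m) (fun z => f (cR sig *: z)) (sig * M).
Proof.
move=> /andP[s0 s1] f0 [c [hc hf]].
have pm0 b : pmon b (0 : 'rV[C]_m) = 0 ^+ deg b * pmon b 0 by rewrite -pmonZ scaler0.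
have c0 : c [ffun=> 0%N] = 0.
  rewrite -f0; have h0 : @mdom R (par m) 0 by move=> i; rewrite mxE nrm0.
  apply: hsum_unique (hf 0 h0).
  have := @hsum_single R (mi (par m)) (fun b => c b * pmon b 0) [ffun=> 0%N].
  rewrite pmon1 mulr1; apply=> b bn.
  rewrite pm0; case: (posnP (deg b)) => [/deg0 b0|]; first by rewrite b0 eqxx in bn.
  by rewrite expr0n; case: (deg b) => // n _; rewrite mul0r mulr0.
exists (fun b => c b * cR sig ^+ deg b); split.
  rewrite -[X in X * _](nrm_cR0 s0).
  apply: absb_mono (absbZ (cR sig) hc) => b; rewrite !nrmM nrmX nrm_cR0 //.
  case: (posnP (deg b)) => [/deg0 ->|b0]; first by rewrite c0 nrm0 !(mul0r, mulr0).
  rewrite [leRHS]mulrC ler_wpM2l ?nrm_ge0 // -(prednK b0) exprS -[leRHS]mulr1.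
  by rewrite ler_wpM2l // exprn_ile1.
move=> z hz; have hsz : @mdom R (par m) (cR sig *: z).
  by move=> i; rewrite mxE nrmM nrm_cR0 // mulr_ile1 ?nrm_ge0 //; exact: hz.
by apply: hsum_ext (hf _ hsz) => b /=; rewrite pmonZ; ring.
Qed.

End Systems.

(** * Germs as absolutely convergent series on a polydisc *)

Section Germs.
Variable R : realType.
Local Notation C := (Cplx R).

Definition box n N : seq {ffun 'I_n -> nat} :=
  [seq [ffun i => val (a i)] | a : {ffun 'I_n -> 'I_N}].

Lemma box_uniq n N : uniq (box n N).
Proof.
rewrite map_inj_uniq ?enum_uniq // => a b /ffunP h; apply/ffunP => i.
by apply: val_inj; have := h i; rewrite !ffunE.
Qed.

Lemma mem_box n N (b : {ffun 'I_n -> nat}) : (forall i, (b i < N)%N) -> b \in box n N.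
Proof.
move=> h; apply/mapP; exists [ffun i => Ordinal (h i)]; first by rewrite mem_enum.
by apply/ffunP => i; rewrite !ffunE.
Qed.

Lemma box_sumE n (c : {ffun 'I_n -> nat} -> C) z N :
  box_sum c z N = \sum_(b <- box n N) c b * pmon b z.
Proof.
rewrite /box_sum /box big_map big_enum /=; apply: eq_bigr => a _.
by congr (_ * _); apply: eq_bigr => i _; rewrite ffunE.
Qed.

Lemma box_cover n (s : seq {ffun 'I_n -> nat}) :
  exists N0, forall N, (N0 <= N)%N -> {subset s <= box n N}.
Proof.
exists (\max_(b <- s) \max_i b i).+1 => N hN b bs; apply: mem_box => i.
apply: leq_trans hN; rewrite ltnS; apply: leq_trans (leq_bigmax_seq _ bs isT).
exact: leq_bigmax.
Qed.

Lemma box_cvg n (c : {ffun 'I_n -> nat} -> C) z s :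
  hsum (fun b => c b * pmon b z) s -> box_sum c z N @[N --> \oo] --> s.
Proof.
move=> h; apply/cvgrPdist_le => _ /pos_cR[e e0 ->].
have [s0 [_ hs0]] := h e e0; have [N0 hN0] := box_cover s0.
exists N0 => // N /= hN; rewrite distrC nrmE ler_cR box_sumE.
by apply: hs0; [exact: box_uniq|exact: hN0].
Qed.

Lemma le_cR_Re (a : R) (M : C) : cR a <= M -> a <= complex.Re M.
Proof. by case: M => x y; rewrite lecE /= => /andP[]. Qed.

Lemma box_sum_norm n (c : {ffun 'I_n -> nat} -> C) (z : 'rV[C]_n) N :
  box_sum (fun a => `|c a|) (map_mx Num.norm z) N =
  cR (\sum_(b <- box n N) nrm (c b * pmon b z)).
Proof.
rewrite box_sumE cR_sum; apply: eq_bigr => b _; rewrite -nrmE normrM; congr (_ * _).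
by rewrite /pmon normr_prod; apply: eq_bigr => i _; rewrite mxE normrX.
Qed.

(** The absolute box sums at the single point (r, ..., r) control all coefficients c_b r^|b|, since
    boxes exhaust the multi-indices. The values agree because the box sums converge both to [f] and
    to the unordered sum; conversely, an unordered sum is the limit of its box sums. *)
Lemma germ_mass n (f : 'rV[C]_n -> C) :
  analytic_germ f <->
  exists r M : R, 0 < r /\ @mass R (par R n) (fun z => f (cR r *: z)) M.
Proof.
split=> [[c /near_rV[r0 r00 hr0]]|[r [M [r0 [c [hc hf]]]]]].
  pose r := r0 / 2; have rp : 0 < r by rewrite divr_gt0.
  have rr0 : r < r0 by rewrite /r; lra.
  have hz0 i : nrm ((const_mx (cR r) : 'rV[C]_n) 0 i) < r0 by rewrite mxE nrm_cR0 // ltW.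
  have [[M hM] _] := hr0 _ hz0.
  have pr b : pmon b (const_mx (cR r) : 'rV[C]_n) = cR r ^+ deg b.
    have -> : const_mx (cR r) = cR r *: const_mx 1 :> 'rV[C]_n.
      by apply/rowP => i; rewrite !mxE mulr1.
    rewrite pmonZ; have -> : pmon b (const_mx 1 : 'rV[C]_n) = 1.
      by rewrite /pmon big1 // => i _; rewrite mxE expr1n.
    by rewrite mulr1.
  have ha : absb (fun b => c b * cR r ^+ deg b) (complex.Re M).
    move=> s us; have [N0 hN0] := box_cover s.
    apply: le_trans (le_cR_Re (_ : cR (\sum_(b <- box n N0) nrm (c b * cR r ^+ deg b)) <= M)).
      by apply: sum_uniq_le => //[b|]; [exact: nrm_ge0|exact: hN0].
    rewrite (_ : cR _ = box_sum (fun a => `|c a|) (map_mx Num.norm (const_mx (cR r) : 'rV[C]_n)) N0) //.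
    by rewrite box_sum_norm; congr cR; apply: eq_bigr => b _; rewrite pr.
  exists r, (complex.Re M); split=> //; exists (fun b => c b * cR r ^+ deg b); split=> // z hz.
  have hrz i : nrm ((cR r *: z) 0 i) < r0.
    rewrite mxE nrmM nrm_cR0 ?ltW //; apply: le_lt_trans rr0.
    by have hzi := hz i; rewrite ler_piMr // ltW.
  have [_ hcv] := hr0 _ hrz.
  have [s hs] := hsum_ex (@absb_mv R (par R n) _ _ _ ha hz).
  have hs' : hsum (fun b => c b * pmon b (cR r *: z)) s.
    by apply: hsum_ext hs => b /=; rewrite pmonZ; ring.
  suff -> : f (cR r *: z) = s by [].
  exact: cvg_unique hcv (box_cvg hs').
exists (fun b => c b / cR r ^+ deg b); apply/near_rV; exists r => // z hz.
have r1 : cR r != 0 by rewrite cR_eq0 gt_eqF.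
pose w := (cR r)^-1 *: z.
have zw : z = cR r *: w by rewrite scalerA divff ?scale1r.
have hw : @mdom R (par R n) w.
  move=> i; rewrite mxE nrmM nrmV (nrm_cR0 (ltW r0)) ler_pdivrMl // mulr1; exact: ltW (hz i).
have ew b : c b / cR r ^+ deg b * pmon b z = c b * pmon b w.
  by rewrite zw pmonZ; field; rewrite expf_neq0.
split.
  exists (cR M) => N; rewrite box_sum_norm ler_cR.
  under eq_bigr do rewrite ew.
  by apply: (@absb_mv R (par R n) _ _ _ hc hw); exact: box_uniq.
rewrite [X in f X]zw; apply: box_cvg; apply: hsum_ext (hf w hw) => b.
by rewrite ew.
Qed.

(** [mhead] and [mcons] separate and rejoin the exponent of x and the multi-index in lambda; they
    carry the germs of the statement to [ext (par R m)]. *)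
Definition mhead m (a : {ffun 'I_(1 + m) -> nat}) : nat * {ffun 'I_m -> nat} :=
  (a (lshift m ord0), [ffun i => a (rshift 1 i)]).

Definition mcons m (a : nat * {ffun 'I_m -> nat}) : {ffun 'I_(1 + m) -> nat} :=
  [ffun i => match fintype.split i with inl _ => a.1 | inr j => a.2 j end].

Lemma mheadK m : cancel (@mhead m) (@mcons m).
Proof.
move=> a; apply/ffunP => i; rewrite ffunE /mhead /=; case: splitP => j /= ij.
  by congr (a _); apply: val_inj; rewrite /= ij ord1.
by rewrite ffunE; congr (a _); apply: val_inj; rewrite /= ij.
Qed.

Lemma mconsK m : cancel (@mcons m) (@mhead m).
Proof.
move=> [j b]; rewrite /mhead; congr (_, _); first by rewrite ffunE (unsplitK (inl ord0)).
by apply/ffunP => i; rewrite !ffunE (unsplitK (inr i)).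
Qed.

Lemma pmon_mcons m (a : nat * {ffun 'I_m -> nat}) (z : 'rV[C]_(1 + m)) :
  pmon (mcons a) z = @mv R (ext (par R m)) a (lsubmx z 0 0, rsubmx z).
Proof.
rewrite /pmon big_split_ord /= big_ord1 /emon /= /pmon; congr (_ * _).
  by rewrite ffunE (unsplitK (inl ord0)) mxE.
by apply: eq_bigr => i _; rewrite ffunE (unsplitK (inr i)) mxE.
Qed.

Lemma mass_split m (f : C * 'rV[C]_m -> C) M :
  @mass R (ext (par R m)) f M <->
  @mass R (par R (1 + m)) (fun z => f (lsubmx z 0 0, rsubmx z)) M.
Proof.
split=> -[c [hc hf]].
  exists (c \o @mhead m); split; first by apply: absb_inj hc; exact: can_inj (@mheadK m).
  move=> z hz; apply: (@hsum_reindex R _ _ (@mcons m)) => [|a _|].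
  - exact: can_inj (@mconsK m).
  - by exists (mhead a); rewrite mheadK.
  apply: hsum_ext (hf (lsubmx z 0 0, rsubmx z) _) => [a|]; first by rewrite /= mconsK pmon_mcons.
  by split=> /= [|i]; rewrite mxE; exact: hz.
exists (c \o @mcons m); split; first by apply: absb_inj hc; exact: can_inj (@mconsK m).
move=> [x l] [/= hx hl]; pose z : 'rV[C]_(1 + m) := row_mx (x%:M : 'M[C]_1) l.
have xz : lsubmx z 0 0 = x by rewrite row_mxKl mxE eqxx mulr1n.
have lz : rsubmx z = l by rewrite row_mxKr.
have := hf z; rewrite xz lz => h.
apply: (@hsum_reindex R _ _ (@mhead m)) => [|a _|].
- exact: can_inj (@mheadK m).
- by exists (mcons a); rewrite mconsK.
apply: hsum_ext (h _) => [a|i].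
  by rewrite /= mheadK; congr (_ * _); rewrite -[in LHS](mheadK a) pmon_mcons xz lz.
case: (splitP i) => j ij.
  have -> : i = lshift m j by apply: val_inj.
  by rewrite row_mxEl ord1 mxE eqxx mulr1n.
have -> : i = rshift 1 j by apply: val_inj.
by rewrite row_mxEr; exact: hl.
Qed.

Lemma family_mass m (f : C -> 'rV[C]_m -> C) :
  analytic_family f <->
  exists r M : R, 0 < r /\ @mass R (ext (par R m)) (fun z => f (cR r * z.1) (cR r *: z.2)) M.
Proof.
rewrite /analytic_family germ_mass; split=> -[r [M [r0 h]]]; exists r, M; split=> //.
  apply/mass_split; apply: mass_ext h => z _ /=.
  by congr (f _ _); [rewrite !mxE|apply/rowP => i; rewrite !mxE].
move/mass_split: h; apply: mass_ext => z _ /=.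
by congr (f _ _); [rewrite !mxE|apply/rowP => i; rewrite !mxE].
Qed.

Lemma at1_mass (f : C -> C) (p : C) :
  analytic_at1 f p <->
  exists r M : R, 0 < r /\ @mass R (ext (par R 0)) (fun z => f (p + cR r * z.1)) M.
Proof.
have e0 (z : 'rV[C]_1) : z 0 (lshift 0 0 : 'I_(1 + 0)) = z 0 0.
  by congr (z 0 _); apply: val_inj.
rewrite /analytic_at1 germ_mass; split=> -[r [M [r0 h]]]; exists r, M; split=> //.
  apply/mass_split; apply: mass_ext h => z _ /=.
  by rewrite !mxE -e0.
move/mass_split: h; apply: mass_ext => z _ /=.
by rewrite !mxE e0.
Qed.

End Germs.

(** * Newton scheme *)

Section Newton.
Variable R : realType.
Local Notation C := (Cplx R).

Lemma hsum_head (f : nat -> C) s : hsum (fun k => f k.+1) s -> hsum f (f 0%N + s).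
Proof.
move=> h.
have h1 : hsum (fun k : nat => if k == 0%N then f 0%N else 0) (f 0%N).
  have := @hsum_single R _ (fun k : nat => if k == 0%N then f 0%N else 0) 0%N.
  by apply=> i /negbTE ->.
have h2 : hsum (fun k : nat => if k == 0%N then 0 else f k) s.
  apply: (@hsum_reindex _ _ _ succn) => [i j []//|[|j]|]; first by rewrite /= eqxx.
    by exists j.
  by apply: hsum_ext h.
by apply: hsum_ext (hsumD h1 h2) => -[|i] /=; rewrite ?addr0 ?add0r.
Qed.

Lemma half_pow_small (K e : R) : 0 < e -> exists n, K * 2^-1 ^+ n <= e.
Proof.
move=> e0; have [K0|K0] := lerP K 0.
  by exists 0%N; rewrite expr0 mulr1 (le_trans K0) // ltW.
pose n := Num.bound (K / e); exists n.
have h1 : K / e < n%:R by apply: archi_boundP; rewrite divr_ge0 // ltW.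
have h2 : (n%:R : R) <= 2 ^+ n by rewrite -natrX ler_nat ltnW // ltn_expl.
rewrite exprVn ler_pdivrMr ?exprn_gt0 // -ler_pdivrMl // mulrC.
by apply: le_trans h2; exact: ltW.
Qed.

Variable Q : msys R.
Local Notation J := (mi Q).
Local Notation T := (mt Q).

(** The linear part is the identity in the coordinates [u], so the correction is just a family of
    coefficients for - G u. Each correction halves the residual, and their total length 2 eps stays
    in the ball of radius [eta], where the Lipschitz hypothesis is available. *)
Lemma newton (G : (J -> C) -> T -> C) (eta eps : R) :
  mass (G (fun=> 0)) eps -> 2 * eps <= eta ->
  (forall u v m, absb u eta -> absb v m -> absb (fun a => u a + v a) eta ->
     mass (fun z => G (fun a => u a + v a) z - G u z - ev v z) (m / 2)) ->
  exists u, absb u (2 * eps) /\ forall z, mdom z -> G u z = 0.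
Proof.
move=> h0 heps hlip; have eps0 := mass_ge0 h0.
(* The choice is made for all pairs at once; the zero family is the default value where the residual
   exceeds its bound. *)
have step (um : (J -> C) * R) : exists v : J -> C, mass (G um.1) um.2 ->
    absb v um.2 /\ forall z, mdom z -> ev v z = - G um.1 z.
  have [/massN[c [hc hG]]|n] := pselect (mass (G um.1) um.2); last by exists (fun=> 0).
  by exists c => _; split=> // z hz; apply: hsE; exact: hG.
have [V hV] := choice step.
pose m n : R := eps * 2^-1 ^+ n.
pose fix useq n : J -> C :=
  if n is n'.+1 then (fun a => useq n' a + V (useq n', m n') a) else (fun=> 0).
pose v n := V (useq n, m n).
have m0 n : 0 <= m n by rewrite mulr_ge0 ?exprn_ge0.
have mS n : m n.+1 = m n / 2 by rewrite /m exprS; ring.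
have inv n : mass (G (useq n)) (m n) /\ absb (useq n) (2 * eps - 2 * m n).
  elim: n => [|n [ih1 ih2]].
    rewrite /m expr0 mulr1 subrr; split=> //= s us; rewrite big1 // => i _; exact: nrm0.
  have [hv1 hv2] := hV (useq n, m n) ih1.
  have hb : absb (fun a => useq n a + v n a) (2 * eps - 2 * m n.+1).
    have := absbD ih2 hv1; apply: absb_le => /=; rewrite mS; lra.
  split=> //=.
  have := hlip (useq n) (v n) (m n); rewrite -mS => h.
  have {}h : mass _ _ := h _ hv1 _.
  apply: mass_ext (h _ _).
  - by move=> z hz; rewrite [ev _ _]hv2 //=; ring.
  - by apply: absb_le ih2; have := m0 n; lra.
  - by apply: absb_le hb; have := m0 n.+1; lra.
have hv n : absb (v n) (m n) by case: (hV (useq n, m n) (inv n).1).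
have hpair n : absb (fun ka => v (n + ka.1)%N ka.2) (2 * m n).
  apply: (absb_sig (f := fun k a => v (n + k)%N a) (m := fun k => m (n + k)%N)) => // s us.
  have -> : \sum_(k <- s) m (n + k)%N = m n * \sum_(k <- s) 2^-1 ^+ k.
    by rewrite mulr_sumr; apply: eq_bigr => k _; rewrite /m exprD; ring.
  rewrite mulrC ler_wpM2r //.
  apply: le_trans (geometric_le _ _ us) _; rewrite ?invr_ge0 //; first lra.
  by rewrite (_ : (1 - 2^-1)^-1 = 2) //; field.
pose w n a := hs (fun k => v (n + k)%N a).
have hw n a : hsum (fun k => v (n + k)%N a) (w n a).
  apply: (@hsP _ _ _ (2 * m n)); have := hpair n.
  by move/(absb_inj (h := fun k => (k, a))); apply=> k k' [].
have hwb n : absb (w n) (2 * m n).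
  exact: (@absb_iter2 R nat J (fun k a => v (n + k)%N a) _ _ (hw n) (hpair n)).
have hwS n a : w n a = v n a + w n.+1 a.
  apply: hsum_unique (hw n a) _; rewrite -[n in v n a]addn0.
  apply: (@hsum_head (fun k => v (n + k)%N a)).
  by apply: hsum_ext (hw n.+1 a) => k; rewrite addnS addSn.
have dec n a : w 0%N a = useq n a + w n a.
  by elim: n => [|n ->]; [rewrite /= add0r|rewrite hwS addrA].
exists (w 0%N); split; first by have := hwb 0%N; rewrite /m expr0 mulr1.
move=> z hz; apply: nrm_le_eps => e e0; have [n hn] := half_pow_small (4 * eps) e0.
apply: le_trans hn; rewrite -mulrA -/(m n).
have [i1 i2] := inv n.
have hw0 : w 0%N = (fun a => useq n a + w n a) by apply/funext => a; exact: dec.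
have hb : absb (fun a => useq n a + w n a) eta.
  by rewrite -hw0; apply: absb_le (hwb 0%N); rewrite /m expr0 mulr1.
have hu : absb (useq n) eta by apply: absb_le i2; have := m0 n; lra.
have := mass_sup (hlip _ _ _ hu (hwb n) hb) hz; rewrite -hw0 => h1.
have h2 := mass_sup i1 hz; have h3 := mass_sup (mass_ev (hwb n)) hz.
have -> : G (w 0%N) z = (G (w 0%N) z - G (useq n) z - ev (w n) z) + (G (useq n) z + ev (w n) z).
  by ring.
have h4 := nrm_leD h1 (nrm_leD h2 h3); apply: le_trans h4 _; lra.
Qed.

(** The linear operator that sends the monomial of index [i] to [phi i]; on l^1 it is bounded as
    soon as these images are uniformly bounded. *)
Definition comb (K : eqType) (phi : K -> T -> C) (u : K -> C) (z : T) : C :=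
  hs (fun i => u i * phi i z).

Lemma comb_absb (K : eqType) (phi : K -> T -> C) (u : K -> C) B M z : 0 <= B ->
  (forall i, mass (phi i) B) -> absb u M -> mdom z -> absb (fun i => u i * phi i z) (M * B).
Proof.
move=> B0 hphi hu hz s us; apply: (@le_trans _ _ (\sum_(i <- s) nrm (u i) * B)).
  apply: ler_sum => i _; rewrite nrmM ler_wpM2l ?nrm_ge0 //; exact: mass_sup (hphi i) hz.
by rewrite -mulr_suml ler_wpM2r // hu.
Qed.

Lemma comb_hsum (K : eqType) (phi : K -> T -> C) (u : K -> C) B M z : 0 <= B ->
  (forall i, mass (phi i) B) -> absb u M -> mdom z ->
  hsum (fun i => u i * phi i z) (comb phi u z).
Proof. by move=> B0 hphi hu hz; exact: hsP (comb_absb B0 hphi hu hz). Qed.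

Lemma comb_mass (K : eqType) (phi : K -> T -> C) (u : K -> C) B M : 0 <= B ->
  (forall i, mass (phi i) B) -> absb u M -> mass (comb phi u) (M * B).
Proof.
move=> B0 hphi hu.
apply: (@mass_sum _ _ _ (fun i z => u i * phi i z) (fun i => nrm (u i) * B)).
- by move=> i; exact: massZ.
- by move=> s us; rewrite -mulr_suml ler_wpM2r // hu.
- by move=> z hz; exact: (comb_hsum B0 hphi hu hz).
Qed.

Lemma combD (K : eqType) (phi : K -> T -> C) (u v : K -> C) B M N z : 0 <= B ->
  (forall i, mass (phi i) B) -> absb u M -> absb v N -> mdom z ->
  comb phi (fun i => u i + v i) z = comb phi u z + comb phi v z.
Proof.
move=> B0 hphi hu hv hz; apply: hsE.
apply: hsum_ext (hsumD (comb_hsum B0 hphi hu hz) (comb_hsum B0 hphi hv hz)) => i.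
by rewrite mulrDl.
Qed.

(* [Lp eta K p A]: on the ball of radius eta, A is of size at most K eta^p and
   Lipschitz with constant at most K eta^(p-1) (K when p = 0). *)
Definition Lp (K0 : eqType) (eta K : R) (p : nat) (A : (K0 -> C) -> T -> C) : Prop :=
  (forall u, absb u eta -> mass (A u) (K * eta ^+ p)) /\
  (forall u v m, absb u eta -> absb v m -> absb (fun a => u a + v a) eta ->
     mass (fun z => A (fun a => u a + v a) z - A u z) (K * eta ^+ p.-1 * m)).

Section Lp.
Variables (I : eqType) (eta : R).
Hypotheses (eta0 : 0 < eta) (eta1 : eta <= 1).
Implicit Types A B : (I -> C) -> T -> C.

Let e0 p : 0 <= eta ^+ p. Proof. by rewrite exprn_ge0 // ltW. Qed.
Let e1 p q : (p <= q)%N -> eta ^+ q <= eta ^+ p.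
Proof. by move=> pq; apply: ler_wiXn2l => //; exact: ltW. Qed.

Lemma Lp_ge0 K p A : Lp eta K p A -> 0 <= K.
Proof.
move=> [h _]; have /h/mass_ge0 : absb (fun _ : I => 0) eta.
  by move=> s _; rewrite big1 ?ltW // => i _; exact: nrm0.
by rewrite pmulr_lge0 // exprn_gt0.
Qed.

Lemma Lp_ext K p A B : (forall u z, absb u eta -> mdom z -> A u z = B u z) ->
  Lp eta K p A -> Lp eta K p B.
Proof.
move=> h [h1 h2]; split=> [u hu|u v m hu hv huv].
  by apply: mass_ext (h1 _ hu) => z; exact: h.
by apply: mass_ext (h2 _ _ _ hu hv huv) => z hz; rewrite !h.
Qed.

Lemma Lp_le K K' p q A : K <= K' -> (q <= p)%N -> Lp eta K p A -> Lp eta K' q A.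
Proof.
move=> hK hq hA; have K0 := Lp_ge0 hA; case: hA => h1 h2; split=> [u hu|u v m hu hv huv].
  by apply: mass_le (h1 _ hu); rewrite ler_pM // e1.
have m0 := absb_ge0 hv.
apply: mass_le (h2 _ _ _ hu hv huv); rewrite ler_wpM2r // ler_pM // e1 //.
by rewrite -!subn1 leq_sub2r.
Qed.

Lemma Lp_const K p f : mass f (K * eta ^+ p) -> 0 <= K -> Lp eta K p (fun _ : I -> C => f).
Proof.
move=> h K0; split=> [u _ //|u v m _ hv _].
apply: mass_ext (mass0 _ (_ : 0 <= K * eta ^+ p.-1 * m)) => [z _|]; first by rewrite subrr.
by rewrite !mulr_ge0 //; exact: absb_ge0 hv.
Qed.

Lemma LpD K K' p A B : Lp eta K p A -> Lp eta K' p B ->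
  Lp eta (K + K') p (fun u z => A u z + B u z).
Proof.
move=> [h1 h2] [h1' h2']; split=> [u hu|u v m hu hv huv].
  by rewrite mulrDl; apply: massD; [exact: h1|exact: h1'].
rewrite !mulrDl; apply: mass_ext (massD (h2 _ _ _ hu hv huv) (h2' _ _ _ hu hv huv)) => z _.
ring.
Qed.

Lemma LpN K p A : Lp eta K p A -> Lp eta K p (fun u z => - A u z).
Proof.
move=> [h1 h2]; split=> [u hu|u v m hu hv huv]; first by apply: massN; exact: h1.
by apply: mass_ext (massN (h2 _ _ _ hu hv huv)) => z _; ring.
Qed.

Lemma LpB K K' p A B : Lp eta K p A -> Lp eta K' p B ->
  Lp eta (K + K') p (fun u z => A u z - B u z).
Proof. by move=> hA hB; exact: LpD hA (LpN hB). Qed.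

(** The two terms of the Leibniz rule account for the factor 2. Since eta <= 1, the exponent
    [(p + q).-1] can be used for both, also when [p] or [q] is 0. *)
Lemma LpM K K' p q A B : Lp eta K p A -> Lp eta K' q B ->
  Lp eta (2 * (K * K')) (p + q) (fun u z => A u z * B u z).
Proof.
move=> hA hB; have K0 := Lp_ge0 hA; have K'0 := Lp_ge0 hB.
case: hA hB => h1 h2 [h1' h2']; split=> [u hu|u v m hu hv huv].
  apply: mass_le (massM (h1 _ hu) (h1' _ hu)).
  have -> : K * eta ^+ p * (K' * eta ^+ q) = K * K' * eta ^+ (p + q) by rewrite exprD; ring.
  by rewrite ler_wpM2r //; have := mulr_ge0 K0 K'0; lra.
have m0 := absb_ge0 hv.
have hh := massD (massM (h1 _ huv) (h2' _ _ _ hu hv huv)) (massM (h2 _ _ _ hu hv huv) (h1' _ hu)).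
apply: mass_ext (mass_le _ hh) => [z _|]; first by ring.
have -> : K * eta ^+ p * (K' * eta ^+ q.-1 * m) + K * eta ^+ p.-1 * m * (K' * eta ^+ q) =
  K * K' * m * (eta ^+ (p + q.-1) + eta ^+ (p.-1 + q)) by rewrite !exprD; ring.
have -> : 2 * (K * K') * eta ^+ (p + q).-1 * m =
  K * K' * m * (eta ^+ (p + q).-1 + eta ^+ (p + q).-1) by ring.
rewrite ler_wpM2l ?mulr_ge0 // lerD // e1 //; lia.
Qed.

Lemma Lp_sum p (L : Type) (s : seq L) (K : L -> R) (A : L -> (I -> C) -> T -> C) :
  (forall i, Lp eta (K i) p (A i)) ->
  Lp eta (\sum_(i <- s) K i) p (fun u z => \sum_(i <- s) A i u z).
Proof.
move=> h; elim: s => [|i s ih].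
  rewrite big_nil; apply: Lp_ext (Lp_const (f := fun=> 0) _ (lexx 0)) => [u z _ _|].
    by rewrite big_nil.
  by rewrite mul0r; exact: mass0.
by rewrite big_cons; apply: Lp_ext (LpD (h i) ih) => u z _ _; rewrite big_cons.
Qed.

Lemma Lp_comb (phi : I -> T -> C) (B : R) : 0 <= B -> (forall i, mass (phi i) B) ->
  Lp eta B 1 (comb phi).
Proof.
move=> B0 hphi; split=> [u hu|u v m hu hv huv].
  by rewrite mulrC; exact: comb_mass.
rewrite expr0 mulr1; apply: mass_le (_ : m * B <= _) _; first by rewrite mulrC.
by apply: mass_ext (comb_mass B0 hphi hv) => z hz; rewrite (combD B0 hphi hu hv hz); ring.
Qed.

End Lp.

(* In the next two lemmas the constant K does not depend on the data, which
   are chosen after it. *)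
Lemma Lp_pow_diff (n : nat) (B D : R) : 0 <= B -> 0 <= D -> exists K : R, 0 <= K /\
  forall (I : eqType) (eta : R) (x : T -> C) (d : (I -> C) -> T -> C),
  0 < eta -> eta <= 1 -> mass x B -> Lp eta D 1 d ->
  Lp eta K 1 (fun u z => (x z + d u z) ^+ n - x z ^+ n).
Proof.
move=> B0 D0; elim: n => [|n [K [K0 ih]]].
  exists 0; split=> // I eta x d e0 e1 hx hd.
  apply: (@Lp_ext _ _ _ _ (fun _ _ => 0)) => [u z _ _|]; first by rewrite !expr0 subrr.
  by apply: Lp_const => //; rewrite mul0r; exact: mass0.
exists (2 * ((B + D) * K) + 2 * (D * B ^+ n)); split.
  by rewrite addr_ge0 ?mulr_ge0 ?addr_ge0 ?exprn_ge0.
move=> I eta x d e0 e1 hx hd.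
have hx0 : Lp eta B 0 (fun _ : I -> C => x) by apply: Lp_const => //; rewrite mulr1.
have hxn : Lp eta (B ^+ n) 0 (fun (_ : I -> C) z => x z ^+ n).
  by apply: Lp_const; rewrite ?exprn_ge0 // mulr1; exact: massX.
have hd0 : Lp eta D 0 d by apply: Lp_le hd.
apply: Lp_ext (LpD (LpM e0 e1 (LpD hx0 hd0) (ih I eta x d e0 e1 hx hd)) (LpM e0 e1 hd hxn)).
by move=> u z _ _; rewrite !exprS; ring.
Qed.

Lemma Lp_pow_diff2 (n : nat) (D : R) : 0 <= D -> exists K : R, 0 <= K /\
  forall (I : eqType) (eta : R) (x : T -> C) (d : (I -> C) -> T -> C),
  0 < eta -> eta <= 1 -> mass x 1 -> Lp eta D 1 d ->
  Lp eta K 2 (fun u z => (x z + d u z) ^+ n - x z ^+ n - n%:R * x z ^+ n.-1 * d u z).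
Proof.
move=> D0; elim: n => [|n [K [K0 ih]]].
  exists 0; split=> // I eta x d e0 e1 hx hd.
  apply: (@Lp_ext _ _ _ _ (fun _ _ => 0)) => [u z _ _|]; first by rewrite !expr0 subrr; ring.
  by apply: Lp_const => //; rewrite mul0r; exact: mass0.
exists (2 * ((1 + D) * K) + 2 * (n%:R * (2 * (D * D)))); split.
  by rewrite addr_ge0 ?mulr_ge0 ?addr_ge0.
move=> I eta x d e0 e1 hx hd.
have hx0 : Lp eta 1 0 (fun _ : I -> C => x) by apply: Lp_const => //; rewrite mul1r.
have hxn : Lp eta n%:R 0 (fun (_ : I -> C) z => n%:R * x z ^+ n.-1).
  apply: Lp_const => //; rewrite expr0.
  by have := massZ n%:R (massX n.-1 hx); rewrite nrm_nat expr1n.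
have hd0 : Lp eta D 0 d by apply: Lp_le hd.
apply: Lp_ext (LpD (LpM e0 e1 (LpD hx0 hd0) (ih I eta x d e0 e1 hx hd))
  (LpM e0 e1 hxn (LpM e0 e1 hd hd))).
move=> u z _ _; case: n {ih hxn} => [|n] /=; first by rewrite !expr1 !expr0; ring.
by rewrite !exprS -!natr1; ring.
Qed.

End Newton.

(** * The homological equation *)

Section NormalForm.
Variable R : realType.
Local Notation C := (Cplx R).
Variables (Q : msys R) (k : nat).
Local Notation X := (ext Q).
Local Notation J := (mi X).
Local Notation T := (mt X).

(* Solving the homological equation
     (k+1) x^k xi - x^(k+1) xi' + sum_i y_i x^i - mu x^(2k+1) = x^j,  xi(1) = 0,
   for each monomial on the right-hand side. *)
Definition hxi (a : J) (z : T) : C :=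
  if (k <= a.1)%N && (a.1 != (2 * k).+1)
  then (z.1 ^+ (a.1 - k) - z.1 ^+ k.+1) * mv a.2 z.2 / ((2 * k).+1%:R - a.1%:R) else 0.
Definition hdxi (a : J) (z : T) : C :=
  if (k <= a.1)%N && (a.1 != (2 * k).+1)
  then ((a.1 - k)%:R * z.1 ^+ (a.1 - k).-1 - k.+1%:R * z.1 ^+ k) * mv a.2 z.2
         / ((2 * k).+1%:R - a.1%:R) else 0.
Definition hy (i : 'I_k) (a : J) (l : mt Q) : C := if a.1 == i :> nat then mv a.2 l else 0.
Definition hmu (a : J) (l : mt Q) : C := if a.1 == (2 * k).+1 then - mv a.2 l else 0.

Lemma nrm_intdiff (p q : nat) : p != q -> 1 <= nrm (p%:R - q%:R : C).
Proof.
move=> pq; case: (ltngtP p q) pq => // h _.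
  by rewrite nrmBC -natrB ?nrm_nat ?ler1n ?subn_gt0 // ltnW.
by rewrite -natrB ?nrm_nat ?ler1n ?subn_gt0 // ltnW.
Qed.

Lemma mass_xn n : @mass R X (fun z => z.1 ^+ n) 1.
Proof. by rewrite -(expr1n R n); apply: massX; exact: mass_x. Qed.

Lemma mass_mv2 b : @mass R X (fun z => mv b z.2) 1.
Proof. exact: (mass_lift (mass_mono b)). Qed.

Lemma hxi_mass a : @mass R X (hxi a) 2.
Proof.
rewrite /hxi; case: (boolP ((k <= a.1)%N && (a.1 != (2 * k).+1))) => [/andP[ka an]|_]; last exact: mass0.
have hn : nrm ((2 * k).+1%:R - a.1%:R : C)^-1 <= 1.
  by rewrite nrmV invf_le1 ?(lt_le_trans ltr01) // nrm_intdiff // eq_sym.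
apply: mass_ext (mass_le _ (massZ ((2 * k).+1%:R - a.1%:R)^-1
   (massM (massB (mass_xn (a.1 - k)) (mass_xn k.+1)) (mass_mv2 a.2)))).
  by move=> z _; ring.
by move: hn; lra.
Qed.

(** This is where no derivative is lost. With D >= 1 the modulus of the denominator, j - k <= (k +
    1) + D, so that (j - k) + (k + 1) is at most (2k + 3) D. *)
Lemma hdxi_mass a : @mass R X (hdxi a) (2 * k + 3)%:R.
Proof.
rewrite /hdxi; case: (boolP ((k <= a.1)%N && (a.1 != (2 * k).+1))) => [/andP[ka an]|_]; last exact: mass0.
set D := nrm ((2 * k).+1%:R - a.1%:R : C).
have hn : 1 <= D by rewrite nrm_intdiff // eq_sym.
have hD : (a.1 - k)%:R <= k.+1%:R + D :> R.
  rewrite -(nrm_nat R (a.1 - k)) natrB //.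
  have -> : a.1%:R - k%:R = k.+1%:R - ((2 * k).+1%:R - a.1%:R) :> C.
    by rewrite -!natr1 natrM; ring.
  by apply: le_trans (nrmB _ _) _; rewrite nrm_nat.
apply: mass_ext (mass_le _ (massZ ((2 * k).+1%:R - a.1%:R)^-1
   (massM (massB (massZ (a.1 - k)%:R (mass_xn (a.1 - k).-1)) (massZ k.+1%:R (mass_xn k))) (mass_mv2 a.2)))).
  by move=> z _; ring.
rewrite !mulr1 nrmV -/D !nrm_nat ler_pdivrMl; last by apply: lt_le_trans hn.
have k0 : (0 : R) <= k%:R by [].
rewrite -!natr1 in hD *; rewrite natrD natrM; nra.
Qed.

Lemma hy_mass i a : @mass R Q (hy i a) 1.
Proof. by rewrite /hy; case: (a.1 == i :> nat); [exact: mass_mono|exact: mass0]. Qed.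

Lemma hmu_mass a : @mass R Q (hmu a) 1.
Proof. by rewrite /hmu; case: (a.1 == (2 * k).+1); [exact/massN/mass_mono|exact: mass0]. Qed.

(** Degrees below k are matched by [hy] alone and degree 2k+1 by [hmu] alone. Elsewhere the x^(k+1)
    subtracted in [hxi] lies in the kernel, and x^(j-k) produces x^j with the factor (k+1) - (j-k) =
    2k+1-j. *)
Lemma homological a (z : T) :
  k.+1%:R * z.1 ^+ k * hxi a z - z.1 ^+ k.+1 * hdxi a z +
  \sum_(i < k) hy i a z.2 * z.1 ^+ i - hmu a z.2 * z.1 ^+ (2 * k).+1 = mv a z.
Proof.
case: a z => j b [x l] /=; rewrite /hxi /hdxi /hy /hmu /emon /=.
have [kj|jk] := leqP k j => /=; last first.
  rewrite (_ : (j == (2 * k).+1) = false); last by apply/negbTE; lia.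
  rewrite (bigD1 (Ordinal jk)) //= eqxx big1 => [|i]; first by ring.
  by rewrite -val_eqE /= eq_sym => /negbTE ->; rewrite mul0r.
rewrite big1 => [|i _]; last first.
  by rewrite (_ : (j == i) = false) ?mul0r //; apply/negbTE; have := ltn_ord i; lia.
have [->|jn] /= := eqVneq j (2 * k).+1; first by ring.
have n0 : (2 * k).+1%:R - j%:R != 0 :> C.
  by rewrite -nrm_gt0; apply: lt_le_trans ltr01 (nrm_intdiff _); rewrite eq_sym.
have ex1 : x ^+ j = x ^+ k * x ^+ (j - k) by rewrite -exprD subnKC.
have ex2 : x ^+ k.+1 * ((j - k)%:R * x ^+ (j - k).-1) = (j - k)%:R * x ^+ j :> C.
  rewrite ex1; case: (j - k)%N => [|n]; first by rewrite !mul0r mulr0.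
  by rewrite !exprS /=; ring.
have -> : k.+1%:R * x ^+ k * ((x ^+ (j - k) - x ^+ k.+1) * mv b l / ((2 * k).+1%:R - j%:R)) -
   x ^+ k.+1 * (((j - k)%:R * x ^+ (j - k).-1 - k.+1%:R * x ^+ k) * mv b l / ((2 * k).+1%:R - j%:R)) +
   0 - 0 * x ^+ (2 * k).+1 =
  (k.+1%:R * (x ^+ k * x ^+ (j - k)) - x ^+ k.+1 * ((j - k)%:R * x ^+ (j - k).-1)) * mv b l / ((2 * k).+1%:R - j%:R).
  by ring.
rewrite -ex1 ex2; set D := _ - _ in n0 *.
have -> : k.+1%:R = D + (j - k)%:R by rewrite /D natrB // -!natr1 natrM; ring.
by field.
Qed.

Variables (a : T -> C) (tau : mt Q -> C).

(* [hxi a] vanishes at x = 1, so that nphi = 1 + tau there. *)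
Definition nphi (u : J -> C) (z : T) := z.1 + tau z.2 * z.1 ^+ k.+1 + comb (Q := X) hxi u z.
Definition ndphi (u : J -> C) (z : T) :=
  1 + k.+1%:R * tau z.2 * z.1 ^+ k + comb (Q := X) hdxi u z.
Definition ny (u : J -> C) (i : 'I_k) (l : mt Q) := comb (hy i) u l.
Definition nmu (u : J -> C) (l : mt Q) := comb hmu u l.

(** The conjugacy equation cleared of the denominator of the normal form. [dphi] is an independent
    argument, identified with the derivative of [phi] separately. *)
Definition conj_eq (phi dphi : T -> C) (y : 'I_k -> mt Q -> C) (mu : mt Q -> C) (z : T) : C :=
  phi z ^+ k.+1 + \sum_(i < k) y i z.2 * phi z ^+ i - (1 + mu z.2 * phi z ^+ k) * a z * dphi z.

Definition nG (u : J -> C) : T -> C := conj_eq (nphi u) (ndphi u) (ny u) (nmu u).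

Lemma homological_comb (u : J -> C) M (z : T) : absb u M -> mdom z ->
  k.+1%:R * z.1 ^+ k * comb (Q := X) hxi u z - z.1 ^+ k.+1 * comb (Q := X) hdxi u z +
  \sum_(i < k) ny u i z.2 * z.1 ^+ i - nmu u z.2 * z.1 ^+ (2 * k).+1 = ev (Q := X) u z.
Proof.
move=> hu hz; have [_ hz2] := hz.
symmetry; apply: hsE.
have h1 := comb_hsum (ler0n _ 2) hxi_mass hu hz.
have h2 := comb_hsum (ler0n _ _) hdxi_mass hu hz.
have h3 i := comb_hsum ler01 (hy_mass i) hu hz2.
have h4 := comb_hsum ler01 hmu_mass hu hz2.
have h5 : hsum (fun a => \sum_(i < k) z.1 ^+ i * (u a * hy i a z.2))
    (\sum_(i < k) z.1 ^+ i * ny u i z.2).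
  elim: (index_enum _) => [|i s ih].
    by rewrite big_nil; apply: hsum_ext (hsum0 _) => i; rewrite big_nil.
  by rewrite big_cons; apply: hsum_ext (hsumD (hsumZ _ (h3 i)) ih) => j; rewrite big_cons.
have := hsumB (hsumD (hsumB (hsumZ (k.+1%:R * z.1 ^+ k) h1) (hsumZ (z.1 ^+ k.+1) h2)) h5)
   (hsumZ (z.1 ^+ (2 * k).+1) h4).
rewrite -[nmu u z.2]/(comb hmu u z.2).
set s1 := (X in hsum _ X -> _); set s2 := (X in _ -> hsum _ X).
have -> : s1 = s2.
  by rewrite /s1 /s2 mulrC; congr (_ + _ - _); rewrite 1?mulrC //; apply: eq_bigr => i _; rewrite mulrC.
apply: hsum_ext => i; rewrite -homological !mulrDr !mulr_sumr.
congr (_ + _ + _ + _); rewrite ?mulrN; try by ring.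
by apply: eq_bigr => j _; ring.
Qed.

End NormalForm.

Section Remainder.
Variable R : realType.
Local Notation C := (Cplx R).
Variables (Q : msys R) (k : nat).
Local Notation X := (ext Q).
Local Notation J := (mi X).
Local Notation T := (mt X).

Lemma Lp_lift (I : eqType) (eta K : R) p (A : (I -> C) -> mt Q -> C) :
  Lp eta K p A -> @Lp R X I eta K p (fun u z => A u z.2).
Proof.
move=> [h1 h2]; split=> [u hu|u v m hu hv huv]; first exact: (mass_lift (h1 u hu)).
exact: (mass_lift (h2 _ _ _ hu hv huv)).
Qed.

(** Every remaining term has two small factors among e, tau and quantities linear in [u]. The terms
    linear in tau cancel, tau x^(k+1) being in the kernel of the homological operator. *)
Lemma nG_remainder : exists K : R, 0 <= K /\
  forall (eta : R) (e : T -> C) (tau : mt Q -> C), 0 < eta -> eta <= 1 ->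
  mass e eta -> mass tau eta ->
  @Lp R X J eta K 2 (fun u z =>
     nG k (fun z => z.1 ^+ k.+1 + e z) tau u z - ev (Q := X) u z + e z).
Proof.
have h3 : (0 : R) <= 3 by [].
have [K2 [K20 hK2]] := @Lp_pow_diff2 R X k.+1 3 h3.
have [K1 hK1] := choice (fun n => @Lp_pow_diff R X n 1 3 ler01 h3).
pose D := k.+1%:R + (2 * k + 3)%:R : R.
pose K := K2 + (\sum_(i < k) 2 * (1 * K1 i)) + 2 * (1 * D) +
  2 * (1 * (2 * (2 * (K1 k * (1 + 1)) * (1 + D)) + 2 * (1 * (1 + 2 * (1 * D) + 2 * (1 * D))))).
have D0 : 0 <= D by rewrite addr_ge0.
have K10 n : 0 <= K1 n by case: (hK1 n).
exists K; split.
  rewrite /K; do ?[apply: addr_ge0 | apply: mulr_ge0 | by []].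
  by apply: sumr_ge0 => i _; rewrite !mulr_ge0.
move=> eta e tau e0 e1 he htau.
pose x (z : T) := z.1.
have hx : @mass R X x 1 by exact: mass_x.
have hxn n : @Lp R X J eta 1 0 (fun _ z => x z ^+ n).
  by apply: Lp_const => //; rewrite mul1r expr0; exact: mass_xn.
have hE1 : @Lp R X J eta 1 1 (fun _ => e) by apply: Lp_const => //; rewrite mul1r expr1.
have hE0 : @Lp R X J eta 1 0 (fun _ => e) by apply: Lp_le hE1.
pose d u (z : T) := tau z.2 * x z ^+ k.+1 + comb (Q := X) (@hxi R Q k) u z.
pose d' u (z : T) := k.+1%:R * tau z.2 * x z ^+ k + comb (Q := X) (@hdxi R Q k) u z.
have hcd : @Lp R X J eta 3 1 d.
  suff : @Lp R X J eta (1 + 2) 1 d by rewrite (_ : 1 + 2 = 3 :> R) //; lra.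
  apply: LpD; last by apply: Lp_comb => //; exact: hxi_mass.
  apply: Lp_const => //; rewrite mul1r expr1 -[eta]mulr1.
  by apply: massM; [exact: (mass_lift htau)|exact: mass_xn].
have hd' : @Lp R X J eta D 1 d'.
  apply: LpD; last by apply: Lp_comb => //; exact: hdxi_mass.
  apply: Lp_const => //; rewrite expr1.
  have := massM (massZ k.+1%:R (mass_lift htau)) (@mass_xn R Q k).
  by rewrite nrm_nat mulr1.
have h1 : @Lp R X J eta 1 0 (fun _ _ => 1).
  by apply: Lp_const => //; rewrite mul1r expr0; exact: mass1.
have hd0 : @Lp R X J eta D 0 d' by apply: Lp_le hd'.
have hy (i : 'I_k) : @Lp R X J eta 1 1 (fun u z => ny u i z.2).
  by apply: Lp_lift; apply: Lp_comb => //; exact: hy_mass.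
have hm : @Lp R X J eta 1 1 (fun u z => nmu k u z.2).
  by apply: Lp_lift; apply: Lp_comb => //; exact: hmu_mass.
(* [pd2] is the second order Taylor remainder of the power k + 1; [r1], [r2] and [r5] are products
   of y, e and mu with another small factor. [K] adds up their constants. *)
have pd2 := hK2 _ _ _ _ e0 e1 hx hcd.
have pd n := (hK1 n).2 _ _ _ _ e0 e1 hx hcd.
have r1 := Lp_sum e0 (index_enum 'I_k) (fun i : 'I_k => LpM e0 e1 (hy i) (pd i)).
have r2 := LpM e0 e1 hE1 hd'.
have r3 := LpM e0 e1 (LpM e0 e1 (pd k) (LpD (hxn k.+1) hE0)) (LpD h1 hd0).
have r4 := LpM e0 e1 (hxn k) (LpD (LpD hE1 (LpM e0 e1 hE0 hd')) (LpM e0 e1 (hxn k.+1) hd')).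
have r5 := LpM e0 e1 hm (LpD r3 r4).
apply: Lp_ext (LpB (LpB (LpD pd2 r1) r2) r5) => u z hu hz.
rewrite /nG /conj_eq -(homological_comb k hu hz).
have -> : nphi k tau u z = x z + d u z by rewrite /nphi /d addrA.
have -> : ndphi k tau u z = 1 + d' u z by rewrite /ndphi /d' addrA.
rewrite -[comb _ u z](addKr (tau z.2 * x z ^+ k.+1)) -/(d u z).
rewrite -[comb _ u z](addKr (k.+1%:R * tau z.2 * x z ^+ k)) -/(d' u z).
have -> : \sum_(i < k) ny u i z.2 * ((x z + d u z) ^+ i - x z ^+ i) =
   \sum_(i < k) ny u i z.2 * (x z + d u z) ^+ i - \sum_(i < k) ny u i z.2 * x z ^+ i.
  by rewrite -sumrB; apply: eq_bigr => i _; rewrite mulrBr.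
have -> : z.1 ^+ (2 * k).+1 = x z ^+ k * (x z ^+ k * x z).
  by rewrite /x -exprSr -exprD; congr (_ ^+ _); lia.
rewrite -/(x z) !exprS; ring.
Qed.

Lemma conj_exists : exists2 eta0 : R, 0 < eta0 <= 1 &
  forall (eta : R) (e : T -> C) (tau : mt Q -> C), 0 < eta -> eta <= eta0 ->
  mass e (eta / 4) -> mass tau eta ->
  exists u : J -> C, absb u eta /\
    forall z : T, @mdom R X z -> nG k (fun z => z.1 ^+ k.+1 + e z) tau u z = 0.
Proof.
have [K [K0 hK]] := nG_remainder.
(* This makes K eta <= 1/4: the initial residual is at most eta / 4 + K eta^2 <= eta / 2, and the
   Lipschitz constant stays below 1/2. *)
exists (4 * K + 4)^-1.
  rewrite invr_gt0 invf_le1; lra.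
move=> eta e tau e0 ee he htau.
have K4 : 0 < 4 * K + 4 by lra.
have eK : K * eta <= 4^-1.
  have : eta * (4 * K + 4) <= 1 by rewrite -ler_pdivlMr // mul1r.
  nra.
have e1 : eta <= 1 by apply: le_trans ee _; rewrite invf_le1; lra.
have he' : mass e eta by apply: mass_le he; lra.
have [h1 h2] := hK eta e tau e0 e1 he' htau.
have z0 : @absb R J (fun=> 0) 0 by move=> s _; rewrite big1 // => i _; exact: nrm0.
have z1 : @absb R J (fun=> 0) eta by apply: absb_le z0; exact: ltW.
have [|||u [hu hG]] := @newton R X (nG k (fun z => z.1 ^+ k.+1 + e z) tau) eta (eta / 2).
- apply: mass_ext (mass_le _ (massB (h1 _ z1) he)) => [z hz|]; last by rewrite expr2; nra.
  have -> : ev (Q := X) (fun=> 0) z = 0.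
    by apply: hsE; apply: hsum_ext (hsum0 _) => i; rewrite mul0r.
  by ring.
- lra.
- move=> u v m hu hv huv; have m0 := absb_ge0 hv.
  apply: mass_ext (mass_le _ (h2 _ _ _ hu hv huv)) => [z hz|]; last by rewrite expr1; nra.
  have -> : ev (Q := X) (fun a => u a + v a) z = ev (Q := X) u z + ev (Q := X) v z.
    apply: hsE; apply: hsum_ext (hsumD (ev_hsum hu hz) (ev_hsum hv hz)) => i.
    by rewrite mulrDl.
  by ring.
by exists u; split=> //; apply: absb_le hu; lra.
Qed.

(** Uniqueness of the expansion, which allows a bound for the function [ev v] to be read as a bound
    for the coefficients [v]. *)
Definition separated : Prop := forall c M, absb c M ->
  (forall z : T, @mdom R X z -> hsum (fun a => c a * @mv R X a z) 0) -> forall a, c a = 0.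

(** For the difference [v] of two solutions, [ev v] is minus the variation of the remainder, so
    every l^1 bound for [v] can be halved. *)
Lemma conj_unique : separated -> exists2 eta0 : R, 0 < eta0 <= 1 &
  forall (eta : R) (e : T -> C) (tau : mt Q -> C) (u u' : J -> C), 0 < eta -> eta <= eta0 ->
  mass e eta -> mass tau eta -> absb u eta -> absb u' eta ->
  (forall z : T, @mdom R X z -> nG k (fun z => z.1 ^+ k.+1 + e z) tau u z = 0) ->
  (forall z : T, @mdom R X z -> nG k (fun z => z.1 ^+ k.+1 + e z) tau u' z = 0) ->
  u' = u.
Proof.
move=> sep; have [K [K0 hK]] := nG_remainder.
exists (4 * K + 4)^-1.
  rewrite invr_gt0 invf_le1; lra.
move=> eta e tau u u' e0 ee he htau hu hu' hG hG'.
have K4 : 0 < 4 * K + 4 by lra.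
have eK : K * eta <= 4^-1.
  have : eta * (4 * K + 4) <= 1 by rewrite -ler_pdivlMr // mul1r.
  nra.
have e1 : eta <= 1 by apply: le_trans ee _; rewrite invf_le1; lra.
have [_ h2] := hK eta e tau e0 e1 he htau.
pose v a := u' a - u a.
have uv : u' = (fun a => u a + v a) by apply/funext => a; rewrite /v addrC subrK.
have hv0 : absb v (eta + eta) by apply: absbD => //; exact: absbN.
have step m : absb v m -> absb v (m / 2).
  move=> hv; have m0 := absb_ge0 hv; have huv : absb (fun a => u a + v a) eta by rewrite -uv.
  have [c [hc hcv]] : @mass R X (ev (Q := X) v) (m / 2).
    apply: mass_ext (mass_le _ (massN (h2 _ _ _ hu hv huv))) => [z hz|]; last by rewrite expr1; nra.
    have -> : ev (Q := X) (fun a => u a + v a) z = ev (Q := X) u z + ev (Q := X) v z.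
      apply: hsE; apply: hsum_ext (hsumD (ev_hsum hu hz) (ev_hsum hv hz)) => i.
      by rewrite /v; ring.
    by rewrite -uv (hG _ hz) (hG' _ hz); ring.
  have cv : forall a, c a - v a = 0.
    apply: sep (absbD hc (absbN hv)) _ => z hz.
    rewrite -(subrr (ev (Q := X) v z)).
    by apply: hsum_ext (hsumB (hcv z hz) (ev_hsum hv hz)) => b; rewrite /v; ring.
  by apply: absb_mono hc => a; rewrite (subr0_eq (cv a)).
have hvn n : absb v ((eta + eta) * 2^-1 ^+ n).
  elim: n => [|n /step]; first by rewrite expr0 mulr1.
  by rewrite exprSr mulrA.
apply/funext => a; apply: subr0_eq; apply: nrm_le_eps => d d0.
have [n hn] := half_pow_small (eta + eta) d0.
by apply: le_trans hn; have := hvn n [:: a] isT; rewrite big_seq1.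
Qed.

End Remainder.

(** * Complex derivatives *)

Section Derivatives.
Variable R : realType.
Local Notation C := (Cplx R).

(** A derivative with a uniform quadratic remainder on a disc. Unlike bare differentiability, this
    passes to absolutely convergent sums term by term. *)
Definition qd (rho K : R) (F F' : C -> C) : Prop :=
  forall x h, nrm x <= rho -> nrm (x + h) <= rho ->
    nrm (F (x + h) - F x - h * F' x) <= K * nrm h ^+ 2.

Lemma qd_is_derive (F F' : C -> C) rho K x :
  qd rho K F F' -> nrm x < rho -> is_derive x (1 : C) F (F' x).
Proof.
move=> hF hx.
have K0 : 0 <= Num.max K 0 by rewrite le_max lexx orbT.
have cv : (fun h : C => h^-1 *: (F (h *: (1 : C) + x) - F x)) @ (0 : C)^' --> F' x.
  apply/cvgrPdist_le => _ /pos_cR[e e0 ->]; apply/near_dnbhs.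
  pose r := Num.min (rho - nrm x) (e / (Num.max K 0 + 1)).
  have r0 : 0 < r by rewrite lt_min subr_gt0 hx divr_gt0 // ltr_pwDr.
  exists r => // h h0; rewrite subr0 => hr.
  rewrite distrC nrmE ler_cR -[h *: 1]/(h * 1) mulr1 -[_ *: _]/(_ * _).
  have hh : nrm h <= rho - nrm x by apply: ltW; apply: lt_le_trans hr _; rewrite ge_min lexx.
  have := hF x h (ltW hx) _; rewrite [h + x]addrC.
  have hxh : nrm (x + h) <= rho by apply: le_trans (nrmD _ _) _; lra.
  move=> /(_ hxh) hb.
  have -> : h^-1 * (F (x + h) - F x) - F' x = h^-1 * (F (x + h) - F x - h * F' x) by field.
  rewrite nrmM nrmV ler_pdivrMl ?nrm_gt0 //; apply: le_trans hb _.
  rewrite expr2 mulrCA mulrA -mulrA [_ * nrm h]mulrC mulrA.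
  have h2 : nrm h * (Num.max K 0 + 1) <= e.
    by rewrite -ler_pdivlMr ?ltr_pwDr //; apply: ltW; apply: lt_le_trans hr _; rewrite ge_min lexx orbT.
  have h3 : K <= Num.max K 0 by rewrite le_max lexx.
  have h4 := nrm_ge0 h.
  rewrite -mulrA ler_wpM2l //; nra.
apply: DeriveDef; first by apply/cvg_ex; exists (F' x).
exact/cvg_lim.
Qed.

Lemma is_derive_unique (F : C -> C) x a b :
  is_derive x (1 : C) F a -> is_derive x (1 : C) F b -> a = b.
Proof. by move=> [_ <-] [_ <-]. Qed.

(** The segment is cut into N + 1 equal pieces; the quadratic remainders add up to K' / (N + 1),
    which tends to 0. *)
Lemma mean_value (F F' : C -> C) rho K a b B : qd rho K F F' ->
  (forall s : R, 0 <= s <= 1 -> nrm (a + cR s * (b - a)) <= rho) ->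
  (forall s : R, 0 <= s <= 1 -> nrm (F' (a + cR s * (b - a))) <= B) ->
  nrm (F b - F a) <= B * nrm (b - a).
Proof.
move=> hF hdom hB; apply/ler_addgt0Pr => e e0.
pose K' := Num.max K 0 * nrm (b - a) ^+ 2.
have [N hN] : exists N : nat, K' / N.+1%:R <= e.
  exists (Num.bound (K' / e)); rewrite ler_pdivrMr ?ltr0n // mulrC -ler_pdivrMr //.
  have /archi_boundP/ltW h : 0 <= K' / e.
    by apply: divr_ge0; [rewrite mulr_ge0 ?exprn_ge0 ?nrm_ge0 // le_max lexx orbT|exact: ltW].
  by apply: le_trans h _; rewrite ler_nat.
pose p (i : nat) : C := a + cR (i%:R / N.+1%:R) * (b - a).
have sI i : (i <= N.+1)%N -> 0 <= (i%:R / N.+1%:R : R) <= 1.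
  by move=> iN; rewrite divr_ge0 //= ler_pdivrMr ?ltr0n // mul1r ler_nat.
have pS i : p i.+1 = p i + cR (N.+1%:R^-1) * (b - a).
  rewrite /p -addrA -mulrDl -cRD; congr (_ + cR _ * _).
  by rewrite -[i.+1%:R]natr1 mulrDl mul1r.
have stepb i : (i < N.+1)%N -> nrm (F (p i.+1) - F (p i)) <=
    B * nrm (b - a) / N.+1%:R + K' / N.+1%:R ^+ 2.
  move=> iN; have h1 := hF (p i) (cR (N.+1%:R^-1) * (b - a)) (hdom _ (sI _ (ltnW iN))).
  rewrite -pS in h1; have {}h1 := h1 (hdom _ (sI _ iN)).
  rewrite -[F _ - F _](subrK (cR N.+1%:R^-1 * (b - a) * F' (p i))) addrC.
  have n0 : (0 : R) <= N.+1%:R^-1 by rewrite invr_ge0.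
  apply: nrm_leD.
    have -> : B * nrm (b - a) / N.+1%:R = N.+1%:R^-1 * nrm (b - a) * B by ring.
    rewrite !nrmM nrm_cR0 // ler_wpM2l ?mulr_ge0 ?nrm_ge0 //.
    exact: hB (sI _ (ltnW iN)).
  apply: le_trans h1 _; rewrite nrmM nrm_cR0 // exprMn /K' exprVn.
  have -> : Num.max K 0 * nrm (b - a) ^+ 2 / N.+1%:R ^+ 2 =
    Num.max K 0 * ((N.+1%:R ^+ 2)^-1 * nrm (b - a) ^+ 2) by ring.
  by rewrite ler_wpM2r ?le_max ?lexx // mulr_ge0 ?invr_ge0 ?exprn_ge0 ?nrm_ge0.
have tel n : (n <= N.+1)%N -> nrm (F (p n) - F (p 0%N)) <=
    n%:R * (B * nrm (b - a) / N.+1%:R + K' / N.+1%:R ^+ 2).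
  elim: n => [_|n ih nN]; first by rewrite subrr nrm0 mul0r.
  have -> : F (p n.+1) - F (p 0%N) = (F (p n.+1) - F (p n)) + (F (p n) - F (p 0%N)) by ring.
  by rewrite -[n.+1%:R]natr1 mulrDl mul1r [leRHS]addrC; apply: nrm_leD; [exact: stepb|exact: ih (ltnW nN)].
have := tel N.+1 (leqnn _).
have N0 : (N.+1%:R : R) != 0 by rewrite pnatr_eq0.
have -> : p N.+1 = b by rewrite /p divff // cR1 mul1r addrC subrK.
have -> : p 0%N = a by rewrite /p mul0r cR0 mul0r addr0.
move=> h.
apply: le_trans h _.
have -> : N.+1%:R * (B * nrm (b - a) / N.+1%:R + K' / N.+1%:R ^+ 2) =
   B * nrm (b - a) + K' / N.+1%:R by field.
by rewrite lerD2l.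
Qed.

(** Induction on n rho^(n-1) (1 - rho) <= 1 - rho^n. The bound is uniform in the degree, so that
    differentiated powers can be summed. *)
Lemma expr_deriv_le (rho : R) n : 0 <= rho -> rho < 1 -> n%:R * rho ^+ n.-1 <= (1 - rho)^-1.
Proof.
move=> r0 r1; have p0 : 0 < 1 - rho by lra.
rewrite -[leRHS]mul1r ler_pdivlMr //.
suff : n%:R * rho ^+ n.-1 * (1 - rho) <= 1 - rho ^+ n by have := exprn_ge0 n r0; lra.
elim: n => [|n ih]; first by rewrite mul0r mul0r expr0 subrr.
rewrite /= exprS -natr1.
have -> : (n%:R + 1) * rho ^+ n * (1 - rho) =
   rho * (n%:R * rho ^+ n.-1 * (1 - rho)) + rho ^+ n * (1 - rho).
  by case: n {ih} => [|n]; rewrite ?exprS /=; ring.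
have e0 : 0 <= rho ^+ n by exact: exprn_ge0.
have e1 : rho ^+ n <= 1 by apply: exprn_ile1 => //; exact: ltW.
nra.
Qed.

Lemma qd_expr (rho : R) n : 0 <= rho -> rho < 1 ->
  qd rho ((1 - rho)^-1 ^+ 2) (fun x => x ^+ n) (fun x => n%:R * x ^+ n.-1).
Proof.
move=> r0 r1 x h hx hxh; have p0 : 0 < 1 - rho by lra.
set K := (1 - rho)^-1; have K0 : 0 < K by rewrite invr_gt0.
elim: n => [|n ih].
  by rewrite expr0 mul0r mulr0 subrr subr0 nrm0 mulr_ge0 ?exprn_ge0 ?nrm_ge0 // ltW.
have -> : (x + h) ^+ n.+1 - x ^+ n.+1 - h * (n.+1%:R * x ^+ n.+1.-1) =
  (x + h) * ((x + h) ^+ n - x ^+ n - h * (n%:R * x ^+ n.-1)) + n%:R * x ^+ n.-1 * h ^+ 2.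
  by case: n {ih} => [|n] /=; rewrite ?expr0 !exprS -?natr1; ring.
have hh : nrm (n%:R * x ^+ n.-1) <= K.
  rewrite nrmM nrm_nat; apply: le_trans (expr_deriv_le n r0 r1).
  by rewrite ler_wpM2l // nrm_leX.
have := nrm_leD (nrm_leM hxh ih) (nrm_leM hh (lexx (nrm (h ^+ 2)))).
move/le_trans; apply; rewrite nrmX.
have -> : rho * (K ^+ 2 * nrm h ^+ 2) + K * nrm h ^+ 2 = (rho * K ^+ 2 + K) * nrm h ^+ 2 by ring.
rewrite ler_wpM2r ?exprn_ge0 ?nrm_ge0 //.
suff : K = K ^+ 2 * (1 - rho) by nra.
by rewrite /K; field; lra.
Qed.

Lemma qd_sum (I : eqType) (phi phi' : I -> C -> C) (h : I -> C) rho K M (F F' : C -> C) :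
  0 <= K -> (forall i, qd rho K (phi i) (phi' i)) -> absb h M ->
  (forall x, nrm x <= rho -> hsum (fun i => h i * phi i x) (F x)) ->
  (forall x, nrm x <= rho -> hsum (fun i => h i * phi' i x) (F' x)) ->
  qd rho (M * K) F F'.
Proof.
move=> K0 hphi hh hF hF' x t hx hxt.
have := hsumB (hsumB (hF _ hxt) (hF _ hx)) (hsumZ t (hF' _ hx)).
apply: hsum_le => s us.
apply: (@le_trans _ _ (\sum_(i <- s) nrm (h i) * (K * nrm t ^+ 2))).
  apply: ler_sum => i _.
  have -> : h i * phi i (x + t) - h i * phi i x - t * (h i * phi' i x) =
    h i * (phi i (x + t) - phi i x - t * phi' i x) by ring.
  by rewrite nrmM ler_wpM2l ?nrm_ge0 // hphi.
by rewrite -mulr_suml -mulrA ler_wpM2r ?mulr_ge0 ?exprn_ge0 ?nrm_ge0 // hh.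
Qed.

Section Series.
Variables (I : eqType) (p : I -> nat).

(** Terms are indexed by any [I] with an exponent map [p], without grouping equal powers. One
    coefficient family with two exponent maps is thereby a series in either of two variables. *)
Definition ser (h : I -> C) (s : C) : C := hs (fun i => h i * s ^+ p i).
Definition dser (h : I -> C) (s : C) : C := hs (fun i => h i * ((p i)%:R * s ^+ (p i).-1)).

Lemma ser_absb (h : I -> C) M s : absb h M -> nrm s <= 1 -> absb (fun i => h i * s ^+ p i) M.
Proof.
move=> hh hs; apply: absb_mono hh => i; rewrite nrmM ler_piMr ?nrm_ge0 //.
by rewrite nrmX exprn_ile1 ?nrm_ge0.
Qed.

Lemma ser_hsum (h : I -> C) M s : absb h M -> nrm s <= 1 -> hsum (fun i => h i * s ^+ p i) (ser h s).
Proof. by move=> hh hs; exact: hsP (ser_absb hh hs). Qed.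

Lemma dser_coef (h : I -> C) M rho s : absb h M -> 0 <= rho -> rho < 1 -> nrm s <= rho ->
  absb (fun i => h i * ((p i)%:R * s ^+ (p i).-1)) (M * (1 - rho)^-1).
Proof.
move=> hh r0 r1 hs; have p0 : 0 < 1 - rho by lra.
have K0 : 0 <= (1 - rho)^-1 by rewrite invr_ge0 ltW.
rewrite mulrC -[X in X * _](nrm_cR0 K0).
apply: absb_mono (absbZ (cR (1 - rho)^-1) hh) => i.
rewrite !nrmM nrm_nat nrm_cR0 // mulrC ler_wpM2r ?nrm_ge0 //.
apply: le_trans (expr_deriv_le (p i) r0 r1); rewrite ler_wpM2l //; exact: nrm_leX.
Qed.

Lemma dser_hsum (h : I -> C) M rho s : absb h M -> 0 <= rho -> rho < 1 -> nrm s <= rho ->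
  hsum (fun i => h i * ((p i)%:R * s ^+ (p i).-1)) (dser h s).
Proof. by move=> hh r0 r1 hs; exact: hsP (dser_coef hh r0 r1 hs). Qed.

Lemma ser_qd (h : I -> C) M rho : absb h M -> 0 <= rho -> rho < 1 ->
  qd rho (M * (1 - rho)^-1 ^+ 2) (ser h) (dser h).
Proof.
move=> hh r0 r1; have p0 : 0 < 1 - rho by lra.
apply: (@qd_sum _ (fun i x => x ^+ p i) (fun i x => (p i)%:R * x ^+ (p i).-1) h) => // [|i|x hx|x hx].
- by rewrite exprn_ge0 // invr_ge0 ltW.
- exact: qd_expr.
- by apply: ser_hsum hh _; apply: le_trans hx (ltW r1).
- exact: dser_hsum hh r0 r1 hx.
Qed.

Lemma ser_derive (h : I -> C) M s : absb h M -> nrm s < 1 -> is_derive s (1 : C) (ser h) (dser h s).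
Proof.
move=> hh hs; have h1 : (nrm s + 1) / 2 < 1 by lra.
have h0 : 0 <= (nrm s + 1) / 2 by have := nrm_ge0 s; lra.
by apply: qd_is_derive (ser_qd hh h0 h1) _; lra.
Qed.

End Series.

Lemma is_derive_near (F G : C -> C) x a (r : R) : 0 < r ->
  (forall y, nrm (y - x) < r -> F y = G y) ->
  is_derive x (1 : C) F a -> is_derive x (1 : C) G a.
Proof.
move=> r0 h; apply: near_eq_is_derive.
by apply/near_C; exists r => // y /h.
Qed.

End Derivatives.

(** * Flows of normal forms *)

Section Flow.
Variable R : realType.
Local Notation C := (Cplx R).
Variables (Q : msys R) (k : nat).
Local Notation S := (ext (ext Q)).
Local Notation J := (mi S).
Local Notation T := (mt S).

(** The primitive of the monomial [a] in the time variable, vanishing at time 0. *)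
Definition wB (a : J) (z : T) : C := z.1 ^+ a.1.+1 / a.1.+1%:R * @mv R (ext Q) a.2 z.2.

Lemma wB_mass a : @mass R S (wB a) 1.
Proof.
have h : nrm (a.1.+1%:R^-1 : C) <= 1 by rewrite nrmV nrm_nat invf_le1 ?ltr0n // ler1n.
apply: mass_ext (mass_le _ (massZ a.1.+1%:R^-1 (massM (@mass_xn R (ext Q) a.1.+1)
  (@mass_lift R (ext Q) _ _ (@mass_mono R (ext Q) a.2))))) => [z _|]; last by rewrite !mulr1.
by rewrite /wB; ring.
Qed.

Lemma half_le1 : nrm (2^-1 : C) <= 1.
Proof. by rewrite nrmV nrm_nat invf_le1 ?ltr0n // ler1n. Qed.

Lemma mass_half (f : T -> C) M : @mass R S f M -> mass (fun l : mt Q => f (2^-1, (2^-1, l))) M.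
Proof.
move=> h; have := @mass_at R (ext Q) f M _ half_le1 h => h1.
exact: (@mass_at R Q (fun w => f (2^-1, w)) M _ half_le1 h1).
Qed.

Variables (y : 'I_k -> mt Q -> C) (mu tau : mt Q -> C).

(* The initial point is X = 2x, so that the unit x-disc covers |X| <= 2; the time
   function makes E(1/2, X = 1) equal to 1 + tau whatever u is. *)
Definition ft (u : J -> C) (l : mt Q) : C :=
  2 * (tau l - comb (Q := S) wB u (2^-1, (2^-1, l))).
Definition fE (u : J -> C) (z : T) : C :=
  2 * z.2.1 + z.1 * ft u z.2.2 * (2 * z.2.1) ^+ k.+1 + comb (Q := S) wB u z.
Definition fEs (u : J -> C) (z : T) : C :=
  ft u z.2.2 * (2 * z.2.1) ^+ k.+1 + ev (Q := S) u z.
(** The flow equation in rescaled time, for [ft] times the normal form, cleared of the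
    denominator. *)
Definition fH (u : J -> C) (z : T) : C :=
  (1 + mu z.2.2 * fE u z ^+ k) * fEs u z -
  ft u z.2.2 * (fE u z ^+ k.+1 + \sum_(i < k) y i z.2.2 * fE u z ^+ i).

Lemma ft_Lp eta : 0 < eta -> eta <= 1 -> mass tau eta -> @Lp R Q J eta 4 1 ft.
Proof.
move=> e0 e1 ht.
have h1 : @Lp R Q J eta 1 1 (fun _ => tau) by apply: Lp_const => //; rewrite mul1r expr1.
have h2 : @Lp R Q J eta 1 1 (comb (Q := Q) (fun a l => wB a (2^-1, (2^-1, l)))).
  by apply: Lp_comb => // a; apply: (mass_half (wB_mass a)).
have h3 := LpB h1 h2; have := LpD h3 h3.
rewrite (_ : 1 + 1 + (1 + 1) = 4 :> R); last by lra.
by apply: Lp_ext => u z _ _; rewrite /ft /comb; cbv beta; ring.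
Qed.

End Flow.

Section FlowExists.
Variable R : realType.
Local Notation C := (Cplx R).
Variables (Q : msys R) (k : nat).
Local Notation S := (ext (ext Q)).
Local Notation J := (mi S).
Local Notation T := (mt S).

Lemma LpS_lift (I : eqType) (eta K : R) p (A : (I -> C) -> mt Q -> C) :
  Lp eta K p A -> @Lp R S I eta K p (fun u z => A u z.2.2).
Proof. by move=> /(@Lp_lift R Q) /(@Lp_lift R (ext Q)). Qed.

Lemma fd_Lp : exists D : R, 0 <= D /\ forall (eta : R) (tau : mt Q -> C),
  0 < eta -> eta <= 1 -> mass tau eta ->
  @Lp R S J eta D 1 (fun u z => z.1 * ft tau u z.2.2 * (2 * z.2.1) ^+ k.+1 + comb (Q := S) (@wB R Q) u z).
Proof.
exists (2 * (2 * (1 * 4) * 2 ^+ k.+1) + 1); split; first by rewrite !addr_ge0 ?mulr_ge0 ?exprn_ge0.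
move=> eta tau e0 e1 ht.
have hs : @Lp R S J eta 1 0 (fun _ z => z.1).
  by apply: Lp_const => //; rewrite mulr1; exact: mass_x.
have hX : @Lp R S J eta (2 ^+ k.+1) 0 (fun _ z => (2 * z.2.1) ^+ k.+1).
  apply: Lp_const; rewrite ?exprn_ge0 // mulr1; apply: massX.
  have := massZ 2 (@mass_lift R (ext Q) _ _ (@mass_x R Q)).
  by rewrite nrm_nat mulr1.
have ht1 := LpS_lift (ft_Lp e0 e1 ht).
have hw := Lp_comb eta ler01 (@wB_mass R Q).
exact: LpD (LpM e0 e1 (LpM e0 e1 hs ht1) hX) hw.
Qed.

(** The term ft (2x)^(k+1) of [fEs] cancels the main part of ft E^(k+1); what is left besides [ev u]
    has two small factors. *)
Lemma fH_remainder : exists K : R, 0 <= K /\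
  forall (eta : R) (y : 'I_k -> mt Q -> C) (mu tau : mt Q -> C), 0 < eta -> eta <= 1 ->
  (forall i, mass (y i) eta) -> mass mu eta -> mass tau eta ->
  @Lp R S J eta K 2 (fun u z => fH y mu tau u z - ev (Q := S) u z).
Proof.
have [D [D0 hD]] := fd_Lp.
have h2 : (0 : R) <= 2 by [].
have [K1 hK1] := choice (fun n => @Lp_pow_diff R S n 2 D h2 D0).
have K10 n : 0 <= K1 n by case: (hK1 n).
pose Es := 2 * (4 * 2 ^+ k.+1) + 1 : R.
pose K := 2 * (2 * (1 * (K1 k + 2 ^+ k)) * Es) + 2 * (4 * K1 k.+1)
  + 2 * (4 * \sum_(i < k) 2 * (1 * (K1 i + 2 ^+ i))).
have Es0 : 0 <= Es by rewrite addr_ge0 ?mulr_ge0 ?exprn_ge0.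
exists K; split.
  rewrite /K; do ?[apply: addr_ge0 | apply: mulr_ge0 | apply: exprn_ge0 | by []].
  by apply: sumr_ge0 => i _; rewrite !mulr_ge0 // addr_ge0 // exprn_ge0.
move=> eta y mu tau e0 e1 hy hmu ht.
pose x (z : T) := 2 * z.2.1.
have hx : @mass R S x 2.
  have := massZ 2 (@mass_lift R (ext Q) _ _ (@mass_x R Q)).
  by rewrite nrm_nat mulr1.
have hxn n : @Lp R S J eta (2 ^+ n) 0 (fun _ z => x z ^+ n).
  by apply: Lp_const; rewrite ?exprn_ge0 // mulr1; exact: massX.
have hd := hD eta tau e0 e1 ht.
have pd n := (hK1 n).2 _ _ _ _ e0 e1 hx hd.
have hE n : @Lp R S J eta (K1 n + 2 ^+ n) 0 (fun u z => fE k tau u z ^+ n).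
  have pd0 : @Lp R S J eta (K1 n) 0 _ := Lp_le e0 e1 (lexx _) (isT : (0 <= 1)%N) (pd n).
  by apply: Lp_ext (LpD pd0 (hxn n)) => u z _ _; rewrite /fE -[in RHS]addrA subrK.
have ht1 := LpS_lift (ft_Lp e0 e1 ht).
have hev : @Lp R S J eta 1 1 (fun u z => ev (Q := S) u z).
  by apply: (Lp_comb eta ler01) => a; exact: mass_mono.
have hEs : @Lp R S J eta Es 1 (fun u z => fEs k tau u z) := LpD (LpM e0 e1 ht1 (hxn k.+1)) hev.
have hmu1 : @Lp R S J eta 1 1 (fun _ z => mu z.2.2).
  by apply: (@LpS_lift J eta 1 1 (fun _ => mu)); apply: Lp_const => //; rewrite mul1r expr1.
have hy1 (i : 'I_k) : @Lp R S J eta 1 1 (fun _ z => y i z.2.2).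
  by apply: (@LpS_lift J eta 1 1 (fun _ => y i)); apply: Lp_const => //; rewrite mul1r expr1.
have r1 := LpM e0 e1 (LpM e0 e1 hmu1 (hE k)) hEs.
have r2 := LpM e0 e1 ht1 (pd k.+1).
have r3 := LpM e0 e1 ht1 (Lp_sum e0 (index_enum 'I_k) (fun i : 'I_k => LpM e0 e1 (hy1 i) (hE i))).
apply: Lp_ext (LpB (LpB r1 r2) r3) => u z hu hz.
rewrite /fH /fEs addrA -/(fE k tau u z) -/(x z); ring.
Qed.

Lemma flow_exists : exists D : R, 0 <= D /\ exists2 eta0 : R, 0 < eta0 <= 1 &
  forall (eta : R) (y : 'I_k -> mt Q -> C) (mu tau : mt Q -> C), 0 < eta -> eta <= eta0 ->
  (forall i, mass (y i) eta) -> mass mu eta -> mass tau eta ->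
  exists u : J -> C, [/\ absb u eta,
    forall z : T, @mdom R S z -> fH y mu tau u z = 0,
    mass (ft tau u) (4 * eta) &
    @mass R S (fun z => fE k tau u z - 2 * z.2.1) (D * eta)].
Proof.
have [D [D0 hD]] := fd_Lp; exists D; split=> //.
have [K [K0 hK]] := fH_remainder.
exists (4 * K + 4)^-1.
  rewrite invr_gt0 invf_le1; lra.
move=> eta y mu tau e0 ee hy hmu htau.
have K4 : 0 < 4 * K + 4 by lra.
have eK : K * eta <= 4^-1.
  have : eta * (4 * K + 4) <= 1 by rewrite -ler_pdivlMr // mul1r.
  nra.
have e1 : eta <= 1 by apply: le_trans ee _; rewrite invf_le1; lra.
have [h1 h2] := hK eta y mu tau e0 e1 hy hmu htau.
have z0 : @absb R J (fun=> 0) 0 by move=> s _; rewrite big1 // => i _; exact: nrm0.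
have z1 : @absb R J (fun=> 0) eta by apply: absb_le z0; exact: ltW.
have [|||u [hu hG]] := @newton R S (fH y mu tau) eta (eta / 2).
- apply: mass_ext (mass_le _ (h1 _ z1)) => [z hz|]; last by rewrite expr2; nra.
  have -> : ev (Q := S) (fun=> 0) z = 0.
    by apply: hsE; apply: hsum_ext (hsum0 _) => i; rewrite mul0r.
  by ring.
- lra.
- move=> u v m hu hv huv; have m0 := absb_ge0 hv.
  apply: mass_ext (mass_le _ (h2 _ _ _ hu hv huv)) => [z hz|]; last by rewrite expr1; nra.
  have -> : ev (Q := S) (fun a => u a + v a) z = ev (Q := S) u z + ev (Q := S) v z.
    apply: hsE; apply: hsum_ext (hsumD (ev_hsum hu hz) (ev_hsum hv hz)) => i.
    by rewrite mulrDl.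
  by ring.
have hu' : absb u eta by apply: absb_le hu; lra.
exists u; split=> //.
  by have := (ft_Lp e0 e1 htau).1 _ hu'; rewrite expr1.
apply: mass_ext ((hD eta tau e0 e1 htau).1 _ hu') => z _.
by rewrite /fE; ring.
Qed.

End FlowExists.

Section DeriveRules.
Variable R : realType.
Local Notation C := (Cplx R).
Implicit Types f g : C -> C.

Lemma dM f g (x a b : C) : is_derive x (1 : C) f a -> is_derive x (1 : C) g b ->
  is_derive x (1 : C) (fun s => f s * g s) (a * g x + f x * b).
Proof.
move=> hf hg; apply: is_derive_eq (is_deriveM hf hg) _.
by rewrite -![_ *: _]/(_ * _); ring.
Qed.

Lemma dD f g x a b : is_derive x (1 : C) f a -> is_derive x (1 : C) g b ->
  is_derive x (1 : C) (fun s => f s + g s) (a + b).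
Proof. by move=> hf hg; exact: is_deriveD. Qed.

Lemma dcst (c x : C) : is_derive x (1 : C) (fun _ => c) 0.
Proof. exact: is_derive_cst. Qed.

Lemma did (x : C) : is_derive x (1 : C) (fun s => s) 1.
Proof. exact: is_derive_id. Qed.

Lemma dZ (c : C) f x a : is_derive x (1 : C) f a -> is_derive x (1 : C) (fun s => c * f s) (c * a).
Proof. by move=> /(dM (dcst c x)); rewrite mul0r add0r. Qed.

Lemma dB f g x a b : is_derive x (1 : C) f a -> is_derive x (1 : C) g b ->
  is_derive x (1 : C) (fun s => f s - g s) (a - b).
Proof. by move=> hf hg; exact: is_deriveB. Qed.

Lemma dX n f x a : is_derive x (1 : C) f a ->
  is_derive x (1 : C) (fun s => f s ^+ n) (n%:R * f x ^+ n.-1 * a).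
Proof.
move=> hf; elim: n => [|n ih]; first by rewrite !mul0r; exact: dcst.
rewrite (_ : (fun s => _) = (fun s => f s * f s ^+ n)); last first.
  by apply/funext => s; rewrite exprS.
apply: is_derive_eq (dM hf ih) _.
by case: n {ih} => [|n] /=; rewrite ?expr0 ?exprS -!natr1; ring.
Qed.

Lemma dsum (I : Type) (s : seq I) (F : I -> C -> C) (a : I -> C) x :
  (forall i, is_derive x (1 : C) (F i) (a i)) ->
  is_derive x (1 : C) (fun w => \sum_(i <- s) F i w) (\sum_(i <- s) a i).
Proof.
move=> h; elim: s => [|i s ih].
  by rewrite big_nil (_ : (fun w => _) = (fun _ => 0)); [exact: dcst|apply/funext => w; rewrite big_nil].
rewrite big_cons (_ : (fun w => _) = (fun w => F i w + \sum_(j <- s) F j w)).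
  exact: dD.
by apply/funext => w; rewrite big_cons.
Qed.

Lemma is_derive_eps f x d : is_derive x (1 : C) f d <->
  forall e : R, 0 < e -> exists2 r : R, 0 < r &
    forall h, h != 0 -> nrm h < r -> nrm (h^-1 * (f (x + h) - f x) - d) <= e.
Proof.
have eqh (h : C) : h^-1 *: (f (h *: (1 : C) + x) - f x) = h^-1 * (f (x + h) - f x).
  by rewrite -[h *: 1]/(h * 1) mulr1 [h + x]addrC.
split=> [[hd <-] e e0|hf].
  have /cvgrPdist_le/(_ (cR e)) : (fun h : C => h^-1 *: (f (h *: (1 : C) + x) - f x)) @ (0 : C)^'
      --> 'D_1 f x by exact: hd.
  rewrite -cR0 ltr_cR => /(_ e0)/near_dnbhs[r r0 hr]; exists r => // h h0 hh.
  have := hr h h0; rewrite subr0 => /(_ hh).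
  by rewrite distrC nrmE ler_cR eqh.
have cv : (fun h : C => h^-1 *: (f (h *: (1 : C) + x) - f x)) @ (0 : C)^' --> d.
  apply/cvgrPdist_le => _ /pos_cR[e e0 ->]; apply/near_dnbhs.
  have [r r0 hr] := hf e e0; exists r => // h h0; rewrite subr0 => hh.
  by rewrite distrC nrmE ler_cR eqh; exact: hr.
apply: DeriveDef; first by apply/cvg_ex; exists d.
exact/cvg_lim.
Qed.

Lemma daffine f (a b x d : C) : is_derive (a * x + b) (1 : C) f d ->
  is_derive x (1 : C) (fun s => f (a * s + b)) (a * d).
Proof.
have [->|a0] := eqVneq a 0 => hf.
  rewrite mul0r (_ : (fun s => _) = (fun=> f b)); first exact: dcst.
  by apply/funext => s; rewrite mul0r add0r.
have na : 0 < nrm a by rewrite nrm_gt0.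
apply/is_derive_eps => e e0; move/is_derive_eps: hf => /(_ (e / nrm a)).
rewrite divr_gt0 // => /(_ isT)[r r0 hr]; exists (r / nrm a); first by rewrite divr_gt0.
move=> h h0; rewrite ltr_pdivlMr // => hh.
have ah0 : a * h != 0 by rewrite mulf_neq0.
have := hr (a * h) ah0; rewrite nrmM mulrC => /(_ hh).
rewrite ler_pdivlMr // mulrC -nrmM; apply: le_trans.
rewrite le_eqVlt; apply/orP; left; apply/eqP; congr nrm.
have -> : a * (x + h) + b = a * x + b + a * h by ring.
by field; rewrite a0 h0.
Qed.

End DeriveRules.

(** * One-variable series and linear differential equations *)

Section OneVariable.
Variable R : realType.
Local Notation C := (Cplx R).

(** The only monomial of [par R 0] is the constant 1, so this is the algebra of power series in one
    variable. *)
Definition umass (f : C -> C) (M : R) := @mass R (ext (par R 0)) (fun z => f z.1) M.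

Lemma dom0 (l : 'rV[C]_0) : @mdom R (par R 0) l.
Proof. by case. Qed.

Lemma pmon0 (b : {ffun 'I_0 -> nat}) (l : 'rV[C]_0) : pmon b l = 1.
Proof. by rewrite /pmon big_ord0. Qed.

Lemma umass_ser (f : C -> C) M : umass f M <->
  exists c : nat * {ffun 'I_0 -> nat} -> C,
    absb c M /\ forall s, nrm s <= 1 -> f s = ser fst c s.
Proof.
have e c s : (fun a : mi (ext (par R 0)) => c a * @mv R (ext (par R 0)) a (s, 0)) =
    (fun a => c a * s ^+ a.1) by apply/funext => a /=; rewrite /emon /= pmon0 mulr1.
split=> [[c [hc hf]]|[c [hc hf]]]; exists c; split=> //.
  by move=> s hs; have := hf (s, 0) (conj hs (@dom0 0)); rewrite e /ser => /hsE.
move=> [s l] [hs _]; rewrite hf // [l]thinmx0 e; exact: ser_hsum hc hs.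
Qed.

Lemma ser_umass (I : eqType) (p : I -> nat) (h : I -> C) M : absb h M -> umass (ser p h) M.
Proof.
move=> hh; apply: (@mass_sum R (ext (par R 0)) _ (fun i z => h i * z.1 ^+ p i) (fun i => nrm (h i))) => //.
  by move=> i; apply: mass_le (massZ _ (@mass_xn R (par R 0) (p i))); rewrite mulr1.
by move=> z [hz _]; exact: ser_hsum hh hz.
Qed.

Lemma umass_qd (f : C -> C) M : umass f M -> exists f' : C -> C,
  (forall rho, 0 <= rho -> rho < 1 -> qd rho (M * (1 - rho)^-1 ^+ 2) f f') /\
  (forall s, nrm s < 1 -> is_derive s (1 : C) f (f' s)).
Proof.
move=> /umass_ser[c [hc hf]]; exists (dser fst c); split=> [rho r0 r1 x h hx hxh|s hs].
  by rewrite !hf ?(le_trans _ (ltW r1)) //; exact: ser_qd hc r0 r1 _ _ hx hxh.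
have r0 : 0 < 1 - nrm s by rewrite subr_gt0.
have hn w : nrm (w - s) < 1 - nrm s -> ser fst c w = f w.
  move=> hw; rewrite hf // -(subrK s w) ltW //; apply: le_lt_trans (nrmD _ _) _; lra.
exact: (is_derive_near r0 hn (ser_derive fst hc hs)).
Qed.

(** A Gronwall argument: on [0, 1/2] the mean value inequality turns a bound B for |f| into B / 2,
    and this is iterated. *)
Lemma linear_ode_zero_qd (f g : C -> C) K M : qd 2^-1 K f g -> f 0 = 0 ->
  (forall s, nrm s <= 2^-1 -> nrm (f s) <= M) ->
  (forall s, nrm s <= 2^-1 -> nrm (g s) <= nrm (f s)) ->
  forall s : R, 0 <= s <= 2^-1 -> f (cR s) = 0.
Proof.
move=> hq f0 hM hb.
have M0 : 0 <= M by apply: le_trans (hM 0 _); rewrite ?nrm_ge0 // nrm0; lra.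
have key n s : 0 <= s <= 2^-1 -> nrm (f (cR s)) <= M * 2^-1 ^+ n.
  elim: n s => [|n ih] s /andP[s0 s1].
    by rewrite expr0 mulr1; apply: hM; rewrite nrm_cR0.
  have ps (w : R) : 0 <= w <= 1 -> 0 <= w * s <= 2^-1.
    move=> /andP[w0 w1]; rewrite mulr_ge0 //=; nra.
  have pe (w : R) : 0 + cR w * (cR s - 0) = cR (w * s) by rewrite subr0 add0r cRM.
  have := @mean_value R f g 2^-1 K 0 (cR s) (M * 2^-1 ^+ n) hq.
  rewrite f0 !subr0 nrm_cR0 // => h.
  have {}h : nrm (f (cR s)) <= M * 2^-1 ^+ n * s.
    apply: h => w hw; rewrite -[X in cR w * X]subr0 pe.
      by have /andP[p0 p1] := ps w hw; rewrite nrm_cR0.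
    have hp := ps w hw; have /andP[p0 p1] := hp.
    have hn : nrm (cR (w * s)) <= 2^-1 by rewrite nrm_cR0.
    by apply: le_trans (hb _ hn) _; exact: ih.
  apply: le_trans h _; rewrite exprSr mulrA ler_wpM2l //.
  by rewrite mulr_ge0 ?exprn_ge0.
move=> s hs; apply: nrm_le_eps => e e0; have [n hn] := half_pow_small M e0.
by apply: le_trans hn; exact: key.
Qed.

Lemma linear_ode_zero (f f' : C -> C) M : umass f M -> f 0 = 0 ->
  (forall s, nrm s < 1 -> is_derive s (1 : C) f (f' s)) ->
  (forall s, nrm s <= 2^-1 -> nrm (f' s) <= nrm (f s)) ->
  forall s : R, 0 <= s <= 2^-1 -> f (cR s) = 0.
Proof.
move=> hf f0 hd hb; have [g [hq hg]] := umass_qd hf.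
have r0 : (0 : R) <= 2^-1 by lra.
have r1 : (2^-1 : R) < 1 by lra.
apply: (linear_ode_zero_qd (hq _ r0 r1) f0 (M := M)) => s hs.
  by apply: (@mass_sup R (ext (par R 0)) _ _ (s, 0) hf); split=> /=; [lra|exact: dom0].
have s1 : nrm s < 1 by lra.
by rewrite (is_derive_unique (hg s s1) (hd s s1)); exact: hb.
Qed.

End OneVariable.

(** * Time maps as symmetries of the field *)

Section FlowConj.
Variable R : realType.
Local Notation C := (Cplx R).
Variables (k : nat) (y : 'I_k -> C) (mu t : C).

Definition npoly (w : C) : C := w ^+ k.+1 + \sum_(i < k) y i * w ^+ i.
Definition ndpoly (w : C) : C := k.+1%:R * w ^+ k + \sum_(i < k) y i * (i%:R * w ^+ i.-1).

Lemma npoly_derive (f : C -> C) x a : is_derive x (1 : C) f a ->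
  is_derive x (1 : C) (fun s => npoly (f s)) (ndpoly (f x) * a).
Proof.
move=> hf; rewrite /npoly /ndpoly mulrDl mulr_suml.
have h := dD (dX k.+1 hf) (dsum (index_enum 'I_k) (fun i : 'I_k => dZ (y i) (dX i hf))).
by apply: is_derive_eq h _; congr (_ + _); apply: eq_bigr => i _; ring.
Qed.

Variables (I : eqType) (p q : I -> nat) (c : I -> C) (M : R).
Hypothesis hc : absb c M.

Local Notation E s x := (ser p (fun i => c i * x ^+ q i) s).
Local Notation Ex s x := (ser p (fun i => c i * ((q i)%:R * x ^+ (q i).-1)) s).

Lemma serC s x : ser p (fun i => c i * x ^+ q i) s = ser q (fun i => c i * s ^+ p i) x.
Proof. by rewrite /ser; congr (hs _); apply/funext => i; ring. Qed.

Lemma ser_derive_x s x : nrm s <= 1 -> nrm x < 1 ->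
  is_derive x (1 : C) (fun x => E s x) (Ex s x).
Proof.
move=> s1 hx.
have -> : (fun x => E s x) = ser q (fun i => c i * s ^+ p i) by apply/funext => w; exact: serC.
have -> : Ex s x = dser q (fun i => c i * s ^+ p i) x.
  by rewrite /ser /dser; congr (hs _); apply/funext => i; ring.
exact: (ser_derive q (ser_absb p hc s1) hx).
Qed.

Variable Es : C -> C -> C.
Hypothesis hEs : forall s x, nrm s < 1 -> nrm x <= 1 -> is_derive s (1 : C) (fun s => E s x) (Es s x).
Hypothesis hode : forall s x, nrm s <= 1 -> nrm x <= 1 ->
  (1 + mu * E s x ^+ k) * Es s x = t * npoly (E s x).
Hypothesis hinit : forall x, nrm x <= 1 -> E 0 x = 2 * x.
Hypothesis hden : forall s x, nrm s <= 1 -> nrm x <= 1 -> 2^-1 <= nrm (1 + mu * E s x ^+ k).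
Hypothesis hsmall : forall s x, nrm s <= 1 -> nrm x <= 1 -> nrm (t * ndpoly (E s x)) <= 2^-1.

(** The mixed derivative, as a single double series: it is at once the s-derivative of E_x and the
    x-derivative of E_s. *)
Definition Esx s x := dser p (fun i => c i * ((q i)%:R * x ^+ (q i).-1)) s.

Lemma Ex_derive_s s x : nrm s < 1 -> nrm x < 1 ->
  is_derive s (1 : C) (fun s => Ex s x) (Esx s x).
Proof.
move=> s1 hx; exact: ser_derive (dser_coef (rho := nrm x) q hc (nrm_ge0 x) hx (lexx _)) s1.
Qed.

Lemma Es_derive_x s x : nrm s < 1 -> nrm x < 1 -> is_derive x (1 : C) (fun x => Es s x) (Esx s x).
Proof.
move=> s1 hx.
have h := ser_derive q (dser_coef (rho := nrm s) p hc (nrm_ge0 s) s1 (lexx _)) hx.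
have r0 : 0 < 1 - nrm x by rewrite subr_gt0.
have hn w : nrm (w - x) < 1 - nrm x -> ser q (fun i => c i * ((p i)%:R * s ^+ (p i).-1)) w = Es s w.
  move=> hw; have hw1 : nrm w <= 1.
    by rewrite -(subrK x w) ltW //; apply: le_lt_trans (nrmD _ _) _; lra.
  have e1 : is_derive s (1 : C) (fun s => E s w) (ser q (fun i => c i * ((p i)%:R * s ^+ (p i).-1)) w).
    have -> : ser q (fun i => c i * ((p i)%:R * s ^+ (p i).-1)) w =
      dser p (fun i => c i * w ^+ q i) s.
      by rewrite /ser /dser; congr (hs _); apply/funext => i; ring.
    exact: (ser_derive p (ser_absb q hc hw1) s1).
  exact: is_derive_unique e1 (hEs s1 hw1).
have e2 : dser q (fun i => c i * ((p i)%:R * s ^+ (p i).-1)) x = Esx s x.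
  by rewrite /Esx /dser; congr (hs _); apply/funext => i; ring.
by rewrite -e2; exact: (is_derive_near r0 hn h).
Qed.

(** The variational equation, obtained by differentiating the flow equation in the initial point. *)
Lemma flow_variation s x : nrm s < 1 -> nrm x < 1 ->
  mu * (k%:R * E s x ^+ k.-1 * Ex s x) * Es s x + (1 + mu * E s x ^+ k) * Esx s x =
  t * (ndpoly (E s x) * Ex s x).
Proof.
move=> s1 x1.
have dE := ser_derive_x (ltW s1) x1; have dEs := Es_derive_x s1 x1.
have h1 := dM (dD (dcst 1 x) (dZ mu (dX k dE))) dEs.
have h2 := dZ t (npoly_derive dE).
have h3 : is_derive x (1 : C) (fun w => (1 + mu * E s w ^+ k) * Es s w) (t * (ndpoly (E s x) * Ex s x)).
  have r0 : 0 < 1 - nrm x by rewrite subr_gt0.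
  have hn w : nrm (w - x) < 1 - nrm x -> t * npoly (E s w) = (1 + mu * E s w ^+ k) * Es s w.
    move=> hw; rewrite hode ?ltW //.
    by rewrite -(subrK x w); apply: le_lt_trans (nrmD _ _) _; lra.
  exact: (is_derive_near r0 hn h2).
by rewrite -(is_derive_unique h1 h3) add0r.
Qed.

(* The defect of E(s, .) from being a symmetry of the field satisfies a linear
   differential equation in s and vanishes at s = 0. *)
Lemma flow_symmetry x : nrm x < 1 ->
  npoly (2 * x) * (1 + mu * E 2^-1 x ^+ k) * Ex 2^-1 x =
  2 * (1 + mu * (2 * x) ^+ k) * npoly (E 2^-1 x).
Proof.
move=> x1.
pose D s := npoly (2 * x) * ((1 + mu * E s x ^+ k) * Ex s x)
   - 2 * (1 + mu * (2 * x) ^+ k) * npoly (E s x).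
pose D' s := npoly (2 * x) * (mu * (k%:R * E s x ^+ k.-1 * Es s x) * Ex s x +
   (1 + mu * E s x ^+ k) * Esx s x) - 2 * (1 + mu * (2 * x) ^+ k) * (ndpoly (E s x) * Es s x).
suff h0 : D 2^-1 = 0 by rewrite -mulrA; exact: subr0_eq h0.
have hE : umass (fun s => E s x) M by apply: ser_umass; exact: (ser_absb q hc (ltW x1)).
have hEx : umass (fun s => Ex s x) (M * (1 - nrm x)^-1).
  by apply: ser_umass; exact: (dser_coef q hc (nrm_ge0 x) x1 (lexx _)).
have mE n := massX n hE.
have mP : @mass R (ext (par R 0)) (fun z => npoly (E z.1 x)) _ :=
  massD (mE k.+1) (mass_bigsum (index_enum 'I_k) (fun i : 'I_k => massZ (y i) (mE i))).
have mD := massB (massZ (npoly (2 * x)) (massM (massD (mass1 (ext (par R 0))) (massZ mu (mE k))) hEx))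
  (massZ (2 * (1 + mu * (2 * x) ^+ k)) mP).
have hsd s : nrm s < 1 -> is_derive s (1 : C) D (D' s).
  move=> s1; have dE := hEs s1 (ltW x1); have dEx := Ex_derive_s s1 x1.
  have h := dB (dZ (npoly (2 * x)) (dM (dD (dcst 1 s) (dZ mu (dX k dE))) dEx))
    (dZ (2 * (1 + mu * (2 * x) ^+ k)) (npoly_derive dE)).
  by apply: is_derive_eq h _; rewrite add0r.
have D0 : D 0 = 0.
  have e0 : E 0 x = 2 * x by rewrite hinit // ltW.
  have n0 : nrm (0 : C) <= 1 by rewrite nrm0.
  have ex0 : Ex 0 x = 2.
    have h2 := dZ 2 (did x); rewrite mulr1 in h2.
    have r0 : 0 < 1 - nrm x by rewrite subr_gt0.
    have hn w : nrm (w - x) < 1 - nrm x -> 2 * w = E 0 w.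
      move=> hw; rewrite hinit // -(subrK x w) ltW //; apply: le_lt_trans (nrmD _ _) _; lra.
    exact: is_derive_unique (ser_derive_x n0 x1) (is_derive_near r0 hn h2).
  by rewrite /D e0 ex0; ring.
have half : cR 2^-1 = 2^-1 :> C by rewrite cRV cRn.
have := @linear_ode_zero R D D' _ mD D0 hsd _ 2^-1.
rewrite half; apply; last by apply/andP; split; lra.
move=> s hs; have s1 : nrm s < 1 by apply: le_lt_trans hs _; lra.
have s1' := ltW s1; have x1' := ltW x1.
pose d := 1 + mu * E s x ^+ k.
have nd : 2^-1 <= nrm d by exact: hden.
(* Both terms of [D] satisfy this linear equation, one by the variational equation and the other by
   the flow equation. With |d| >= 1/2 and |t P'(E)| <= 1/2 it gives |D'| <= |D|. *)
have eq : d * D' s = t * ndpoly (E s x) * D s.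
  have hv := flow_variation s1 x1; have ho := hode s1' x1'; rewrite -/d in hv ho.
  rewrite /D /D' -/d.
  transitivity (npoly (2 * x) * (d * (mu * (k%:R * E s x ^+ k.-1 * Ex s x) * Es s x + d * Esx s x))
    - 2 * (1 + mu * (2 * x) ^+ k) * (ndpoly (E s x) * (d * Es s x))); first by ring.
  by rewrite hv ho; ring.
have hsm := hsmall s1' x1'.
have h1 : nrm d * nrm (D' s) <= 2^-1 * nrm (D s).
  by rewrite -nrmM eq nrmM ler_wpM2r ?nrm_ge0.
have h2 := nrm_ge0 (D' s); nra.
Qed.

End FlowConj.

Section Collect.
Variable R : realType.
Local Notation C := (Cplx R).

Lemma absb_reindex (I J : eqType) (h : I -> J) (f : J -> C) M : injective h ->
  (forall j, f j != 0 -> exists i, j = h i) -> absb (f \o h) M -> absb f M.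
Proof.
move=> hi him hf; apply: (absb_group (p := h)) hf => j.
have [[i ->]|nj] := pselect (exists i, j = h i).
  have := @hsum_single R I (fun i' => if h i' == h i then (f \o h) i' else 0) i.
  by rewrite eqxx; apply=> i'; rewrite (inj_eq hi) => /negbTE ->.
have -> : f j = 0 by have [//|/him] := eqVneq (f j) 0.
apply: hsum_ext (hsum0 _) => i; case: eqP => // hij; by case: nj; exists i.
Qed.

(** Coefficients of equal powers are added. The weight [(q i).+1] controls the series and its
    derivative together, and survives the grouping because it is constant on each block. *)
Lemma collect_powers (I : eqType) (q : I -> nat) (g : I -> C) d :
  absb (fun i => (q i).+1%:R * g i) d ->
  exists f : nat -> C, [/\ absb (fun j => j.+1%:R * f j) d,
    forall x s, hsum (fun i => g i * x ^+ q i) s -> hsum (fun j => f j * x ^+ j) s &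
    forall x s, hsum (fun i => g i * ((q i)%:R * x ^+ (q i).-1)) s ->
      hsum (fun j => f j * (j%:R * x ^+ j.-1)) s].
Proof.
move=> hg.
have hg1 : absb g d.
  apply: absb_mono hg => i; rewrite nrmM nrm_nat; have := nrm_ge0 (g i).
  by have : (1 : R) <= (q i).+1%:R by [rewrite ler1n]; nra.
have hfib j : hsum (fun i => if q i == j then g i else 0)
    (hs (fun i => if q i == j then g i else 0)).
  by apply: (@hsP R I _ d); apply: absb_mono hg1 => i; case: ifP; rewrite ?nrm0 ?nrm_ge0.
have hfibw (w : nat -> C) j : hsum (fun i => if q i == j then g i * w (q i) else 0)
    (hs (fun i => if q i == j then g i else 0) * w j).
  rewrite mulrC; apply: hsum_ext (hsumZ (w j) (hfib j)) => i.
  by case: eqP => [->|_]; [ring|rewrite mulr0].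
exists (fun j => hs (fun i => if q i == j then g i else 0)); split.
- apply: (absb_group (p := q)) hg => j; rewrite mulrC.
  apply: hsum_ext (hfibw (fun j => j.+1%:R) j) => i; by case: eqP => // _; ring.
- by move=> x s; apply: (hsum_group (p := q)) => j; exact: (hfibw (fun j => x ^+ j)).
- by move=> x s; apply: (hsum_group (p := q)) => j; exact: (hfibw (fun j => j%:R * x ^+ j.-1)).
Qed.

End Collect.

(** * Normal forms and maps encoded as right-hand sides *)

Section Representation.
Variable R : realType.
Local Notation C := (Cplx R).
Variable k : nat.
Local Notation X := (ext (par R 0)).
Local Notation J := (mi X).
Let b0 : {ffun 'I_0 -> nat} := [ffun=> 0%N].

Lemma ffun0 (b : {ffun 'I_0 -> nat}) : b = b0.
Proof. by apply/ffunP => -[]. Qed.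

Lemma fst_inj : injective (fst : J -> nat).
Proof. by move=> [i b] [j b'] /= ->; rewrite (ffun0 b) (ffun0 b'). Qed.

Lemma separated0 : separated (par R 0).
Proof.
move=> c M hc h a.
have hc' : absb (fun j => c (j, b0)) M by apply: (absb_inj (h := fun j => (j, b0) : J)) hc => i j [].
have := @series_zero R (fun j => c (j, b0)) M 1 hc' ltr01 _ a.1.
case: a => j b; rewrite (ffun0 b) /=; apply=> x hx _.
apply: (@hsum_reindex R J nat fst _ _ fst_inj) => [i _|]; first by exists (i, b0).
by apply: hsum_ext (h (x, 0) (conj hx (@dom0 R 0))) => -[i b'] /=; rewrite /emon /= pmon0 mulr1 (ffun0 b').
Qed.

Variables (y : 'I_k -> C) (mu : C) (f : nat -> C) (d : R).
Hypothesis hf : absb (fun j => j.+1%:R * f j) d.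

(** The sum [rep] of the three families is the homological operator applied to (f, y, mu). The right
    inverse gives these data back, provided tau is the value f(1). *)
Definition rep1 (a : J) : C := if insub a.1 is Some i then y i else 0.
Definition rep2 (a : J) : C := if a.1 == (2 * k).+1 then - mu else 0.
Definition rep3 (a : J) : C :=
  if (k <= a.1)%N then ((2 * k).+1%:R - a.1%:R) * f (a.1 - k)%N else 0.
Definition rep (a : J) : C := rep1 a + rep2 a + rep3 a.

Lemma rep1_ge a : (k <= a.1)%N -> rep1 a = 0.
Proof. by move=> h; rewrite /rep1 insubN // -leqNgt. Qed.

Lemma rep1_absb : absb rep1 (\sum_(i < k) nrm (y i)).
Proof.
pose s : seq J := [seq (val i, b0) | i : 'I_k].
have -> : \sum_(i < k) nrm (y i) = \sum_(a <- s) nrm (rep1 a).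
  by rewrite big_map big_enum /=; apply: eq_bigr => i _; rewrite /rep1 valK.
apply: absb_fin => -[j b]; rewrite /rep1 (ffun0 b) /=; case: insubP => // i _ <-.
by move/negP; case; apply/mapP; exists i; rewrite ?mem_enum.
Qed.

Lemma rep2_absb : absb rep2 (nrm mu).
Proof.
have := @absb_single R J rep2 ((2 * k).+1, b0); rewrite /rep2 eqxx nrmN; apply=> -[j b].
by rewrite (ffun0 b) xpair_eqE eqxx andbT /= => /negbTE ->.
Qed.

Lemma rep3_absb : absb rep3 (k.+1%:R * d).
Proof.
have -> : rep3 = (fun j => if (k <= j)%N then ((2 * k).+1%:R - j%:R) * f (j - k)%N else 0) \o fst by [].
apply: absb_inj fst_inj _; apply: (@absb_reindex R nat nat (addn k)) => [i j /addnI //|j|].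
  by case: leqP => kj; [exists (j - k)%N; rewrite subnKC|rewrite eqxx].
rewrite -(nrm_nat R k.+1); apply: absb_mono (absbZ k.+1%:R hf) => j /=.
rewrite leq_addr addKn !nrmM mulrA ler_wpM2r ?nrm_ge0 //.
have -> : (2 * k).+1%:R - (k + j)%:R = k.+1%:R - j%:R :> C.
  by rewrite -!natr1 natrM natrD; ring.
rewrite !nrm_nat -natrM; case: (leqP j k.+1) => h.
  by rewrite -natrB // nrm_nat ler_nat; nia.
by rewrite nrmBC -natrB ?(ltnW h) // nrm_nat ler_nat; nia.
Qed.

Lemma rep_absb : absb rep (\sum_(i < k) nrm (y i) + nrm mu + k.+1%:R * d).
Proof. exact: absbD (absbD rep1_absb rep2_absb) rep3_absb. Qed.

Lemma comb_rep (Q : msys R) (phi : J -> mt Q -> C) (B : R) z s1 s2 s3 : 0 <= B ->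
  (forall i, mass (phi i) B) -> mdom z ->
  hsum (fun a => rep1 a * phi a z) s1 -> hsum (fun a => rep2 a * phi a z) s2 ->
  hsum (fun a => rep3 a * phi a z) s3 -> comb phi rep z = s1 + s2 + s3.
Proof.
move=> B0 hphi hz h1 h2 h3; apply: hsE; apply: hsum_ext (hsumD (hsumD h1 h2) h3) => a.
by rewrite /rep; ring.
Qed.

Lemma rep_y i l : ny rep i l = y i.
Proof.
rewrite /ny (comb_rep ler01 (hy_mass i) (dom0 l) (s1 := y i) (s2 := 0) (s3 := 0)) ?addr0 //.
- have := @hsum_single R J (fun a => rep1 a * hy i a l) (val i, b0).
  rewrite /rep1 /hy /= valK eqxx pmon0 mulr1; apply=> -[j b].
  by rewrite (ffun0 b) xpair_eqE eqxx andbT /= => /negbTE ->; rewrite mulr0.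
- apply: hsum_ext (hsum0 _) => a; rewrite /rep2 /hy; case: eqP => [->|_]; last by rewrite mul0r.
  by case: eqP => [ki|_]; [have := ltn_ord i; lia|rewrite mulr0].
- apply: hsum_ext (hsum0 _) => a; rewrite /rep3 /hy; case: leqP => h; last by rewrite mul0r.
  by case: eqP => [ki|_]; [have := ltn_ord i; lia|rewrite mulr0].
Qed.

Lemma rep_mu l : nmu k rep l = mu.
Proof.
rewrite /nmu (comb_rep ler01 (@hmu_mass R (par R 0) k) (dom0 l) (s1 := 0) (s2 := mu) (s3 := 0)) ?addr0 ?add0r //.
- apply: hsum_ext (hsum0 _) => a; rewrite /hmu; case: eqP => [e|_]; last by rewrite mulr0.
  by rewrite rep1_ge ?mul0r // e; lia.
- have := @hsum_single R J (fun a => rep2 a * hmu k a l) ((2 * k).+1, b0).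
  rewrite /rep2 /hmu /= eqxx pmon0 mulrNN mulr1; apply=> -[j b].
  by rewrite (ffun0 b) xpair_eqE eqxx andbT /= => /negbTE ->; rewrite mulr0.
- apply: hsum_ext (hsum0 _) => a; rewrite /hmu; case: eqP => [e|_]; last by rewrite mulr0.
  by rewrite /rep3 e subrr mul0r; case: ifP; rewrite mul0r.
Qed.

(** Serves both xi and xi': [w j] is x^j or its derivative, and [v] is its value at j = k + 1, the
    index where the factor of [rep3] and the difference w - v vanish together. *)
Lemma rep3_hsum (w : nat -> C) (v s s1 : C) (phi : J -> C) :
  (forall j, phi (j, b0) = if (k <= j)%N && (j != (2 * k).+1)
     then (w (j - k)%N - v) / ((2 * k).+1%:R - j%:R) else 0) ->
  w k.+1 = v ->
  hsum (fun j => f j * w j) s -> hsum f s1 -> hsum (fun a => rep3 a * phi a) (s - v * s1).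
Proof.
move=> hphi hv hs hs1.
apply: (@hsum_reindex R nat J (fun j => ((k + j)%N, b0))) => [i j [] /addnI //|[j b]|].
  rewrite /rep3 /=; case: leqP => [kj _|]; last by rewrite mul0r eqxx.
  by exists (j - k)%N; rewrite subnKC // (ffun0 b).
apply: hsum_ext (hsumB hs (hsumZ v hs1)) => j /=.
rewrite /rep3 /= hphi leq_addr addKn /=.
have [e|n] := eqVneq (k + j)%N (2 * k).+1.
  have -> : j = k.+1 by lia.
  by rewrite hv mulr0; ring.
have n0 : (2 * k).+1%:R - (k + j)%:R != 0 :> C.
  by rewrite -nrm_gt0; apply: lt_le_trans ltr01 (nrm_intdiff _ _); rewrite eq_sym.
by rewrite /=; set D := (_%:R - _%:R) in n0 *; field.
Qed.

(** The right inverse subtracts f(1) x^(k+1) in order to vanish at x = 1, and tau = f(1) restores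
    it. *)
Lemma rep_phi x s s1 l : nrm x <= 1 -> hsum (fun j => f j * x ^+ j) s -> hsum f s1 ->
  nphi k (fun=> s1) rep (x, l) = x + s.
Proof.
move=> hx hs hs1; rewrite /nphi.
have hz : @mdom R X (x, l) by split=> //; exact: dom0.
rewrite (comb_rep (ler0n _ 2) (@hxi_mass R (par R 0) k) hz (s1 := 0) (s2 := 0) (s3 := s - x ^+ k.+1 * s1)) /=.
- ring.
- apply: hsum_ext (hsum0 _) => a; rewrite /hxi; case: (leqP k a.1) => h /=; last by rewrite mulr0.
  by rewrite rep1_ge ?mul0r.
- apply: hsum_ext (hsum0 _) => a; rewrite /hxi /rep2; case: eqP => /= _; last by rewrite mul0r.
  by rewrite andbF mulr0.
- apply: (rep3_hsum (w := fun j => x ^+ j)) => // j.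
  by rewrite /hxi /= pmon0 mulr1.
Qed.

Lemma rep_dphi x s s1 l : nrm x <= 1 -> hsum (fun j => f j * (j%:R * x ^+ j.-1)) s -> hsum f s1 ->
  ndphi k (fun=> s1) rep (x, l) = 1 + s.
Proof.
move=> hx hs hs1; rewrite /ndphi.
have hz : @mdom R X (x, l) by split=> //; exact: dom0.
rewrite (comb_rep (ler0n _ _) (@hdxi_mass R (par R 0) k) hz (s1 := 0) (s2 := 0)
  (s3 := s - (k.+1%:R * x ^+ k) * s1)) /=.
- ring.
- apply: hsum_ext (hsum0 _) => a; rewrite /hdxi; case: (leqP k a.1) => h /=; last by rewrite mulr0.
  by rewrite rep1_ge ?mul0r.
- apply: hsum_ext (hsum0 _) => a; rewrite /hdxi /rep2; case: eqP => /= _; last by rewrite mul0r.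
  by rewrite andbF mulr0.
- apply: (rep3_hsum (w := fun j => j%:R * x ^+ j.-1)) => // j.
  by rewrite /hdxi /= pmon0 mulr1.
Qed.

End Representation.

(** * Rigidity *)

Section Rigidity.
Variable R : realType.
Local Notation C := (Cplx R).
Variable k : nat.

(** At a fixed parameter, the conjugacy to the other normal form and the self-conjugacy solve the
    same equation, with the same [e] and the same tau = F 1. [conj_unique] identifies their
    encodings, which contain the normal forms as well as the maps. *)
Lemma rigid_pointwise : exists2 eta0 : R, 0 < eta0 <= 2^-1 &
  forall (eta : R) (y y' : 'I_k -> C) (mu mu' : C)
    (I I' : eqType) (q : I -> nat) (g : I -> C) (q' : I' -> nat) (g' : I' -> C)
    (F dF F' dF' : C -> C), 0 < eta -> eta <= eta0 ->
  (forall i, nrm (y i) <= eta) -> (forall i, nrm (y' i) <= eta) ->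
  nrm mu <= eta -> nrm mu' <= eta ->
  absb (fun i => (q i).+1%:R * g i) eta -> absb (fun i => (q' i).+1%:R * g' i) eta ->
  (forall x, nrm x <= 1 -> hsum (fun i => g i * x ^+ q i) (F x)) ->
  (forall x, nrm x <= 1 -> hsum (fun i => g i * ((q i)%:R * x ^+ (q i).-1)) (dF x)) ->
  (forall x, nrm x <= 1 -> hsum (fun i => g' i * x ^+ q' i) (F' x)) ->
  (forall x, nrm x <= 1 -> hsum (fun i => g' i * ((q' i)%:R * x ^+ (q' i).-1)) (dF' x)) ->
  F 1 = F' 1 ->
  (forall x, nrm x <= 1 -> npoly y' (x + F x) * (1 + mu * x ^+ k) =
     (1 + mu' * (x + F x) ^+ k) * npoly y x * (1 + dF x)) ->
  (forall x, nrm x <= 1 -> npoly y (x + F' x) * (1 + mu * x ^+ k) =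
     (1 + mu * (x + F' x) ^+ k) * npoly y x * (1 + dF' x)) ->
  [/\ forall i, y' i = y i, mu' = mu & forall x, nrm x <= 1 -> F x = F' x].
Proof.
have [eta0 /andP[e00 e01] huniq] := @conj_unique R (par R 0) k (@separated0 R).
(* The encoding of data of size eta has l^1 norm at most k eta + eta + (k + 1) eta, and [e] below
   obeys the same bound. *)
pose K : R := (2 * k + 2)%:R.
have K2 : 2 <= K by rewrite /K ler_nat; lia.
exists (eta0 / K).
  apply/andP; split; first by rewrite divr_gt0 //; lra.
  rewrite ler_pdivrMr; [nra|lra].
move=> eta y y' mu mu' I I' q g q' g' F dF F' dF' e0 ee hy hy' hmu hmu' hg hg' hF hdF hF' hdF' F1 hc hc'.
have K0 : 0 < K by lra.
have eK : eta * K <= eta0 by rewrite -ler_pdivlMr.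
have e2 : eta <= 2^-1 by nra.
have [f [fa fF fdF]] := collect_powers hg; have [f' [fa' fF' fdF']] := collect_powers hg'.
have n1 : nrm (1 : C) <= 1 by rewrite nrm1.
have f1 : hsum f (F 1) by apply: hsum_ext (fF _ _ (hF 1 n1)) => j; rewrite expr1n mulr1.
have f1' : hsum f' (F 1) by rewrite F1; apply: hsum_ext (fF' _ _ (hF' 1 n1)) => j; rewrite expr1n mulr1.
pose u := rep y' mu' f; pose u' := rep y mu f'.
pose X := ext (par R 0).
have bnd (v : 'I_k -> C) (nu : C) (h : nat -> C) : (forall i, nrm (v i) <= eta) -> nrm nu <= eta ->
    absb (fun j => j.+1%:R * h j) eta -> absb (rep v nu h) (eta * K).
  move=> hv hnu hh; apply: absb_le (rep_absb v nu hh).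
  have : \sum_(i < k) nrm (v i) <= k%:R * eta.
    apply: le_trans (_ : \sum_(i < k) eta <= _); first by apply: ler_sum => i _.
    by rewrite sumr_const card_ord -[eta *+ k]mulr_natl.
  rewrite /K natrD natrM -natr1; lra.
have den x : nrm x <= 1 -> 1 + mu * x ^+ k != 0.
  move=> hx; rewrite -nrm_gt0; have := nrm_geB 1 (mu * x ^+ k); rewrite nrm1 => h.
  have h2 : nrm (mu * x ^+ k) <= eta * 1 ^+ k by apply: nrm_leM => //; exact: nrm_leX.
  rewrite expr1n mulr1 in h2; lra.
(* This equals (sum_i y_i x^i - mu x^(2k+1)) / (1 + mu x^k), which is small with y and mu. *)
pose e (z : mt X) := npoly y z.1 / (1 + mu * z.1 ^+ k) - z.1 ^+ k.+1.
have me : @mass R X e (eta * K).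
  have m1 : @mass R X (fun z => - (mu * z.1 ^+ k)) eta.
    apply: massN; apply: mass_le (massZ mu (@mass_xn R (par R 0) k)); by rewrite mulr1.
  have m2 := mass_bigsum (index_enum 'I_k) (fun i : 'I_k => massZ (y i) (@mass_xn R (par R 0) i)).
  have e1 : eta < 1 by lra.
  have m3 := massM (massB m2 (massZ mu (@mass_xn R (par R 0) (2 * k).+1))) (mass_inv e1 m1).
  apply: mass_ext (mass_le _ m3) => [z [hz _]|].
    rewrite /e /npoly opprK; have d0 := den _ hz.
    have -> : z.1 ^+ (2 * k).+1 = z.1 ^+ k * z.1 ^+ k.+1 by rewrite -exprD addnS addnn mul2n.
    by field.
  rewrite !mulr1; apply: le_trans (_ : (k%:R * eta + eta) * 2 <= _).
    apply: ler_pM; rewrite ?addr_ge0 ?sumr_ge0 ?nrm_ge0 ?invr_ge0 //.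
    - by move=> i _; rewrite mulr1 nrm_ge0.
    - lra.
    - apply: lerD => //; under eq_bigr do rewrite mulr1.
      apply: le_trans (_ : \sum_(i < k) eta <= _); first by apply: ler_sum => i _.
      by rewrite sumr_const card_ord -[eta *+ k]mulr_natl.
    - rewrite -[leRHS]invrK lef_pV2 ?posrE; lra.
  rewrite /K natrD natrM; lra.
have mt1 : @mass R (par R 0) (fun=> F 1) (eta * K).
  apply: mass_le (mass_const _ (F 1)).
  have : nrm (F 1) <= eta.
    apply: hsum_le f1; apply: absb_mono fa => j; rewrite nrmM nrm_nat.
    have := nrm_ge0 (f j); have : (1 : R) <= j.+1%:R by [rewrite ler1n]; nra.
  by move=> h; nra.
have eK0 : 0 < eta * K by rewrite mulr_gt0.
have conjG (v : 'I_k -> C) (nu : C) (h : nat -> C) (G dG : C -> C) :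
    hsum h (F 1) ->
    (forall x, nrm x <= 1 -> hsum (fun i => h i * x ^+ i) (G x)) ->
    (forall x, nrm x <= 1 -> hsum (fun i => h i * (i%:R * x ^+ i.-1)) (dG x)) ->
    (forall x, nrm x <= 1 -> npoly v (x + G x) * (1 + mu * x ^+ k) =
       (1 + nu * (x + G x) ^+ k) * npoly y x * (1 + dG x)) ->
    forall z : mt X, mdom z -> nG k (fun z => z.1 ^+ k.+1 + e z) (fun=> F 1) (rep v nu h) z = 0.
  move=> h1 hG hdG hcG [x l] [/= hx hl]; rewrite /nG /conj_eq.
  rewrite (rep_phi _ _ _ hx (hG x hx) h1) (rep_dphi _ _ _ hx (hdG x hx) h1) rep_mu /=.
  under eq_bigr do rewrite rep_y.
  rewrite /e /= addrCA subrr addr0; have d0 := den x hx.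
  have h2 : npoly v (x + G x) = (1 + nu * (x + G x) ^+ k) * (npoly y x / (1 + mu * x ^+ k)) * (1 + dG x).
    by apply: (mulIf d0); rewrite hcG //; field.
  by rewrite -h2 /npoly subrr.
have uu : u' = u.
  apply: (huniq (eta * K) e (fun=> F 1)) => //; try exact: bnd.
  - apply: (conjG y' mu' f F dF) => // x hx; [exact: fF (hF x hx)|exact: fdF (hdF x hx)].
  - apply: (conjG y mu f' F' dF') => // x hx; [exact: fF' (hF' x hx)|exact: fdF' (hdF' x hx)].
split.
- by move=> i; rewrite -(rep_y y' mu' f i 0) -(rep_y y mu f' i 0) -/u -/u' uu.
- by rewrite -(rep_mu y' mu' f 0) -(rep_mu y mu f' 0) -/u -/u' uu.
- move=> x hx; apply: (addrI x).
  rewrite -(rep_phi y' mu' 0 hx (fF _ _ (hF x hx)) f1) -(rep_phi y mu 0 hx (fF' _ _ (hF' x hx)) f1').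
  by rewrite -/u -/u' uu.
Qed.

End Rigidity.

(** * Comparison of a conjugacy with the constructed flow *)

Section FlowProperties.
Variable R : realType.
Local Notation C := (Cplx R).
Variables (Q : msys R) (k : nat) (tau : mt Q -> C).
Local Notation S := (ext (ext Q)).
Variables (u : mi S -> C) (M : R).
Hypothesis hu : absb u M.

Lemma comb_wB_derive s (w : mt (ext Q)) : nrm s < 1 -> mdom w ->
  is_derive s (1 : C) (fun s => comb (Q := S) (@wB R Q) u (s, w)) (ev (Q := S) u (s, w)).
Proof.
move=> s1 hw.
have h1 : (nrm s + 1) / 2 < 1 by lra.
have h0 : 0 <= (nrm s + 1) / 2 by have := nrm_ge0 s; lra.
set rho := (nrm s + 1) / 2 in h1 h0.
have K0 : 0 <= (1 - rho)^-1 ^+ 2 by rewrite exprn_ge0 // invr_ge0; lra.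
have hq a : qd rho ((1 - rho)^-1 ^+ 2) (fun s => wB (Q := Q) a (s, w)) (fun s => @mv R S a (s, w)).
  move=> x h hx hxh; have := qd_expr a.1.+1 h0 h1 hx hxh.
  have n0 : a.1.+1%:R != 0 :> C by rewrite pnatr_eq0.
  have -> : wB (Q := Q) a (x + h, w) - wB (Q := Q) a (x, w) - h * @mv R S a (x, w) =
      ((x + h) ^+ a.1.+1 - x ^+ a.1.+1 - h * (a.1.+1%:R * x ^+ a.1.+1.-1)) *
      (a.1.+1%:R^-1 * @mv R (ext Q) a.2 w).
    rewrite /wB /= /emon /= /emon; move: (a.1.+1%:R : C) n0 => n n0; by field.
  move=> hb; rewrite nrmM -[leRHS]mulr1; apply: ler_pM; rewrite ?nrm_ge0 //.
  rewrite nrmM mulr_ile1 ?nrm_ge0 //; last exact: mv_le1.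
  by rewrite nrmV nrm_nat invf_le1 ?ltr0n // ler1n.
have hd (x : C) : nrm x <= rho -> @mdom R S (x, w) by move=> hx; split=> //=; lra.
have hF x : nrm x <= rho -> hsum (fun a => u a * wB (Q := Q) a (x, w)) (comb (Q := S) (@wB R Q) u (x, w)).
  by move=> hx; exact: (comb_hsum ler01 (@wB_mass R Q) hu (hd x hx)).
have hF' x : nrm x <= rho -> hsum (fun a => u a * @mv R S a (x, w)) (ev (Q := S) u (x, w)).
  by move=> hx; exact: ev_hsum hu (hd x hx).
have hqd := qd_sum K0 hq hu hF hF'.
have hs : nrm s < rho by rewrite /rho; lra.
exact: (qd_is_derive hqd hs).
Qed.

Lemma fE_derive s x l : nrm s < 1 -> nrm x <= 1 -> mdom l ->
  is_derive s (1 : C) (fun s => fE k tau u (s, (x, l))) (fEs k tau u (s, (x, l))).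
Proof.
move=> s1 hx hl; have hw : @mdom R (ext Q) (x, l) by split.
have h1 := dM (dM (did s) (dcst (ft tau u l) s)) (dcst ((2 * x) ^+ k.+1) s).
have h := dD (dD (dcst (2 * x) s) h1) (comb_wB_derive s1 hw).
by apply: is_derive_eq h _; rewrite /fEs /=; ring.
Qed.

Lemma fE_init x l : fE k tau u (0, (x, l)) = 2 * x.
Proof.
rewrite /fE /= mul0r mul0r addr0 /comb (_ : hs _ = 0) ?addr0 //.
by apply: hsE; apply: hsum_ext (hsum0 _) => a; rewrite /wB /= exprS !mul0r mulr0.
Qed.

Lemma fE_end l : fE k tau u (2^-1, (2^-1, l)) = 1 + tau l.
Proof. by rewrite /fE /ft /= divff ?pnatr_eq0 // expr1n; field. Qed.

End FlowProperties.

Section Rigid.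
Variable R : realType.
Local Notation C := (Cplx R).
Variables (k m : nat).
Local Notation Q := (par R m).
Local Notation L := ('rV[C]_m).

Definition dev (psi : nat * {ffun 'I_m -> nat} -> C) (z : C * L) : C :=
  hs (fun a => psi a * (a.1%:R * z.1 ^+ a.1.-1 * pmon a.2 z.2)).

(** Halving the radius pays for one differentiation. *)
Lemma half_pow_weight n : n.+1%:R * 2^-1 ^+ n <= 1 :> R.
Proof.
rewrite exprVn ler_pdivrMr ?exprn_gt0 // mul1r -natrX ler_nat; exact: ltn_expl.
Qed.

Lemma ndpoly_bound (y : 'I_k -> C) w : (forall i, nrm (y i) <= 1) -> nrm w <= 3 ->
  nrm (ndpoly y w) <= k.+1%:R * 3 ^+ k + \sum_(i < k) i%:R * 3 ^+ i.-1.
Proof.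
move=> hy hw; rewrite /ndpoly; apply: nrm_leD.
  by rewrite nrmM nrm_nat ler_wpM2l // nrm_leX.
apply: le_trans (nrm_sum _ _ _) _; apply: ler_sum => i _.
rewrite -[leRHS]mul1r; apply: nrm_leM => //.
by rewrite nrmM nrm_nat ler_wpM2l // nrm_leX.
Qed.

(** The flow whose value at x = 1 is 1 + tau, taken at s = 1/2, is a self-conjugacy of the first
    normal form by [flow_symmetry], and [rigid_pointwise] identifies it with x + psi. The path [gam]
    and its speed [gams] are kept, to be turned into a flow in the original coordinates. *)
Lemma rigid : exists2 eta0 : R, 0 < eta0 & forall (eta : R) (y y' : 'I_k -> L -> C)
    (mu mu' : L -> C) (psi : nat * {ffun 'I_m -> nat} -> C),
  0 < eta -> eta <= eta0 ->
  (forall i, @mass R Q (y i) eta) -> (forall i, @mass R Q (y' i) eta) ->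
  @mass R Q mu eta -> @mass R Q mu' eta ->
  absb (fun a => a.1.+1%:R * psi a) eta ->
  (forall x l, nrm x <= 1 -> @mdom R Q l ->
     npoly (y' ^~ l) (x + ev (Q := ext Q) psi (x, l)) * (1 + mu l * x ^+ k) =
     (1 + mu' l * (x + ev (Q := ext Q) psi (x, l)) ^+ k) * npoly (y ^~ l) x * (1 + dev psi (x, l))) ->
  exists t : L -> C, (exists M, @mass R Q t M) /\ forall l, @mdom R Q l ->
    [/\ forall i, y' i l = y i l, mu' l = mu l &
    forall x, nrm x <= 1 -> exists gam gams : C -> C,
      [/\ exists M, umass gam M, gam 0 = x, gam 2^-1 = x + ev (Q := ext Q) psi (x, l) &
      forall s, nrm s < 1 -> [/\ is_derive s (1 : C) gam (gams s),
        1 + mu l * gam s ^+ k != 0 &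
        (1 + mu l * gam s ^+ k) * gams s = t l * npoly (y ^~ l) (gam s)]]].
Proof.
have [D [D0 [etaf /andP[ef0 ef1] hflow]]] := @flow_exists R Q k.
have [etar /andP[er0 er1] hrig] := @rigid_pointwise R k.
pose B : R := k.+1%:R * 3 ^+ k + \sum_(i < k) i%:R * 3 ^+ i.-1.
have B0 : 0 <= B.
  by rewrite addr_ge0 ?mulr_ge0 ?exprn_ge0 ?sumr_ge0 // => i _; rewrite mulr_ge0 ?exprn_ge0.
have T0 : (0 : R) <= 3 ^+ k by rewrite exprn_ge0.
(* eta N <= 1/2 ensures |E| <= 3 and the two bounds 1/2 required by [flow_symmetry]; the summand D +
   1 keeps all data, the coefficients of the flow included, in the range of [rigid_pointwise]. *)
pose N : R := D + 1 + 2 * 3 ^+ k + 8 * B.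
have N0 : 1 <= N by rewrite /N; lra.
exists (Num.min etaf (etar / N)); first by rewrite lt_min ef0 divr_gt0 //; lra.
move=> eta y y' mu mu' psi e0; rewrite le_min => /andP[ee1 ee2] hy hy' hmu hmu' hpsi hconj.
have eN : eta * N <= etar by rewrite -ler_pdivlMr //; lra.
have eN2 : eta * N <= 2^-1 by lra.
have eD : D * eta <= 1 by rewrite /N in eN2; nra.
have e3 : eta * 3 ^+ k <= 2^-1 by rewrite /N in eN2; nra.
have eB : 4 * eta * B <= 2^-1 by rewrite /N in eN2; nra.
have eD1 : eta * (D + 1) <= etar by rewrite /N in eN; nra.
have e1 : eta <= 1 by lra.
have hpsi1 : absb psi eta.
  apply: absb_mono hpsi => a; rewrite nrmM nrm_nat; have := nrm_ge0 (psi a).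
  have : (1 : R) <= a.1.+1%:R by rewrite ler1n. nra.
pose F (z : C * L) := ev (Q := ext Q) psi z.
have mF : @mass R (ext Q) F eta by exact: mass_ev.
pose tau : mt Q -> C := fun l => F (1, l).
have n1 : nrm (1 : C) <= 1 by rewrite nrm1.
have mtau : @mass R Q tau eta by exact: (@mass_at R Q F eta 1 n1 mF).
have [u [hu hH mt_ mE]] := hflow eta y mu tau e0 ee1 hy hmu mtau.
exists (ft tau u); split; first by exists (4 * eta).
move=> l hl; have [d [hd hdE]] := mE.
pose J := mi (ext (ext Q)).
pose p (a : J) := a.1; pose q (a : J) := a.2.1.
pose w (a : J) : C := d a * pmon a.2.2 l.
have hwa : absb w (D * eta).
  by apply: absb_mono hd => a; rewrite nrmM ler_piMr ?nrm_ge0 //; exact: (@mv_le1 R Q).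
(* [a0] is the index of the monomial x: [w] carries the deviation E - 2x, and [c] puts the initial
   term 2x back. *)
pose a0 : J := (0%N, (1%N, [ffun=> 0%N])).
pose c (a : J) : C := w a + (if a == a0 then 2 else 0).
have h2a : absb (fun a : J => if a == a0 then 2 else 0 : C) 2.
  have := @absb_single R J (fun a : J => if a == a0 then 2 else 0 : C) a0.
  by rewrite eqxx nrm_nat; apply=> a /negbTE ->.
have hc : absb c (D * eta + 2) by exact: absbD.
have hdom s x : nrm s <= 1 -> nrm x <= 1 -> @mdom R (ext (ext Q)) (s, (x, l)) by [].
have hw s x : nrm s <= 1 -> nrm x <= 1 ->
    hsum (fun a => w a * x ^+ q a * s ^+ p a) (fE k tau u (s, (x, l)) - 2 * x).
  move=> hs hx; apply: hsum_ext (hdE _ (hdom s x hs hx)) => -[i [j b]] /=.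
  by rewrite /emon /= /emon /= /w /p /q /=; ring.
have single (v : J -> C) : hsum (fun a => (if a == a0 then 2 else 0) * v a) (2 * v a0).
  have := @hsum_single R J (fun a => (if a == a0 then 2 else 0) * v a) a0.
  by rewrite eqxx; apply=> a /negbTE ->; rewrite mul0r.
have hE s x : nrm s <= 1 -> nrm x <= 1 ->
    ser p (fun i => c i * x ^+ q i) s = fE k tau u (s, (x, l)).
  move=> hs hx; apply: hsE.
  have := hsumD (hw s x hs hx) (single (fun a => x ^+ q a * s ^+ p a)).
  rewrite /p /q /= expr0 expr1 mulr1 subrK; apply: hsum_ext => a.
  by rewrite /c !mulrDl !mulrA.
have hy1 i : nrm (y i l) <= eta := mass_sup (hy i) hl.
have hEb s x : nrm s <= 1 -> nrm x <= 1 -> nrm (fE k tau u (s, (x, l))) <= 3.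
  move=> hs hx; rewrite -(subrK (2 * x) (fE _ _ _ _)).
  have h1 := mass_sup mE (hdom s x hs hx); rewrite /= in h1.
  have h2 : nrm (2 * x) <= 2 by rewrite nrmM nrm_nat; lra.
  apply: le_trans (nrm_leD h1 h2) _; lra.
have hden s x : nrm s <= 1 -> nrm x <= 1 -> 2^-1 <= nrm (1 + mu l * fE k tau u (s, (x, l)) ^+ k).
  move=> hs hx; have := nrm_geB 1 (mu l * fE k tau u (s, (x, l)) ^+ k); rewrite nrm1.
  have := nrm_leM (mass_sup hmu hl) (nrm_leX k (hEb s x hs hx)); lra.
have hode s x : nrm s <= 1 -> nrm x <= 1 ->
    (1 + mu l * fE k tau u (s, (x, l)) ^+ k) * fEs k tau u (s, (x, l)) =
    ft tau u l * npoly (y ^~ l) (fE k tau u (s, (x, l))).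
  by move=> hs hx; have := hH _ (hdom s x hs hx); rewrite /fH /= => /subr0_eq.
have hsmall s x : nrm s <= 1 -> nrm x <= 1 ->
    nrm (ft tau u l * ndpoly (y ^~ l) (fE k tau u (s, (x, l)))) <= 2^-1.
  move=> hs hx; apply: le_trans (nrm_leM (mass_sup mt_ hl) (ndpoly_bound _ (hEb s x hs hx))) eB.
  by move=> i; apply: le_trans (hy1 i) e1.
have symm x : nrm x < 1 ->
    npoly (y ^~ l) (2 * x) * (1 + mu l * fE k tau u (2^-1, (x, l)) ^+ k) *
      ser p (fun i => c i * ((q i)%:R * x ^+ (q i).-1)) 2^-1 =
    2 * (1 + mu l * (2 * x) ^+ k) * npoly (y ^~ l) (fE k tau u (2^-1, (x, l))).
  move=> x1; have x1' := ltW x1; have hh := half_le1 R; rewrite -(hE _ _ hh x1').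
  apply: (@flow_symmetry R k (y ^~ l) (mu l) (ft tau u l) J p q c _ hc
    (fun s x => fEs k tau u (s, (x, l)))) => // [s z s1 hz|s z hs hz|z hz|s z hs hz|s z hs hz].
  - have r0 : 0 < 1 - nrm s by rewrite subr_gt0.
    have hn v : nrm (v - s) < 1 - nrm s ->
        fE k tau u (v, (z, l)) = ser p (fun i => c i * z ^+ q i) v.
      move=> hv; rewrite hE // -(subrK s v) ltW //; apply: le_lt_trans (nrmD _ _) _; lra.
    exact: (is_derive_near r0 hn (fE_derive k tau hu s1 hz hl)).
  - by rewrite hE //; exact: hode.
  - by rewrite hE ?nrm0 //; exact: fE_init.
  - by rewrite hE //; exact: hden.
  - by rewrite hE //; exact: hsmall.
have hh := half_le1 R.
have hx2 (x : C) : nrm x <= 1 -> nrm (2^-1 * x) < 1.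
  by move=> hx; rewrite nrmM nrmV nrm_nat; have := nrm_ge0 x; lra.
(* Evaluated at x / 2, the flow issues from the initial point x, and x / 2 stays in the open disc
   where E can be differentiated in its initial point. *)
pose F' x := fE k tau u (2^-1, (2^-1 * x, l)) - x.
pose dF' x := 2^-1 * ser p (fun i => c i * ((q i)%:R * (2^-1 * x) ^+ (q i).-1)) 2^-1 - 1.
pose g a := w a * 2^-1 ^+ p a * 2^-1 ^+ q a.
have two0 : (2 : C) != 0 by rewrite pnatr_eq0.
have hgF x : nrm x <= 1 -> hsum (fun a => g a * x ^+ q a) (F' x).
  move=> hx; have := hw _ _ hh (ltW (hx2 x hx)).
  rewrite mulrA divff // mul1r; apply: hsum_ext => a.
  by rewrite /g exprMn; ring.
have hgdF x : nrm x <= 1 -> hsum (fun a => g a * ((q a)%:R * x ^+ (q a).-1)) (dF' x).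
  move=> hx; have hxl := hx2 x hx.
  have h1 := dser_coef q hc (nrm_ge0 _) hxl (lexx (nrm (2^-1 * x))).
  have h2 := ser_hsum p h1 hh.
  have := hsumB (hsumZ 2^-1 h2) (hsumZ 2^-1 (single (fun a => (q a)%:R * (2^-1 * x) ^+ (q a).-1 * 2^-1 ^+ p a))).
  rewrite /q /= mulr1n expr0 mul1r mulr1 mulr1 mulVf // -/q; apply: hsum_ext => a.
  rewrite /c /g -/(q a); case: (q a) => [|n]; first by rewrite !(mul0r, mulr0, subr0).
  by rewrite /= exprMn exprS; set b := (if _ then _ else _); ring.
have eD0 : 0 < eta * (D + 1) by rewrite mulr_gt0 //; lra.
have ele : eta <= eta * (D + 1) by nra.
have k1 i : nrm (y i l) <= eta * (D + 1) := le_trans (hy1 i) ele.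
have k2 i : nrm (y' i l) <= eta * (D + 1) := le_trans (mass_sup (hy' i) hl) ele.
have k3 : nrm (mu l) <= eta * (D + 1) := le_trans (mass_sup hmu hl) ele.
have k4 : nrm (mu' l) <= eta * (D + 1) := le_trans (mass_sup hmu' hl) ele.
have k5 : absb (fun a => a.1.+1%:R * (psi a * pmon a.2 l)) (eta * (D + 1)).
  apply: absb_le ele _; apply: absb_mono hpsi => a; rewrite mulrA nrmM.
  by rewrite ler_piMr ?nrm_ge0 //; exact: (@mv_le1 R Q).
have k6 : absb (fun a => (q a).+1%:R * g a) (eta * (D + 1)).
  apply: (absb_le (M := D * eta)); first by nra.
  apply: absb_mono hwa => a.
  have -> : nrm ((q a).+1%:R * g a) = (q a).+1%:R * (nrm (w a) * 2^-1 ^+ p a * 2^-1 ^+ q a).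
    by rewrite nrmM nrm_nat /g nrmM nrmM !nrmX nrmV nrm_nat.
  have -> : (q a).+1%:R * (nrm (w a) * 2^-1 ^+ p a * 2^-1 ^+ q a) =
    nrm (w a) * (2^-1 ^+ p a * ((q a).+1%:R * 2^-1 ^+ q a)) :> R by ring.
  rewrite ler_piMr ?nrm_ge0 // mulr_ile1 ?half_pow_weight ?mulr_ge0 ?exprn_ge0 ?invr_ge0 //.
  by rewrite exprn_ile1 ?invr_ge0 // invf_le1 // ler1n.
have k7 x : nrm x <= 1 -> hsum (fun a : nat * {ffun 'I_m -> nat} => psi a * pmon a.2 l * x ^+ a.1) (F (x, l)).
  move=> hx; apply: hsum_ext (@ev_hsum R (ext Q) psi eta (x, l) hpsi1 (conj hx hl)) => a.
  by rewrite /= /emon /=; ring.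
have k8 x : nrm x <= 1 -> hsum (fun a : nat * {ffun 'I_m -> nat} =>
    psi a * pmon a.2 l * (a.1%:R * x ^+ a.1.-1)) (dev psi (x, l)).
  move=> hx; apply: hsum_ext (@hsP R _ (fun a => psi a * (a.1%:R * x ^+ a.1.-1 * pmon a.2 l)) eta _) => [a|].
    by rewrite /=; ring.
  apply: absb_mono hpsi => a; rewrite !nrmM !nrm_nat mulrC ler_wpM2r ?nrm_ge0 //.
  have h1 : nrm (pmon a.2 l) <= 1 by exact: (@mv_le1 R Q).
  have h2 : nrm (x ^+ a.1.-1) <= 1 by rewrite nrmX exprn_ile1 ?nrm_ge0.
  apply: le_trans (_ : a.1%:R * 1 * 1 <= _); last by rewrite !mulr1 ler_nat.
  by apply: ler_pM => //; rewrite ?mulr_ge0 ?nrm_ge0 // ler_wpM2l.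
have k9 : F (1, l) = F' 1 by rewrite /F' mulr1 fE_end /tau; ring.
have k10 x : nrm x <= 1 -> npoly (y' ^~ l) (x + F (x, l)) * (1 + mu l * x ^+ k) =
    (1 + mu' l * (x + F (x, l)) ^+ k) * npoly (y ^~ l) x * (1 + dev psi (x, l)).
  by move=> hx; exact: hconj.
have k11 x : nrm x <= 1 -> npoly (y ^~ l) (x + F' x) * (1 + mu l * x ^+ k) =
    (1 + mu l * (x + F' x) ^+ k) * npoly (y ^~ l) x * (1 + dF' x).
  move=> hx; have := symm _ (hx2 x hx); rewrite mulrA divff // mul1r => hs.
  have -> : x + F' x = fE k tau u (2^-1, (2^-1 * x, l)) by rewrite /F'; ring.
  have -> : 1 + dF' x = 2^-1 * ser p (fun i => c i * ((q i)%:R * (2^-1 * x) ^+ (q i).-1)) 2^-1.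
    by rewrite /dF'; ring.
  apply: (mulfI two0); transitivity (2 * (1 + mu l * x ^+ k) * npoly (y ^~ l) (fE k tau u (2^-1, (2^-1 * x, l)))).
    by ring.
  by rewrite -hs; field.
have [E1 E2 E3] := hrig (eta * (D + 1)) (y ^~ l) (y' ^~ l) (mu l) (mu' l)
    _ _ fst (fun a => psi a * pmon a.2 l) q g (fun x => F (x, l)) (fun x => dev psi (x, l)) F' dF'
    eD0 eD1 k1 k2 k3 k4 k5 k6 k7 k8 hgF hgdF k9 k10 k11.
split=> // x hx; exists (fun s => fE k tau u (s, (2^-1 * x, l))), (fun s => fEs k tau u (s, (2^-1 * x, l))).
have hxl := ltW (hx2 x hx).
split.
- exists (D * eta + 2); have := ser_umass p (ser_absb q hc hxl).
  by apply: mass_ext => -[s v] [/= hs _]; exact: hE.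
- by rewrite fE_init mulrA divff // mul1r.
- by rewrite -[ev _ _]/(F (x, l)) E3 // /F' addrC subrK.
- move=> s s1; split.
  + exact: (fE_derive k tau hu s1 hxl hl).
  + by rewrite -nrm_gt0; apply: lt_le_trans (hden _ _ (ltW s1) hxl); rewrite invr_gt0.
  + exact: hode (ltW s1) hxl.
Qed.

End Rigid.

(** * Exponential and roots of unity *)

Section ComplexExp.
Variable R : realType.
Local Notation C := (Cplx R).

Lemma cexpD (z w : C) : cexp (z + w) = cexp z * cexp w.
Proof.
case: z w => [a b] [c d]; apply/eqP; rewrite eq_complex /=.
by rewrite expRD cosD sinD; apply/andP; split; apply/eqP; ring.
Qed.

Lemma cexp0 : cexp (0 : C) = 1.
Proof. by rewrite /cexp /= expR0 cos0 sin0 mulr1 mulr0. Qed.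

Lemma cexp_neq0 (z : C) : cexp z != 0.
Proof.
apply/eqP => h; have := cexpD z (- z); rewrite subrr cexp0 h mul0r => /eqP.
by rewrite oner_eq0.
Qed.

Lemma cexpN (z : C) : cexp (- z) = (cexp z)^-1.
Proof.
by apply: (mulfI (cexp_neq0 z)); rewrite -cexpD subrr cexp0 divff // cexp_neq0.
Qed.

Lemma cexpMn (z : C) n : cexp (z * n%:R) = cexp z ^+ n.
Proof.
elim: n => [|n ih]; first by rewrite mulr0 cexp0.
by rewrite -natr1 mulrDr mulr1 cexpD ih exprSr.
Qed.

Lemma cexp_two_pi_i : cexp (two_pi_i R) = 1.
Proof. by rewrite /cexp /= expR0 cos2pi mul1r -[pi *+ 2]add0r sinD2pi sin0 mulr0. Qed.

(** Polar coordinates: the argument is acos (Re z / |z|), with the sign of the imaginary part. *)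
Lemma cexp_surj (z : C) : z != 0 -> exists t, cexp t = z.
Proof.
move=> z0; have r0 : 0 < nrm z by rewrite nrm_gt0.
set r := nrm z in r0; case: z z0 @r r0 => [a b] z0 r r0.
have hr : r ^+ 2 = a ^+ 2 + b ^+ 2.
  by rewrite /r nrm_def /= sqr_sqrtr // addr_ge0 ?sqr_ge0.
have hx : -1 <= a / r <= 1.
  rewrite -ler_norml normrM normfV (ger0_norm (ltW r0)) ler_pdivrMr // mul1r.
  exact: (nrm_Re (Complex a b)).
have hs : Num.sqrt (1 - (a / r) ^+ 2) = `|b| / r.
  have -> : 1 - (a / r) ^+ 2 = (b / r) ^+ 2.
    rewrite !exprMn exprVn hr; field; rewrite -hr; exact: lt0r_neq0 (exprn_gt0 2 r0).
  by rewrite sqrtr_sqr normrM normfV (ger0_norm (ltW r0)).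
have rn : r != 0 by rewrite gt_eqF.
have lr : expR (ln r) = r by rewrite lnK.
have [b0|b0] := lerP 0 b.
  exists (Complex (ln r) (acos (a / r))); rewrite /cexp /= lr acosK ?in_itv //= sin_acos // hs ger0_norm //.
  by congr Complex; field.
exists (Complex (ln r) (- acos (a / r))); rewrite /cexp /= lr cosN sinN acosK ?in_itv //= sin_acos // hs ltr0_norm //.
by congr Complex; field.
Qed.

Lemma norm_sin_le (b : R) : `|sin b| <= `|b| /\ `|sin b - b| <= `|b| * b ^+ 2.
Proof.
have cs (c : R) : cos c - 1 = - 2 * sin (c / 2) ^+ 2.
  have -> : cos c = cos (c / 2 + c / 2) by rewrite -splitr.
  by rewrite cosD; have := cos2Dsin2 (c / 2); lra.
have pos (x : R) : 0 <= x -> exists2 c, 0 <= c <= x & sin x = cos c * x.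
  move=> x0; have := @MVT_segment R sin cos 0 x x0 (fun y _ => is_derive_sin y).
  rewrite sin0 !subr0 => h; have [|c] := h.
    by apply: continuous_subspaceT; exact: continuous_sin.
  by rewrite in_itv /= => hc ->; exists c.
have le1 (x : R) : 0 <= x -> `|sin x| <= x.
  move=> /[dup] x0 /pos[c _ ->]; rewrite normrM (ger0_norm x0) ler_piMl //.
  by rewrite ler_norml cos_geN1 cos_le1.
have le2 (x : R) : 0 <= x -> `|sin x - x| <= x * x ^+ 2.
  move=> /[dup] x0 /pos[c /andP[c0 cx] ->].
  rewrite (_ : _ - x = (cos c - 1) * x); last by ring.
  rewrite cs normrM (ger0_norm x0) mulrC ler_wpM2l // normrM normrN normrX [`|2|]ger0_norm //.
  have h1 : `|sin (c / 2)| <= c / 2 by apply: le1; lra.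
  have := normr_ge0 (sin (c / 2)); nra.
have [b0|b0] := lerP 0 b.
  by rewrite (ger0_norm b0); split; [exact: le1|exact: le2].
have b0' : 0 <= - b by lra.
have := le1 _ b0'; have := le2 _ b0'; rewrite sinN normrN sqrrN (ltr0_norm b0) opprK => h1 h2.
by split=> //; move: h1; rewrite -normrN opprD opprK.
Qed.

(** Together with [cexpD], this estimate at 0 gives the complex derivative of [cexp] at other
    points, with a quadratic remainder and without its power series. *)
Lemma cexp_quadratic (h : C) : nrm h <= 2^-1 -> nrm (cexp h - 1 - h) <= 6 * nrm h ^+ 2.
Proof.
move=> hh; have ha := nrm_Re h; have hb := nrm_Im h; have h2 : nrm h ^+ 2 = complex.Re h ^+ 2 + complex.Im h ^+ 2.
  by rewrite nrm_def sqr_sqrtr // addr_ge0 ?sqr_ge0.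
case: h hh ha hb h2 => [a b] hh /= ha hb h2.
have na : `|a| <= 2^-1 by lra.
have nb : `|b| <= 2^-1 by lra.
have [sb1 sb2] := norm_sin_le b; have [sh1 _] := norm_sin_le (b / 2).
have e1 : 1 + a <= expR a := expR_ge1Dx a.
have e2 : expR a <= 2.
  have := expR_ge1Dx (- a); rewrite expRN => h.
  have ea : 0 < expR a := expR_gt0 a.
  have : (1 - a) * expR a <= 1 by rewrite -ler_pdivlMr // mul1r.
  move: na; rewrite ler_norml => /andP[]; nra.
have e3 : expR a - 1 - a <= 2 * a ^+ 2.
  have := expR_ge1Dx (- a); rewrite expRN => h.
  have ea : 0 < expR a := expR_gt0 a.
  have h4 : (1 - a) * expR a <= 1 by rewrite -ler_pdivlMr // mul1r.
  move: na; rewrite ler_norml => /andP[]; nra.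
have cb : `|cos b - 1| <= b ^+ 2.
  have -> : cos b - 1 = - 2 * sin (b / 2) ^+ 2.
    have -> : cos b = cos (b / 2 + b / 2) by rewrite -splitr.
    by rewrite cosD; have := cos2Dsin2 (b / 2); lra.
  rewrite normrM normrN normrX [`|2|]ger0_norm //.
  have : `|sin (b / 2)| ^+ 2 <= `|b / 2| ^+ 2 by rewrite lerXn2r ?nnegrE ?normr_ge0.
  rewrite !real_normK ?num_real // (_ : (b / 2) ^+ 2 = b ^+ 2 / 4); last by field.
  by have := sqr_ge0 b; lra.
set z := _ - _ : C.
have re : complex.Re z = (expR a - 1 - a) + expR a * (cos b - 1) by rewrite /z /=; ring.
have im : complex.Im z = expR a * (sin b - b) + (expR a - 1) * b by rewrite /z /=; ring.
have nz : nrm z <= `|complex.Re z| + `|complex.Im z|.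
  by rewrite {1}(cRI z); apply: le_trans (nrmD _ _) _; rewrite nrmM nrm_cI mul1r !nrm_cR.
apply: le_trans nz _; rewrite h2 re im.
have ea0 : 0 <= expR a by exact: expR_ge0.
have b20 : 0 <= b ^+ 2 by exact: sqr_ge0.
have r1 : `|expR a - 1 - a + expR a * (cos b - 1)| <= 2 * a ^+ 2 + 2 * b ^+ 2.
  apply: le_trans (ler_normD _ _) _; apply: lerD; first by rewrite ger0_norm //; lra.
  by rewrite normrM (ger0_norm ea0); apply: ler_pM.
have ab : `|a| * `|b| <= 2^-1 * (a ^+ 2 + b ^+ 2).
  rewrite -(real_normK (num_real a)) -(real_normK (num_real b)).
  have := sqr_ge0 (`|a| - `|b|); rewrite sqrrB; lra.
have r2 : `|expR a * (sin b - b) + (expR a - 1) * b| <= 2 * a ^+ 2 + 3 * b ^+ 2.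
  apply: le_trans (ler_normD _ _) _; rewrite !normrM (ger0_norm ea0).
  have t1 : expR a * `|sin b - b| <= b ^+ 2.
    apply: le_trans (ler_pM ea0 (normr_ge0 _) e2 sb2) _; nra.
  have t2 : `|expR a - 1| <= 2 * `|a|.
    rewrite ler_norml; apply/andP; split.
      by have := ler_norm (- a); rewrite normrN; have := normr_ge0 a; lra.
    have : a ^+ 2 <= 2^-1 * `|a| by rewrite -(real_normK (num_real a)); have := normr_ge0 a; nra.
    have := ler_norm a; lra.
  have t3 : `|expR a - 1| * `|b| <= 2 * (`|a| * `|b|) by rewrite mulrA ler_wpM2r.
  lra.
have := sqr_ge0 a; lra.
Qed.

End ComplexExp.

Section Roots.
Variable R : realType.
Local Notation C := (Cplx R).
Variables (k : nat).
Hypothesis k0 : (0 < k)%N.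

Let kn : (k%:R : C) != 0. Proof. by rewrite pnatr_eq0 -lt0n. Qed.

Lemma rot_factorE (l : 'I_k) : rot_factor R l = cexp (two_pi_i R / k%:R) ^+ l.
Proof. by rewrite -cexpMn /rot_factor; congr cexp; ring. Qed.

Lemma rot_factorXk (l : 'I_k) : rot_factor R l ^+ k = 1.
Proof.
rewrite rot_factorE -exprM mulnC exprM -cexpMn.
by rewrite -mulrA mulVf // mulr1 cexp_two_pi_i expr1n.
Qed.

Lemma rot_factor_neq0 (l : 'I_k) : rot_factor R l != 0.
Proof. exact: cexp_neq0. Qed.

(** With the angle written as 2 th, 0 < th < pi, the equation cos (2 th) = 1 would give sin th =
    0. *)
Lemma cexp_root_neq1 (j : nat) : (0 < j < k)%N -> cexp (two_pi_i R / k%:R) ^+ j != 1.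
Proof.
move=> /andP[j0 jk]; rewrite -cexpMn; set th : R := pi * (j%:R / k%:R).
have kp : (0 : R) < k%:R by rewrite ltr0n.
have -> : two_pi_i R / k%:R * j%:R = Complex 0 (th + th).
  have -> : two_pi_i R = cI * cR (pi *+ 2).
    by apply/eqP; rewrite eq_complex /=; apply/andP; split; apply/eqP; ring.
  have -> : Complex 0 (th + th) = cI * cR (th + th).
    by apply/eqP; rewrite eq_complex /=; apply/andP; split; apply/eqP; ring.
  by rewrite -!cRn -mulrA -cRV -cRM -mulrA -cRM; congr (_ * cR _); rewrite /th; field; rewrite gt_eqF.
apply/eqP => /(congr1 (@complex.Re R)); rewrite /= expR0 mul1r cosD => h.
have := cos2Dsin2 th => h2.
have s0 : sin th ^+ 2 = 0 by rewrite !expr2 in h h2 *; lra.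
have : 0 < sin th.
  apply: sin_gt0_pi; rewrite /th mulr_gt0 ?pi_gt0 ?divr_gt0 ?ltr0n //=.
  by rewrite -[ltRHS]mulr1 ltr_pM2l ?pi_gt0 // ltr_pdivrMr // mul1r ltr_nat.
by move=> /lt0r_neq0; rewrite -sqrf_eq0 s0 eqxx.
Qed.

(** The first k powers of exp (2 pi i / k) are distinct roots of X^k - 1, and one more root would
    exceed the degree. *)
Lemma root_of_unity (b : C) : b ^+ k = 1 -> exists l : 'I_k, b = rot_factor R l.
Proof.
move=> bk; pose z := cexp (two_pi_i R / k%:R).
have z0 : z != 0 by exact: cexp_neq0.
pose rs := [seq z ^+ val l | l : 'I_k].
have [/mapP[l _ ->]|nb] := boolP (b \in rs); first by exists l; rewrite rot_factorE.
have zk (l : 'I_k) : (z ^+ val l) ^+ k = 1 by rewrite -(rot_factorXk l) rot_factorE.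
pose P : {poly C} := 'X^k - 1.
have P0 : P != 0 by rewrite -size_poly_gt0 size_XnsubC.
have sz : size P = k.+1 by rewrite size_XnsubC.
have A : all (root P) (b :: rs).
  apply/andP; split; first by rewrite /root !hornerE bk subrr.
  by apply/allP => _ /mapP[l _ ->]; rewrite /root !hornerE zk subrr.
suff U : uniq (b :: rs).
  by have := max_poly_roots P0 A U; rewrite sz /= size_map size_enum_ord ltnn.
rewrite cons_uniq nb map_inj_uniq ?enum_uniq // => l1 l2 e; apply: val_inj.
wlog l12 : l1 l2 e / (l1 <= l2)%N.
  by move=> hw; case/orP: (leq_total l1 l2) => ?; [exact: hw|apply/esym/hw].
apply/eqP; rewrite eqn_leq l12 /= leqNgt; apply/negP => lt12.
have := @cexp_root_neq1 (l2 - l1)%N; rewrite subn_gt0 lt12 (leq_ltn_trans (leq_subr _ _) (ltn_ord l2)) => /(_ isT).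
move/eqP; apply; apply: (mulfI (expf_neq0 (val l1) z0)).
by rewrite -exprD subnKC // mulr1 e.
Qed.

Lemma rot_coefE m (l : 'I_k) (y : 'I_k -> 'rV[C]_m -> C) j lam :
  rot_coef l y j lam = rot_factor R l / rot_factor R l ^+ j * y j lam.
Proof.
rewrite /rot_coef; congr (_ * _); rewrite /rot_factor -cexpMn -cexpN -cexpD; congr cexp; ring.
Qed.

End Roots.

(** * Rescaling of germs and families *)

Section Rescale.
Variable R : realType.
Local Notation C := (Cplx R).

(** Continuity of a convergent series at 0, used after division by a power of x. *)
Lemma umass_limit0 (G : C -> C) M r : umass G M -> 0 < r ->
  (forall x, x != 0 -> nrm x <= r -> G x = 0) -> G 0 = 0.
Proof.
move=> /umass_ser[c [hc hG]] r0 h.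
have hq := ser_qd fst hc (lexx 0) ltr01.
apply: nrm_le_eps => e e0.
have half1 : (2^-1 : R) < 1 by lra.
have half0 : (0 : R) <= 2^-1 by lra.
have hq2 := ser_qd fst hc half0 half1.
set K := M * _ in hq2; set b := dser fst c 0.
have K0 : 0 <= K by rewrite mulr_ge0 ?(absb_ge0 hc) // exprn_ge0 // invr_ge0; lra.
have nb := nrm_ge0 b.
pose t := Num.min (Num.min r 2^-1) (e / (K + nrm b + 1)).
have d0 : 0 < K + nrm b + 1 by lra.
have t0 : 0 < t by rewrite !lt_min r0 divr_gt0 // andbT /=; lra.
have tr : t <= r by rewrite !ge_min lexx.
have t1 : t <= 2^-1 by rewrite !ge_min lexx !orbT.
have te : t * (K + nrm b + 1) <= e by rewrite -ler_pdivlMr // ge_min lexx orbT.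
have nt : nrm (cR t) = t by rewrite nrm_cR0 // ltW.
have n0 : nrm (0 : C) <= 2^-1 by rewrite nrm0.
have h1 : nrm (0 + cR t) <= 2^-1 by rewrite add0r nt.
have := hq2 0 (cR t) n0 h1; rewrite add0r nt -/b.
rewrite -!hG ?nrm0 ?nt //; last by lra.
rewrite (h (cR t)) ?nt //; last by rewrite cR_eq0 gt_eqF.
move=> h2.
have -> : G 0 = - (0 - G 0 - cR t * b) - cR t * b by ring.
have h3 : nrm (cR t * b) <= t * nrm b by rewrite nrmM nt.
have := nrm_leD (_ : nrm (- (0 - G 0 - cR t * b)) <= K * t ^+ 2) (_ : nrm (- (cR t * b)) <= t * nrm b).
rewrite !nrmN => /(_ h2 h3) h4; apply: le_trans h4 _.
apply: le_trans te; have h5 : 0 <= K * t * (1 - t) by apply: mulr_ge0; [exact: (mulr_ge0 K0 (ltW t0))|lra].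
by rewrite expr2; lra.
Qed.

Lemma ev_derive m (c : nat * {ffun 'I_m -> nat} -> C) M x l :
  absb c M -> nrm x < 1 -> @mdom R (par R m) l ->
  is_derive x (1 : C) (fun x => ev (Q := ext (par R m)) c (x, l)) (dev c (x, l)).
Proof.
move=> hc hx hl.
have hw : absb (fun a : nat * {ffun 'I_m -> nat} => c a * pmon a.2 l) M.
  by apply: absb_mono hc => a; rewrite nrmM ler_piMr ?nrm_ge0 //; exact: (@mv_le1 R (par R m)).
have := ser_derive fst hw hx.
have -> : ser fst (fun a : nat * {ffun 'I_m -> nat} => c a * pmon a.2 l) =
    (fun x => ev (Q := ext (par R m)) c (x, l)).
  by apply/funext => w; rewrite /ser /ev; congr (hs _); apply/funext => a; rewrite /= /emon /=; ring.
suff -> : dser fst (fun a : nat * {ffun 'I_m -> nat} => c a * pmon a.2 l) x = dev c (x, l) by [].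
by rewrite /dser /dev; congr (hs _); apply/funext => a /=; ring.
Qed.

Lemma derive1_is_derive (f : C -> C) x d : is_derive x (1 : C) f d -> derive1 f x = d.
Proof. by move=> [_ <-]; rewrite derive1E. Qed.

Lemma unscale_dom m (r : R) (l : 'rV[C]_m) : 0 < r -> (forall i, nrm (l 0 i) < r) ->
  @mdom R (par R m) ((cR r)^-1 *: l).
Proof.
by move=> r0 hl i; rewrite mxE nrmM nrmV nrm_cR0 ?(ltW r0) // ler_pdivrMl // mulr1 ltW.
Qed.

Lemma unscaleK m (r : R) (l : 'rV[C]_m) : 0 < r -> cR r *: ((cR r)^-1 *: l) = l.
Proof. by move=> r0; rewrite scalerA mulfV ?scale1r // cR_eq0 gt_eqF. Qed.

Lemma germ_shrink m (f : 'rV[C]_m -> C) (r r' M : R) : 0 < r' -> r' <= r ->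
  @mass R (par R m) (fun z => f (cR r *: z)) M -> @mass R (par R m) (fun z => f (cR r' *: z)) M.
Proof.
move=> r0 rr h; have rp : 0 < r by exact: lt_le_trans rr.
have hq : 0 <= r' / r <= 1 by rewrite divr_ge0 ?(ltW r0) ?(ltW rp) //= ler_pdivrMr // mul1r.
apply: mass_ext (mass_par_scale hq h) => z _.
by rewrite scalerA -cRM mulrCA divff ?mulr1 // gt_eqF.
Qed.

Lemma family_shrink m (f : C -> 'rV[C]_m -> C) (r r' M : R) : 0 < r' -> r' <= r ->
  @mass R (ext (par R m)) (fun z => f (cR r * z.1) (cR r *: z.2)) M ->
  @mass R (ext (par R m)) (fun z => f (cR r' * z.1) (cR r' *: z.2)) M.
Proof.
move=> r0 rr h; have rp : 0 < r by exact: lt_le_trans rr.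
have hq : 0 <= r' / r <= 1 by rewrite divr_ge0 ?(ltW r0) ?(ltW rp) //= ler_pdivrMr // mul1r.
apply: mass_ext (mass_scale hq hq h) => z _ /=.
by rewrite mulrA scalerA -!cRM mulrCA divff ?mulr1 // gt_eqF.
Qed.

Lemma germs_common m k (y : 'I_k -> 'rV[C]_m -> C) : (forall j, analytic_germ (y j)) ->
  exists r M : R, 0 < r /\ forall (r' : R), 0 < r' -> r' <= r ->
    forall j, @mass R (par R m) (fun z => y j (cR r' *: z)) M.
Proof.
move=> h.
have /choice[rM hrM] : forall j, exists rM : R * R,
    0 < rM.1 /\ @mass R (par R m) (fun z => y j (cR rM.1 *: z)) rM.2.
  by move=> j; have /germ_mass[r [M hh]] := h j; exists (r, M).
have [r [r0 hr]] : exists r : R, 0 < r /\ forall j, r <= (rM j).1.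
  exists (\big[Num.min/1]_j (rM j).1); split; last first.
    by move=> j; rewrite (bigD1 j) //= ge_min lexx.
  by elim/big_ind: _ => // [x z x0 z0|j _]; [rewrite lt_min x0|case: (hrM j)].
exists r, (\sum_j (rM j).2); split=> // r' r'0 r'r j.
apply: mass_le (germ_shrink r'0 (le_trans r'r (hr j)) (hrM j).2).
rewrite (bigD1 j) //= lerDl sumr_ge0 // => i _; exact: mass_ge0 (hrM i).2.
Qed.

Lemma mass_germ m (f : 'rV[C]_m -> C) (r M : R) : 0 < r ->
  @mass R (par R m) f M -> analytic_germ (fun l => f ((cR r)^-1 *: l)).
Proof.
move=> r0 h; apply/germ_mass; exists r, M; split=> //; apply: mass_ext h => z _.
by rewrite scalerA mulVf ?scale1r // cR_eq0 gt_eqF.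
Qed.

Lemma germZ m (f : 'rV[C]_m -> C) (c : C) : analytic_germ f -> analytic_germ (fun l => c * f l).
Proof.
move=> /germ_mass[r [M [r0 h]]]; apply/germ_mass; exists r, (nrm c * M); split=> //.
exact: massZ.
Qed.

End Rescale.

(** * The multiplier of a conjugacy and the reduction to a map close to the identity *)

Section Multiplier.
Variable R : realType.
Local Notation C := (Cplx R).
Variables (k m : nat).
Local Notation b0 := ([ffun=> 0%N] : {ffun 'I_m -> nat}).

Lemma pmon_at0 (c : {ffun 'I_m -> nat} -> C) : hsum (fun b => c b * pmon b 0) (c b0).
Proof.
have pm0 b : pmon b (0 : 'rV[C]_m) = 0 ^+ deg b * pmon b 0 by rewrite -pmonZ scaler0.
have := @hsum_single R (mi (par R m)) (fun b => c b * pmon b 0) b0.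
rewrite pmon1 mulr1; apply=> b bn.
rewrite pm0; case: (posnP (deg b)) => [/deg0 e|]; first by rewrite e eqxx in bn.
by rewrite expr0n; case: (deg b) => // n _; rewrite mul0r mulr0.
Qed.

Lemma dom_0 : @mdom R (par R m) 0.
Proof. by move=> i; rewrite mxE nrm0. Qed.

Lemma slice0 (c : nat * {ffun 'I_m -> nat} -> C) M x : absb c M -> nrm x <= 1 ->
  hsum (fun j => c (j, b0) * x ^+ j) (ev (Q := ext (par R m)) c (x, 0)).
Proof.
move=> hc hx; have [_ h] := @slice R (par R m) c M 0 hc dom_0.
apply: hsum_ext (h x hx) => j; congr (_ * _); apply: hsE; exact: pmon_at0.
Qed.

Lemma dslice0 (c : nat * {ffun 'I_m -> nat} -> C) M x : absb c M -> nrm x < 1 ->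
  hsum (fun j => c (j, b0) * (j%:R * x ^+ j.-1)) (dev c (x, 0)).
Proof.
move=> hc hx.
have hw : absb (fun a : nat * {ffun 'I_m -> nat} => c a * pmon a.2 0) M.
  by apply: absb_mono hc => a; rewrite nrmM ler_piMr ?nrm_ge0 //; exact: (@mv_le1 R (par R m) _ _ dom_0).
have := dser_hsum fst hw (nrm_ge0 x) hx (lexx _).
have -> : dser fst (fun a : nat * {ffun 'I_m -> nat} => c a * pmon a.2 0) x = dev c (x, 0).
  by rewrite /dser /dev; congr (hs _); apply/funext => a /=; ring.
move=> h; pose g j b := c (j, b) * pmon b 0 * (j%:R * x ^+ j.-1).
have hp : hsum (fun jb : nat * {ffun 'I_m -> nat} => g jb.1 jb.2) (dev c (x, 0)).
  by apply: hsum_ext h => -[j b].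
apply: (hsum_iter1 (f := g)) hp => j; rewrite mulrC.
apply: hsum_ext (hsumZ (j%:R * x ^+ j.-1) (pmon_at0 (fun b => c (j, b)))) => b.
by rewrite /g; ring.
Qed.

(* Comparing the lowest order terms of the conjugacy equation at lambda = 0. *)
Lemma multiplier_root (c : nat * {ffun 'I_m -> nat} -> C) M (r d : R) (mu mu' : C) :
  absb c M -> 0 < r -> 0 < d -> c (0%N, b0) = 0 -> c (1%N, b0) != 0 ->
  (forall X, nrm X < d -> nrm X < 1 ->
     1 + mu * (cR r * X) ^+ k != 0 -> 1 + mu' * ev (Q := ext (par R m)) c (X, 0) ^+ k != 0 ->
     ev (Q := ext (par R m)) c (X, 0) ^+ k.+1 / (1 + mu' * ev (Q := ext (par R m)) c (X, 0) ^+ k) =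
     (cR r * X) ^+ k.+1 / (1 + mu * (cR r * X) ^+ k) * ((cR r)^-1 * dev c (X, 0))) ->
  (0 < k)%N -> ((cR r)^-1 * c (1%N, b0)) ^+ k = 1.
Proof.
move=> hc r0 d0 c0 c1 hconj kpos.
pose e j := c (j, b0); have he : absb e M by apply: (absb_inj (h := fun j => (j, b0))) hc => i j [].
have he1 : absb (fun j => e j.+1) M by apply: absb_inj he => i j [].
have half0 : (0 : R) <= 2^-1 by rewrite invr_ge0.
(* At Z / 2 the map is Z / 2 times [hh Z] and its derivative is [DD Z]; halving the variable makes
   both series converge on the closed unit disc. *)
pose hh := ser id (fun j => e j.+1 * 2^-1 ^+ j).
pose DD := ser id (fun j => e j.+1 * (j.+1%:R * 2^-1 ^+ j)).
have h2 : nrm (2^-1 : C) = 2^-1 by rewrite nrmV nrm_nat.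
have ah : absb (fun j => e j.+1 * 2^-1 ^+ j) M.
  apply: absb_mono he1 => j; rewrite nrmM nrmX h2 ler_piMr ?nrm_ge0 // exprn_ile1 //.
  by rewrite invf_le1 ?ler1n.
have aD : absb (fun j => e j.+1 * (j.+1%:R * 2^-1 ^+ j)) M.
  apply: absb_mono he1 => j; rewrite !nrmM nrmX h2 nrm_nat ler_piMr ?nrm_ge0 //.
  exact: half_pow_weight.
have hz2 (Z : C) : nrm Z <= 1 -> nrm (2^-1 * Z) < 1.
  by move=> hZ; rewrite nrmM h2; have := nrm_ge0 Z; lra.
have ef Z : nrm Z <= 1 -> ev (Q := ext (par R m)) c (2^-1 * Z, 0) = 2^-1 * Z * hh Z.
  move=> hZ; have := slice0 hc (ltW (hz2 Z hZ)); move=> h1.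
  have := hsum_head (f := fun j => c (j, b0) * (2^-1 * Z) ^+ j) (s := 2^-1 * Z * hh Z).
  rewrite c0 mul0r add0r => h3; apply: hsum_unique h1 (h3 _).
  apply: hsum_ext (hsumZ (2^-1 * Z) (ser_hsum id ah hZ)) => j.
  by rewrite /e exprS exprMn /=; ring.
have eD Z : nrm Z <= 1 -> dev c (2^-1 * Z, 0) = DD Z.
  move=> hZ; have h1 := dslice0 hc (hz2 Z hZ).
  have := hsum_head (f := fun j => c (j, b0) * (j%:R * (2^-1 * Z) ^+ j.-1)) (s := DD Z).
  rewrite c0 mul0r add0r => h3; apply: hsum_unique h1 (h3 _).
  apply: hsum_ext (ser_hsum id aD hZ) => j.
  by rewrite /e exprMn /=; ring.
have z0 (w : nat -> C) : absb w M -> ser id w 0 = w 0%N.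
  move=> hw; apply: hsE; have := @hsum_single R nat (fun j => w j * 0 ^+ j) 0%N.
  by rewrite expr0 mulr1; apply=> j j0; rewrite expr0n (negbTE j0) mulr0.
have hh0 : hh 0 = e 1%N by rewrite /hh z0 // expr0 mulr1.
have DD0 : DD 0 = e 1%N by rewrite /DD z0 // expr0 !mulr1.
pose rc := cR r.
have rc0 : rc != 0 by rewrite cR_eq0 gt_eqF.
(* The conjugacy equation at lambda = 0, cleared of its denominators and divided by the common
   factor x^(k+1). At Z = 0 it reads b^(k+1) = b, with b the multiplier. *)
pose G Z := (rc^-1 * hh Z) ^+ k.+1 * (1 + mu * (rc * (2^-1 * Z)) ^+ k) -
   (1 + mu' * (2^-1 * Z * hh Z) ^+ k) * (rc^-1 * DD Z).
have mZ : @mass R (ext (par R 0)) (fun z => 2^-1 * z.1) _ := massZ 2^-1 (mass_x (par R 0)).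
have mh := ser_umass id ah; have mD := ser_umass id aD.
have m1 := @mass1 R (ext (par R 0)).
have mG : umass G _ := massB (massM (massX k.+1 (massZ rc^-1 mh)) (massD m1 (massZ mu (massX k (massZ rc mZ)))))
   (massM (massD m1 (massZ mu' (massX k (massM mZ mh)))) (massZ rc^-1 mD)).
pose M1 := nrm mu * (1 + r) ^+ k + nrm mu' * (1 + M) ^+ k + 1.
have M0 : 0 <= M := absb_ge0 hc.
have M10 : 1 <= M1.
  by rewrite /M1 lerDr addr_ge0 // mulr_ge0 ?nrm_ge0 ?exprn_ge0 // addr_ge0 // ltW.
(* For |Z| <= q both denominators are within 1/2 of 1. *)
pose q := Num.min (Num.min d 2^-1) (2^-1 / M1).
have q0 : 0 < q by rewrite !lt_min d0 !divr_gt0 ?invr_gt0 //=; lra.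
have qd_ : q <= d by rewrite !ge_min lexx.
have q2 : q <= 2^-1 by rewrite !ge_min lexx !orbT.
have qM : q * M1 <= 2^-1 by rewrite -ler_pdivlMr ?ge_min ?lexx ?orbT //; lra.
have small (nu : C) (w : C) (B : R) Z : nrm Z <= q -> nrm w <= nrm Z * B -> 0 <= B ->
    nrm nu * (1 + B) ^+ k <= M1 -> 1 + nu * w ^+ k != 0.
  move=> hZ hw B00 hB; have nZ := nrm_ge0 Z.
  rewrite -nrm_gt0; have := nrm_geB 1 (nu * w ^+ k); rewrite nrm1.
  suff : nrm (nu * w ^+ k) <= 2^-1 by lra.
  apply: le_trans qM; apply: le_trans (_ : q * (nrm nu * (1 + B) ^+ k) <= _); last first.
    by rewrite ler_wpM2l // ltW.
  rewrite nrmM mulrCA ler_wpM2l ?nrm_ge0 //.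
  apply: le_trans (nrm_leX k hw) _; rewrite exprMn; apply: ler_pM; rewrite ?exprn_ge0 //.
    rewrite -(prednK kpos) exprS -[leRHS]mulr1; apply: ler_pM; rewrite ?exprn_ge0 //.
    by rewrite exprn_ile1 //; lra.
  by rewrite lerXn2r ?nnegrE //; lra.
have G0 : G 0 = 0.
  apply: (umass_limit0 mG q0) => Z Z0 hZ.
  have hZ1 : nrm Z <= 1 by lra.
  have w0 : 2^-1 * Z != 0 by rewrite mulf_neq0 ?invr_eq0 ?pnatr_eq0.
  have nZ : nrm (2^-1 * Z) <= nrm Z by rewrite nrmM h2; have := nrm_ge0 Z; lra.
  have nZ' : nrm (2^-1 * Z) < d by rewrite nrmM h2; have := nrm_gt0 Z; rewrite Z0; lra.
  have nh : nrm (hh Z) <= M.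
    by apply: (@mass_sup R (ext (par R 0)) _ _ (Z, 0) mh); split=> //; exact: dom0.
  have d1 : 1 + mu * (rc * (2^-1 * Z)) ^+ k != 0.
    apply: (small _ _ r Z hZ) => //; first by rewrite nrmM nrm_cR0 ?(ltW r0) // mulrC ler_wpM2r // ltW.
      exact: ltW.
    rewrite /M1 -addrA lerDl addr_ge0 // mulr_ge0 ?nrm_ge0 // exprn_ge0 // addr_ge0 //.
  have d2 : 1 + mu' * (2^-1 * Z * hh Z) ^+ k != 0.
    apply: (small _ _ M Z hZ) => //; first by rewrite nrmM; apply: ler_pM; rewrite ?nrm_ge0.
    rewrite /M1 addrAC lerDr addr_ge0 // mulr_ge0 ?nrm_ge0 // exprn_ge0 // addr_ge0 // ltW //.
  have := hconj (2^-1 * Z) nZ' (hz2 Z hZ1); rewrite ef // eD // => /(_ d1 d2) => hcj.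
  have xk : (2^-1 * Z) ^+ k.+1 != 0 by rewrite expf_neq0.
  rewrite /G -/rc in hcj d1 d2 *; move: d1 d2 hcj.
  set A := 1 + mu * _; set B := 1 + mu' * _; move=> d1 d2.
  move=> hcj; have P : hh Z ^+ k.+1 = rc ^+ k.+1 / A * (rc^-1 * DD Z) * B.
    apply: (mulfI xk); rewrite -exprMn -[LHS](divfK d2) hcj exprMn; ring.
  have rk : rc ^+ k.+1 != 0 by rewrite expf_neq0.
  by rewrite exprMn exprVn P; field; rewrite d1 rk rc0.
have := G0; rewrite /G hh0 DD0 mulr0 !mulr0 mul0r !expr0n; case: (k) kpos => // n _ /=.
rewrite !mulr0 !addr0 mul1r mulr1 => /subr0_eq; rewrite exprSr => h.
have b00 : rc^-1 * e 1%N != 0 by rewrite mulf_neq0 ?invr_eq0.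
by apply: (mulIf b00); rewrite mul1r.
Qed.

End Multiplier.

Section NormalFormRigidity.
Variable R : realType.
Local Notation C := (Cplx R).
Variables (k m : nat).
Local Notation b0 := ([ffun=> 0%N] : {ffun 'I_m -> nat}).
Local Notation L := ('rV[C]_m).

(** Quasi-homogeneity: under x = S X the coefficient y_j has weight k + 1 - j. *)
Lemma npoly_scale (y : 'I_k -> C) (S X : C) : S != 0 ->
  npoly (fun j => y j / S ^+ (k.+1 - j)) X * S ^+ k.+1 = npoly y (S * X).
Proof.
move=> S0; rewrite /npoly mulrDl mulr_suml exprMn mulrC; congr (_ + _).
apply: eq_bigr => j _; have jk : (j <= k.+1)%N by have := ltn_ord j; lia.
by rewrite -{2}(subnK jk) exprD exprMn; field; rewrite expf_neq0.
Qed.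

Lemma npoly_rot (y : 'I_k -> C) (ze w : C) : ze != 0 -> ze ^+ k = 1 ->
  npoly y (ze * w) = ze * npoly (fun j => ze ^+ j / ze * y j) w.
Proof.
move=> z0 zk; rewrite /npoly mulrDr mulr_sumr exprMn exprS zk mulr1; congr (_ + _).
by apply: eq_bigr => j _; rewrite exprMn; field.
Qed.

Lemma npoly0 (y : 'I_k -> C) w : (forall j, y j = 0) -> npoly y w = w ^+ k.+1.
Proof. by move=> h; rewrite /npoly big1 ?addr0 // => j _; rewrite h mul0r. Qed.

Lemma phi_chart (phi : C -> L -> C) (r M : R) : 0 < r ->
  @mass R (ext (par R m)) (fun z => phi (cR r * z.1) (cR r *: z.2)) M ->
  exists c : nat * {ffun 'I_m -> nat} -> C, [/\ absb c M,
    forall x l, nrm x <= 1 -> @mdom R (par R m) l ->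
      phi (cR r * x) (cR r *: l) = ev (Q := ext (par R m)) c (x, l) &
    forall x l, nrm x < 1 -> @mdom R (par R m) l ->
      is_derive (cR r * x) (1 : C) (fun u => phi u (cR r *: l)) ((cR r)^-1 * dev c (x, l))].
Proof.
move=> r0 [c [hc hE]]; exists c; have rn : cR r != 0 by rewrite cR_eq0 gt_eqF.
have eE x l : nrm x <= 1 -> @mdom R (par R m) l ->
    phi (cR r * x) (cR r *: l) = ev (Q := ext (par R m)) c (x, l).
  by move=> hx hl; apply/esym/hsE; exact: (hE (x, l)).
split=> // x l hx hl.
have ex : (cR r)^-1 * (cR r * x) + 0 = x by rewrite addr0 mulrA mulVf // mul1r.
have h1 := ev_derive hc hx hl; rewrite -{1}ex in h1.
have h2 := daffine h1.
have p0 : 0 < r * (1 - nrm x) by rewrite mulr_gt0 // subr_gt0.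
apply: (is_derive_near p0 _ h2) => v hv; rewrite addr0 -eE //.
  by rewrite mulrA divff // mul1r.
have -> : (cR r)^-1 * v = (cR r)^-1 * (v - cR r * x) + x by field.
apply: le_trans (nrmD _ _) _; rewrite nrmM nrmV nrm_cR0 ?(ltW r0) // -lerBrDr.
by rewrite ler_pdivrMl // ltW.
Qed.

Lemma chart_origin (phi : C -> L -> C) (c : nat * {ffun 'I_m -> nat} -> C) (r M : R) :
  absb c M -> phi 0 0 = ev (Q := ext (par R m)) c (0, 0) ->
  is_derive (0 : C) (1 : C) (fun u => phi u 0) ((cR r)^-1 * dev c (0, 0)) ->
  phi 0 0 = 0 -> derive1 (fun u => phi u 0) 0 != 0 -> c (0%N, b0) = 0 /\ c (1%N, b0) != 0.
Proof.
move=> hc cE cD phi0 dphi.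
have n00 : nrm (0 : C) <= 1 by rewrite nrm0.
have n01 : nrm (0 : C) < 1 by rewrite nrm0.
split.
  have h1 := slice0 hc n00; rewrite -cE phi0 in h1.
  apply: hsum_unique h1; have := @hsum_single R _ (fun j => c (j, b0) * 0 ^+ j) 0%N.
  by rewrite expr0 mulr1; apply=> j j0; rewrite expr0n (negbTE j0) mulr0.
have dev0 : dev c (0, 0) = c (1%N, b0).
  apply: hsum_unique (dslice0 hc n01) _.
  have := @hsum_single R _ (fun j => c (j, b0) * (j%:R * 0 ^+ j.-1)) 1%N.
  rewrite expr0 !mulr1; apply=> -[|[|j]] // _; first by rewrite !mul0r mulr0.
  by rewrite /= expr0n /= !mulr0.
by move: dphi; rewrite (derive1_is_derive cD) dev0 mulf_eq0 negb_or => /andP[].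
Qed.

(** The deviation from x has no pure term in x of degree below 2, so scaling x by rho and lambda by
    sig <= rho^2 leaves a size 2 rho^2; dividing by the scale rho / 2 gives 4 rho. The extra factor
    1/2 absorbs the weight of the derivative. *)
Lemma near_identity_chart (c : nat * {ffun 'I_m -> nat} -> C) M (rho sig : R) :
  absb c M -> 0 < rho -> rho <= 1 -> 0 < sig -> sig <= rho ^+ 2 ->
  c (0%N, b0) = 0 -> c (1%N, b0) = 1 ->
  exists psi : nat * {ffun 'I_m -> nat} -> C,
  [/\ absb (fun a => a.1.+1%:R * psi a) (4 * rho * (M + 1)),
    forall x l, nrm x <= 1 -> @mdom R (par R m) l ->
      ev (Q := ext (par R m)) c (cR (rho / 2) * x, cR sig *: l) =
      cR (rho / 2) * (x + ev (Q := ext (par R m)) psi (x, l)) &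
    forall x l, nrm x <= 1 -> @mdom R (par R m) l ->
      dev c (cR (rho / 2) * x, cR sig *: l) = 1 + dev psi (x, l)].
Proof.
move=> hc r0 r1 s0 s1 c0 c1.
have sle : sig <= 1 by apply: le_trans s1 _; rewrite expr2; nra.
have rh : 0 < rho / 2 by rewrite divr_gt0.
pose d (a : nat * {ffun 'I_m -> nat}) : C := if a == (1%N, b0) then 1 else 0.
have hd : absb d 1.
  have := @absb_single R _ d (1%N, b0); rewrite /d eqxx nrm1.
  by apply=> a /negbTE ->.
pose e a := c a - d a; have he : absb e (M + 1) by apply: absbD => //; exact: absbN.
pose w (a : nat * {ffun 'I_m -> nat}) := a.1.+1%:R * 2^-1 ^+ a.1 * e a.
have hw : absb w (M + 1).
  apply: absb_mono he => a; rewrite /w nrmM ler_piMl ?nrm_ge0 //.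
  by rewrite nrmM nrm_nat nrmX nrmV nrm_nat; exact: half_pow_weight.
have e2 j : (j < 2)%N -> e (j, b0) = 0.
  by case: j => [|[|]] // _; rewrite /e /d ?c0 ?c1 ?eqxx ?subrr //= subr0.
have w2 j : (j < 2)%N -> w (j, b0) = 0 by move=> j2; rewrite /w e2 // mulr0.
have hr01 : 0 <= rho <= 1 by rewrite (ltW r0).
have hs01 : 0 <= sig <= 1 by rewrite (ltW s0).
have hsm := scoef_small hr01 hs01 hw w2.
pose t := cR (rho / 2); have t0 : t != 0 by rewrite cR_eq0 gt_eqF.
pose psi a := e a * t ^+ a.1 * cR sig ^+ deg a.2 / t.
have ht : t = cR rho * 2^-1 by rewrite /t cRM cRV cRn.
have hpsi : absb (fun a => a.1.+1%:R * psi a) (4 * rho * (M + 1)).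
  have M0 : 0 <= M + 1 := absb_ge0 hw.
  have tv : nrm t^-1 = 2 / rho by rewrite nrmV nrm_cR0 ?(ltW rh) // invf_div.
  apply: absb_le (_ : nrm t^-1 * ((rho ^+ 2 + sig) * (M + 1)) <= _) _.
    rewrite mulrA ler_wpM2r // tv; have -> : 2 / rho * (rho ^+ 2 + sig) = 2 * rho + 2 * (sig / rho) by field; rewrite gt_eqF.
    suff : sig / rho <= rho by lra.
    by rewrite ler_pdivrMr // -expr2.
  apply: absb_mono (absbZ t^-1 hsm) => a; rewrite le_eqVlt; apply/orP; left; apply/eqP; congr nrm.
  by rewrite /psi /scoef /w [in t ^+ a.1]ht exprMn; ring.
exists psi.
have hdom x l : nrm x <= 1 -> @mdom R (par R m) l ->
    @mdom R (ext (par R m)) (t * x, cR sig *: l) /\ nrm (t * x) < 1.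
  move=> hx hl; have h1 : nrm (t * x) <= rho / 2.
    by rewrite nrmM nrm_cR0 ?(ltW rh) // ler_piMr // ltW.
  split; last by lra.
  split=> /= [|i]; first by lra.
  by rewrite mxE nrmM nrm_cR0 ?(ltW s0) // mulr_ile1 ?nrm_ge0 ?(ltW s0) //; exact: hl.
have single (v : nat * {ffun 'I_m -> nat} -> C) : hsum (fun a => d a * v a) (v (1%N, b0)).
  have := @hsum_single R _ (fun a => d a * v a) (1%N, b0); rewrite /d eqxx mul1r.
  by apply=> a /negbTE ->; rewrite mul0r.
split=> // x l hx hl; have [hz hz1] := hdom x l hx hl.
- have h1 := hsumB (@ev_hsum R (ext (par R m)) c M _ hc hz) (single (fun a => @mv R (ext (par R m)) a (t * x, cR sig *: l))).
  have h2 : ev (Q := ext (par R m)) psi (x, l) =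
      t^-1 * (ev (Q := ext (par R m)) c (t * x, cR sig *: l) - t * x).
    apply: hsE; have := hsumZ t^-1 h1; rewrite /= /emon /= expr1 pmon1 mulr1.
    apply: hsum_ext => a; rewrite /psi /e pmonZ exprMn; ring.
  by rewrite -/t h2; field.
- have hw' : absb (fun a : nat * {ffun 'I_m -> nat} => c a * pmon a.2 (cR sig *: l)) M.
    by apply: absb_mono hc => a; rewrite nrmM ler_piMr ?nrm_ge0 //; exact: (@mv_le1 R (par R m) _ _ hz.2).
  have h1 := dser_hsum fst hw' (nrm_ge0 _) hz1 (lexx _).
  have e1 : dser fst (fun a : nat * {ffun 'I_m -> nat} => c a * pmon a.2 (cR sig *: l)) (t * x) =
      dev c (t * x, cR sig *: l).
    by rewrite /dser /dev; congr (hs _); apply/funext => a /=; ring.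
  rewrite e1 in h1.
  have h2 := hsumB h1 (single (fun a => a.1%:R * (t * x) ^+ a.1.-1 * pmon a.2 (cR sig *: l))).
  have h3 : dev psi (x, l) = dev c (t * x, cR sig *: l) - 1.
    apply: hsE; move: h2; rewrite /= expr0 pmon1 !mulr1.
    apply: hsum_ext => a; rewrite /psi /e pmonZ; case: a => [[|n] b] /=; first by rewrite !(mul0r, mulr0, subr0).
    by rewrite !exprMn exprS; field.
  by rewrite -/t h3; ring.
Qed.

End NormalFormRigidity.

Section NormalFormSymmetry.
Variable R : realType.
Local Notation C := (Cplx R).
Variables (k m : nat).
Local Notation b0 := ([ffun=> 0%N] : {ffun 'I_m -> nat}).
Local Notation L := ('rV[C]_m).

(** In the variable x = S X the path has velocity T / S^k times the field, and it is followed up to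
    s = 1/2; this makes a time T / (2 S^k). *)
Lemma flow_unscale (y : 'I_k -> C) (mu T S x : C) (gam gams : C -> C) M :
  S != 0 -> umass gam M -> gam 0 = x ->
  (forall s, nrm s < 1 -> [/\ is_derive s (1 : C) gam (gams s),
     1 + mu * S ^+ k * gam s ^+ k != 0 &
     (1 + mu * S ^+ k * gam s ^+ k) * gams s = T * npoly (fun j => y j / S ^+ (k.+1 - j)) (gam s)]) ->
  time_flow (fun x => npoly y x / (1 + mu * x ^+ k)) (T / (2 * S ^+ k)) (S * x) (S * gam 2^-1).
Proof.
move=> S0 hg g0 hd.
have two0 : (2 : C) != 0 by rewrite pnatr_eq0.
have Sk : S ^+ k != 0 by rewrite expf_neq0.
have h2 : nrm (2^-1 : C) = 2^-1 by rewrite nrmV nrm_nat.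
set t := T / _; pose a := (2 * t)^-1.
pose v x := npoly y x / (1 + mu * x ^+ k).
have vS (w : C) : 1 + mu * S ^+ k * w ^+ k != 0 ->
    v (S * w) = S ^+ k.+1 * npoly (fun j => y j / S ^+ (k.+1 - j)) w / (1 + mu * S ^+ k * w ^+ k).
  by move=> hw; rewrite /v -(npoly_scale y w S0) exprMn mulrA [_ * S ^+ k.+1]mulrC.
(* For t = 0 the segment of times is a point and s cannot be expressed through the time. The path is
   then constant, and an affine [gamma] with the right slope at 0 is enough. *)
have [t0|t0] := eqVneq t 0.
  have T0 : T = 0.
    by move/eqP: t0; rewrite /t mulf_eq0 invr_eq0 mulf_eq0 (negbTE two0) (negbTE Sk) !orbF => /eqP.
  have gh : gam 2^-1 = x.
    have gs0 s : nrm s < 1 -> gams s = 0.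
      move=> hs; have [_ n0 e] := hd s hs; apply: (mulfI n0).
      by rewrite e T0 mul0r mulr0.
    have mf : umass (fun s => gam s - x) _ := massB hg (mass_const (ext (par R 0)) x).
    have df s : nrm s < 1 -> is_derive s (1 : C) (fun s => gam s - x) 0.
      move=> hs; have [d1 _ _] := hd s hs; rewrite gs0 // in d1.
      by apply: is_derive_eq (dB d1 (dcst x s)) _; rewrite subr0.
    have f0 : gam 0 - x = 0 by rewrite g0 subrr.
    have := linear_ode_zero (f' := fun=> 0) mf f0 df _ (s := 2^-1).
    rewrite cRV cRn => h; apply: subr0_eq; apply: h; last by apply/andP; split; lra.
    by move=> s _; rewrite nrm0 nrm_ge0.
  exists (fun u => S * x + u * v (S * x)); split; first by rewrite mul0r addr0.
    by rewrite t0 mul0r addr0 gh.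
  move=> s _; rewrite t0 !mulr0 mul0r addr0.
  by apply: is_derive_eq (dD (dcst (S * x) 0) (dM (did 0) (dcst (v (S * x)) 0))) _; rewrite /v; ring.
have at2 : a * t = 2^-1 by rewrite /a invfM mulfVK.
exists (fun u => S * gam (a * u + 0)); split; first by rewrite mulr0 addr0 g0.
  by rewrite addr0 at2.
move=> s hs; have [s' hs' ->] : exists2 s' : R, 0 <= s' <= 1 & s = cR s'.
  have /complex_realP[s' es] : s \is Num.real by case/andP: hs => /ger0_real.
  by exists s'; rewrite ?es //; move: hs; rewrite es -!ler_cR.
have ast : a * (cR s' * t) + 0 = cR s' * 2^-1 by rewrite -at2; ring.
have ns : nrm (cR s' * 2^-1) < 1.
  by case/andP: hs' => p0 p1; rewrite nrmM h2 nrm_cR0 //; lra.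
have [d1 n0 e] := hd _ ns; rewrite -{1}ast in d1.
apply: is_derive_eq (dZ S (daffine d1)) _.
rewrite ast -/(v _) vS //.
have -> : gams (cR s' * 2^-1) = T * npoly (fun j => y j / S ^+ (k.+1 - j)) (gam (cR s' * 2^-1)) /
    (1 + mu * S ^+ k * gam (cR s' * 2^-1) ^+ k) by rewrite -e; field.
have T0 : T != 0 by apply: contraNneq t0 => T0; rewrite /t T0 mul0r.
by rewrite /a /t exprS; field; rewrite ?n0 ?T0 ?Sk ?two0.
Qed.

(** The multiplier is a k-th root of unity [ze]. Dividing the map by [ze] and rotating the second
    normal form accordingly leaves, after rescaling, a map close to the identity, to which [rigid]
    applies. *)
Lemma normal_form_rigidity (y y' : 'I_k -> L -> C) (mu mu' : L -> C) (phi : C -> L -> C) :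
  (0 < k)%N -> form_B_data y mu -> form_B_data y' mu' ->
  is_conjugacy phi (form_B y mu) (form_B y' mu') ->
  exists (l : 'I_k) (t : L -> C),
    [/\ analytic_germ t,
        \forall lam \near (0 : L), (forall j, y' j lam = rot_coef l y j lam) /\ mu' lam = mu lam
      & \forall z \near ((0, 0) : C * L), exists2 w : C,
          time_flow (fun x => form_B y mu x z.2) (t z.2) z.1 w &
          phi z.1 z.2 = rot_factor R l * w].
Proof.
move=> kpos [hy hmu hy0] [hy' hmu' hy0'] [hphi phi0 dphi /near_pair[rc rc0 hconj]].
have [ry [My [ry0 hry]]] := germs_common hy.
have [ry' [My' [ry0' hry']]] := germs_common hy'.
have /germ_mass[rm [Mm [rm0 hrm]]] := hmu.
have /germ_mass[rm' [Mm' [rm0' hrm']]] := hmu'.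
have /family_mass[rp [Mp [rp0 hrp]]] := hphi.
pose r : R := Num.min (Num.min ry ry') (Num.min (Num.min rm rm') (Num.min rp (Num.min (rc / 2) 1))).
have r0 : 0 < r by rewrite !lt_min ry0 ry0' rm0 rm0' rp0 ltr01 divr_gt0.
have rle1 : r <= ry by rewrite !ge_min lexx.
have rle2 : r <= ry' by rewrite !ge_min lexx !orbT.
have rle3 : r <= rm by rewrite !ge_min lexx !orbT.
have rle4 : r <= rm' by rewrite !ge_min lexx !orbT.
have rle5 : r <= rp by rewrite !ge_min lexx !orbT.
have rle6 : r <= rc / 2 by rewrite !ge_min lexx !orbT.
have rle7 : r <= 1 by rewrite !ge_min lexx !orbT.
have {}hry := hry r r0 rle1; have {}hry' := hry' r r0 rle2.
have {}hrm := germ_shrink r0 rle3 hrm; have {}hrm' := germ_shrink r0 rle4 hrm'.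
have [c [hc cE cD]] := phi_chart r0 (family_shrink r0 rle5 hrp).
have rn : cR r != 0 by rewrite cR_eq0 gt_eqF.
have d00 := @dom_0 R m.
have n00 : nrm (0 : C) <= 1 by rewrite nrm0.
have n01 : nrm (0 : C) < 1 by rewrite nrm0.
have h00 := cE _ _ n00 d00; have hD0 := cD _ _ n01 d00.
rewrite !(mulr0, scaler0) in h00 hD0.
have [c0 c1] := chart_origin hc h00 hD0 phi0 dphi.
have conj1 x l : nrm x < 1 -> @mdom R (par R m) l ->
    npoly (y' ^~ (cR r *: l)) (ev (Q := ext (par R m)) c (x, l)) /
      (1 + mu' (cR r *: l) * ev (Q := ext (par R m)) c (x, l) ^+ k) =
    npoly (y ^~ (cR r *: l)) (cR r * x) / (1 + mu (cR r *: l) * (cR r * x) ^+ k) *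
      ((cR r)^-1 * dev c (x, l)).
  move=> hx hl; have := hconj (cR r * x) (cR r *: l); rewrite /form_B /= cE ?(ltW hx) //.
  rewrite (derive1_is_derive (cD _ _ hx hl)); apply.
    by rewrite nrmM nrm_cR0 ?(ltW r0) //; have := nrm_ge0 x; nra.
  by move=> i; rewrite mxE nrmM nrm_cR0 ?(ltW r0) //; have := hl i; have := nrm_ge0 (l 0 i); nra.
have bk : ((cR r)^-1 * c (1%N, b0)) ^+ k = 1.
  apply: (@multiplier_root R k m c Mp r 1 (mu 0) (mu' 0)) => // X _ hX _ _.
  have := conj1 X 0 hX d00; rewrite scaler0.
  by rewrite (npoly0 _ hy0) (npoly0 _ hy0').
have [l0 el0] := root_of_unity kpos bk.
set ze := rot_factor R l0 in el0; have ze0 : ze != 0 by exact: rot_factor_neq0.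
have zek : ze ^+ k = 1 by exact: rot_factorXk.
have nze : nrm ze = 1.
  have : nrm ze ^+ k = 1 by rewrite -nrmX zek nrm1.
  move/eqP; rewrite pexpr_eq1 ?nrm_ge0 // => /eqP//.
pose K1 := nrm (ze^-1 * (cR r)^-1).
pose ct a := ze^-1 * (cR r)^-1 * c a.
have hct : absb ct (K1 * Mp) by exact: absbZ.
have ct0 : ct (0%N, b0) = 0 by rewrite /ct c0 mulr0.
have ct1 : ct (1%N, b0) = 1 by rewrite /ct -mulrA el0 mulVf.
have [eta0 e00 hrig] := @rigid R k m.
pose eta := Num.min eta0 1.
have eta_gt0 : 0 < eta by rewrite lt_min e00 ltr01.
have eta_le : eta <= eta0 by rewrite ge_min lexx.
have eta_le1 : eta <= 1 by rewrite ge_min lexx orbT.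
pose Mc := K1 * Mp + 1.
have Mc0 : 0 <= Mc by rewrite addr_ge0 // (absb_ge0 hct).
have Mm0 : 0 <= Mm := mass_ge0 hrm. have Mm0' : 0 <= Mm' := mass_ge0 hrm'.
pose N := 4 * Mc + 2 * Mm + 2 * Mm' + 1.
have N1 : 1 <= N by rewrite /N; lra.
pose rho := eta / N.
have rho0 : 0 < rho by rewrite divr_gt0 //; lra.
have rhoN : rho * N = eta by rewrite /rho divfK // gt_eqF //; lra.
have rho1 : rho <= 1 by nra.
have rA : 4 * rho * Mc <= eta by rewrite -rhoN /N; nra.
have rB : 2 * Mm * rho <= eta by rewrite -rhoN /N; nra.
have rB' : 2 * Mm' * rho <= eta by rewrite -rhoN /N; nra.
pose S := r * (rho / 2).
have S0 : 0 < S by rewrite mulr_gt0 // divr_gt0.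
have S1 : 2 * S <= rho by rewrite /S; nra.
have Sle1 : S <= 1 by clear - S1 S0 rho1; lra.
have Sk : S ^+ k <= S by rewrite -(prednK kpos) exprS ler_piMr ?(ltW S0) // exprn_ile1 ?(ltW S0).
have S2k : (2 * S) ^+ k <= 2 * S.
  by rewrite -(prednK kpos) exprS ler_piMr ?exprn_ile1 //; clear - S0 S1 rho1; lra.
pose My2 := My + My' + 1.
have My0 : 0 <= My := mass_ge0 (hry (Ordinal kpos)).
have My0' : 0 <= My' := mass_ge0 (hry' (Ordinal kpos)).
(* The scale S is fixed first, and dividing by S^(k+1-j) enlarges y_j. As y_j vanishes at the
   origin, a small [sig] makes up for it; the bound rho^2 is the one of [near_identity_chart]. *)
pose sig := Num.min (rho ^+ 2) (eta * S ^+ k.+1 / My2).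
have My20 : 0 < My2 by rewrite /My2; lra.
have sig0 : 0 < sig by rewrite lt_min exprn_gt0 // divr_gt0 // mulr_gt0 // exprn_gt0.
have sig1 : sig <= rho ^+ 2 by rewrite ge_min lexx.
have sigM : sig * My2 <= eta * S ^+ k.+1 by rewrite -ler_pdivlMr // ge_min lexx orbT.
have sigl : sig <= 1 by apply: le_trans sig1 _; rewrite exprn_ile1 // ltW.
have sig01 : 0 <= sig <= 1 by rewrite (ltW sig0).
have [psi [hpsi psiE psiD]] := near_identity_chart hct rho0 rho1 sig0 sig1 ct0 ct1.
have Sn : cR S != 0 by rewrite cR_eq0 gt_eqF.
pose lam (l : L) := cR r *: (cR sig *: l).
pose Y j (l : L) := y j (lam l) / cR S ^+ (k.+1 - j).
pose Y' (j : 'I_k) (l : L) := ze ^+ j / ze * y' j (lam l) / cR S ^+ (k.+1 - j).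
pose MU (l : L) := mu (lam l) * cR S ^+ k.
pose MU' (l : L) := mu' (lam l) * cR S ^+ k.
have Sj (j : 'I_k) (B : R) : 0 <= B -> B <= My2 -> nrm (cR S ^+ (k.+1 - j))^-1 * (sig * B) <= eta.
  move=> B0 BM; rewrite nrmV nrmX nrm_cR0 ?(ltW S0) // ler_pdivrMl ?exprn_gt0 //.
  apply: le_trans (_ : sig * My2 <= _); first by rewrite ler_wpM2l // ltW.
  apply: le_trans sigM _; rewrite mulrC ler_wpM2r ?(ltW eta_gt0) //.
  by apply: ler_wiXn2l; rewrite ?(ltW S0) ?leq_subr // Sle1.
have mY j : @mass R (par R m) (Y j) eta.
  have h := @mass_par_small R m (fun l => y j (cR r *: l)) sig My sig01 _ (hry j).
  have {}h := h _; apply: mass_ext (mass_le (Sj j My My0 _) (massZ (cR S ^+ (k.+1 - j))^-1 (h _))).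
  - by move=> z _; rewrite /Y mulrC.
  - by rewrite /My2; clear - My0'; lra.
  - by rewrite scaler0 hy0.
have mY' j : @mass R (par R m) (Y' j) eta.
  have h := @mass_par_small R m (fun l => y' j (cR r *: l)) sig My' sig01 _ (hry' j).
  apply: mass_ext (mass_le (Sj j My' My0' _) (massZ (cR S ^+ (k.+1 - j))^-1 (mass_le _ (massZ (ze ^+ j / ze) (h _))))).
  - by move=> z _; rewrite /Y' mulrC.
  - by rewrite /My2; clear - My0; lra.
  - by rewrite nrmM nrmV nrmX nze expr1n invr1 !mul1r.
  - by rewrite scaler0 hy0'.
have nSk : nrm (cR S ^+ k) <= S by rewrite nrmX nrm_cR0 ?(ltW S0).
have mMU : @mass R (par R m) MU eta.
  have h := massZ (cR S ^+ k) (mass_par_scale sig01 hrm).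
  by apply: mass_ext (mass_le _ h) => [z _|]; [rewrite /MU mulrC|nra].
have mMU' : @mass R (par R m) MU' eta.
  have h := massZ (cR S ^+ k) (mass_par_scale sig01 hrm').
  by apply: mass_ext (mass_le _ h) => [z _|]; [rewrite /MU' mulrC|nra].
have hsl (l : L) : @mdom R (par R m) l -> @mdom R (par R m) (cR sig *: l).
  by move=> hl i; rewrite mxE nrmM nrm_cR0 ?(ltW sig0) // mulr_ile1 ?nrm_ge0 ?(ltW sig0) //; exact: hl.
have SE : cR S = cR r * cR (rho / 2) by rewrite /S cRM.
have half_scale x : nrm x <= 1 -> nrm (cR (rho / 2) * x) < 1.
  have rho2 : 0 < rho / 2 by rewrite divr_gt0.
  rewrite nrmM nrm_cR0 ?(ltW rho2) //; clear - rho0 rho1; move: rho rho0 rho1 => q q0 q1.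
  by have := nrm_ge0 x; nra.
pose Phi x l := x + ev (Q := ext (par R m)) psi (x, l).
have cPhi x l : nrm x <= 1 -> @mdom R (par R m) l ->
    ev (Q := ext (par R m)) c (cR (rho / 2) * x, cR sig *: l) = ze * (cR S * Phi x l).
  move=> hx hl; rewrite SE -mulrA /Phi -psiE //.
  have nx : nrm (cR (rho / 2) * x) <= 1.
    apply: ltW; exact: half_scale.
  have h1 := @ev_hsum R (ext (par R m)) c Mp (cR (rho / 2) * x, cR sig *: l) hc (conj nx (hsl l hl)).
  have -> : ev (Q := ext (par R m)) ct (cR (rho / 2) * x, cR sig *: l) =
     ze^-1 * (cR r)^-1 * ev (Q := ext (par R m)) c (cR (rho / 2) * x, cR sig *: l).
    by apply: hsE; apply: hsum_ext (hsumZ _ h1) => a; rewrite /ct !mulrA.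
  by field; rewrite ze0 rn.
have cdPhi x l : nrm x <= 1 -> @mdom R (par R m) l ->
    (cR r)^-1 * dev c (cR (rho / 2) * x, cR sig *: l) = ze * (1 + dev psi (x, l)).
  move=> hx hl; rewrite -psiD //.
  have nx : nrm (cR (rho / 2) * x) < 1.
    exact: half_scale.
  have hcl : absb (fun a : nat * {ffun 'I_m -> nat} => c a * pmon a.2 (cR sig *: l)) Mp.
    by apply: absb_mono hc => a; rewrite nrmM ler_piMr ?nrm_ge0 //; exact: (@mv_le1 R (par R m) _ _ (hsl l hl)).
  have h1 := dser_hsum fst hcl (nrm_ge0 _) nx (lexx _).
  have e1 : dser fst (fun a : nat * {ffun 'I_m -> nat} => c a * pmon a.2 (cR sig *: l)) (cR (rho / 2) * x) =
      dev c (cR (rho / 2) * x, cR sig *: l).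
    by rewrite /dser /dev; congr (hs _); apply/funext => a /=; ring.
  rewrite e1 in h1.
  have -> : dev ct (cR (rho / 2) * x, cR sig *: l) = ze^-1 * (cR r)^-1 * dev c (cR (rho / 2) * x, cR sig *: l).
    by apply: hsE; apply: hsum_ext (hsumZ (ze^-1 * (cR r)^-1) h1) => a; rewrite /ct /=; ring.
  by field; rewrite ze0 rn.
have hpsi' : absb (fun a => a.1.+1%:R * psi a) eta by apply: absb_le hpsi.
have den (nu : C) (w : C) (B : R) : nrm nu <= B -> nrm w <= 2 * S -> 2 * B * rho <= eta -> 0 <= B ->
    1 + nu * w ^+ k != 0.
  move=> h1 h2 h3 B0; rewrite -nrm_gt0; have := nrm_geB 1 (nu * w ^+ k); rewrite nrm1.
  have h4 := nrm_leM h1 (nrm_leX k h2).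
  have h5 : B * (2 * S) ^+ k <= B * rho by rewrite ler_wpM2l // (le_trans S2k).
  clear - h3 h4 h5 eta_le1; move: (nrm _) h4 => q h4; move: (B * _) h4 h5 => p h4 h5; lra.
have hphi2 x l : nrm x <= 1 -> @mdom R (par R m) l -> nrm (Phi x l) <= 2.
  move=> hx hl; have hz : @mdom R (ext (par R m)) (x, l) by [].
  have hp1 : absb psi eta.
    apply: absb_mono hpsi' => a; by rewrite nrmM nrm_nat ler_peMl ?nrm_ge0 // ler1n.
  apply: le_trans (nrm_leD hx (mass_sup (mass_ev (Q := ext (par R m)) hp1) hz)) _; lra.
have hcj x l : nrm x <= 1 -> @mdom R (par R m) l ->
    npoly (Y' ^~ l) (Phi x l) * (1 + MU l * x ^+ k) =
    (1 + MU' l * Phi x l ^+ k) * npoly (Y ^~ l) x * (1 + dev psi (x, l)).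
  move=> hx hl; have nx : nrm (cR (rho / 2) * x) < 1.
    exact: half_scale.
  have := conj1 _ _ nx (hsl l hl); rewrite -/(lam l) cPhi // cdPhi // [cR r * (_ * _)]mulrA -SE.
  rewrite npoly_rot // -(npoly_scale (fun j => ze ^+ j / ze * y' j (lam l)) (Phi x l) Sn).
  rewrite -(npoly_scale (y ^~ (lam l)) x Sn).
  rewrite -[npoly _ (Phi x l)]/(npoly (Y' ^~ l) (Phi x l)) -[npoly _ x]/(npoly (Y ^~ l) x).
  have d1 : 1 + mu (lam l) * (cR S * x) ^+ k != 0.
    apply: (den _ _ Mm) => //; first exact: (mass_sup hrm (hsl l hl)).
    rewrite nrmM nrm_cR0 ?(ltW S0) // mulrC ler_pM2r //; apply: le_trans hx _; exact: ler1n.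
  have d2 : 1 + mu' (lam l) * (ze * (cR S * Phi x l)) ^+ k != 0.
    apply: (den _ _ Mm') => //; first exact: (mass_sup hrm' (hsl l hl)).
    rewrite nrmM nze mul1r nrmM nrm_cR0 ?(ltW S0) // mulrC ler_wpM2r ?(ltW S0) //; exact: hphi2.
  have eA : 1 + MU l * x ^+ k = 1 + mu (lam l) * (cR S * x) ^+ k by rewrite /MU exprMn mulrA.
  have eB : 1 + MU' l * Phi x l ^+ k = 1 + mu' (lam l) * (ze * (cR S * Phi x l)) ^+ k.
    by rewrite /MU' !exprMn zek mul1r mulrA.
  rewrite eA eB; move: d1 d2; set A := 1 + mu _ * _; set B := 1 + mu' _ * _ => d1 d2 hE.
  have Sk1 : cR S ^+ k.+1 != 0 by rewrite expf_neq0.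
  apply: (mulfI (mulf_neq0 ze0 Sk1)).
  transitivity (ze * (npoly (Y' ^~ l) (Phi x l) * cR S ^+ k.+1) / B * (A * B)); first by field.
  by rewrite hE; field.
have [T [[MT hT] hTl]] := hrig eta Y Y' MU MU' psi eta_gt0 eta_le mY mY' mMU mMU' hpsi' hcj.
pose rs := r * sig.
have rs0 : 0 < rs by rewrite mulr_gt0.
pose t l := (2 * cR S ^+ k)^-1 * T ((cR rs)^-1 *: l).
have rsn : cR rs != 0 by rewrite cR_eq0 gt_eqF.
have lamE l : lam ((cR rs)^-1 *: l) = l.
  by rewrite /lam !scalerA /rs cRM -cRM mulfV ?scale1r.
have lamD (l : L) : (forall i, nrm (l 0 i) < rs) -> @mdom R (par R m) ((cR rs)^-1 *: l).
  exact: unscale_dom.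
exists l0, t; split.
- exact: germZ (mass_germ rs0 hT).
- apply/near_rV; exists rs => // l hl; have [E1 E2 _] := hTl _ (lamD l hl).
  split; last by move: E2; rewrite /MU' /MU lamE; apply: mulIf; rewrite expf_neq0.
  move=> j; have := E1 j; rewrite /Y' /Y lamE => /(mulIf _) h.
  rewrite rot_coefE -/ze -h ?invr_eq0 ?expf_neq0 //.
  by field; rewrite ?ze0 ?expf_neq0.
- apply/near_pair; exists (Num.min S rs); first by rewrite lt_min S0.
  move=> x l; rewrite lt_min => /andP[hx _] hl /=.
  have hl' : forall i, nrm (l 0 i) < rs by move=> i; have := hl i; rewrite lt_min => /andP[].
  have hld := lamD l hl'; have [E1 E2 E3] := hTl _ hld.
  set l1 := (cR rs)^-1 *: l in hld E1 E2 E3.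
  pose X := (cR S)^-1 * x.
  have xX : x = cR S * X by rewrite /X mulrA divff // mul1r.
  have hX : nrm X <= 1 by rewrite nrmM nrmV nrm_cR0 ?(ltW S0) // ler_pdivrMl // mulr1 ltW.
  have [gam [gams [[Mg hg] g0 g1 hgs]]] := E3 X hX.
  exists (cR S * gam 2^-1).
    have := @flow_unscale (y ^~ l) (mu l) (T l1) (cR S) X gam gams Mg Sn hg g0 _.
    have -> : T l1 / (2 * cR S ^+ k) = t l by rewrite /t mulrC.
    rewrite -xX => h; apply: h => s s1.
    by have := hgs s s1; rewrite /MU /Y /l1 lamE.
  rewrite g1 -/(Phi X l1).
  have nx : nrm (cR (rho / 2) * X) < 1.
    exact: half_scale.
  rewrite -/ze -cPhi // -(cE _ _ (ltW nx) (hsl _ hld)) -/(lam l1) lamE; congr (phi _ _); by rewrite mulrA -SE -xX.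
Qed.

End NormalFormSymmetry.

(** * The action of the cyclic group on normal forms *)

Section Rotation.
Variable R : realType.
Local Notation C := (Cplx R).
Variables (k m : nat).
Local Notation L := ('rV[C]_m).

Lemma rotation_conjugacy (y : 'I_k -> L -> C) (mu : L -> C) (l : 'I_k) :
  form_B_data y mu ->
  form_B_data (rot_coef l y) mu /\
  is_conjugacy (fun x _ => rot_factor R l * x) (form_B y mu) (form_B (rot_coef l y) mu).
Proof.
move=> [hy hmu hy0]; have kpos : (0 < k)%N := leq_ltn_trans (leq0n l) (ltn_ord l).
have z0 := rot_factor_neq0 R l; have zk := rot_factorXk R kpos l.
have dz x : derive1 (fun u => rot_factor R l * u) x = rot_factor R l.
  by apply: derive1_is_derive; rewrite -[X in is_derive _ _ _ X]mulr1; exact: dZ (did x).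
split.
  split=> [j||j]; [exact: (germZ _ (hy j))|exact: hmu|by rewrite /rot_coef hy0 mulr0].
split.
- apply/family_mass; exists 1, (nrm (rot_factor R l) * 1); split=> //.
  by apply: mass_ext (massZ (rot_factor R l) (mass_x (par R m))) => z _; rewrite cR1 mul1r.
- by rewrite mulr0.
- by rewrite dz.
- apply/near_pair; exists 1 => // x v _ _ /=; rewrite dz.
  rewrite -[form_B (rot_coef l y) mu _ _]/(npoly (fun j => rot_coef l y j v) (rot_factor R l * x) /
    (1 + mu v * (rot_factor R l * x) ^+ k)) -[form_B y mu _ _]/(npoly (y ^~ v) x / (1 + mu v * x ^+ k)).
  rewrite npoly_rot // exprMn zk mul1r.
  have -> : (fun j : 'I_k => rot_factor R l ^+ j / rot_factor R l * rot_coef l y j v) = y ^~ v.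
    by apply/funext => j; rewrite rot_coefE; field; rewrite z0 expf_neq0.
  ring.
Qed.

End Rotation.

(** * The linear case: analytic logarithms and Taylor coefficients *)

Section LinearCase.
Variable R : realType.
Local Notation C := (Cplx R).
Variable m : nat.
Local Notation L := ('rV[C]_m).

Lemma mass_near (f : L -> C) M (e : R) : @mass R (par R m) f M -> 0 < e ->
  exists2 sig : R, 0 < sig <= 1 & @mass R (par R m) (fun l => f (cR sig *: l) - f 0) e.
Proof.
move=> hf e0; have h1 := massB hf (mass_const (par R m) (f 0)).
pose N := M + nrm (f 0) + 1.
have N0 : 0 < N by rewrite /N; have := mass_ge0 h1; lra.
pose sig := Num.min 1 (e / N).
have s0 : 0 < sig by rewrite lt_min ltr01 divr_gt0.
have s1 : sig <= 1 by rewrite ge_min lexx.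
have sN : sig * N <= e by rewrite -ler_pdivlMr // ge_min lexx orbT.
exists sig; first by rewrite s0.
have hs : 0 <= sig <= 1 by rewrite (ltW s0).
have := mass_par_small (f := fun l => f l - f 0) hs (subrr _) h1.
by apply: mass_le; rewrite /N in sN; nra.
Qed.

Lemma germ_near (f : L -> C) (e : R) : analytic_germ f -> 0 < e ->
  exists2 r : R, 0 < r & @mass R (par R m) (fun l => f (cR r *: l) - f 0) e.
Proof.
move=> /germ_mass[r [M [r0 h]]] e0; have [s /andP[s0 _] hs] := mass_near h e0.
exists (r * s); first by rewrite mulr_gt0.
by apply: mass_ext hs => z _; rewrite scaler0 scalerA cRM.
Qed.

Lemma cexp_bound (z : C) : nrm z <= 2^-1 -> nrm (cexp z) <= 4.
Proof.
move=> hz; have h := cexp_quadratic hz.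
have -> : cexp z = (cexp z - 1 - z) + (1 + z) by ring.
have h2 := nrm_leD (lexx (nrm (1 : C))) hz; rewrite nrm1 in h2.
have h3 : nrm z ^+ 2 <= 4^-1.
  by have := nrm_ge0 z; rewrite expr2; nra.
apply: le_trans (nrm_leD h h2) _; lra.
Qed.

Lemma cexp_qd (t : C) : nrm t <= 2^-1 ->
  qd 2^-1 24 (fun s => cexp (t * s)) (fun s => t * cexp (t * s)).
Proof.
move=> ht x h hx hxh.
have hh : nrm h <= 1.
  by rewrite (_ : h = (x + h) + - x); [apply: le_trans (nrmB _ _) _; lra|ring].
have th : nrm (t * h) <= 2^-1 by rewrite nrmM; have := nrm_ge0 h; have := nrm_ge0 t; nra.
have tx : nrm (t * x) <= 2^-1 by rewrite nrmM; have := nrm_ge0 x; have := nrm_ge0 t; nra.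
have -> : cexp (t * (x + h)) - cexp (t * x) - h * (t * cexp (t * x)) =
  cexp (t * x) * (cexp (t * h) - 1 - t * h) by rewrite mulrDr cexpD; ring.
apply: le_trans (nrm_leM (cexp_bound tx) (cexp_quadratic th)) _.
have : nrm (t * h) ^+ 2 <= nrm h ^+ 2.
  rewrite lerXn2r ?nnegrE ?nrm_ge0 // nrmM; have := nrm_ge0 h; have := nrm_ge0 t; nra.
lra.
Qed.

(** The difference f - exp (t s) solves the same linear equation and vanishes at s = 0, so the
    Gronwall argument kills it on [0, 1/2]. *)
Lemma exp_ode_unique (f f' : C -> C) (t : C) M : umass f M -> nrm t <= 2^-1 -> f 0 = 1 ->
  (forall s, nrm s < 1 -> is_derive s (1 : C) f (f' s)) ->
  (forall s, nrm s <= 2^-1 -> f' s = t * f s) -> f 2^-1 = cexp (t * 2^-1).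
Proof.
move=> hf ht f0 hd hode; have [g [hq hg]] := umass_qd hf.
have r0 : (0 : R) <= 2^-1 by lra.
have r1 : (2^-1 : R) < 1 by lra.
have eg s : nrm s <= 2^-1 -> g s = t * f s.
  move=> hs; have s1 : nrm s < 1 by lra.
  by rewrite (is_derive_unique (hg s s1) (hd s s1)) hode.
have hK := hq _ r0 r1.
have hcq := cexp_qd ht.
pose D s := f s - cexp (t * s); pose D' s := g s - t * cexp (t * s).
have qD : qd 2^-1 (M * (1 - 2^-1)^-1 ^+ 2 + 24) D D'.
  move=> x h hx hxh; rewrite [leRHS]mulrDl.
  have -> : D (x + h) - D x - h * D' x = (f (x + h) - f x - h * g x) +
     - (cexp (t * (x + h)) - cexp (t * x) - h * (t * cexp (t * x))) by rewrite /D /D'; ring.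
  by apply: nrm_leD; [exact: hK|rewrite nrmN; exact: hcq].
have D0 : D 0 = 0 by rewrite /D f0 mulr0 cexp0 subrr.
have DM s : nrm s <= 2^-1 -> nrm (D s) <= M + 4.
  move=> hs; apply: le_trans (nrmB _ _) _; apply: lerD.
    by apply: (@mass_sup R (ext (par R 0)) _ _ (s, 0) hf); split=> /=; [lra|exact: dom0].
  by apply: cexp_bound; rewrite nrmM; have := nrm_ge0 s; have := nrm_ge0 t; nra.
have Db s : nrm s <= 2^-1 -> nrm (D' s) <= nrm (D s).
  move=> hs; have -> : D' s = t * D s by rewrite /D' /D eg //; ring.
  by rewrite nrmM; have := nrm_ge0 (D s); nra.
have := linear_ode_zero_qd qD D0 DM Db (s := 2^-1); rewrite cRV cRn => h.
apply: subr0_eq; apply: h; apply/andP; split; lra.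
Qed.

(* Obtained from the linear flow E_s = t E, the case k = 0 of [flow_exists]. *)
Lemma analytic_log (f : L -> C) : analytic_germ f -> f 0 != 0 ->
  exists2 t : L -> C, analytic_germ t & \forall l \near (0 : L), cexp (t l) = f l.
Proof.
move=> hf f0; have [t0 et0] := cexp_surj f0.
have [D [D0 [eta0 /andP[e00 e01] hflow]]] := @flow_exists R (par R m) 0.
(* Then |ft| <= 4 eta <= 1/2, as [exp_ode_unique] requires. *)
pose eta := eta0 / 8.
have eta_gt0 : 0 < eta by rewrite divr_gt0.
have eta_le : eta <= eta0 by rewrite /eta; lra.
have hg : analytic_germ (fun l => (f 0)^-1 * f l) by exact: germZ.
have [r r0 hr] := germ_near hg eta_gt0.
pose tau : mt (par R m) -> C := fun l => (f 0)^-1 * f (cR r *: l) - 1.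
have mtau : @mass R (par R m) tau eta.
  by apply: mass_ext hr => l _; rewrite mulVf.
have my0 (i : 'I_0) : @mass R (par R m) (fun=> 0) eta by case: i.
have mmu0 : @mass R (par R m) (fun=> 0) eta by apply: mass0; exact: ltW.
have [u [hu hH mt_ mE]] := hflow eta (fun _ => fun=> 0) (fun=> 0) tau eta_gt0 eta_le my0 mmu0 mtau.
have key l : @mdom R (par R m) l -> cexp (ft tau u l * 2^-1) = 1 + tau l.
  (* This path starts at 1, twice the initial value 1/2, and reaches 1 + tau at s = 1/2, so that ft
     / 2 is a logarithm of 1 + tau. *)
  move=> hl; pose f1 s := fE 0 tau u (s, (2^-1, l)).
  have hh := half_le1 R.
  have hx : @mdom R (ext (par R m)) (2^-1, l) by [].
  have md : umass (fun s => f1 s - 1) (D * eta).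
    have [d [hd hdE]] := mE.
    apply: (@mass_sum R (ext (par R 0)) (mi (ext (ext (par R m))))
      (fun a z => d a * @mv R (ext (par R m)) a.2 (2^-1, l) * z.1 ^+ a.1) (fun a => nrm (d a))) => //.
      move=> a; apply: mass_le (massZ _ (mass_xn (par R 0) a.1)); rewrite mulr1 nrmM ler_piMr ?nrm_ge0 //.
      exact: mv_le1.
    move=> [s v] [/= hs _]; have := hdE (s, (2^-1, l)) (conj hs hx).
    rewrite /= mulfV ?pnatr_eq0 //; apply: hsum_ext => -[j [i b]]; rewrite /= /emon /= -!mulrA; congr (_ * _); rewrite mulrC -mulrA //.
  have mf1 : umass f1 (D * eta + nrm (1 : C)).
    apply: mass_ext (massD md (mass_const (ext (par R 0)) 1)) => z _; by rewrite subrK.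
  have nt : nrm (ft tau u l) <= 2^-1.
    by apply: le_trans (mass_sup mt_ hl) _; rewrite /eta; lra.
  have f10 : f1 0 = 1 by rewrite /f1 fE_init mulfV // pnatr_eq0.
  have hd s : nrm s < 1 -> is_derive s (1 : C) f1 (fEs 0 tau u (s, (2^-1, l))).
    by move=> hs; exact: (fE_derive 0 tau hu hs hh hl).
  have hode s : nrm s <= 2^-1 -> fEs 0 tau u (s, (2^-1, l)) = ft tau u l * f1 s.
    move=> hs; have hs1 : nrm s <= 1 by lra.
    have := hH (s, (2^-1, l)) (conj hs1 hx); rewrite /fH /= mul0r addr0 mul1r big_ord0 addr0 expr1.
    exact: subr0_eq.
  have := exp_ode_unique mf1 nt f10 hd hode; rewrite /f1 fE_end => ->.
  by [].
exists (fun l => t0 + 2^-1 * ft tau u ((cR r)^-1 *: l)).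
  apply/germ_mass; exists r, (nrm t0 + nrm (2^-1 : C) * (4 * eta)); split=> //.
  apply: mass_ext (massD (mass_const (par R m) t0) (massZ 2^-1 mt_)) => z _.
  by rewrite scalerA mulVf ?scale1r // cR_eq0 gt_eqF.
apply/near_rV; exists r => // l hl.
have hl1 : @mdom R (par R m) ((cR r)^-1 *: l).
  exact: unscale_dom.
rewrite cexpD et0 [2^-1 * _]mulrC key // /tau unscaleK //.
by rewrite addrC subrK mulrA mulfV // mul1r.
Qed.

End LinearCase.

Section LinearRigidity.
Variable R : realType.
Local Notation C := (Cplx R).
Variable m : nat.
Local Notation L := ('rV[C]_m).

Lemma dev_slice (g : nat * {ffun 'I_m -> nat} -> C) M X l : absb g M -> nrm X < 1 ->
  @mdom R (par R m) l ->
  dev g (X, l) = dser id (fun j => ev (Q := par R m) (fun b => g (j, b)) l) X.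
Proof.
move=> hg hX hl; have [ha hE] := @slice R (par R m) g _ l hg hl.
have h1 := ser_derive id ha hX.
have p0 : 0 < 1 - nrm X by rewrite subr_gt0.
apply: is_derive_unique (ev_derive hg hX hl) _.
apply: (is_derive_near p0 _ h1) => v hv.
apply: hsE; apply: hE; have -> : v = (v - X) + X by rewrite subrK.
by apply: le_trans (nrmD _ _) _; rewrite -lerBrDr ltW.
Qed.

Lemma germ_neq0 (f : L -> C) : analytic_germ f -> f 0 != 0 ->
  exists2 r : R, 0 < r & forall l : L, (forall i, nrm (l 0 i) < r) -> f l != 0.
Proof.
move=> hf f0; have e0 : 0 < nrm (f 0) / 2 by rewrite divr_gt0 // nrm_gt0.
have [r r0 hr] := germ_near hf e0; exists r => // l hl.
have := mass_sup hr (unscale_dom r0 hl); rewrite unscaleK //.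
by move=> h; apply: contraTneq h => ->; rewrite sub0r nrmN -ltNge; lra.
Qed.

(** The coefficients a_j of phi in x satisfy (c' - j c) a_j = 0. The nonzero a_1 gives c' = c, and
    then a_j = 0 for every other j because c does not vanish nearby; t is a logarithm of a_1, up to
    the scale. *)
Lemma linear_rigidity (c c' : L -> C) (phi : C -> L -> C) :
  analytic_germ c -> c 0 != 0 -> is_conjugacy phi (form_A c) (form_A c') ->
  (\forall lam \near (0 : L), c' lam = c lam) /\
  exists2 t : L -> C, analytic_germ t &
    \forall z \near ((0, 0) : C * L), phi z.1 z.2 = cexp (t z.2) * z.1.
Proof.
move=> hc c0 [hphi phi0 dphi /near_pair[rc rc0 hconj]].
have [r1 r10 cn] := germ_neq0 hc c0.
have /family_mass[rp [Mp [rp0 hrp]]] := hphi.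
pose r : R := Num.min (Num.min (r1 / 2) rp) (rc / 2).
have r0 : 0 < r by rewrite !lt_min rp0 !divr_gt0.
have rle1 : r < r1 by apply: (@le_lt_trans _ _ (r1 / 2)); [rewrite !ge_min lexx|lra].
have rle2 : r <= rp by rewrite !ge_min lexx !orbT.
have rle3 : r < rc by apply: (@le_lt_trans _ _ (rc / 2)); [rewrite !ge_min lexx orbT|lra].
have [g [hg gE gD]] := phi_chart r0 (family_shrink r0 rle2 hrp).
have rn : cR r != 0 by rewrite cR_eq0 gt_eqF.
pose a j (l : L) := ev (Q := par R m) (fun b => g (j, b)) l.
have d00 := @dom_0 R m.
have ha l : @mdom R (par R m) l -> absb (a ^~ l) Mp by move=> hl; have [] := @slice R (par R m) g _ l hg hl.
have ma j : @mass R (par R m) (a j) Mp.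
  by apply: mass_ev; apply: (absb_inj (h := pair j)) hg => b b' [].
have a0 : a 1%N 0 != 0.
  have n01 : nrm (0 : C) < 1 by rewrite nrm0.
  have := derive1_is_derive (gD _ _ n01 d00); rewrite mulr0 scaler0 (dev_slice hg n01 d00).
  have -> : dser id (a ^~ 0) 0 = a 1%N 0.
    apply: hsE; have := @hsum_single R _ (fun j => a j 0 * (j%:R * 0 ^+ j.-1)) 1%N.
    rewrite expr0 !mulr1; apply=> -[|[|j]] // _; first by rewrite !mul0r mulr0.
    by rewrite /= expr0n /= !mulr0.
  by move=> h; move: dphi; rewrite h mulf_eq0 negb_or => /andP[].
have hdom (l : L) : (forall i, nrm (l 0 i) < r) -> @mdom R (par R m) ((cR r)^-1 *: l).
  exact: unscale_dom.
have scl (l : L) : cR r *: ((cR r)^-1 *: l) = l by exact: unscaleK.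
have ac (l : L) j : (forall i, nrm (l 0 i) < r) -> (c' l - j%:R * c l) * a j ((cR r)^-1 *: l) = 0.
  move=> hl; have hd := hdom l hl; set l1 := _ *: l in hd *.
  have two0 : (2^-1 : C) ^+ j != 0 by rewrite expf_neq0 // invr_eq0 pnatr_eq0.
  have n2 : nrm (2^-1 : C) = 2^-1 by rewrite nrmV nrm_nat.
  (* The factors 1/2^i, from halving the variable, make the family i a_i absolutely summable. *)
  pose w i := (c' l - i%:R * c l) * (a i l1 * 2^-1 ^+ i).
  suff : w j = 0 by move=> /eqP; rewrite /w mulrA mulf_eq0 (negbTE two0) orbF => /eqP.
  have hw : absb w (nrm (c' l) * Mp + nrm (c l) * Mp).
    have hA : absb (fun i => a i l1 * 2^-1 ^+ i) Mp.
      apply: absb_mono (ha _ hd) => i; rewrite nrmM nrmX n2 ler_piMr ?nrm_ge0 //.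
      by rewrite exprn_ile1 // ?invr_ge0 // invf_le1 // ler1n.
    have hB : absb (fun i => i%:R * (a i l1 * 2^-1 ^+ i)) Mp.
      apply: absb_mono (ha _ hd) => i; rewrite mulrCA nrmM ler_piMr ?nrm_ge0 //.
      rewrite nrmM nrm_nat nrmX n2; apply: le_trans (half_pow_weight R i).
      by rewrite ler_wpM2r ?exprn_ge0 ?invr_ge0 // ler_nat.
    apply: absb_mono (absbD (absbZ (c' l) hA) (absbN (absbZ (c l) hB))) => i.
    rewrite le_eqVlt; apply/orP; left; apply/eqP; congr nrm; rewrite /w; ring.
  apply: (series_zero hw ltr01) => Y hY _.
  have hX : nrm (2^-1 * Y) < 1 by rewrite nrmM n2; have := nrm_ge0 Y; lra.
  have [_ hE] := @slice R (par R m) g _ _ hg hd.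
  have h1 := hsumZ (c' l) (hE _ (ltW hX)).
  have h2 := hsumZ (c l * (2^-1 * Y)) (dser_hsum id (ha _ hd) (nrm_ge0 _) hX (lexx _)).
  have hcj : c' l * ev (Q := ext (par R m)) g (2^-1 * Y, l1) =
     c l * (2^-1 * Y) * dser id (a ^~ l1) (2^-1 * Y).
    have := hconj (cR r * (2^-1 * Y)) l; rewrite /form_A /= -(scl l) gE ?(ltW hX) //.
    rewrite (derive1_is_derive (gD _ _ hX hd)) -/l1 (dev_slice hg hX hd) scl => -> //.
    - by rewrite /a; field.
    - rewrite nrmM nrm_cR0 ?(ltW r0) //; apply: le_lt_trans rle3.
      by rewrite ler_piMr // ltW.
    - by move=> i; apply: lt_trans rle3.
  have h3 := hsumB h1 h2; rewrite hcj subrr in h3.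
  apply: hsum_ext h3 => i; rewrite /w -/(a i l1) exprMn.
  case: i => [|i]; move: (a _ l1) => b; rewrite ?exprMn ?exprS /=; ring.
have hf : analytic_germ (fun l => (cR r)^-1 * a 1%N ((cR r)^-1 *: l)).
  exact: germZ (mass_germ r0 (ma 1%N)).
have f0 : (cR r)^-1 * a 1%N ((cR r)^-1 *: 0) != 0 by rewrite scaler0 mulf_neq0 ?invr_eq0.
have [r2 r20 fn] := germ_neq0 hf f0.
pose s := Num.min r r2; have s0 : 0 < s by rewrite lt_min r0.
have sr : s <= r by rewrite ge_min lexx.
have s2 : s <= r2 by rewrite ge_min lexx orbT.
have cc (l : L) : (forall i, nrm (l 0 i) < s) -> c' l = c l.
  move=> hl; have hlr i : nrm (l 0 i) < r by apply: lt_le_trans sr.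
  have hl2 i : nrm (l 0 i) < r2 by apply: lt_le_trans s2.
  have := fn l hl2; rewrite mulf_eq0 negb_or => /andP[_ an].
  have /eqP := ac l 1%N hlr; rewrite mulf_eq0 (negbTE an) orbF mul1r subr_eq0 => /eqP //.
split; first by apply/near_rV; exists s.
have [t ht /near_rV[r3 r30 htE]] := analytic_log hf f0.
exists t => //; apply/near_pair; exists (Num.min s r3); first by rewrite lt_min s0.
move=> x l; rewrite lt_min => /andP[hx _] hl /=.
have hls i : nrm (l 0 i) < s by have := hl i; rewrite lt_min => /andP[].
have hl3 i : nrm (l 0 i) < r3 by have := hl i; rewrite lt_min => /andP[].
have hlr i : nrm (l 0 i) < r by apply: lt_le_trans sr.
rewrite htE //; have hd := hdom l hlr.
have [_ hE] := @slice R (par R m) g _ _ hg hd.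
have hX : nrm ((cR r)^-1 * x) <= 1.
  by rewrite nrmM nrmV nrm_cR0 ?(ltW r0) // ler_pdivrMl // mulr1 ltW // (lt_le_trans hx).
have xE : cR r * ((cR r)^-1 * x) = x by rewrite mulrA mulfV // mul1r.
rewrite -{1}xE -{1}(scl l) gE //.
have -> : (cR r)^-1 * a 1%N ((cR r)^-1 *: l) * x = a 1%N ((cR r)^-1 *: l) * ((cR r)^-1 * x) ^+ 1.
  by rewrite expr1; ring.
apply: hsum_unique (hE _ hX) _; apply: hsum_single => j j1.
have : a j ((cR r)^-1 *: l) = 0; last by rewrite /a => ->; rewrite mul0r.
have cl : c l != 0 by apply: cn => i; apply: lt_trans (hlr i) _.
have := ac l j hlr; rewrite cc // -{1}[c l]mul1r -mulrBl => /eqP.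
rewrite !mulf_eq0 (negbTE cl) orbF subr_eq0 => /orP[|/eqP //].
by rewrite -[1]/(1%:R) eqr_nat eq_sym (negbTE j1).
Qed.

End LinearRigidity.

Section Uniqueness.
Variable R : realType.
Local Notation C := (Cplx R).
Variable m : nat.
Local Notation L := ('rV[C]_m).

Lemma normal_form_unique1 (y y' : 'I_1 -> L -> C) (mu mu' : L -> C) :
  form_B_data y mu -> form_B_data y' mu' -> conjugate (form_B y mu) (form_B y' mu') ->
  \forall lam \near (0 : L), (forall j, y' j lam = y j lam) /\ mu' lam = mu lam.
Proof.
move=> hy hy' [phi hphi].
have [l [t [_ hl _]]] := normal_form_rigidity (ltn0Sn 0) hy hy' hphi.
move: hl; apply: filterS => lam [h ->]; split=> // j; rewrite h.
by rewrite /rot_coef (ord1 l) mulr0 mul0r oppr0 cexp0 mul1r.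
Qed.

End Uniqueness.

(** * Residues *)

Section AnalyticAtPoint.
Variable R : realType.
Local Notation C := (Cplx R).
Implicit Types (f g : C -> C) (p : C).

Lemma near_all p (P : C -> Prop) : (forall x, P x) -> \forall x \near p, P x.
Proof. by move=> h; apply/near_C; exists 1. Qed.

Lemma umass_nat f M : umass f M -> exists c : nat -> C, absb c M /\
  forall s, nrm s <= 1 -> hsum (fun j => c j * s ^+ j) (f s).
Proof.
move=> [c [hc hf]]; have [h1 h2] := @slice R (par R 0) c M 0 hc (@dom0 R 0).
exists (fun j => ev (Q := par R 0) (fun b => c (j, b)) 0); split=> // s hs.
have -> : f s = ev (Q := ext (par R 0)) c (s, 0); last exact: h2.
by apply/esym/hsE; exact: (hf (s, 0) (conj hs (@dom0 R 0))).
Qed.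

Lemma umass_nat_ser f M : umass f M -> exists2 c : nat -> C, absb c M &
  forall s, nrm s <= 1 -> f s = ser id c s.
Proof.
move=> /umass_nat[c [hc h]]; exists c => // s hs; apply/esym/hsE; exact: h.
Qed.

Lemma umass_shrink f M (s : R) : 0 <= s <= 1 -> umass f M -> umass (fun z => f (cR s * z)) M.
Proof.
move=> hs hf; have h1 : 0 <= (1 : R) <= 1 by rewrite ler01 lexx.
exact: (@mass_scale R 0 (fun z => f z.1) s 1 M hs h1 hf).
Qed.

Lemma at1E f p : analytic_at1 f p <->
  exists r M : R, 0 < r /\ umass (fun z => f (p + cR r * z)) M.
Proof. exact: at1_mass. Qed.

Lemma at1_shrink f p (r r' M : R) : 0 < r' -> r' <= r ->
  umass (fun z => f (p + cR r * z)) M -> umass (fun z => f (p + cR r' * z)) M.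
Proof.
move=> r0 rr h; have rp : 0 < r by exact: lt_le_trans rr.
have hq : 0 <= r' / r <= 1 by rewrite divr_ge0 ?(ltW r0) ?(ltW rp) //= ler_pdivrMr // mul1r.
apply: mass_ext (umass_shrink hq h) => z _.
by congr (f (_ + _)); rewrite mulrA -cRM mulrCA divff ?mulr1 // gt_eqF.
Qed.

Lemma at1_common f g p : analytic_at1 f p -> analytic_at1 g p ->
  exists r M N : R, [/\ 0 < r, umass (fun z => f (p + cR r * z)) M &
    umass (fun z => g (p + cR r * z)) N].
Proof.
move=> /at1E[r1 [M [r10 h1]]] /at1E[r2 [N [r20 h2]]].
have r0 : 0 < Num.min r1 r2 by rewrite lt_min r10.
exists (Num.min r1 r2), M, N; split=> //.
  by apply: at1_shrink h1 => //; rewrite ge_min lexx.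
by apply: at1_shrink h2 => //; rewrite ge_min lexx orbT.
Qed.

Lemma at1_ext f g p : (\forall x \near p, f x = g x) -> analytic_at1 f p -> analytic_at1 g p.
Proof.
move=> /near_C[r r0 hr] /at1E[r1 [M [r10 h1]]]; apply/at1E.
pose s := Num.min r1 (r / 2).
have s0 : 0 < s by rewrite lt_min r10 divr_gt0.
have sr1 : s <= r1 by rewrite ge_min lexx.
have sr : s < r by apply: (@le_lt_trans _ _ (r / 2)); [rewrite ge_min lexx orbT|lra].
exists s, M; split=> //; apply: mass_ext (at1_shrink s0 sr1 h1) => z [hz _].
apply: hr; rewrite addrC addKr nrmM nrm_cR0 ?(ltW s0) //; apply: le_lt_trans sr.
by rewrite ler_piMr // ltW.
Qed.

Lemma at1_const c p : analytic_at1 (fun _ => c) p.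
Proof. by apply/at1E; exists 1, (nrm c); split=> //; exact: mass_const. Qed.

Lemma at1_id p : analytic_at1 (fun x : C => x) p.
Proof.
apply/at1E; exists 1, (nrm p + nrm (cR 1) * 1); split=> //.
exact: (massD (mass_const (ext (par R 0)) p) (massZ (cR 1) (mass_x (par R 0)))).
Qed.

Lemma at1D f g p : analytic_at1 f p -> analytic_at1 g p -> analytic_at1 (fun x => f x + g x) p.
Proof.
move=> hf hg; have [r [M [N [r0 h1 h2]]]] := at1_common hf hg.
by apply/at1E; exists r, (M + N); split=> //; exact: massD h1 h2.
Qed.

Lemma at1M f g p : analytic_at1 f p -> analytic_at1 g p -> analytic_at1 (fun x => f x * g x) p.
Proof.
move=> hf hg; have [r [M [N [r0 h1 h2]]]] := at1_common hf hg.
by apply/at1E; exists r, (M * N); split=> //; exact: massM h1 h2.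
Qed.

Lemma at1Z c f p : analytic_at1 f p -> analytic_at1 (fun x => c * f x) p.
Proof. by move=> hf; exact: at1M (at1_const c p) hf. Qed.

Lemma at1X n f p : analytic_at1 f p -> analytic_at1 (fun x => f x ^+ n) p.
Proof.
move=> /at1E[r [M [r0 h]]]; apply/at1E; exists r, (M ^+ n); split=> //; exact: massX h.
Qed.

Lemma at1_sum (I : Type) (s : seq I) (f : I -> C -> C) p :
  (forall i, analytic_at1 (f i) p) -> analytic_at1 (fun x => \sum_(i <- s) f i x) p.
Proof.
move=> h; elim: s => [|i s ih].
  by apply: at1_ext (at1_const 0 p); apply: near_all => x; rewrite big_nil.
by apply: at1_ext (at1D (h i) ih); apply: near_all => x; rewrite big_cons.
Qed.

Lemma at1_bounded f p : analytic_at1 f p ->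
  exists2 B : R, 0 <= B & \forall x \near p, nrm (f x) <= B.
Proof.
move=> /at1E[r [M [r0 h]]]; exists M; first exact: mass_ge0 h.
apply/near_C; exists r => // x hx.
have hz : nrm ((cR r)^-1 * (x - p)) <= 1.
  by rewrite nrmM nrmV nrm_cR0 ?(ltW r0) // ler_pdivrMl // mulr1 ltW.
have := @mass_sup R (ext (par R 0)) _ _ ((cR r)^-1 * (x - p), 0) h (conj hz (@dom0 R 0)).
rewrite /= mulrA mulfV ?cR_eq0 ?gt_eqF // mul1r addrC subrK //.
Qed.

(** Division by x - p shifts the coefficients. Nonvanishing, inverses, Taylor expansions and the
    local form of zeros all rest on this factorization. *)
Lemma at1_factor f p : analytic_at1 f p ->
  exists2 g, analytic_at1 g p & \forall x \near p, f x = f p + (x - p) * g x.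
Proof.
move=> /at1E[r [M [r0 /umass_nat_ser[c hc hf]]]].
have rn : cR r != 0 by rewrite cR_eq0 gt_eqF.
have hc1 : absb (fun j => c j.+1) M by apply: absb_inj hc => i j [].
pose g x := (cR r)^-1 * ser id (fun j => c j.+1) ((cR r)^-1 * (x - p)).
exists g.
  apply/at1E; exists r, (nrm (cR r)^-1 * M); split=> //.
  apply: mass_ext (massZ (cR r)^-1 (ser_umass id hc1)) => z _.
  by rewrite /g; congr (_ * ser _ _ _); rewrite addrC addKr mulrA mulVf // mul1r.
have n1 : nrm (0 : C) <= 1 by rewrite nrm0.
have h0 : f p = c 0%N.
  have := hf 0 n1; rewrite mulr0 addr0 => ->; apply: hsE.
  have := @hsum_single R nat (fun j => c j * 0 ^+ j) 0%N.
  by rewrite expr0 mulr1; apply=> j j0; rewrite expr0n (negbTE j0) mulr0.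
apply/near_C; exists r => // x hx; set z := (cR r)^-1 * (x - p).
have hz : nrm z <= 1 by rewrite nrmM nrmV nrm_cR0 ?(ltW r0) // ler_pdivrMl // mulr1 ltW.
have xE : x = p + cR r * z by rewrite /z mulrA mulfV // mul1r addrC subrK.
rewrite {1}xE (hf z hz) h0; apply: hsE.
have := hsum_head (f := fun j => c j * z ^+ j) (s := (x - p) * g x); rewrite expr0 mulr1; apply.
have -> : (x - p) * g x = z * ser id (fun j => c j.+1) z by rewrite /g -/z {2}/z; ring.
by apply: hsum_ext (hsumZ z (ser_hsum id hc1 hz)) => j; rewrite /= exprS; ring.
Qed.

Lemma at1_neq0 f p : analytic_at1 f p -> f p != 0 -> \forall x \near p, f x != 0.
Proof.
move=> hf f0; have [g hg hgE] := at1_factor hf; have [B B0 hB] := at1_bounded hg.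
have hn : \forall x \near p, nrm (x - p) * (B + 1) < nrm (f p).
  apply/near_C; exists (nrm (f p) / (B + 1)) => [|x].
    by rewrite divr_gt0 ?nrm_gt0 //; lra.
  by rewrite ltr_pdivlMr //; lra.
apply: filterS3 hgE hB hn => x -> h1 h2.
apply: contraTneq h2 => h3; rewrite -leNgt.
have -> : f p = - ((x - p) * g x) by apply: (addIr ((x - p) * g x)); rewrite h3 addNr.
rewrite nrmN nrmM ler_wpM2l ?nrm_ge0 //; lra.
Qed.

(** Close to p, 1/f is 1/f(p) times the geometric series in - (x - p) g(x) / f(p). *)
Lemma at1_inv f p : analytic_at1 f p -> f p != 0 -> analytic_at1 (fun x => (f x)^-1) p.
Proof.
move=> hf f0; have [g hg hgE] := at1_factor hf.
have /at1E[r [M [r0 h1]]] := at1Z (- (f p)^-1) hg.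
have M0 := mass_ge0 h1.
pose s := Num.min r (2 * (M + 1))^-1.
have s0 : 0 < s by rewrite lt_min r0 invr_gt0; lra.
have sr : s <= r by rewrite ge_min lexx.
have sM : s * M <= 2^-1.
  have : s * (2 * (M + 1)) <= 1 by rewrite -ler_pdivlMr ?mul1r ?ge_min ?lexx ?orbT //; lra.
  by nra.
have hsc := at1_shrink (f := fun x => - (f p)^-1 * g x) (p := p) s0 sr h1.
have h2 : umass (fun z => cR s * z * (- (f p)^-1 * g (p + cR s * z))) (s * M).
  have hs1 : nrm (cR s) * 1 <= s by rewrite nrm_cR0 ?mulr1 // ltW.
  exact: (massM (mass_le hs1 (massZ (cR s) (mass_x (par R 0)))) hsc).
have half1 : (2^-1 : R) < 1 by lra.
have h3 := massZ (f p)^-1 (mass_inv half1 (mass_le sM h2)).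
apply: (@at1_ext (fun x => (f p)^-1 * (1 - (x - p) * (- (f p)^-1 * g x))^-1)).
  apply: filterS hgE => x ->; rewrite -invfM; congr (_^-1).
  by field.
apply/at1E; exists s, (nrm (f p)^-1 * (1 - 2^-1)^-1); split=> //.
by apply: mass_ext h3 => z _ /=; rewrite [p + _ - p]addrC addKr.
Qed.

Lemma at1_derive f p : analytic_at1 f p ->
  exists2 f', analytic_at1 f' p & \forall x \near p, is_derive x (1 : C) f (f' x).
Proof.
move=> /at1E[r [M [r0 /umass_nat_ser[c hc hf]]]].
have rn : cR r != 0 by rewrite cR_eq0 gt_eqF.
have half0 : 0 < r / 2 by rewrite divr_gt0.
have n2 : nrm (2^-1 : C) = 2^-1 by rewrite nrmV nrm_nat.
exists (fun x => (cR r)^-1 * dser id c ((cR r)^-1 * x + - ((cR r)^-1 * p))).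
  pose d j := c j.+1 * (j.+1%:R * 2^-1 ^+ j).
  have hd : absb d M.
    have hc1 : absb (fun j => c j.+1) M by apply: absb_inj hc => i j [].
    apply: absb_mono hc1 => j; rewrite /d !nrmM nrmX n2 nrm_nat ler_piMr ?nrm_ge0 //.
    exact: half_pow_weight.
  apply/at1E; exists (r / 2), (nrm (cR r)^-1 * M); split=> //.
  apply: mass_ext (massZ (cR r)^-1 (ser_umass id hd)) => z [hz _]; congr (_ * _).
  have hz2 : nrm (2^-1 * z.1) < 1 by rewrite nrmM n2; have := nrm_ge0 z.1; lra.
  have -> : (cR r)^-1 * (p + cR (r / 2) * z.1) + - ((cR r)^-1 * p) = 2^-1 * z.1.
    by rewrite cRM cRV cRn; field.
  apply: hsum_unique (dser_hsum id hc (nrm_ge0 _) hz2 (lexx _)).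
  have := hsum_head (f := fun j => c j * (j%:R * (2^-1 * z.1) ^+ j.-1)) (s := ser id d z.1).
  rewrite !mul0r mulr0 add0r; apply.
  by apply: hsum_ext (ser_hsum id hd hz) => j; rewrite /d exprMn /=; ring.
apply/near_C; exists r => // x hx; set z := (cR r)^-1 * x + _.
have hz : nrm z < 1.
  have -> : z = (cR r)^-1 * (x - p) by rewrite /z; ring.
  by rewrite nrmM nrmV nrm_cR0 ?(ltW r0) // ltr_pdivrMl // mulr1.
have h2 := daffine (ser_derive id hc hz : is_derive ((cR r)^-1 * x + - ((cR r)^-1 * p)) (1 : C) _ _).
have p0 : 0 < r - nrm (x - p) by rewrite subr_gt0.
apply: (is_derive_near p0 _ h2) => v hv.
have hvp : nrm (v - p) < r.
  have -> : v - p = (v - x) + (x - p) by ring.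
  by apply: le_lt_trans (nrmD _ _) _; rewrite -ltrBrDr.
rewrite -hf; first by congr f; field.
have -> : (cR r)^-1 * v + - ((cR r)^-1 * p) = (cR r)^-1 * (v - p) by ring.
by rewrite nrmM nrmV nrm_cR0 ?(ltW r0) // ler_pdivrMl // mulr1 ltW.
Qed.

Lemma at1_taylor n f p : analytic_at1 f p ->
  exists (w : nat -> C) (V : C -> C), analytic_at1 V p /\
    \forall x \near p, f x = \sum_(i < n) w i * (x - p) ^+ i + (x - p) ^+ n * V x.
Proof.
elim: n f => [|n ih] f hf.
  exists (fun=> 0), f; split=> //; apply: near_all => x; by rewrite big_ord0 expr0 add0r mul1r.
have [g hg hgE] := at1_factor hf; have [w [V [hV hVE]]] := ih g hg.
exists (fun i => if i is j.+1 then w j else f p), V; split=> //.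
apply: filterS2 hgE hVE => x -> ->.
rewrite big_ord_recl expr0 mulr1 -addrA; congr (_ + _).
rewrite mulrDr mulr_sumr exprS mulrA; congr (_ + _); apply: eq_bigr => i _.
by rewrite /= exprS; ring.
Qed.

End AnalyticAtPoint.

Section Residues.
Variable R : realType.
Local Notation C := (Cplx R).
Implicit Types (f g : C -> C) (p : C).

Lemma is_residueP f p r : is_residue f p r <->
  exists N (c : nat -> C) (h : C -> C), [/\ analytic_at1 h p,
    \forall z \near p^', f z = \sum_(j < N.+1) c j / (z - p) ^+ j.+1 + h z & r = c 0%N].
Proof.
split=> [[N [c [h [hh hf ->]]]]|[N [c [h [hh hf ->]]]]]; last first.
  by exists N, (fun j : 'I_N.+1 => c j), h.
exists N, (fun j => c (inord j)), h; split; [exact: hh|move: hf|].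
  apply: filterS => z ->; rewrite /pole_part; congr (_ + _).
  by apply: eq_bigr => j _; rewrite inord_val.
by congr c; apply: val_inj; rewrite /= inordK.
Qed.

Lemma is_residue_ext f g p r : (\forall x \near p^', f x = g x) -> is_residue f p r -> is_residue g p r.
Proof.
move=> hfg [N [c [h [hh hf hr]]]]; exists N, c, h; split; [exact: hh| |exact: hr].
by apply: filterS2 hfg hf => x -> ->.
Qed.

Lemma pole_widen N N' (c : nat -> C) (F : nat -> C) : (N <= N')%N ->
  \sum_(j < N.+1) c j * F j = \sum_(j < N'.+1) (if (j <= N)%N then c j else 0) * F j.
Proof.
move=> h; rewrite (@big_ord_widen _ _ _ N.+1 N'.+1 (fun j => c j * F j)) // big_mkcond.
by apply: eq_bigr => j _; rewrite ltnS; case: leqP; rewrite // mul0r.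
Qed.

Lemma is_residueD f g p r s : is_residue f p r -> is_residue g p s ->
  is_residue (fun x => f x + g x) p (r + s).
Proof.
move=> /is_residueP[N [c [h [hh hf ->]]]] /is_residueP[N' [c' [h' [hh' hg ->]]]].
apply/is_residueP; exists (maxn N N'),
  (fun j => (if (j <= N)%N then c j else 0) + (if (j <= N')%N then c' j else 0)), (fun x => h x + h' x).
split; [exact: at1D| |by []].
apply: filterS2 hf hg => x -> ->.
rewrite (pole_widen c (fun j => ((x - p) ^+ j.+1)^-1) (leq_maxl N N')).
rewrite (pole_widen c' (fun j => ((x - p) ^+ j.+1)^-1) (leq_maxr N N')).
rewrite addrACA -big_split /=; congr (_ + _); apply: eq_bigr => j _; by rewrite mulrDl.
Qed.

Lemma is_residue_analytic f p : analytic_at1 f p -> is_residue f p 0.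
Proof.
move=> hf; apply/is_residueP; exists 0%N, (fun=> 0), f; split; [exact: hf| |by []].
by apply/near_dnbhs; exists 1 => // x _ _; rewrite big_ord1 mul0r add0r.
Qed.

Lemma is_residueZ a f p r : is_residue f p r -> is_residue (fun x => a * f x) p (a * r).
Proof.
move=> /is_residueP[N [c [h [hh hf ->]]]]; apply/is_residueP.
exists N, (fun j => a * c j), (fun x => a * h x); split; [exact: at1Z| |by []].
apply: filterS hf => x ->; rewrite mulrDr mulr_sumr; congr (_ + _).
by apply: eq_bigr => j _; rewrite mulrA.
Qed.

Lemma is_residue_sum (I : eqType) (s : seq I) (f : I -> C -> C) (r : I -> C) p :
  (forall i, i \in s -> is_residue (f i) p (r i)) ->
  is_residue (fun x => \sum_(i <- s) f i x) p (\sum_(i <- s) r i).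
Proof.
elim: s => [|i s ih] h.
  rewrite big_nil; apply: is_residue_ext (is_residue_analytic (at1_const 0 p)).
  by apply/near_dnbhs; exists 1 => // x _ _; rewrite big_nil.
rewrite big_cons; apply: is_residue_ext (is_residueD (h i (mem_head _ _)) (ih _)).
  by apply/near_dnbhs; exists 1 => // x _ _; rewrite big_cons.
by move=> j hj; apply: h; rewrite inE hj orbT.
Qed.

Lemma near_is_derive f g p : (\forall x \near p, f x = g x) ->
  \forall x \near p, forall a, is_derive x (1 : C) f a -> is_derive x (1 : C) g a.
Proof.
move=> /near_C[r r0 h]; apply/near_C; exists r => // x hx a.
have p0 : 0 < r - nrm (x - p) by rewrite subr_gt0.
apply: (is_derive_near p0) => y hy; apply: h.
have -> : y - p = (y - x) + (x - p) by ring.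
by apply: le_lt_trans (nrmD _ _) _; rewrite -ltrBrDr.
Qed.

Lemma near_dnbhs_of p (P : C -> Prop) : (\forall x \near p, P x) -> \forall x \near p^', x - p != 0 /\ P x.
Proof.
move=> /near_C[r r0 h]; apply/near_dnbhs; exists r => // x xp hx.
by split; [rewrite subr_eq0|exact: h].
Qed.

(* f'/f^(j+1) is the derivative of - 1/(j f^j) when j > 0. *)
Lemma residue_dlog_pow f f' p j : analytic_at1 f p -> f p = 0 ->
  (\forall x \near p, is_derive x (1 : C) f (f' x)) -> f' p != 0 ->
  is_residue (fun x => f' x / f x ^+ j.+1) p (j == 0%N)%:R.
Proof.
move=> hf f0 hd f'0; have [g hg hgE] := at1_factor hf; have [g' hg' hgd] := at1_derive hg.
have dt (x : C) : is_derive x (1 : C) (fun s => s - p) 1.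
  by apply: is_derive_eq (dB (did x) (dcst p x)) _; rewrite subr0.
have hE : \forall x \near p, f x = (x - p) * g x.
  by apply: filterS hgE => x; rewrite f0 add0r.
have hE' : \forall x \near p, f' x = g x + (x - p) * g' x.
  apply: filterS3 hd hgd (near_is_derive hE) => x h1 h2 h3.
  by rewrite (is_derive_unique (h3 _ h1) (dM (dt x) h2)) mul1r.
have gp : g p != 0.
  by have := nbhs_singleton hE'; rewrite subrr mul0r addr0 => <-.
have gn := at1_neq0 hg gp.
have core : \forall x \near p^', [/\ x - p != 0, g x != 0, f x = (x - p) * g x & f' x = g x + (x - p) * g' x].
  by apply: filterS2 (near_dnbhs_of hE) (near_dnbhs_of (filterI gn hE')) => x [h1 h2] [_ [h3 h4]].
case: j => [|j].
  apply/is_residueP; exists 0%N, (fun=> 1), (fun x => g' x * (g x)^-1); split; [|move: core|by []].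
    exact: at1M hg' (at1_inv hg gp).
  by apply: filterS => x [t0 n0 -> ->]; rewrite big_ord1 !expr1; field; rewrite n0 t0.
(* With t = x - p, f = t g and S = 1 / g^n, the quotient f' / f^(n+1) equals S / t^(n+1) - S' / (n
   t^n). *)
pose n := j.+1; have hS := at1_inv (at1X n hg) (expf_neq0 n gp).
have [S' hS' hSd] := at1_derive hS.
have hS'E : \forall x \near p, S' x = - (n%:R * g' x / g x ^+ n.+1).
  have hone : \forall x \near p, (g x ^+ n)^-1 * g x ^+ n = 1.
    by apply: filterS gn => x h; rewrite mulVf // expf_neq0.
  apply: filterS3 (filterI hSd hgd) (near_is_derive hone) gn => x [h1 h2] h3 h4.
  have := is_derive_unique (h3 _ (dM h1 (dX n h2))) (dcst 1 x).
  have gnn : g x ^+ n != 0 by rewrite expf_neq0.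
  move=> h; apply: (mulIf gnn); rewrite exprS; move/eqP: h; rewrite addr_eq0 => /eqP ->.
  rewrite /n /= exprS; move: (j.+1%:R : C) => D.
  by field; rewrite h4 expf_neq0.
have [w [V [hV hVE]]] := at1_taylor n.+1 hS; have [V' hV' hVd] := at1_derive hV.
have hS'T : \forall x \near p, S' x = \sum_(i < n.+1) w i * (i%:R * (x - p) ^+ i.-1) +
    (n.+1%:R * (x - p) ^+ n * V x + (x - p) ^+ n.+1 * V' x).
  apply: filterS3 hSd hVd (near_is_derive hVE) => x h1 h2 h3.
  have hs := dsum (index_enum 'I_n.+1) (fun i : 'I_n.+1 => dZ (w i) (dX i (dt x))).
  rewrite (is_derive_unique (h3 _ h1) (dD hs (dM (dX n.+1 (dt x)) h2))).
  by congr (_ + _); [apply: eq_bigr => i _; rewrite mulr1|rewrite mulr1].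
have nn0 : n%:R != 0 :> C by rewrite pnatr_eq0.
(* Inserting the Taylor polynomial of S, the coefficient of 1 / t^(i+1) is i / n times w_(n-i),
   which is 0 at i = 0. *)
apply/is_residueP; exists n, (fun i => i%:R / n%:R * w (n - i)%N),
  (fun x => - n%:R^-1 * (V x + (x - p) * V' x)); split; [| |by rewrite !mul0r].
  apply: at1Z; apply: at1D hV (at1M _ hV').
  by apply: at1_ext (at1D (at1_id p) (at1_const (- p) p)); exact: near_all.
apply: filterS3 core (near_dnbhs_of hVE) (near_dnbhs_of (filterI hS'E hS'T)).
move=> x [t0 n0 -> ->] [_ hA] [_ [hB hC]].
move: t0 hA hB hC; set t := x - p => t0 hA hB hC.
have -> : (g x + t * g' x) / (t * g x) ^+ n.+1 = (g x ^+ n)^-1 / t ^+ n.+1 - S' x / (n%:R * t ^+ n).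
  rewrite hB exprMn !exprS; move: (n%:R : C) nn0 => D D0.
  by field; rewrite D0 t0 n0 !expf_neq0.
rewrite hA hC [in RHS](reindex_inj rev_ord_inj) /=.
have -> : \sum_(i < n.+1) ((n.+1 - i.+1)%:R / n%:R * w (n - (n.+1 - i.+1))%N / t ^+ (n.+1 - i.+1).+1) =
   (\sum_(i < n.+1) w i * t ^+ i) / t ^+ n.+1 -
   (\sum_(i < n.+1) w i * (i%:R * t ^+ i.-1)) / (n%:R * t ^+ n).
  rewrite !mulr_suml -sumrB; apply: eq_bigr => i _.
  have iN : (i <= n)%N by rewrite -ltnS.
  rewrite subSS subKn // natrB //.
  have e1 : t ^+ n.+1 = t ^+ i * t ^+ (n - i).+1 by rewrite -exprD addnS subnKC.
  have e2 : (i%:R : C) * t ^+ i.-1 = i%:R * t ^+ i / t.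
    by case: (nat_of_ord i) => [|l]; rewrite ?mul0r // exprS /=; field.
  have e3 : t ^+ n = t ^+ n.+1 / t by rewrite exprS; field.
  rewrite e2 e3 e1; move: (n%:R : C) nn0 => D D0; move: (i%:R : C) => I.
  by field; rewrite D0 t0 !expf_neq0.
rewrite -natr1 exprS; move: (n%:R : C) nn0 => D D0; move: (\sum_(i < _) _) (\sum_(i < _) _) => s1 s2.
by field; rewrite D0 t0 expf_neq0.
Qed.

End Residues.

(** * Partial fractions *)

Section PartialFractions.
Variable R : realType.
Local Notation C := (Cplx R).

(** A triple ((a, j), c) stands for c / (w - a)^(j+1). Terms with the same pole and order may be
    repeated, and [s] lists multiple roots several times. *)
Definition pfrac (s : seq C) (T : seq (C * nat * C)) (F : C -> C) : Prop :=
  {in T, forall t, t.1.1 \in s} /\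
  forall w, w \notin s -> F w = \sum_(t <- T) t.2 / (w - t.1.1) ^+ t.1.2.+1.

Definition pres (T : seq (C * nat * C)) : C := \sum_(t <- T | t.1.2 == 0%N) t.2.

Lemma notin_sub (s : seq C) w a : w \notin s -> a \in s -> w - a != 0.
Proof. by move=> hw ha; rewrite subr_eq0; apply: contraNneq hw => ->. Qed.

(** The product decays at least like w^-2 at infinity, so its residues add up to 0. For distinct
    points the order is lowered by 1/((w - a)(w - q)) = (1/(w - a) - 1/(w - q)) / (a - q). *)
Lemma pfrac_mul_pole (s : seq C) a q j c : a \in s -> q \in s ->
  exists2 T, pfrac s T (fun w => c / (w - a) ^+ j.+1 / (w - q)) & pres T = 0.
Proof.
move=> ha hq; have [<-|aq] := eqVneq a q.
  exists [:: (a, j.+1, c)]; last by rewrite /pres big_cons big_nil.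
  split=> [t|w hw]; first by rewrite inE => /eqP ->.
  by rewrite big_seq1 /= [in RHS]exprSr invfM mulrA.
have d0 : a - q != 0 by rewrite subr_eq0.
elim: j c => [|j ih] c.
  exists [:: (a, 0%N, c / (a - q)); (q, 0%N, - (c / (a - q)))].
    split=> [t|w hw]; first by rewrite !inE => /orP[] /eqP ->.
    rewrite big_cons big_seq1 /= !expr1.
    by have wa := notin_sub hw ha; have wq := notin_sub hw hq; field; rewrite wa wq d0.
  by rewrite /pres !big_cons big_nil /= addr0 subrr.
have [T [hT hE] hp] := ih (- (c / (a - q))).
exists ((a, j.+1, c / (a - q)) :: T); last by rewrite /pres big_cons.
split=> [t|w hw]; first by rewrite inE => /orP[/eqP ->|/hT].
rewrite big_cons -hE //= !exprS.
by have wa := notin_sub hw ha; have wq := notin_sub hw hq; field; rewrite wa wq d0 expf_neq0.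
Qed.

Lemma pfrac_div (s : seq C) T F q : pfrac s T F -> q \in s ->
  exists2 T', pfrac s T' (fun w => F w / (w - q)) & pres T' = 0.
Proof.
move=> [hT hF] hq; elim: T F hT hF => [|[[a j] c] T ih] F hT hF.
  exists [::]; last by rewrite /pres big_nil.
  by split=> // w /hF ->; rewrite !big_nil mul0r.
have [|w hw //|T1 [hT1 h1] p1] := ih (fun w => \sum_(t <- T) t.2 / (w - t.1.1) ^+ t.1.2.+1).
  by move=> t ht; apply: hT; rewrite inE ht orbT.
have [T2 [hT2 h2] p2] := pfrac_mul_pole j c (hT _ (mem_head _ _)) hq.
exists (T2 ++ T1); last by rewrite /pres big_cat /= -/(pres T2) -/(pres T1) p1 p2 addr0.
split=> [t|w hw]; first by rewrite mem_cat => /orP[/hT2|/hT1].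
by rewrite big_cat /= -h1 // -h2 // hF // big_cons mulrDl.
Qed.

(** With P the product over the remaining n roots, N' = N - N_n P has degree below n. Then N / (P (w
    - q)) is N_n / (w - q) plus (N' / P) / (w - q), and the second term has residue sum 0 by
    [pfrac_div]. *)
Lemma partial_fractions (s : seq C) (N : {poly C}) : (size N <= size s)%N ->
  exists2 T, pfrac s T (fun w => N.[w] / \prod_(q <- s) (w - q)) & pres T = N`_(size s).-1.
Proof.
elim: s N => [|q s ih] N hN.
  have -> : N = 0 by apply/eqP; rewrite -size_poly_leq0.
  exists [::]; last by rewrite /pres big_nil coef0.
  by split=> // w _; rewrite !big_nil horner0 mul0r.
pose n := size s; pose P := \prod_(a <- s) ('X - a%:P).
have sP : size P = n.+1 by rewrite /P size_prod_XsubC.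
have Pn : P`_n = 1 by have := monicP (monic_prod_XsubC s xpredT id); rewrite /lead_coef -/P sP.
pose N' := N - N`_n *: P.
have hN' : (size N' <= size s)%N.
  apply/leq_sizeP => j; rewrite -/n leq_eqVlt => /orP[/eqP <-|hj].
    by rewrite coefB coefZ Pn mulr1 subrr.
  have Nj : N`_j = 0 by apply: nth_default; exact: leq_trans hN hj.
  have Pj : P`_j = 0 by apply: nth_default; rewrite sP.
  by rewrite coefB coefZ Nj Pj mulr0 subrr.
have [T [hT hE] _] := ih N' hN'.
have hT' : pfrac (q :: s) T (fun w => N'.[w] / \prod_(q <- s) (w - q)).
  split=> [t /hT h|w hw]; first by rewrite inE h orbT.
  by apply: hE; move: hw; rewrite inE negb_or => /andP[].
have [T' [hT1 hE1] p1] := pfrac_div hT' (mem_head q s).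
exists ((q, 0%N, N`_n) :: T'); last by rewrite /pres big_cons /= -/(pres T') p1 addr0.
split=> [t|w hw]; first by rewrite inE => /orP[/eqP ->|/hT1] //; exact: mem_head.
rewrite !big_cons -hE1 //= expr1.
have wq := notin_sub hw (mem_head q s).
have PE : P.[w] = \prod_(q <- s) (w - q).
  by rewrite /P horner_prod; apply: eq_bigr => a _; rewrite hornerXsubC.
have P0 : \prod_(q <- s) (w - q) != 0.
  rewrite prodf_seq_neq0; apply/allP => a ha; apply: (notin_sub hw).
  by rewrite inE ha orbT.
rewrite /N' hornerD hornerN hornerZ PE; move: (\prod_(_ <- _) _) P0 => p p0.
by field; rewrite wq p0.
Qed.

End PartialFractions.

Section ResidueAtInfinity.
Variable R : realType.
Local Notation C := (Cplx R).

(** With w = 1/x the form becomes - (mu / w + w^(k-1)) / D(w) dw, where D(0) = 1. *)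
Lemma form_residue_infty (k : nat) (y : 'I_k -> C) (mu : C) : (0 < k)%N ->
  is_residue_infty (fun x => (npoly y x / (1 + mu * x ^+ k))^-1) (- mu).
Proof.
move=> kpos; pose D (w : C) := 1 + \sum_(j < k) y j * w ^+ (k.+1 - j).
have hD : analytic_at1 D 0.
  apply: at1D (at1_const 1 0) _; apply: at1_sum => j.
  exact: at1Z (at1X _ (at1_id 0)).
have D0 : D 0 = 1.
  rewrite /D big1 ?addr0 // => j _.
  by rewrite expr0n subn_eq0 leqNgt (leq_trans (ltn_ord j)) // mulr0.
have D0n : D 0 != 0 by rewrite D0 oner_eq0.
have hDi := at1_inv hD D0n; have [V hV hVE] := at1_factor hDi.
apply/is_residueP; exists 0%N, (fun=> - mu), (fun w => - mu * V w + - 1 * (w ^+ k.-1 * (D w)^-1)).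
split; [| |by []].
  apply: at1D (at1Z _ hV) (at1Z _ (at1M (at1X _ (at1_id 0)) hDi)).
apply: filterS2 (near_dnbhs_of hVE) (near_dnbhs_of (at1_neq0 hD D0n)) => w [w0 hw] [_ dw].
rewrite subr0 in w0 hw; rewrite D0 invr1 in hw.
rewrite big_ord1 subr0 expr1 invf_div.
have wk : w ^+ k.+1 != 0 by rewrite expf_neq0.
have -> : npoly y w^-1 = D w / w ^+ k.+1.
  rewrite /npoly /D mulrDl mul1r exprVn; congr (_ + _); rewrite mulr_suml.
  apply: eq_bigr => j _; have jk : (j <= k.+1)%N by have := ltn_ord j; lia.
  by rewrite -{2}(subnK jk) exprD exprVn; field; rewrite !expf_neq0.
have -> : V w = ((D w)^-1 - 1) / w by rewrite hw; field.
rewrite exprVn -(prednK kpos) !exprS /=; move: (D w) dw => d d0.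
by field; rewrite w0 d0 expf_neq0.
Qed.

End ResidueAtInfinity.

(** * Sum of the residues over a disc *)

Section ResidueSum.
Variable R : realType.
Local Notation C := (Cplx R).
Variable k : nat.

Definition fpoly (y : 'I_k -> C) : {poly C} := 'X^(k.+1) + \sum_(j < k) y j *: 'X^j.

Lemma fpoly_horner y w : (fpoly y).[w] = npoly y w.
Proof.
rewrite /fpoly /npoly hornerD hornerXn horner_sum; congr (_ + _).
by apply: eq_bigr => j _; rewrite hornerZ hornerXn.
Qed.

Lemma fpoly_tail y : (size (\sum_(j < k) y j *: 'X^j : {poly C})%R <= k)%N.
Proof.
apply: (leq_trans (size_sum _ _ _)); apply/bigmax_leqP => j _.
by apply: leq_trans (size_scale_leq _ _) _; rewrite size_polyXn.
Qed.

Lemma fpoly_size y : size (fpoly y) = k.+2.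
Proof.
by rewrite /fpoly size_polyDl ?size_polyXn // (leq_ltn_trans (fpoly_tail y)) // ltnW.
Qed.

Lemma fpoly_monic y : fpoly y \is monic.
Proof.
rewrite monicE /fpoly lead_coefDl ?lead_coefXn //.
by rewrite size_polyXn (leq_ltn_trans (fpoly_tail y)) // ltnW.
Qed.

Lemma fpoly_roots (y : 'I_k -> C) : exists2 qs : seq C, size qs = k.+1 &
  forall w, npoly y w = \prod_(q <- qs) (w - q).
Proof.
have [qs hq] := closed_field_poly_normal (fpoly y).
rewrite (monicP (fpoly_monic y)) scale1r in hq; exists qs.
  by have := fpoly_size y; rewrite hq size_prod_XsubC => -[].
move=> w; rewrite -fpoly_horner hq horner_prod; apply: eq_bigr => q _; exact: hornerXsubC.
Qed.

Lemma near_seq (p : C) (s : seq C) (P : C -> C -> Prop) :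
  (forall q, q \in s -> \forall x \near p, P q x) -> \forall x \near p, forall q, q \in s -> P q x.
Proof.
elim: s => [|a s ih] h; first exact: near_all.
have h2 : \forall x \near p, forall q, q \in s -> P q x.
  by apply: ih => q hq; apply: h; rewrite inE hq orbT.
apply: filterS2 (h a (mem_head _ _)) h2 => x h1 h3 q.
by rewrite inE => /orP[/eqP ->|/h3].
Qed.

(** dx / X is the pull-back by phi of (1 + mu w^k) / P(w) dw, and phi is a bijection from the zeros
    of X in the disc onto the roots of P. Each term of the partial fraction expansion pulls back to
    a multiple of phi' / (phi - q)^(j+1), whose residue is known. *)
Lemma residue_sum_disc (X phi : C -> C) (y : 'I_k -> C) (mu : C) (D : R) : (0 < k)%N ->
  (forall x, nrm x < D -> analytic_at1 phi x) ->
  (forall x, nrm x < D -> derive1 phi x != 0) ->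
  (forall x, nrm x < D -> npoly y (phi x) / (1 + mu * phi x ^+ k) = X x * derive1 phi x) ->
  (forall x, nrm x < D -> 1 + mu * phi x ^+ k != 0) ->
  (forall x x', nrm x < D -> nrm x' < D -> phi x = phi x' -> x = x') ->
  (forall q, npoly y q = 0 -> exists2 x, nrm x < D & phi x = q) ->
  exists (poles : seq C) (res : C -> C),
    [/\ uniq poles, forall x, x \in poles <-> nrm x < D /\ X x = 0,
      forall p, p \in poles -> is_residue (fun x => (X x)^-1) p (res p)
    & mu = \sum_(p <- poles) res p].
Proof.
move=> kpos hphi hd hX hden hinj hsurj.
have [qs sq hP] := fpoly_roots y.
have root_qs q : (q \in qs) = (npoly y q == 0).
  rewrite hP; apply/idP/idP => [hq|].
    by rewrite (big_rem q hq) /= subrr mul0r.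
  rewrite prodf_seq_eq0 => /hasP[a ha /=]; rewrite subr_eq0 => /eqP -> //.
pose N : {poly C} := 1 + mu *: 'X^k.
have sN : (size N <= size qs)%N.
  rewrite sq; apply: leq_trans (size_polyD _ _) _; rewrite geq_max size_poly1 /=.
  by apply: leq_trans (size_scale_leq _ _) _; rewrite size_polyXn.
have [T [hT hF] hp] := partial_fractions sN.
have Nk : N`_(size qs).-1 = mu.
  by rewrite sq /= coefD coefZ coefXn eqxx mulr1 coef1 eqn0Ngt kpos /= add0r.
rewrite Nk in hp.
have NE w : N.[w] = 1 + mu * w ^+ k by rewrite hornerD hornerZ hornerXn hornerE.
have XE x : nrm x < D -> (X x)^-1 = derive1 phi x * (N.[phi x] / npoly y (phi x)).
  move=> hx; have d0 := hd x hx; have -> : X x = npoly y (phi x) / (1 + mu * phi x ^+ k) / derive1 phi x.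
    by rewrite hX // mulfK.
  by rewrite invf_div invf_div NE.
have X0 x : nrm x < D -> (X x == 0) = (phi x \in qs).
  move=> hx; rewrite root_qs; have h := hX x hx; apply/eqP/eqP => e.
    move: h; rewrite e mul0r => /eqP; rewrite mulf_eq0 invr_eq0 (negbTE (hden x hx)) orbF => /eqP //.
  move: h; rewrite e mul0r => /esym/eqP; rewrite mulf_eq0 (negbTE (hd x hx)) orbF => /eqP //.
have /choice[g hg] : forall q, exists x, npoly y q = 0 -> nrm x < D /\ phi x = q.
  move=> q; have [/hsurj[x hx hxq]|n0] := eqVneq (npoly y q) 0; first by exists x.
  by exists 0 => /eqP; rewrite (negbTE n0).
have hgq q : q \in qs -> nrm (g q) < D /\ phi (g q) = q by rewrite root_qs => /eqP /hg.
(* Only simple poles contribute; the residue at p collects the terms whose pole is phi p. *)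
pose v (t : C * nat * C) : C := t.2 * (t.1.2 == 0%N)%:R.
exists [seq g q | q <- undup qs], (fun p => \sum_(t <- T) if phi p == t.1.1 then v t else 0); split.
- rewrite map_inj_in_uniq ?undup_uniq // => q q'; rewrite !mem_undup => /hgq[_ e] /hgq[_ e'] h.
  by rewrite -e -e' h.
- move=> x; split=> [/mapP[q]|[hx /eqP]].
    rewrite mem_undup => hq ->; have [h1 h2] := hgq q hq; split=> //.
    by apply/eqP; rewrite X0 // h2.
  rewrite X0 // => hq; have [h1 h2] := hgq _ hq.
  by apply/mapP; exists (phi x); [rewrite mem_undup|exact: hinj].
- move=> p /mapP[q]; rewrite mem_undup => hq pE; have [hpD hpq] := hgq q hq; rewrite -pE in hpD hpq.
  have hphip := hphi p hpD; have [f' hf' hfd] := at1_derive hphip.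
  have f'E : \forall x \near p, derive1 phi x = f' x.
    by apply: filterS hfd => x; exact: derive1_is_derive.
  have f'0 : f' p != 0 by rewrite -(nbhs_singleton f'E); exact: hd.
  have hball : \forall x \near p, nrm x < D.
    apply/near_C; exists (D - nrm p); first by rewrite subr_gt0.
    move=> x hx; have -> : x = (x - p) + p by rewrite subrK.
    by apply: le_lt_trans (nrmD _ _) _; rewrite -ltrBrDr.
  have hq2 : forall a, a \in qs -> \forall x \near p, a != q -> phi x != a.
    move=> a _; have [->|aq] := eqVneq a q; first exact: near_all.
    have h1 : analytic_at1 (fun x => phi x + - a) p by exact: at1D hphip (at1_const _ _).
    have h2 : phi p + - a != 0 by rewrite hpq subr_eq0 eq_sym.
    by apply: filterS (at1_neq0 h1 h2) => x; rewrite subr_eq0.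
  (* Near p the other roots are avoided by continuity, and q itself by injectivity. *)
  have hnotin : \forall x \near p^', phi x \notin qs.
    apply: filterS2 (near_dnbhs_of hball) (near_dnbhs_of (near_seq hq2)) => x [xp hx] [_ h].
    apply/negP => hin; have [e|n] := eqVneq (phi x) q; last by have := h _ hin n; rewrite eqxx.
    by move: xp; rewrite (hinj x p) ?subrr ?eqxx // hpq.
  apply: (@is_residue_ext _ (fun x => \sum_(t <- T) t.2 * (f' x / (phi x - t.1.1) ^+ t.1.2.+1))).
    apply: filterS3 hnotin (near_dnbhs_of hball) (near_dnbhs_of f'E) => x hx [_ hxD] [_ e].
    rewrite XE // hP hF // -e mulr_sumr; apply: eq_bigr => t _; by rewrite mulrCA.
  apply: is_residue_sum => -[[a j] c] /hT /= ha; rewrite /v /=.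
  have h1 : analytic_at1 (fun x => phi x + - a) p by exact: at1D hphip (at1_const _ _).
  case: eqP => [e|/eqP n].
    apply: is_residueZ; apply: (@residue_dlog_pow R (fun x => phi x + - a) f' p j h1) => //.
      by rewrite e subrr.
    by apply: filterS hfd => x h; apply: is_derive_eq (dD h (dcst (- a) x)) _; rewrite addr0.
  rewrite -[X in is_residue _ _ X](mulr0 c); apply: is_residueZ; apply: is_residue_analytic.
  have h2 : (phi p + - a) ^+ j.+1 != 0 by rewrite expf_neq0 // subr_eq0.
  exact: at1M hf' (at1_inv (at1X j.+1 h1) h2).
- rewrite big_map -[LHS]hp.
  have -> : \sum_(q <- undup qs) \sum_(t <- T) (if phi (g q) == t.1.1 then v t else 0) =
      \sum_(q <- undup qs) \sum_(t <- T) (if q == t.1.1 then v t else 0).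
    by apply: eq_big_seq => q; rewrite mem_undup => /hgq[_ ->].
  rewrite exchange_big /= /pres big_mkcond; apply: eq_big_seq => t /hT ht.
  rewrite (bigD1_seq t.1.1) ?undup_uniq ?mem_undup //= eqxx big1 ?addr0 => [|q /negbTE -> //].
  by rewrite /v; case: eqP; rewrite ?mulr1 ?mulr0.
Qed.

End ResidueSum.

(** * Zeros of the family in a fixed disc *)

Section Contraction.
Variable R : realType.
Local Notation C := (Cplx R).

(** The increments of the iterates are bounded by B / 2^n, so their unordered sum exists; it is the
    fixed point. *)
Lemma contraction_fixpoint (T : C -> C) (B : R) : nrm (T 0) <= B ->
  (forall x y, nrm x <= 2 * B -> nrm y <= 2 * B -> nrm (T x - T y) <= 2^-1 * nrm (x - y)) ->
  exists2 x, nrm x <= 2 * B & T x = x.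
Proof.
move=> hT0 hT; have B0 : 0 <= B := le_trans (nrm_ge0 _) hT0.
pose x n := iter n T 0; pose d n := x n.+1 - x n.
have P0 n : (0 : R) < 2^-1 ^+ n by rewrite exprn_gt0 // invr_gt0.
have hx n : nrm (x n) <= 2 * B * (1 - 2^-1 ^+ n) /\ nrm (d n) <= B * 2^-1 ^+ n.
  elim: n => [|n [h1 h2]]; first by rewrite /d /= subr0 expr0 subrr mulr0 nrm0 mulr1.
  have hle q : (0 : R) < q -> 2 * B * (1 - q) <= 2 * B by move=> q0; nra.
  have h3 : nrm (x n.+1) <= 2 * B * (1 - 2^-1 ^+ n.+1).
    have -> : x n.+1 = x n + d n by rewrite /d; ring.
    apply: le_trans (nrm_leD h1 h2) _; rewrite exprS; lra.
  split=> //; have := hT _ _ (le_trans h3 (hle _ (P0 _))) (le_trans h1 (hle _ (P0 _))).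
  move=> h4; apply: le_trans h4 _; rewrite exprS; lra.
have n2 : nrm (2^-1 : C) = 2^-1 by rewrite nrmV nrm_nat.
have habs N : absb (fun n => d (N + n)%N) (2 * B * 2^-1 ^+ N).
  have hg := @geometric_absb R 2^-1; rewrite n2 in hg; have {}hg := hg _.
  have := absbZ (cR (B * 2^-1 ^+ N)) (hg _); rewrite nrm_cR0 ?mulr_ge0 ?(ltW (P0 N)) // => h.
  apply: absb_le (_ : B * 2^-1 ^+ N * (1 - 2^-1)^-1 <= _) (absb_mono _ (h _)).
  - by rewrite (_ : 1 - 2^-1 = 2^-1 :> R) ?invrK; [rewrite mulrAC [B * 2]mulrC|field].
  - move=> n; rewrite nrmM nrm_cR0 ?mulr_ge0 ?(ltW (P0 N)) // nrmX n2 -mulrA -exprD.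
    exact: (hx _).2.
  - lra.
pose S N := hs (fun n => d (N + n)%N).
have hS N : hsum (fun n => d (N + n)%N) (S N) by exact: hsP (habs N).
have SE N : S 0%N = x N + S N.
  elim: N => [|N ->]; first by rewrite add0r.
  have h1 : hsum (fun n => d (N + n.+1)%N) (S N.+1).
    by apply: hsum_ext (hS N.+1) => n; rewrite addSnnS.
  have := hsum_unique (hS N) (hsum_head (f := fun n => d (N + n)%N) h1).
  by rewrite addn0 => ->; rewrite /d; ring.
have hSN N : nrm (S N) <= 2 * B * 2^-1 ^+ N := hsum_le (habs N) (hS N).
have hS0 : nrm (S 0%N) <= 2 * B by have := hSN 0%N; rewrite expr0 mulr1.
exists (S 0%N) => //; apply: subr0_eq; apply: nrm_le_eps => e e0.
have [N hN] := half_pow_small (2 * B) e0; apply: le_trans hN.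
have hxN : nrm (x N) <= 2 * B.
  by apply: le_trans (hx N).1 _; have := P0 N; nra.
have h1 := hT _ _ hS0 hxN.
have -> : T (S 0%N) - S 0%N = (T (S 0%N) - T (x N)) + - (S 0%N - x N.+1).
  by rewrite -[x N.+1]/(T (x N)); ring.
have h2 : nrm (S 0%N - x N) <= 2 * B * 2^-1 ^+ N by rewrite (SE N) addrC addKr.
have h3 : nrm (S 0%N - x N.+1) <= 2 * B * 2^-1 ^+ N.+1 by rewrite (SE N.+1) addrC addKr.
apply: le_trans (nrm_leD h1 (_ : _ <= 2 * B * 2^-1 ^+ N.+1)) _; first by rewrite nrmN.
rewrite exprS; lra.
Qed.

End Contraction.

Section LocalResidues.
Variable R : realType.
Local Notation C := (Cplx R).
Variables (k m : nat).
Local Notation L := ('rV[C]_m).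
Local Notation b0 := ([ffun=> 0%N] : {ffun 'I_m -> nat}).

(** Re-expansion at p: the affine map (p + (S - |p|) z) / S has l^1 norm |p| / S + (S - |p|) / S =
    1, so it may be substituted into the series. *)
Lemma umass_at1 (f : C -> C) (S M : R) p : 0 < S -> umass (fun z => f (cR S * z)) M ->
  nrm p < S -> analytic_at1 f p.
Proof.
move=> S0 /umass_nat[c [hc hf]] hp; have Sn : cR S != 0 by rewrite cR_eq0 gt_eqF.
apply/at1E; exists (S - nrm p), M; split; first by rewrite subr_gt0.
have r0 : 0 <= S - nrm p by rewrite subr_ge0 ltW.
pose w z := (cR S)^-1 * (p + cR (S - nrm p) * z).
have mw : umass w 1.
  apply: mass_le (massZ (cR S)^-1 (massD (mass_const (ext (par R 0)) p) (massZ (cR (S - nrm p)) (mass_x (par R 0))))).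
  by rewrite nrmV !nrm_cR0 ?(ltW S0) // mulr1 addrCA subrr addr0 mulVf // gt_eqF.
apply: (@mass_sum R (ext (par R 0)) nat (fun j z => c j * w z.1 ^+ j) (fun j => nrm (c j))) => //.
  by move=> j; have := massZ (c j) (massX j mw); rewrite expr1n mulr1.
move=> z hz; have := hf (w z.1) (mass_sup mw hz).
by rewrite {2}/w mulrA mulfV // mul1r.
Qed.

Lemma evE_ser (psi : nat * {ffun 'I_m -> nat} -> C) (X : C) (l : L) :
  ev (Q := ext (par R m)) psi (X, l) = ser fst (fun a => psi a * pmon a.2 l) X.
Proof. by rewrite /ev /ser; congr (hs _); apply/funext => a /=; rewrite /emon /=; ring. Qed.

Lemma pow_lipschitz (x x' : C) j : nrm x <= 1 -> nrm x' <= 1 ->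
  nrm (x ^+ j - x' ^+ j) <= j%:R * nrm (x - x').
Proof.
move=> hx hx'; elim: j => [|j ih]; first by rewrite subrr nrm0 mul0r.
have -> : x ^+ j.+1 - x' ^+ j.+1 = x * (x ^+ j - x' ^+ j) + (x - x') * x' ^+ j by rewrite !exprS; ring.
have h1 := nrm_leM hx ih.
have h2 := nrm_leM (lexx (nrm (x - x'))) (nrm_leX j hx'); rewrite expr1n mulr1 in h2.
apply: le_trans (nrm_leD h1 h2) _; rewrite -natr1; lra.
Qed.

Lemma ev_lipschitz (psi : nat * {ffun 'I_m -> nat} -> C) (d : R) (x x' : C) (l : L) :
  absb (fun a => a.1.+1%:R * psi a) d -> nrm x <= 1 -> nrm x' <= 1 -> @mdom R (par R m) l ->
  nrm (ev (Q := ext (par R m)) psi (x, l) - ev (Q := ext (par R m)) psi (x', l)) <= d * nrm (x - x').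
Proof.
move=> hpsi hx hx' hl.
have hp : absb psi d.
  by apply: absb_mono hpsi => a; rewrite nrmM nrm_nat ler_peMl ?nrm_ge0 // ler1n.
have h1 := @ev_hsum R (ext (par R m)) psi d (x, l) hp (conj hx hl).
have h2 := @ev_hsum R (ext (par R m)) psi d (x', l) hp (conj hx' hl).
apply: hsum_le (hsumB h1 h2); rewrite -[X in _ * X](nrm_cR0 (nrm_ge0 (x - x'))) mulrC.
apply: absb_mono (absbZ (cR (nrm (x - x'))) hpsi) => a.
have -> : psi a * @mv R (ext (par R m)) a (x, l) - psi a * @mv R (ext (par R m)) a (x', l) =
  psi a * ((x ^+ a.1 - x' ^+ a.1) * pmon a.2 l) by rewrite /= /emon /=; ring.
rewrite !nrmM nrm_nat nrm_cR0 ?nrm_ge0 //.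
have hm : nrm (pmon a.2 l) <= 1 by exact: (@mv_le1 R (par R m) _ _ hl).
have h3 := pow_lipschitz a.1 hx hx'.
have h4 : nrm (x ^+ a.1 - x' ^+ a.1) * nrm (pmon a.2 l) <= a.1.+1%:R * nrm (x - x').
  rewrite -[leRHS]mulr1; apply: ler_pM; rewrite ?nrm_ge0 //; apply: le_trans h3 _.
  by rewrite ler_wpM2r ?nrm_ge0 // ler_nat.
have := ler_wpM2l (nrm_ge0 (psi a)) h4; lra.
Qed.

Lemma dev_bound (psi : nat * {ffun 'I_m -> nat} -> C) (d : R) (x : C) (l : L) :
  absb (fun a => a.1.+1%:R * psi a) d -> nrm x <= 1 -> @mdom R (par R m) l ->
  nrm (dev psi (x, l)) <= d.
Proof.
move=> hpsi hx hl; have hb : absb (fun a => psi a * (a.1%:R * x ^+ a.1.-1 * pmon a.2 l)) d.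
  apply: absb_mono hpsi => a; rewrite !nrmM mulrC ler_wpM2r ?nrm_ge0 // !nrm_nat.
  have hm : nrm (pmon a.2 l) <= 1 by exact: (@mv_le1 R (par R m) _ _ hl).
  rewrite -[leRHS]mulr1; apply: ler_pM; rewrite ?mulr_ge0 ?nrm_ge0 //.
  rewrite -[leRHS]mulr1; apply: ler_pM; rewrite ?nrm_ge0 ?ler_nat // nrmX.
  by rewrite exprn_ile1 ?nrm_ge0.
exact: hsum_le hb (hsP hb).
Qed.

Lemma germ_small (f : L -> C) (e : R) : analytic_germ f -> f 0 = 0 -> 0 < e ->
  \forall l \near (0 : L), nrm (f l) <= e.
Proof.
move=> hf f0 e0; have [r r0 hr] := germ_near hf e0; apply/near_rV; exists r => // l hl.
by have := mass_sup hr (unscale_dom r0 hl); rewrite f0 subr0 unscaleK.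
Qed.

Lemma germ_bounded (f : L -> C) : analytic_germ f ->
  exists2 B : R, 0 <= B & \forall l \near (0 : L), nrm (f l) <= B.
Proof.
move=> /germ_mass[r [M [r0 h]]]; exists M; first exact: mass_ge0 h.
apply/near_rV; exists r => // l hl.
by have := mass_sup h (unscale_dom r0 hl); rewrite unscaleK.
Qed.

(** A root satisfies |q|^(k+1) <= k d max(1, |q|)^k, which excludes |q| > e1 because k d < e1^(k+1)
    <= 1. *)
Lemma roots_small (e : R) : 0 < e -> exists2 d : R, 0 < d &
  forall (y : 'I_k -> C) q, (forall j, nrm (y j) <= d) -> npoly y q = 0 -> nrm q <= e.
Proof.
move=> e0; pose e1 := Num.min e 1; have e10 : 0 < e1 by rewrite lt_min e0 ltr01.
have e1e : e1 <= e by rewrite ge_min lexx. have e11 : e1 <= 1 by rewrite ge_min lexx orbT.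
exists (e1 ^+ k.+1 / k.+1%:R); first by rewrite divr_gt0 ?exprn_gt0 // ltr0n.
set d := _ / _ => y q hy hq; apply: le_trans e1e; rewrite leNgt; apply/negP => hlt.
have q0 : 0 < nrm q by exact: lt_trans hlt.
have d0 : 0 < d by rewrite divr_gt0 ?exprn_gt0 // ltr0n.
have ek0 : 0 < e1 ^+ k.+1 by rewrite exprn_gt0.
have kd : k%:R * d < e1 ^+ k.+1.
  by rewrite /d mulrCA gtr_pMr // ltr_pdivrMr ?ltr0n // mul1r ltr_nat.
pose b := Num.max 1 (nrm q).
have b1 : 1 <= b by rewrite le_max lexx.
have bq : nrm q <= b by rewrite le_max lexx orbT.
have h1 : nrm q ^+ k.+1 <= k%:R * d * b ^+ k.
  have -> : nrm q ^+ k.+1 = nrm (\sum_(j < k) y j * q ^+ j).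
    rewrite -nrmX -nrmN; congr nrm; apply/eqP; rewrite eq_sym -addr_eq0 addrC; apply/eqP; exact: hq.
  apply: le_trans (nrm_sum _ _ _) _.
  rewrite -mulrA mulr_natl -[X in _ *+ X]card_ord -sumr_const; apply: ler_sum => j _.
  apply: nrm_leM => //; rewrite nrmX; apply: (@le_trans _ _ (b ^+ j)).
    by rewrite lerXn2r ?nnegrE ?nrm_ge0 // (le_trans ler01).
  by apply: ler_weXn2l => //; exact: ltnW.
have [qb|qb] := leP (nrm q) 1.
  have bE : b = 1 by rewrite /b max_l.
  have h2 : e1 ^+ k.+1 <= nrm q ^+ k.+1 by rewrite lerXn2r ?nnegrE ?nrm_ge0 ?(ltW hlt) // ltW.
  by rewrite bE expr1n mulr1 in h1; lra.
have bE : b = nrm q by rewrite /b max_r // ltW.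
have h2 : e1 ^+ k.+1 <= 1 by rewrite exprn_ile1 // ltW.
rewrite bE exprS ler_pM2r ?exprn_gt0 // in h1; lra.
Qed.

(** The disc is fixed before lambda. In the rescaled variable phi is [ga] times x + ps(x), with ps
    Lipschitz of constant 1/2. It is therefore injective, and a contraction finds a preimage of each
    root q in the disc, once lambda is so small that q / ga and ps(0) are at most s / 8. *)
Lemma conjugacy_residue_sum (y : 'I_k -> L -> C) (mu : L -> C) (Xt phi : C -> L -> C) :
  (0 < k)%N -> form_B_data y mu -> is_conjugacy phi Xt (form_B y mu) ->
  is_local_residue_sum Xt mu.
Proof.
move=> kpos [hy hmu hy0] [hphi phi0 dphi /near_pair[rc rc0 hconj]].
have /family_mass[rp [Mp [rp0 hrp]]] := hphi.
have [Bm Bm0 hBm] := germ_bounded hmu.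
pose r : R := Num.min rp (rc / 2).
have r0 : 0 < r by rewrite lt_min rp0 divr_gt0.
have rle1 : r <= rp by rewrite ge_min lexx.
have rle2 : r < rc by apply: (@le_lt_trans _ _ (rc / 2)); [rewrite ge_min lexx orbT|lra].
have [c [hc cE cD]] := phi_chart r0 (family_shrink r0 rle1 hrp).
have d00 := @dom_0 R m.
have n00 : nrm (0 : C) <= 1 by rewrite nrm0.
have n01 : nrm (0 : C) < 1 by rewrite nrm0.
have h00 := cE _ _ n00 d00; have hD0 := cD _ _ n01 d00.
rewrite !(mulr0, scaler0) in h00 hD0.
have [c0 c1] := chart_origin hc h00 hD0 phi0 dphi.
pose be := c (1%N, b0); pose ct a := be^-1 * c a.
have hct : absb ct (nrm be^-1 * Mp) by exact: absbZ.
have ct0 : ct (0%N, b0) = 0 by rewrite /ct c0 mulr0.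
have ct1 : ct (1%N, b0) = 1 by rewrite /ct mulVf.
pose Mc := nrm be^-1 * Mp + 1.
have Mc1 : 1 <= Mc by rewrite lerDr (absb_ge0 hct).
(* Then the bound 4 rho Mc of [near_identity_chart] is the Lipschitz constant 1/2. *)
pose rho := (8 * Mc)^-1.
have rho0 : 0 < rho by rewrite invr_gt0; lra.
have rho1 : rho <= 1 by rewrite invf_le1; lra.
have sig0 : 0 < rho ^+ 2 by rewrite exprn_gt0.
have [psi [hpsi psiE _]] := near_identity_chart hct rho0 rho1 sig0 (lexx _) ct0 ct1.
have {}hpsi : absb (fun a => a.1.+1%:R * psi a) 2^-1.
  apply: absb_le hpsi; rewrite -/Mc /rho le_eqVlt; apply/orP; left; apply/eqP.
  by field; rewrite gt_eqF //; lra.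
have hpsi1 : absb psi 2^-1.
  by apply: absb_mono hpsi => a; rewrite nrmM nrm_nat ler_peMl ?nrm_ge0 // ler1n.
pose sig := rho ^+ 2; pose S := r * (rho / 2); pose rs := r * sig; pose ga := be * cR (rho / 2).
have rho2 : 0 < rho / 2 by rewrite divr_gt0.
have S0 : 0 < S by rewrite mulr_gt0.
have rs0 : 0 < rs by rewrite mulr_gt0.
have sigl : sig <= 1 by rewrite exprn_ile1 // ltW.
have Sr : S < rc.
  apply: le_lt_trans rle2; rewrite /S ler_piMr ?(ltW r0) //; lra.
have rsr : rs < rc by apply: le_lt_trans rle2; rewrite /rs ler_piMr // ltW.
have ga0 : ga != 0 by rewrite mulf_neq0 // cR_eq0 gt_eqF.
have Sn : cR S != 0 by rewrite cR_eq0 gt_eqF.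
have rsn : cR rs != 0 by rewrite cR_eq0 gt_eqF.
have phiE x l : nrm x <= 1 -> @mdom R (par R m) l ->
    phi (cR S * x) (cR rs *: l) = ga * (x + ev (Q := ext (par R m)) psi (x, l)).
  have SE : cR S = cR r * cR (rho / 2) by rewrite -cRM.
  have rsE : cR rs = cR r * cR sig by rewrite -cRM.
  move=> hx hl; rewrite SE rsE -[X in phi X]mulrA -scalerA.
  have hx1 : nrm (cR (rho / 2) * x) <= 1.
    rewrite nrmM nrm_cR0 ?(ltW rho2) // mulr_ile1 ?nrm_ge0 ?(ltW rho2) //; lra.
  have hl1 : @mdom R (par R m) (cR sig *: l).
    by move=> i; rewrite mxE nrmM nrm_cR0 ?(ltW sig0) // mulr_ile1 ?nrm_ge0 ?(ltW sig0) //; exact: hl.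
  rewrite (cE _ _ hx1 hl1) /ga -[RHS]mulrA -(psiE _ _ hx hl).
  have h1 := @ev_hsum R (ext (par R m)) c Mp (cR (rho / 2) * x, cR sig *: l) hc (conj hx1 hl1).
  have -> : ev (Q := ext (par R m)) ct (cR (rho / 2) * x, cR sig *: l) =
     be^-1 * ev (Q := ext (par R m)) c (cR (rho / 2) * x, cR sig *: l).
    by apply: hsE; apply: hsum_ext (hsumZ _ h1) => a; rewrite /ct !mulrA.
  by rewrite mulVKf.
pose g l := ev (Q := ext (par R m)) psi (0, (cR rs)^-1 *: l).
have hg : analytic_germ g.
  apply: (mass_germ (f := fun l => ev (Q := ext (par R m)) psi (0, l)) (M := 2^-1) rs0).
  by apply: (mass_at (f := fun z => ev (Q := ext (par R m)) psi z) n00); exact: mass_ev.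
have g0 : g 0 = 0.
  have := phiE 0 0 n00 d00; rewrite mulr0 !scaler0 phi0 add0r => /esym/eqP.
  by rewrite mulf_eq0 (negbTE ga0) /= /g scaler0 => /eqP.
pose ng := nrm ga; have ng0 : 0 < ng by rewrite nrm_gt0.
(* With this bound |phi| <= w0 <= 1 and |mu phi^k| <= 1/2 on the disc, so the denominator of the
   normal form has no zero there. *)
pose s0 := Num.min 4^-1 (6 * ng * (Bm + 1))^-1.
have q0 : 0 < 6 * ng * (Bm + 1) by rewrite !mulr_gt0 //; lra.
have s00 : 0 < s0 by rewrite lt_min !invr_gt0 q0 andbT.
have s01 : s0 <= 4^-1 by rewrite ge_min lexx.
have s02 : s0 * (6 * ng * (Bm + 1)) <= 1 by rewrite -ler_pdivlMr // mul1r ge_min lexx orbT.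
pose w0 := ng * (3 * s0); have w00 : 0 <= w0 by rewrite !mulr_ge0 // ltW.
have w0B : w0 * (Bm + 1) <= 2^-1 by rewrite /w0; clear - s02; lra.
have w0B1 : Bm * w0 <= 2^-1 by clear - w0B w00; lra.
have w01 : w0 <= 1 by clear - w0B w00 Bm0; move: w0 w00 w0B => w *; nra.
exists (cR (S * s0)); first by rewrite -[0]/(cR 0) ltr_cR mulr_gt0.
move=> _ /andP[/pos_cR[D D0 ->]]; rewrite ler_cR => hD.
pose s := D / S; have hs0 : 0 < s by rewrite divr_gt0.
have DE : D = S * s by rewrite /s mulrC divfK // gt_eqF.
have ss0 : s <= s0 by rewrite /s ler_pdivrMr // mulrC.
have s1 : s <= 4^-1 := le_trans ss0 s01.
have DS : D <= S by rewrite DE ler_piMr ?(ltW S0) //; clear - s1; lra.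
have [de de0 hroots] := @roots_small (ng * (s / 8)) (mulr_gt0 ng0 (divr_gt0 hs0 (ltr0n _ 8))).
have Ny : \forall lam \near (0 : L), forall j, nrm (y j lam) <= de.
  have h j : \forall lam \near (0 : L), nrm (y j lam) <= de.
    exact: germ_small (hy j) (hy0 j) de0.
  exact: filter_forall h.
have Ng := germ_small hg g0 (divr_gt0 hs0 (ltr0n R 8)).
have Nl : \forall lam \near (0 : L), forall i, nrm ((lam : L) 0 i) < rs by apply/near_rV; exists rs.
apply: filterS3 (filterI hBm Nl) Ny Ng => lam [hm hl] hyl hgl.
pose l := (cR rs)^-1 *: lam.
have hld : @mdom R (par R m) l by exact: unscale_dom.
have lE : lam = cR rs *: l by rewrite /l unscaleK.
pose ps x := ev (Q := ext (par R m)) psi (x, l).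
have lip x x' : nrm x <= 1 -> nrm x' <= 1 -> nrm (ps x - ps x') <= 2^-1 * nrm (x - x').
  by move=> hx hx'; exact: ev_lipschitz.
have pE x : nrm x <= 1 -> phi (cR S * x) lam = ga * (x + ps x) by move=> hx; rewrite lE phiE.
have xE x : x = cR S * ((cR S)^-1 * x) by rewrite mulrA mulfV // mul1r.
have scal x : nrm x < D -> nrm ((cR S)^-1 * x) < s.
  by move=> hx; rewrite nrmM nrmV nrm_cR0 ?(ltW S0) // ltr_pdivrMl // -DE.
have scal1 x : nrm x < D -> nrm ((cR S)^-1 * x) < 1 by move=> /scal h; apply: lt_le_trans h (le_trans s1 _); rewrite invf_le1 // ler1n.
have p0 : nrm (ps 0) <= s / 8 by exact: hgl.
have hdv x : nrm x < D -> is_derive x (1 : C) (fun u => phi u lam)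
    (ga * ((cR S)^-1 * (1 + dev psi ((cR S)^-1 * x, l)))).
  move=> hx; have h1 := dD (did ((cR S)^-1 * x)) (ev_derive hpsi1 (scal1 _ hx) hld).
  have ex : (cR S)^-1 * x + 0 = (cR S)^-1 * x by rewrite addr0.
  rewrite -{1}ex in h1; have h2 := dZ ga (daffine h1).
  have q1 : 0 < S - nrm x by rewrite subr_gt0; exact: lt_le_trans hx DS.
  apply: (is_derive_near q1 _ h2) => v hv; rewrite addr0 [in RHS](xE v) pE //.
  rewrite nrmM nrmV nrm_cR0 ?(ltW S0) // ler_pdivrMl // mulr1.
  by have -> : v = (v - x) + x by [rewrite subrK]; apply: le_trans (nrmD _ _) _; rewrite -lerBrDr ltW.
have [||||||poles [res [h1 h2 h3 h4]]] := @residue_sum_disc R k (Xt ^~ lam) (phi ^~ lam) (y ^~ lam) (mu lam) D kpos.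
- move=> x hx; apply: (@umass_at1 _ S (nrm ga * (1 + 2^-1)) x S0).
    have hser : absb (fun a => psi a * pmon a.2 l) 2^-1.
      apply: absb_mono hpsi1 => a; rewrite nrmM ler_piMr ?nrm_ge0 //.
      exact: (@mv_le1 R (par R m) _ _ hld).
    apply: mass_ext (massZ ga (massD (mass_x (par R 0)) (ser_umass fst hser))) => z [hz _].
    by rewrite pE // /ps evE_ser.
  exact: lt_le_trans hx DS.
- move=> x hx; rewrite (derive1_is_derive (hdv x hx)).
  apply: (mulf_neq0 ga0); apply: mulf_neq0; first by rewrite invr_eq0.
  rewrite -nrm_gt0.
  have h5 := dev_bound hpsi (ltW (scal1 _ hx)) hld.
  by have := nrm_geB 1 (dev psi ((cR S)^-1 * x, l)); rewrite nrm1; lra.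
- move=> x hx; apply: hconj.
    exact: lt_le_trans hx (le_trans DS (ltW Sr)).
  by move=> i; apply: lt_trans (hl i) rsr.
- move=> x hx; rewrite -nrm_gt0.
  have hX := scal _ hx; rewrite (xE x) pE; last exact: ltW (scal1 _ hx).
  set u := (cR S)^-1 * x in hX *.
  have hu1 : nrm u <= 1 by lra.
  have hps : nrm (ps u) <= 2^-1 * nrm u + s / 8.
    have -> : ps u = (ps u - ps 0) + ps 0 by rewrite subrK.
    by have := lip u 0 hu1 n00; rewrite subr0 => h; exact: nrm_leD.
  have hw : nrm (ga * (u + ps u)) <= w0.
    apply: nrm_leM; first exact: lexx.
    apply: le_trans (nrm_leD (lexx (nrm u)) hps) _.
    move: (nrm u) hX => n hX; clear - hX ss0 hs0; lra.
  have hk : nrm ((ga * (u + ps u)) ^+ k) <= w0.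
    apply: le_trans (nrm_leX k hw) _; rewrite -(prednK kpos) exprS ler_piMr //.
    exact: exprn_ile1.
  have h6 := nrm_leM hm hk; have := nrm_geB 1 (mu lam * (ga * (u + ps u)) ^+ k); rewrite nrm1.
  move: (nrm (mu lam * _)) (nrm (1 + _)) h6 => p p' h6; clear - h6 w0B1; lra.
- move=> x x' hx hx'; have hX := ltW (scal1 _ hx); have hX' := ltW (scal1 _ hx').
  rewrite (xE x) (xE x') (pE _ hX) (pE _ hX') => /(mulfI ga0) h.
  congr (_ * _); apply: subr0_eq; apply/eqP; rewrite -nrm_eq0; apply/eqP.
  have h5 := lip _ _ hX hX'.
  have e5 : ((cR S)^-1 * x) - ((cR S)^-1 * x') = - (ps ((cR S)^-1 * x) - ps ((cR S)^-1 * x')).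
    apply/eqP; rewrite -addr_eq0 addrACA -opprD h subrr; exact: eqxx.
  rewrite e5 nrmN in h5 *; move: (nrm _) (nrm_ge0 (ps ((cR S)^-1 * x) - ps ((cR S)^-1 * x'))) h5.
  by move=> w hw0 hw1; clear - hw0 hw1; lra.
- move=> q /(hroots _ _ hyl) hq.
  have hT0 : nrm (ga^-1 * q - ps 0) <= s / 4.
    apply: le_trans (nrmB _ _) _; have : nrm (ga^-1 * q) <= s / 8.
      by rewrite nrmM nrmV -/ng ler_pdivrMl.
    by lra.
  (* The fixed point has modulus at most s / 2, hence lies in the open disc of radius s. *)
  have [u v hu hv|x hx xT] := @contraction_fixpoint R (fun x => ga^-1 * q - ps x) (s / 4) hT0.
    have -> : ga^-1 * q - ps u - (ga^-1 * q - ps v) = ps v - ps u by move: (ps u) (ps v) => ? ?; ring.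
    rewrite nrmBC; apply: lip; [apply: le_trans hu _|apply: le_trans hv _]; clear - s1; lra.
  exists (cR S * x).
    rewrite nrmM nrm_cR0 ?(ltW S0) // DE ltr_pM2l //; apply: le_lt_trans hx _; clear - hs0; lra.
  rewrite pE; last by apply: le_trans hx _; clear - s1; lra.
  by rewrite -{1}xT subrK mulrA mulfV // mul1r.
- exists poles, res; split=> // x; rewrite h2 nrmE ltr_cR //.
Qed.

End LocalResidues.

(** * Existence of normal forms *)

Section NormalFormDerivative.
Variable R : realType.
Local Notation C := (Cplx R).
Variables (Q : msys R) (k : nat).

(** The formula [hdxi] becomes the derivative of [hxi] here, with a constant independent of the
    monomial, so that the result can be summed over [u]. *)
Lemma hxi_qd (a : mi (ext Q)) (l : mt Q) rho : 0 <= rho -> rho < 1 -> mdom l ->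
  qd rho (2 * (1 - rho)^-1 ^+ 2) (fun x => hxi (Q := Q) k a (x, l)) (fun x => hdxi (Q := Q) k a (x, l)).
Proof.
move=> r0 r1 hl x h hx hxh; rewrite /hxi /hdxi /=.
have P0 : 0 <= (1 - rho)^-1 ^+ 2 by rewrite exprn_ge0 // invr_ge0; lra.
case: (boolP ((k <= a.1)%N && (a.1 != (2 * k).+1))) => [/andP[ka an]|_]; last first.
  by rewrite mulr0 !subr0 nrm0; apply: mulr_ge0; [exact: mulr_ge0|rewrite exprn_ge0 ?nrm_ge0].
have hn : nrm (mv a.2 l / ((2 * k).+1%:R - a.1%:R) : C) <= 1.
  rewrite nrmM -[leRHS]mulr1; apply: ler_pM; rewrite ?nrm_ge0 //; first exact: mv_le1.
  by rewrite nrmV invf_le1 ?(lt_le_trans ltr01) // nrm_intdiff // eq_sym.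
set w := mv a.2 l / _ in hn.
have h1 := qd_expr (a.1 - k) r0 r1 hx hxh; have h2 := qd_expr k.+1 r0 r1 hx hxh.
have -> : ((x + h) ^+ (a.1 - k) - (x + h) ^+ k.+1) * mv a.2 l / ((2 * k).+1%:R - a.1%:R) -
   (x ^+ (a.1 - k) - x ^+ k.+1) * mv a.2 l / ((2 * k).+1%:R - a.1%:R) -
   h * (((a.1 - k)%:R * x ^+ (a.1 - k).-1 - k.+1%:R * x ^+ k) * mv a.2 l / ((2 * k).+1%:R - a.1%:R)) =
   w * (((x + h) ^+ (a.1 - k) - x ^+ (a.1 - k) - h * ((a.1 - k)%:R * x ^+ (a.1 - k).-1)) +
     - ((x + h) ^+ k.+1 - x ^+ k.+1 - h * (k.+1%:R * x ^+ k.+1.-1))) by rewrite /w /=; ring.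
rewrite -(nrmN (_ - _ - h * (k.+1%:R * _))) in h2.
apply: le_trans (nrm_leM hn (nrm_leD h1 h2)) _; lra.
Qed.

Lemma comb_hxi_qd (u : mi (ext Q) -> C) eta (l : mt Q) rho : absb u eta -> 0 <= rho -> rho < 1 ->
  mdom l -> qd rho (eta * (2 * (1 - rho)^-1 ^+ 2))
    (fun x => comb (Q := ext Q) (hxi k) u (x, l)) (fun x => comb (Q := ext Q) (hdxi k) u (x, l)).
Proof.
move=> hu h0 h1 hl.
have K0 : 0 <= 2 * (1 - rho)^-1 ^+ 2 by rewrite mulr_ge0 // exprn_ge0 // invr_ge0; lra.
have hd (z : C) : nrm z <= rho -> @mdom R (ext Q) (z, l) by move=> hz; split=> //=; lra.
apply: (qd_sum K0 (fun a => hxi_qd a h0 h1 hl) hu) => z hz.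
  exact: (comb_hsum (ler0n _ 2) (@hxi_mass R Q k) hu (hd z hz)).
exact: (comb_hsum (ler0n _ _) (@hdxi_mass R Q k) hu (hd z hz)).
Qed.

Lemma nphi_derive (tau : mt Q -> C) (u : mi (ext Q) -> C) eta (x : C) (l : mt Q) :
  absb u eta -> nrm x < 1 -> mdom l ->
  is_derive x (1 : C) (fun x => nphi k tau u (x, l)) (ndphi k tau u (x, l)).
Proof.
move=> hu hx hl.
have h1 : (nrm x + 1) / 2 < 1 by lra.
have h0 : 0 <= (nrm x + 1) / 2 by have := nrm_ge0 x; lra.
have hs : nrm x < (nrm x + 1) / 2 by lra.
have h2 := dD (dD (did x) (dZ (tau l) (dX k.+1 (did x)))) (qd_is_derive (comb_hxi_qd hu h0 h1 hl) hs).
by apply: is_derive_eq h2 _; rewrite /ndphi /= mulr1; ring.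
Qed.

Lemma comb_hxi_lipschitz (u : mi (ext Q) -> C) eta (x : C) (l : mt Q) :
  absb u eta -> nrm x <= 2^-1 -> mdom l ->
  nrm (comb (Q := ext Q) (hxi k) u (x, l) - comb (Q := ext Q) (hxi k) u (0, l)) <=
    eta * (2 * k + 3)%:R * nrm x.
Proof.
move=> hu hx hl; have half0 : (0 : R) <= 2^-1 by rewrite invr_ge0.
have half1 : (2^-1 : R) < 1 by lra.
have hseg (s : R) : 0 <= s <= 1 -> nrm (0 + cR s * (x - 0)) <= 2^-1.
  by move=> /andP[s0 s1]; rewrite add0r subr0 nrmM nrm_cR0 //; have := nrm_ge0 x; nra.
have := mean_value (comb_hxi_qd hu half0 half1 hl) hseg (B := eta * (2 * k + 3)%:R).
rewrite subr0; apply=> s /hseg; rewrite subr0 => hs.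
apply: (mass_sup (comb_mass (ler0n _ _) (@hdxi_mass R Q k) hu)); split=> //=; lra.
Qed.

End NormalFormDerivative.

(** * The polynomial at the origin of the parameter space *)

Section VanishingRoots.
Variable R : realType.
Local Notation C := (Cplx R).
Variable k : nat.

Lemma fpoly_coef (y : 'I_k -> C) (j : 'I_k) : (fpoly y)`_j = y j.
Proof.
rewrite /fpoly coefD coefXn ltn_eqF ?add0r; last exact: ltnW (ltn_ord j).
rewrite coef_sum (bigD1 j) //= coefZ coefXn eqxx mulr1 big1 ?addr0 // => i ij.
by rewrite coefZ coefXn eq_sym (inj_eq val_inj) (negbTE ij) mulr0.
Qed.

Lemma fpoly_coefk (y : 'I_k -> C) : (fpoly y)`_k = 0.
Proof.
rewrite /fpoly coefD coefXn ltn_eqF // add0r; apply: nth_default; exact: fpoly_tail.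
Qed.

Lemma horner_at1 (P : {poly C}) p : analytic_at1 (fun w => P.[w]) p.
Proof.
elim/poly_ind: P => [|P c ih].
  by apply: at1_ext (at1_const 0 p); apply: near_all => x; rewrite horner0.
apply: at1_ext (at1D (at1M ih (at1_id p)) (at1_const c p)).
by apply: near_all => x; rewrite hornerMXaddC.
Qed.

(* A near-identity map sends 0 to a root of multiplicity k + 1; the monic
   polynomial without term of degree k is then w^(k+1). *)
Lemma vanishing_roots (y : 'I_k -> C) (F : C -> C) (B : R) :
  (forall x, nrm x <= 2^-1 -> nrm (F x - F 0 - x) <= 2^-1 * nrm x) ->
  (forall x, nrm x <= 2^-1 -> nrm (npoly y (F x)) <= B * nrm x ^+ k.+1) ->
  F 0 = 0 /\ forall j, y j = 0.
Proof.
move=> hF hP; set q := F 0 in hF *.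
have P0 : fpoly y != 0 by rewrite monic_neq0 // fpoly_monic.
have [n [Q Qq PE]] := multiplicity_XsubC (fpoly y) q; rewrite P0 /= in Qq.
have Q0 : Q != 0 by apply: contraNneq Qq => ->; rewrite root0.
have sz : (size Q + n = k.+2)%N.
  rewrite -(fpoly_size y) PE size_Mmonic ?monic_exp ?monicXsubC // size_exp_XsubC addnS //.
(* [n] is the multiplicity of the root q. For n <= k, |P(F(t))| would be at least a constant times
   (t / 2)^n for small t > 0, which is not O(t^(k+1)). *)
have nk : (k < n)%N.
  rewrite ltnNge; apply/negP => nk.
  have Qn : Q.[q] != 0 by [].
  have hQ := horner_at1 Q q.
  have [B1 B10 hB1] := at1_bounded (at1_inv hQ Qn).
  have hboth : \forall w \near q, nrm (Q.[w])^-1 <= B1 /\ Q.[w] != 0.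
    exact: filterI hB1 (at1_neq0 hQ Qn).
  have /near_C[d d0 hd] := hboth.
  pose Bm := Num.max B 0; have Bm0 : 0 <= Bm by rewrite le_max lexx orbT.
  have BBm : B <= Bm by rewrite le_max lexx.
  pose K := B1 * Bm * 2 ^+ n + 1.
  have K0 : 0 < K by rewrite /K ltr_wpDl // !mulr_ge0 // exprn_ge0.
  pose t := Num.min (Num.min 2^-1 (d / 4)) (2 * K)^-1.
  have t0 : 0 < t by rewrite !lt_min invr_gt0 ltr0n divr_gt0 // invr_gt0 mulr_gt0.
  have t2 : t <= 2^-1 by rewrite !ge_min lexx.
  have td : t <= d / 4 by rewrite !ge_min lexx !orbT.
  have tK : t * (2 * K) <= 1 by rewrite -ler_pdivlMr ?mulr_gt0 // mul1r ge_min lexx orbT.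
  pose x := cR t; have nx : nrm x = t by rewrite nrm_cR0 // ltW.
  have := hF x; have := hP x; rewrite nx => /(_ t2) h1 /(_ t2) h2.
  have h3 : nrm (F x - q) <= 2 * t.
    have -> : F x - q = (F x - q - x) + x by rewrite subrK.
    by apply: le_trans (nrm_leD h2 (lexx (nrm x))) _; rewrite nx; lra.
  have h4 : 2^-1 * t <= nrm (F x - q).
    have e : x + (F x - q - x) = F x - q by ring.
    have := nrm_geB x (F x - q - x); rewrite e nx; lra.
  have td2 : 2 * t < d by lra.
  have [h5 h6] := hd (F x) (le_lt_trans h3 td2).
  move: h1; rewrite -fpoly_horner PE hornerM horner_exp hornerXsubC nrmM nrmX => h1.
  have h7 : (2^-1 * t) ^+ n <= nrm (F x - q) ^+ n.
    by rewrite lerXn2r ?nnegrE ?nrm_ge0 ?mulr_ge0 ?invr_ge0 // ltW.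
  have h8 : 1 <= B1 * nrm Q.[F x].
    by rewrite -ler_pdivrMr ?nrm_gt0 // mul1r -nrmV.
  have tn0 : 0 < t ^+ n by rewrite exprn_gt0.
  have h9 : nrm Q.[F x] * (2^-1 * t) ^+ n <= Bm * t ^+ n.+1.
    apply: le_trans (ler_wpM2l (nrm_ge0 _) h7) _; apply: le_trans h1 _.
    apply: (@le_trans _ _ (Bm * t ^+ k.+1)); first by rewrite ler_wpM2r ?exprn_ge0 // ltW.
    by rewrite ler_wpM2l // ler_wiXn2l ?(ltW t0) //; lra.
  have h10 : nrm Q.[F x] <= Bm * 2 ^+ n * t.
    move: h9; rewrite exprMn exprS !mulrA ler_pM2r //.
    by rewrite exprVn ler_pdivrMr ?exprn_gt0 // mulrAC.
  have h11 : B1 * nrm Q.[F x] <= B1 * (Bm * 2 ^+ n * t) by rewrite ler_wpM2l.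
  have h12 : B1 * Bm * 2 ^+ n * t <= 2^-1 by rewrite /K in tK; lra.
  clear - h8 h11 h12; lra.
have n1 : n = k.+1.
  apply/eqP; rewrite eqn_leq nk andbT; have : (0 < size Q)%N by rewrite size_poly_gt0.
  by lia.
have sQ : size Q = 1%N by lia.
have Q1 : Q = 1.
  have /size_poly1P[c c0 Qc] : size Q == 1%N by rewrite sQ.
  have := monicP (fpoly_monic y); rewrite PE lead_coef_Mmonic ?monic_exp ?monicXsubC //.
  by rewrite Qc lead_coefC => ->.
rewrite Q1 mul1r n1 in PE.
(* The coefficient of w^k in (w - q)^(k+1) is - (k + 1) q, and it is 0 in P. *)
have q0 : q = 0.
  have := fpoly_coefk y; rewrite PE.
  have := @coefPn_prod_XsubC C (nseq k.+1 q) isT; rewrite size_nseq [in LHS]big_nseq iter_mulr_1 -pred_Sn => ->.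
  by rewrite big_nseq iter_addr_0 => /eqP; rewrite oppr_eq0 mulrn_eq0 => /eqP.
split=> // j; rewrite -(fpoly_coef y) PE q0 subr0 coefXn ltn_eqF //.
exact: ltnW (ltn_ord j).
Qed.

End VanishingRoots.

(** * Normalization of the given family *)

Section Existence.
Variable R : realType.
Local Notation C := (Cplx R).
Variables (k m : nat).
Local Notation L := ('rV[C]_m).
Local Notation b0 := ([ffun=> 0%N] : {ffun 'I_m -> nat}).

Lemma family_order (Xt : C -> L -> C) (omega : C -> C) (a : nat * {ffun 'I_m -> nat} -> C) (r M : R) :
  0 < r -> absb a M ->
  (forall x, nrm x <= 1 -> Xt (cR r * x) 0 = ev (Q := ext (par R m)) a (x, 0)) ->
  analytic_at1 omega 0 -> omega 0 != 0 ->
  (\forall x \near (0 : C), Xt x 0 = x ^+ k.+1 * (1 / omega x)) ->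
  a (k.+1, b0) = cR r ^+ k.+1 / omega 0 /\ forall j, (j < k.+1)%N -> a (j, b0) = 0.
Proof.
move=> r0 ha hE hom om0 hX.
have [V hV hVE] := at1_factor (at1_inv hom om0); have [B B0 hB] := at1_bounded hV.
have hall : \forall x \near (0 : C), nrm (Xt x 0 - x ^+ k.+1 / omega 0) <= B * nrm x ^+ k.+2.
  apply: filterS3 hX hVE hB => x -> hv hb.
  have -> : x ^+ k.+1 * (1 / omega x) - x ^+ k.+1 / omega 0 = V x * x ^+ k.+2.
    by rewrite mul1r hv subr0 [in RHS]exprS; ring.
  by rewrite nrmM nrmX ler_wpM2r // exprn_ge0 // nrm_ge0.
have /near_C[d d0 hd] := hall.
have ha0 : absb (fun j => a (j, b0)) M by apply: (absb_inj (h := fun j => (j, b0))) ha => i j [].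
apply: (@series_order R (fun j => a (j, b0)) M (fun x => Xt (cR r * x) 0) _ k.+1
  (B * r ^+ k.+2) (d / (2 * r)) ha0) => [x hx||x hx].
- by rewrite hE //; exact: slice0 ha hx.
- by rewrite divr_gt0 // mulr_gt0.
have nx : nrm (cR r * x) = r * nrm x by rewrite nrmM nrm_cR0 // ltW.
have := hd (cR r * x); rewrite subr0 nx exprMn.
have h1 : r * nrm x < d.
  by move: hx; rewrite ler_pdivlMr ?mulr_gt0 // => hx; have := nrm_ge0 x; nra.
move=> /(_ h1); rewrite exprMn => h2.
have -> : cR r ^+ k.+1 / omega 0 * x ^+ k.+1 = cR r ^+ k.+1 * x ^+ k.+1 / omega 0 by rewrite mulrAC.
by apply: le_trans h2 _; rewrite mulrA.
Qed.

(** Once the leading coefficient is normalized, the error at lambda = 0 has only terms of degree at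
    least k + 2. Scaling x by rho and lambda by rho^(k+2), then dividing by rho^(k+1), leaves a size
    proportional to rho. The last bound retains the order in x, which the norm forgets. *)
Lemma family_scaled (Xt : C -> L -> C) (omega : C -> C) (eps : R) : 0 < eps ->
  analytic_family Xt -> analytic_at1 omega 0 -> omega 0 != 0 ->
  (\forall x \near (0 : C), Xt x 0 = x ^+ k.+1 * (1 / omega x)) ->
  exists S T : R, [/\ 0 < S, 0 < T,
    @mass R (ext (par R m)) (fun z =>
      omega 0 / cR S ^+ k.+1 * Xt (cR S * z.1) (cR T *: z.2) - z.1 ^+ k.+1) eps &
    forall x, nrm x <= 1 ->
      nrm (omega 0 / cR S ^+ k.+1 * Xt (cR S * x) 0 - x ^+ k.+1) <= eps * nrm x ^+ k.+1].
Proof.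
move=> e0 /family_mass[r [M [r0 [a [ha hE]]]]] hom om0 hX.
have hE0 x : nrm x <= 1 -> Xt (cR r * x) 0 = ev (Q := ext (par R m)) a (x, 0).
  move=> hx; have := hE (x, 0) (conj hx (@dom_0 R m)); rewrite /= scaler0 => h.
  exact/esym/hsE.
have [ak aj] := family_order r0 ha hE0 hom om0 hX.
have rn : cR r != 0 by rewrite cR_eq0 gt_eqF.
pose gi := omega 0 / cR r ^+ k.+1.
pose d (i : nat * {ffun 'I_m -> nat}) : C := if i == (k.+1, b0) then 1 else 0.
have hd : absb d 1.
  have := @absb_single R _ d (k.+1, b0); rewrite /d eqxx nrm1.
  by apply=> i /negbTE ->.
pose e i := gi * a i - d i; pose N := nrm gi * M + 1.
have he : absb e N by apply: absbD; [exact: absbZ|exact: absbN].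
have N0 : 0 <= nrm gi * M := absb_ge0 (absbZ gi ha).
have N1 : 1 <= N by rewrite /N; lra.
have ej j : (j < k.+2)%N -> e (j, b0) = 0.
  rewrite ltnS leq_eqVlt => /orP[/eqP ->|jk].
    by rewrite /e /d eqxx ak /gi; field; rewrite om0 expf_neq0.
  rewrite /e aj // /d mulr0 -pair_eqE /= (ltn_eqF jk) subr0 //.
pose rho := Num.min 1 (eps / (2 * N)).
have rho0 : 0 < rho by rewrite lt_min ltr01 divr_gt0 //; lra.
have rho1 : rho <= 1 by rewrite ge_min lexx.
have rhoN : rho * (2 * N) <= eps by rewrite -ler_pdivlMr ?ge_min ?lexx ?orbT //; lra.
have sig0 : 0 < rho ^+ k.+2 by rewrite exprn_gt0.
have sig1 : rho ^+ k.+2 <= 1 by rewrite exprn_ile1 // ltW.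
have hr01 : 0 <= rho <= 1 by rewrite (ltW rho0).
have hs01 : 0 <= rho ^+ k.+2 <= 1 by rewrite (ltW sig0).
set sig := rho ^+ k.+2 in sig0 sig1 hs01.
have hsm := scoef_small hr01 hs01 he ej.
have rhon : cR rho != 0 by rewrite cR_eq0 gt_eqF.
pose w i := (cR rho ^+ k.+1)^-1 * scoef e rho sig i.
have hw : absb w eps.
  apply: absb_le (absbZ (cR rho ^+ k.+1)^-1 hsm).
  rewrite nrmV nrmX nrm_cR0 ?(ltW rho0) // -/sig ler_pdivrMl ?exprn_gt0 //.
  apply: le_trans (_ : rho ^+ k.+1 * (rho * (2 * N)) <= _); last first.
    by rewrite ler_wpM2l // exprn_ge0 // ltW.
  by rewrite /sig exprSr le_eqVlt; apply/orP; left; apply/eqP; ring.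
have hwE z : @mdom R (ext (par R m)) z -> hsum (fun i => w i * @mv R (ext (par R m)) i z)
   (omega 0 / cR (r * rho) ^+ k.+1 * Xt (cR (r * rho) * z.1) (cR (r * sig) *: z.2) - z.1 ^+ k.+1).
  move=> hz; have hz2 := scale_dom hr01 hs01 hz.
  have h1 := hsumZ gi (hE _ hz2).
  have h2 : hsum (fun i => d i * @mv R (ext (par R m)) i (cR rho * z.1, cR sig *: z.2)) ((cR rho * z.1) ^+ k.+1).
    have := @hsum_single R _ (fun i => d i * @mv R (ext (par R m)) i (cR rho * z.1, cR sig *: z.2)) (k.+1, b0).
    rewrite /d eqxx mul1r /= /emon /= pmon1 mulr1.
    by apply=> i /negbTE ->; rewrite mul0r.
  have h3 : hsum (fun i => e i * @mv R (ext (par R m)) i (cR rho * z.1, cR sig *: z.2))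
     (gi * Xt (cR r * (cR rho * z.1)) (cR r *: (cR sig *: z.2)) - (cR rho * z.1) ^+ k.+1).
    by apply: hsum_ext (hsumB h1 h2) => i; rewrite /e mulrBl mulrA.
  case: z hz hz2 h1 h2 h3 => x l hz _ _ _ /= h3.
  have := hsumZ (cR rho ^+ k.+1)^-1 (scoef_hsum h3).
  have -> : (cR rho ^+ k.+1)^-1 * (gi * Xt (cR r * (cR rho * x)) (cR r *: (cR sig *: l)) - (cR rho * x) ^+ k.+1) =
    omega 0 / cR (r * rho) ^+ k.+1 * Xt (cR (r * rho) * x) (cR (r * sig) *: l) - x ^+ k.+1.
    have An : cR r ^+ k.+1 != 0 by rewrite expf_neq0.
    have Bn : cR rho ^+ k.+1 != 0 by rewrite expf_neq0.
    rewrite !cRM scalerA mulrA /gi !exprMn.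
    move: (cR r ^+ k.+1) An (cR rho ^+ k.+1) Bn (Xt _ _) (x ^+ k.+1) => A A0 B B0 v y.
    by field; rewrite A0 B0.
  by apply: hsum_ext => i; rewrite /w mulrA.
exists (r * rho), (r * sig); split; [exact: mulr_gt0|exact: mulr_gt0|by exists w; split|].
move=> x hx; have hz : @mdom R (ext (par R m)) (x, 0) by split; [exact: hx|exact: dom_0].
have := hwE _ hz; rewrite /= scaler0 => h1.
have h2 : hsum (fun j => w (j, b0) * x ^+ j) (omega 0 / cR (r * rho) ^+ k.+1 * Xt (cR (r * rho) * x) 0 - x ^+ k.+1).
  by rewrite -(hsE h1); exact: slice0 hw hx.
apply: hsum_le h2.
have hw0 : absb (fun j => w (j, b0)) eps by apply: (absb_inj (h := fun j => (j, b0))) hw => i j [].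
rewrite mulrC -[X in X * _](nrm_cR0 (exprn_ge0 k.+1 (nrm_ge0 x))).
apply: absb_mono (absbZ (cR (nrm x ^+ k.+1)) hw0) => j.
rewrite [leLHS]nrmM [nrm (x ^+ j)]nrmX [leRHS]nrmM nrm_cR0 ?exprn_ge0 ?nrm_ge0 // [leRHS]mulrC.
have [jk|jk] := ltnP j k.+2.
  by rewrite /w /scoef ej // !mul0r mulr0 nrm0 !mul0r.
by rewrite ler_wpM2l ?nrm_ge0 // ler_wiXn2l ?nrm_ge0 // ltnW.
Qed.

(** The conjugacy equation is solved with tau = 0. As xi may have a constant term, Phi (0, 0) = 0
    and Y_j(0) = 0 are not built in; they come from [vanishing_roots]. *)
Lemma normal_form_exists (Xt : C -> L -> C) (omega : C -> C) :
  analytic_family Xt -> analytic_at1 omega 0 -> omega 0 != 0 ->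
  (\forall x \near (0 : C), Xt x 0 = x ^+ k.+1 * (1 / omega x)) ->
  exists (S T : R) (Phi dPhi : C * L -> C) (Y : 'I_k -> L -> C) (MU : L -> C),
  [/\ 0 < S /\ 0 < T,
    [/\ @mass R (ext (par R m)) Phi 2, forall j, @mass R (par R m) (Y j) 1 & @mass R (par R m) MU 2^-1],
    forall x l, nrm x < 1 -> @mdom R (par R m) l ->
      is_derive x (1 : C) (fun x => Phi (x, l)) (dPhi (x, l)) /\ dPhi (x, l) != 0,
    Phi (0, 0) = 0 /\ forall j, Y j 0 = 0 &
    forall x l, nrm x <= 1 -> @mdom R (par R m) l ->
      1 + MU l * Phi (x, l) ^+ k != 0 /\
      npoly (Y ^~ l) (Phi (x, l)) = (1 + MU l * Phi (x, l) ^+ k) *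
        (omega 0 / cR S ^+ k.+1 * Xt (cR S * x) (cR T *: l)) * dPhi (x, l)].
Proof.
move=> hXt hom om0 hX.
have [eta0 /andP[e00 e01] hconj] := @conj_exists R (par R m) k.
(* [c1] keeps |dPhi - 1| <= 1/2, so that the derivative does not vanish; [c2] keeps |MU Phi^k| <=
   1/4, given |Phi| <= 2. *)
pose c1 : R := (2 * (2 * k + 3)%:R)^-1; pose c2 : R := 2^-1 ^+ k.+2.
have k30 : (0 : R) < (2 * k + 3)%:R by rewrite ltr0n addn_gt0 orbT.
pose eta := Num.min eta0 (Num.min c1 c2).
have eta_gt0 : 0 < eta.
  by rewrite !lt_min e00 /c1 /c2 invr_gt0 mulr_gt0 //= exprn_gt0 // invr_gt0.
have eta_le : eta <= eta0 by rewrite ge_min lexx.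
have etac1 : eta * (2 * k + 3)%:R <= 2^-1.
  have : eta <= c1 by rewrite !ge_min lexx !orbT.
  by rewrite /c1 invfM -ler_pdivrMr // invrK.
have etac2 : eta * 2 ^+ k <= 4^-1.
  have h : eta <= c2 by rewrite !ge_min lexx !orbT.
  have p0 : (0 : R) < 2 ^+ k by rewrite exprn_gt0.
  apply: le_trans (ler_wpM2r (ltW p0) h) _; rewrite /c2 !exprS exprVn.
  rewrite le_eqVlt; apply/orP; left; apply/eqP; field; exact: lt0r_neq0.
have eta4 : eta <= 4^-1.
  apply: le_trans etac2; rewrite ler_peMr ?(ltW eta_gt0) // exprn_ege1 //; lra.
have eta40 : 0 < eta / 4 by rewrite divr_gt0.
have [S [T [S0 T0 hmass hsmall]]] := family_scaled eta40 hXt hom om0 hX.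
pose e (z : C * L) := omega 0 / cR S ^+ k.+1 * Xt (cR S * z.1) (cR T *: z.2) - z.1 ^+ k.+1.
pose tau : L -> C := fun=> 0.
have mtau : @mass R (par R m) tau eta by apply: mass0; exact: ltW.
have [u [hu hG]] := hconj eta e tau eta_gt0 eta_le hmass mtau.
pose Phi := @nphi R (par R m) k tau u; pose dPhi := @ndphi R (par R m) k tau u.
pose Y := @ny R (par R m) k u; pose MU := @nmu R (par R m) k u.
have PhiE z : Phi z = z.1 + comb (Q := ext (par R m)) (hxi k) u z.
  by rewrite /Phi /nphi /tau mul0r addr0.
have mPhi : @mass R (ext (par R m)) Phi 2.
  have h1 : 1 + eta * 2 <= 2 by lra.
  apply: mass_ext (mass_le h1 (massD (mass_x (par R m)) (comb_mass (ler0n _ 2) (@hxi_mass R (par R m) k) hu))) => z _.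
  by rewrite PhiE.
have mY j : @mass R (par R m) (Y j) 1.
  have h1 : eta * 1 <= 1 by lra.
  exact: mass_le h1 (comb_mass ler01 (@hy_mass R (par R m) k j) hu).
have mMUe : @mass R (par R m) MU (eta * 1) := comb_mass ler01 (@hmu_mass R (par R m) k) hu.
have mMU : @mass R (par R m) MU 2^-1 by apply: mass_le mMUe; lra.
have hdP x l : nrm x <= 1 -> @mdom R (par R m) l -> nrm (dPhi (x, l) - 1) <= 2^-1.
  move=> hx hl; have -> : dPhi (x, l) - 1 = comb (Q := ext (par R m)) (hdxi k) u (x, l).
    by rewrite /dPhi /ndphi /tau mulr0 mul0r addr0 addrC addKr.
  have hz : @mdom R (ext (par R m)) (x, l) by [].
  exact: le_trans (mass_sup (comb_mass (ler0n _ _) (@hdxi_mass R (par R m) k) hu) hz) etac1.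
have hden x l : nrm x <= 1 -> @mdom R (par R m) l -> nrm (MU l * Phi (x, l) ^+ k) <= 4^-1.
  move=> hx hl; have hz : @mdom R (ext (par R m)) (x, l) by [].
  apply: le_trans (nrm_leM (mass_sup mMUe hl) (nrm_leX k (mass_sup mPhi hz))) _.
  by rewrite mulr1.
have hE x l : nrm x <= 1 -> @mdom R (par R m) l ->
    npoly (Y ^~ l) (Phi (x, l)) = (1 + MU l * Phi (x, l) ^+ k) *
        (omega 0 / cR S ^+ k.+1 * Xt (cR S * x) (cR T *: l)) * dPhi (x, l).
  move=> hx hl; have := hG (x, l) (conj hx hl); rewrite /nG /conj_eq => /subr0_eq h.
  rewrite [LHS]h; congr (_ * _ * _).
  by rewrite /e /= addrC subrK.
exists S, T, Phi, dPhi, Y, MU; split; [by split|by split| | |].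
- move=> x l hx hl; split; first exact: (@nphi_derive R (par R m) k tau u eta x l hu hx hl).
  have h1 := hdP x l (ltW hx) hl; apply: contraTneq h1 => ->.
  by rewrite sub0r nrmN nrm1 -ltNge; lra.
- have d00 := @dom_0 R m.
  (* The constant 8 is the product of three bounds 2: for the denominator, for the field relative to
     |x|^(k+1), and for the derivative. *)
  apply: (@vanishing_roots R k (Y ^~ 0) (fun x => Phi (x, 0)) 8) => x hx.
    have h := @comb_hxi_lipschitz R (par R m) k u eta x 0 hu hx d00.
    rewrite !PhiE add0r; move: (comb (Q := ext (par R m)) _ u (x, 0)) (comb (Q := ext (par R m)) _ u (0, 0)) h => A A0 h.
    have -> : x + A - A0 - x = A - A0 by ring.
    by apply: le_trans h _; rewrite ler_wpM2r ?nrm_ge0.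
  have hx1 : nrm x <= 1 by lra.
  rewrite hE // scaler0.
  have h1 : nrm (1 + MU 0 * Phi (x, 0) ^+ k) <= 2.
    by apply: le_trans (nrm_leD (lexx _) (hden x 0 hx1 d00)) _; rewrite nrm1; lra.
  have h2 : nrm (dPhi (x, 0)) <= 2.
    have -> : dPhi (x, 0) = (dPhi (x, 0) - 1) + 1 by rewrite subrK.
    by apply: le_trans (nrm_leD (hdP x 0 hx1 d00) (lexx _)) _; rewrite nrm1; lra.
  have h3 : nrm (omega 0 / cR S ^+ k.+1 * Xt (cR S * x) 0) <= 2 * nrm x ^+ k.+1.
    have -> : omega 0 / cR S ^+ k.+1 * Xt (cR S * x) 0 =
      (omega 0 / cR S ^+ k.+1 * Xt (cR S * x) 0 - x ^+ k.+1) + x ^+ k.+1 by rewrite subrK.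
    apply: le_trans (nrm_leD (hsmall x hx1) (lexx _)) _; rewrite nrmX.
    have := exprn_ge0 k.+1 (nrm_ge0 x); move: (nrm x ^+ k.+1) => t t0.
    by clear - t0 eta4; nra.
  apply: le_trans (nrm_leM (nrm_leM h1 h3) h2) _; lra.
- move=> x l hx hl; split; last exact: hE.
  rewrite -nrm_gt0; have := nrm_geB 1 (MU l * Phi (x, l) ^+ k); rewrite nrm1.
  have := hden x l hx hl; lra.
Qed.

End Existence.

(** * Return to the original coordinates *)

Section NormalForms.
Variable R : realType.
Local Notation C := (Cplx R).
Variable m : nat.
Local Notation L := ('rV[C]_m).

Lemma scaled_conjugacy (Xt b : C -> L -> C) (Phi dPhi : C * L -> C) (S T M : R) (be : C) :
  0 < S -> 0 < T -> be != 0 -> @mass R (ext (par R m)) Phi M ->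
  (forall x l, nrm x < 1 -> @mdom R (par R m) l ->
    is_derive x (1 : C) (fun x => Phi (x, l)) (dPhi (x, l)) /\ dPhi (x, l) != 0) ->
  Phi (0, 0) = 0 ->
  (forall x l, nrm x < 1 -> @mdom R (par R m) l ->
    b (be * Phi (x, l)) (cR T *: l) =
    Xt (cR S * x) (cR T *: l) * (be * ((cR S)^-1 * dPhi (x, l)))) ->
  conjugate Xt b.
Proof.
move=> S0 T0 be0 hM hd h00 hE.
have Sn : cR S != 0 by rewrite cR_eq0 gt_eqF.
have Tn : cR T != 0 by rewrite cR_eq0 gt_eqF.
have Tl (l : L) : cR T *: ((cR T)^-1 *: l) = l by exact: unscaleK.
have Sx (x : C) : cR S * ((cR S)^-1 * x) = x by rewrite mulVKf.
pose phi u lam := be * Phi ((cR S)^-1 * u, (cR T)^-1 *: lam).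
have hdom (l : L) : (forall i, nrm (l 0 i) < T) -> @mdom R (par R m) ((cR T)^-1 *: l).
  exact: unscale_dom.
have hx1 (x : C) : nrm x < S -> nrm ((cR S)^-1 * x) < 1.
  by move=> hx; rewrite nrmM nrmV nrm_cR0 ?(ltW S0) // ltr_pdivrMl // mulr1.
have hphi x (l : L) : nrm x < S -> (forall i, nrm (l 0 i) < T) ->
    derive1 (fun u => phi u l) x = be * ((cR S)^-1 * dPhi ((cR S)^-1 * x, (cR T)^-1 *: l)).
  move=> hx hl; have [h1 _] := hd _ _ (hx1 x hx) (hdom l hl).
  have ex : (cR S)^-1 * x + 0 = (cR S)^-1 * x by rewrite addr0.
  rewrite -{1}ex in h1; apply: derive1_is_derive.
  have := dZ be (daffine h1).
  rewrite (_ : (fun s => _) = (fun u => phi u l)) //.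
  by apply/funext => u; rewrite addr0.
have n0S : nrm (0 : C) < S by rewrite nrm0.
have n0T (i : 'I_m) : nrm ((0 : L) 0 i) < T by rewrite mxE nrm0.
exists phi; split.
- apply/family_mass; pose r := Num.min S T; have r0 : 0 < r by rewrite lt_min S0.
  have hrS : 0 <= r / S <= 1.
    by rewrite divr_ge0 ?(ltW r0) ?(ltW S0) //= ler_pdivrMr // mul1r ge_min lexx.
  have hrT : 0 <= r / T <= 1.
    by rewrite divr_ge0 ?(ltW r0) ?(ltW T0) //= ler_pdivrMr // mul1r ge_min lexx orbT.
  exists r, (nrm be * M); split=> //.
  apply: mass_ext (massZ be (mass_scale hrS hrT hM)) => z _; rewrite /phi.
  congr (be * Phi (_, _)); first by rewrite cRM cRV mulrA [_ * cR r]mulrC.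
  by rewrite scalerA cRM cRV [_ * cR r]mulrC.
- by rewrite /phi mulr0 scaler0 h00 mulr0.
- rewrite hphi // mulr0 scaler0; have n01 : nrm (0 : C) < 1 by rewrite nrm0.
  have [_ h] := hd 0 0 n01 (@dom_0 R m).
  by apply: (mulf_neq0 be0); apply: mulf_neq0; rewrite ?invr_eq0.
- apply/near_pair; exists (Num.min S T); first by rewrite lt_min S0.
  move=> x l; rewrite lt_min => /andP[hx _] hl /=.
  have hl' i : nrm (l 0 i) < T by have := hl i; rewrite lt_min => /andP[].
  by have := hE _ _ (hx1 x hx) (hdom l hl'); rewrite Tl Sx hphi.
Qed.

(** With P(w) = w and no y, the solved equation reads c Phi = Xt Phi' up to the scale S, with c = 1
    / (omega(0) (1 + MU)). *)
Lemma normal_form_A (Xt : C -> L -> C) (omega : C -> C) :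
  analytic_family Xt -> analytic_at1 omega 0 -> omega 0 != 0 ->
  (\forall x \near (0 : C), Xt x 0 = x ^+ 1 * (1 / omega x)) ->
  exists c : L -> C, analytic_germ c /\ conjugate Xt (form_A c).
Proof.
move=> hXt hom om0 hX.
have [S [T [Phi [dPhi [Y [MU [[S0 T0] [mPhi _ mMU] hd [h00 _] hE]]]]]]] :=
  @normal_form_exists R 0 m Xt omega hXt hom om0 hX.
have Tn : cR T != 0 by rewrite cR_eq0 gt_eqF.
pose c1 (l : L) := (omega 0)^-1 * (1 - - MU l)^-1.
exists (fun lam => c1 ((cR T)^-1 *: lam)); split.
  have half1 : (2^-1 : R) < 1 by lra.
  exact: (mass_germ T0 (massZ (omega 0)^-1 (mass_inv half1 (massN mMU)))).
apply: (@scaled_conjugacy Xt _ Phi dPhi S T 2 1 S0 T0 (oner_neq0 _) mPhi hd h00).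
move=> x l hx hl; have [d0 h1] := hE x l (ltW hx) hl.
rewrite /form_A scalerA mulVf // scale1r !mul1r /c1 opprK.
move: d0 h1; rewrite /npoly big_ord0 addr0 !expr1 expr0 mulr1 => d0 ->.
have Sn : cR S != 0 by rewrite cR_eq0 gt_eqF.
by field; rewrite Sn om0 d0.
Qed.

(** The k-th root [be] of S^k / omega(0) keeps the numerator monic: replacing Phi by be Phi
    multiplies P by be^(k+1) and Phi' by [be], and the excess be^k turns the factor omega(0) /
    S^(k+1) into the 1 / S of the change of variable. *)
Lemma normal_form_B (k : nat) (Xt : C -> L -> C) (omega : C -> C) : (0 < k)%N ->
  analytic_family Xt -> analytic_at1 omega 0 -> omega 0 != 0 ->
  (\forall x \near (0 : C), Xt x 0 = x ^+ k.+1 * (1 / omega x)) ->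
  exists (y : 'I_k -> L -> C) (mu : L -> C), form_B_data y mu /\ conjugate Xt (form_B y mu).
Proof.
move=> kpos hXt hom om0 hX.
have [S [T [Phi [dPhi [Y [MU [[S0 T0] [mPhi mY mMU] hd [h00 hY0] hE]]]]]]] :=
  @normal_form_exists R k m Xt omega hXt hom om0 hX.
have Tn : cR T != 0 by rewrite cR_eq0 gt_eqF.
have Sn : cR S != 0 by rewrite cR_eq0 gt_eqF.
pose be := k.-root (cR S ^+ k / omega 0).
have bek : be ^+ k = cR S ^+ k / omega 0 by exact: rootCK.
have be0 : be != 0.
  have : be ^+ k != 0 by rewrite bek mulf_neq0 ?invr_eq0 ?expf_neq0.
  by rewrite expf_eq0 kpos.
exists (fun (j : 'I_k) (lam : L) => be ^+ (k.+1 - j) * Y j ((cR T)^-1 *: lam)),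
  (fun lam : L => (be ^+ k)^-1 * MU ((cR T)^-1 *: lam)); split.
  split=> [j||j].
  - exact: (germZ _ (mass_germ T0 (mY j))).
  - exact: (germZ _ (mass_germ T0 mMU)).
  - by rewrite scaler0 hY0 mulr0.
apply: (@scaled_conjugacy Xt _ Phi dPhi S T 2 be S0 T0 be0 mPhi hd h00).
move=> x l hx hl; have [d0 h1] := hE x l (ltW hx) hl.
have Tl : (cR T)^-1 *: (cR T *: l) = l by rewrite scalerA mulVf // scale1r.
set y := (fun (j : 'I_k) (lam : L) => _); set mu := (fun lam : L => _).
rewrite -[form_B y mu _ _]/(npoly (y ^~ (cR T *: l)) (be * Phi (x, l)) /
  (1 + mu (cR T *: l) * (be * Phi (x, l)) ^+ k)).
have bekn : be ^+ k != 0 by rewrite expf_neq0.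
have -> : mu (cR T *: l) * (be * Phi (x, l)) ^+ k = MU l * Phi (x, l) ^+ k.
  by rewrite /mu Tl exprMn; field.
rewrite -(npoly_scale _ _ be0).
have -> : (fun j : 'I_k => y j (cR T *: l) / be ^+ (k.+1 - j)) = Y ^~ l.
  by apply/funext => j; rewrite /y Tl; field; rewrite expf_neq0.
have Skn : cR S ^+ k != 0 by rewrite expf_neq0.
rewrite h1 !exprS bek; move: d0; set D := 1 + _ => d0.
move: (cR S ^+ k) Skn => Sk Sk0.
by field; rewrite Sk0 Sn om0 d0.
Qed.

End NormalForms.

Theorem theorem2p4 (R : realType) (k m : nat) :
  (* (i) *)
  (forall (Xt : Cplx R -> 'rV[Cplx R]_m -> Cplx R) (omega : Cplx R -> Cplx R),
     analytic_family Xt ->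
     analytic_at1 omega 0 ->
     omega 0 != 0 ->
     (\forall x \near (0 : Cplx R), Xt x 0 = x ^+ k.+1 * (1 / omega x)) ->
     (k = 0%N ->
        exists c : 'rV[Cplx R]_m -> Cplx R,
          analytic_germ c /\ conjugate Xt (form_A c)) /\
     ((0 < k)%N ->
        exists (y : 'I_k -> 'rV[Cplx R]_m -> Cplx R) (mu : 'rV[Cplx R]_m -> Cplx R),
          [/\ form_B_data y mu,
              conjugate Xt (form_B y mu),
              \forall lam \near (0 : 'rV[Cplx R]_m),
                exists2 r : Cplx R,
                  is_residue_infty (fun x => (form_B y mu x lam)^-1) r &
                  mu lam = - r
            & is_local_residue_sum Xt mu]))
  /\
  (* (ii), k = 0 *)
  (k = 0%N ->
   forall c c' : 'rV[Cplx R]_m -> Cplx R,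
     analytic_germ c -> analytic_germ c' -> c 0 != 0 -> c' 0 != 0 ->
     (conjugate (form_A c) (form_A c') ->
        \forall lam \near (0 : 'rV[Cplx R]_m), c' lam = c lam) /\
     (forall phi, is_conjugacy phi (form_A c) (form_A c') ->
        exists2 t : 'rV[Cplx R]_m -> Cplx R, analytic_germ t &
          \forall z \near ((0, 0) : Cplx R * 'rV[Cplx R]_m),
            phi z.1 z.2 = cexp (t z.2) * z.1))
  /\
  (* (ii), k = 1: uniqueness *)
  (k = 1%N ->
   forall (y y' : 'I_k -> 'rV[Cplx R]_m -> Cplx R) (mu mu' : 'rV[Cplx R]_m -> Cplx R),
     form_B_data y mu -> form_B_data y' mu' ->
     conjugate (form_B y mu) (form_B y' mu') ->
     \forall lam \near (0 : 'rV[Cplx R]_m),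
       (forall j, y' j lam = y j lam) /\ mu' lam = mu lam)
  /\
  (* (ii), k >= 1: the action of Z_k, and uniqueness up to it *)
  ((0 < k)%N ->
   (forall (y : 'I_k -> 'rV[Cplx R]_m -> Cplx R) (mu : 'rV[Cplx R]_m -> Cplx R)
           (l : 'I_k),
      form_B_data y mu ->
      form_B_data (rot_coef l y) mu /\
      is_conjugacy (fun x _ => rot_factor R l * x)
        (form_B y mu) (form_B (rot_coef l y) mu)) /\
   (forall (y y' : 'I_k -> 'rV[Cplx R]_m -> Cplx R) (mu mu' : 'rV[Cplx R]_m -> Cplx R),
      form_B_data y mu -> form_B_data y' mu' ->
      forall phi, is_conjugacy phi (form_B y mu) (form_B y' mu') ->
      exists (l : 'I_k) (t : 'rV[Cplx R]_m -> Cplx R),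
        [/\ analytic_germ t,
            \forall lam \near (0 : 'rV[Cplx R]_m),
              (forall j, y' j lam = rot_coef l y j lam) /\ mu' lam = mu lam
          & \forall z \near ((0, 0) : Cplx R * 'rV[Cplx R]_m),
              exists2 w : Cplx R,
                time_flow (fun x => form_B y mu x z.2) (t z.2) z.1 w &
                phi z.1 z.2 = rot_factor R l * w])).
Proof.
split.
  move=> Xt omega hXt hom om0 hX; split=> [k0|kpos].
    by subst k; exact: normal_form_A hXt hom om0 hX.
  have [y [mu [hy [phi hphi]]]] := normal_form_B kpos hXt hom om0 hX.
  exists y, mu; split; [exact: hy|by exists phi| |exact: conjugacy_residue_sum kpos hy hphi].
  (* The computation at infinity holds for every value of [lam], so the radius 1 is arbitrary. *)
  apply/near_rV; exists 1 => // lam _; exists (- mu lam); last by rewrite opprK.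
  exact: (form_residue_infty (y ^~ lam) (mu lam) kpos).
split.
  move=> _ c c' hc hc' c0 c0'; split=> [[phi hphi]|phi hphi].
    by have [] := linear_rigidity hc c0 hphi.
  by have [] := linear_rigidity hc c0 hphi.
split; first by move=> k1; subst k; exact: normal_form_unique1.
move=> kpos; split=> [y mu l|y y' mu mu' hy hy' phi]; first exact: rotation_conjugacy.
exact: normal_form_rigidity.
Qed.
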